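(* Let $X$ and $Y$ be reduced coherent schemes, and let $p\colon Y\to X$ be an étale surjective morphism. Then the commutative square $$\begin{array}{ccc} Y_{\mathrm{trig}}&\longrightarrow& Y\\ {\scriptstyle p_{\mathrm{trig}}}\downarrow\;&&\;\downarrow{\scriptstyle p}\\ X_{\mathrm{trig}}&\longrightarrow& X\end{array}$$ is a pullback square, where the horizontal morphisms are the canonical ones.
   Context: A scheme is coherent if it is quasicompact and quasiseparated. A morphism of schemes is a universal homeomorphism if every base change of it is a homeomorphism on underlying topological spaces. A coherent scheme $Y$ is topologically rigid if any universal homeomorphism $Y'\to Y$ with $Y'$ reduced is an isomorphism. The inclusion of topologically rigid schemes into coherent schemes (over a fixed coherent base) has a right adjoint $Y\mapsto Y_{\mathrm{trig}}$, called the topological rigidification; explicitly, $Y_{\mathrm{trig}}$ is the limit in $Y$-schemes of all universal homeomorphisms $Z\to Y$. The canonical morphism $Y_{\mathrm{trig}}\to Y$ is the counit of the adjunction, and $p_{\mathrm{trig}}$ is the morphism obtained from $p$ by functoriality. *)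

(* Defs.v *)
From HB Require Import structures.
From mathcomp Require Import all_boot all_algebra.
From mathcomp Require Import boolp classical_sets topology.

Set Implicit Arguments.
Unset Strict Implicit.
Unset Printing Implicit Defensive.

Import GRing.Theory.
Local Open Scope classical_set_scope.
Local Open Scope ring_scope.

(** * Commutative algebra *)

(* Rings are [comPzRingType]s because the zero ring must be allowed: it is the
   ring of sections of any sheaf of rings over the empty set. *)

Definition is_unit (A : comPzRingType) (a : A) : Prop := exists b, a * b = 1.

Definition reduced_ring (A : comPzRingType) : Prop :=
  forall (a : A) n, a ^+ n = 0 -> a = 0.

Definition is_prime_ideal (A : comPzRingType) (P : set A) : Prop :=
  [/\ P 0,
      forall a b, P a -> P b -> P (a + b),
      forall a b, P b -> P (a * b),
      ~ P 1
    & forall a b, P (a * b) -> P a \/ P b].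

(* [l] exhibits [B] as the localization of [A] at the powers of [a]. *)
Definition is_localization (A B : comPzRingType) (a : A)
    (l : {rmorphism A -> B}) : Prop :=
  [/\ is_unit (l a),
      forall b, exists n s, b * l a ^+ n = l s
    & forall s, l s = 0 -> exists n, a ^+ n * s = 0].

(* [c : A -> P] is the polynomial algebra over [A] in the variables [X i],
   characterized by its universal property ([{poly A}] and [{mpoly A[n]}]
   exclude the zero ring). *)
Definition is_polynomial_algebra (A P : comPzRingType) (n : nat)
    (c : {rmorphism A -> P}) (X : 'I_n -> P) : Prop :=
  forall (C : comPzRingType) (u : {rmorphism A -> C}) (y : 'I_n -> C),
    exists w : {rmorphism P -> C},
      [/\ w \o c =1 u, w \o X =1 y
        & forall w' : {rmorphism P -> C},
            w' \o c =1 u -> w' \o X =1 y -> w' =1 w].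

Definition finitely_presented (A B : comPzRingType)
    (phi : {rmorphism A -> B}) : Prop :=
  exists (n : nat) (P : comPzRingType) (c : {rmorphism A -> P})
         (X : 'I_n -> P) (q : {rmorphism P -> B}),
    [/\ is_polynomial_algebra c X,
        q \o c =1 phi,
        forall b, exists a, q a = b
      & exists (m : nat) (r : 'I_m -> P), forall a,
          q a = 0 <-> exists k : 'I_m -> P, a = \sum_i k i * r i].

(* Unique lifting against surjections [q : C -> D] with square-zero kernel. *)
Definition formally_etale (A B : comPzRingType)
    (phi : {rmorphism A -> B}) : Prop :=
  forall (C D : comPzRingType) (q : {rmorphism C -> D})
         (u : {rmorphism A -> C}) (v : {rmorphism B -> D}),
    (forall d, exists c, q c = d) ->
    (forall a b, q a = 0 -> q b = 0 -> a * b = 0) ->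
    q \o u =1 v \o phi ->
    exists w : {rmorphism B -> C},
      [/\ w \o phi =1 u, q \o w =1 v
        & forall w' : {rmorphism B -> C},
            w' \o phi =1 u -> q \o w' =1 v -> w' =1 w].

Definition etale_ring_hom (A B : comPzRingType)
    (phi : {rmorphism A -> B}) : Prop :=
  formally_etale phi /\ finitely_presented phi.

(** * Ringed spaces *)

(* Primitive projections: [V] is convertible to its eta-expansion, so that the
   preimage of [V] under the identity is [V] itself. *)
#[projections(primitive)]
Record opens (X : topologicalType) := Opens {
  oset :> set X;
  oset_open : open oset }.

(* The gluing axiom is stated with [exists!], so it includes separatedness. *)
Record ringed_space := RingedSpace {
  carrier :> topologicalType;
  sections : opens carrier -> comPzRingType;
  restr : forall U V : opens carrier,
    V `<=` U -> {rmorphism sections U -> sections V};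
  restr_id : forall (U : opens carrier) (h : U `<=` U) (s : sections U),
    restr h s = s;
  restr_comp : forall (U V W : opens carrier)
      (h1 : V `<=` U) (h2 : W `<=` V) (h3 : W `<=` U) (s : sections U),
    restr h2 (restr h1 s) = restr h3 s;
  restr_glue : forall (I : Type) (U : opens carrier) (V : I -> opens carrier)
      (h : forall i, V i `<=` U) (s : forall i, sections (V i)),
    U `<=` \bigcup_i V i ->
    (forall i j (W : opens carrier) (hi : W `<=` V i) (hj : W `<=` V j),
       restr hi (s i) = restr hj (s j)) ->
    exists! t : sections U, forall i, restr (h i) t = s i }.

(* The germ of [s] at [x] is invertible in the stalk at [x]. *)
Definition germ_unit (X : ringed_space) (U : opens X) (s : sections U)
    (x : X) : Prop :=
  exists (V : opens X) (h : V `<=` U), oset V x /\ is_unit (restr h s).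

(** * Schemes *)

(* The ringed space [(U, O_X|U)] is isomorphic to [Spec A], [A := O_X(U)].
   The homeomorphism onto the prime spectrum is [phi] (only its values on [U]
   matter), and the structure sheaf of [Spec A] is the sheaf whose sections
   over each [D(a)] are the localization [A_a], compatibly with restriction. *)
Definition affine_open (X : ringed_space) (U : opens X) : Prop :=
  exists phi : X -> set (sections U),
    [/\ forall x, oset U x -> is_prime_ideal (phi x),
        forall P : set (sections U), is_prime_ideal P ->
          exists! x, oset U x /\ phi x = P,
        forall V : set X, V `<=` U ->
          (open V <-> exists E : set (sections U),
             V = [set x | oset U x /\ exists2 a, E a & ~ phi x a])
      & forall (a : sections U) (V : opens X) (h : V `<=` U),
          oset V = [set x | oset U x /\ ~ phi x a] ->
          is_localization a (restr h)].

(* Local rings as stalks need not be required: they are automatic for a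
   ringed space covered by affine opens. *)
Record scheme := Scheme {
  scheme_space :> ringed_space;
  scheme_affine_cover : forall x : scheme_space,
    exists2 U : opens scheme_space, oset U x & affine_open U }.

Definition preim_opens (X Y : topologicalType) (f : X -> Y)
    (hf : forall V : set Y, open V -> open (f @^-1` V))
    (V : opens Y) : opens X :=
  Opens (hf V (oset_open V)).

(* Morphisms of locally ringed spaces. Continuity is in the form given by
   [continuousP], so that [preim_opens] commutes definitionally with
   composition; [mor_local] says that the maps induced on stalks are local. *)
Record mor (X Y : scheme) := Mor {
  mor_fun :> X -> Y;
  mor_open : forall V : set Y, open V -> open (mor_fun @^-1` V);
  mor_sec : forall V : opens Y,
    {rmorphism sections V -> sections (preim_opens mor_open V)};
  mor_nat : forall (V W : opens Y) (h : W `<=` V)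
      (h' : preim_opens mor_open W `<=` preim_opens mor_open V)
      (s : sections V),
    mor_sec W (restr h s) = restr h' (mor_sec V s);
  mor_local : forall (V : opens Y) (s : sections V) (x : X),
    oset V (mor_fun x) -> germ_unit (mor_sec V s) x -> germ_unit s (mor_fun x) }.

Section Category.

Definition mor_id (X : scheme) : mor X X.
Proof.
refine (@Mor X X (fun x => x) (fun U hU => hU)
  (fun V => (idfun : {rmorphism sections V -> sections V})) _ _).
- by move=> V W h h' s; congr (restr _ s); exact: Prop_irrelevance.
- by [].
Defined.

Variables X Y Z : scheme.

Lemma mor_comp_nat (g : mor Y Z) (f : mor X Y) (V W : opens Z) (h : W `<=` V)
    (h' : preim_opens (mor_open f) (preim_opens (mor_open g) W) `<=`
          preim_opens (mor_open f) (preim_opens (mor_open g) V))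
    (s : sections V) :
  mor_sec f _ (mor_sec g W (restr h s)) =
  restr h' (mor_sec f _ (mor_sec g V s)).
Proof.
have hg : preim_opens (mor_open g) W `<=` preim_opens (mor_open g) V.
  by move=> y /h.
by rewrite (mor_nat h hg) (mor_nat hg h').
Qed.

Definition mor_comp (g : mor Y Z) (f : mor X Y) : mor X Z :=
  @Mor X Z (fun x => g (f x))
    (fun V hV => mor_open f (mor_open g hV))
    (fun V => mor_sec f (preim_opens (mor_open g) V) \o mor_sec g V)
    (fun V W h h' s => mor_comp_nat h h' s)
    (fun V s x hx u =>
       mor_local (m := g) hx
         (mor_local (m := f) (V := preim_opens (mor_open g) V) hx u)).

End Category.

Definition is_iso (X Y : scheme) (f : mor X Y) : Prop :=
  exists g : mor Y X, mor_comp g f = mor_id X /\ mor_comp f g = mor_id Y.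

(* The square  P --b--> Y
               |        |
               a        g
               v        v
               X --f--> S   commutes and is cartesian. *)
Definition is_pullback (P X Y S : scheme) (a : mor P X) (b : mor P Y)
    (f : mor X S) (g : mor Y S) : Prop :=
  mor_comp f a = mor_comp g b /\
  forall (W : scheme) (x : mor W X) (y : mor W Y),
    mor_comp f x = mor_comp g y ->
    exists! w : mor W P, mor_comp a w = x /\ mor_comp b w = y.

(** * Properties of schemes and of their morphisms *)

Definition reduced (X : scheme) : Prop :=
  forall U : opens X, reduced_ring (sections U).

Definition quasicompact (X : scheme) : Prop := cover_compact [set: X].

Definition quasiseparated (X : scheme) : Prop :=
  forall U V : set X, open U -> open V ->
    cover_compact U -> cover_compact V -> cover_compact (U `&` V).

Definition coherent (X : scheme) : Prop := quasicompact X /\ quasiseparated X.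

Definition surjective (X Y : scheme) (f : mor X Y) : Prop :=
  forall y : Y, exists x : X, f x = y.

Definition etale (X Y : scheme) (f : mor Y X) : Prop :=
  forall y : Y, exists (U : opens X) (V : opens Y)
      (h : V `<=` preim_opens (mor_open f) U),
    [/\ oset V y, affine_open U, affine_open V
      & etale_ring_hom (restr h \o mor_sec f U)].

Definition homeomorphism (S T : topologicalType) (f : S -> T) : Prop :=
  continuous f /\
  exists g : T -> S, [/\ cancel f g, cancel g f & continuous g].

Definition universal_homeomorphism (X Y : scheme) (f : mor X Y) : Prop :=
  forall (T P : scheme) (t : mor T Y) (f' : mor P T) (t' : mor P X),
    is_pullback f' t' t f -> homeomorphism f'.

(** * Topological rigidification *)

Definition topologically_rigid (Y : scheme) : Prop :=
  coherent Y /\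
  forall (Y' : scheme) (f : mor Y' Y),
    reduced Y' -> universal_homeomorphism f -> is_iso f.

(* [e : T -> Y] is (the counit at [Y] of the adjunction exhibiting) the value
   at [Y] of a right adjoint to the inclusion of topologically rigid schemes
   into coherent schemes. *)
Definition is_trig (T Y : scheme) (e : mor T Y) : Prop :=
  topologically_rigid T /\
  forall (W : scheme) (g : mor W Y), topologically_rigid W ->
    exists! h : mor W T, mor_comp e h = g.

(* [q] is the value at [p] of that right adjoint: the transpose of
   [p \o eY], equivalently the map making the counit natural. *)
Definition is_trig_mor (X Y Xt Yt : scheme) (eX : mor Xt X) (eY : mor Yt Y)
    (p : mor Y X) (q : mor Yt Xt) : Prop :=
  mor_comp eX q = mor_comp p eY.

(* Main.v *)
(* For an affine open [T] of [Xtrig] and an affine chart [V] of [Y], the fibre product [Spec E]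
   of [T] and [V] is etale over [T]. The main point is that [Spec E] is rigid, so that it maps to
   [Ytrig]: these maps glue to the required lifts, and affine opens of [Ytrig], which are rigid for
   the same reason, give uniqueness. Locally [E] is standard etale over [O(T)], by Zariski's main
   theorem. If [Spec B -> Spec E] is a universal homeomorphism with [B] reduced, an element of [B]
   is determined by symmetric expressions in its values at the roots of the defining polynomial.
   These are integral radicial functions on [T], hence sections: the functions with values in
   residue fields which are locally integral radicial over the structure sheaf form a reduced
   scheme universally homeomorphic to [Xtrig]. *)
Require Import Defs.
From HB Require Import structures.
From mathcomp Require Import all_boot all_algebra.
From mathcomp Require Import boolp classical_sets topology finmap.
From mathcomp Require Import perm cyclic fieldext separable zify ring.
Set Implicit Arguments.
Unset Strict Implicit.
Unset Printing Implicit Defensive.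
Import GRing.Theory.
Local Open Scope classical_set_scope.
Local Open Scope ring_scope.

(** Both corners on the left of the square are known only through maps from rigid schemes, whereas a
    pullback is tested on arbitrary schemes. Hence the passage through charts: [Spec E] is rigid and
    so maps to [Ytrig], and any test scheme maps locally to [Spec E]. Spectra are used rather than
    open subschemes because rigidity includes coherence.

    Rigidity of [Xtrig] enters through one universal homeomorphism, from the scheme of radicial
    functions. It is an isomorphism over all of [Xtrig], hence over every open, so no rigidity of
    opens has to be known beforehand. The functions may take values in any extensions of the residue
    fields, chosen point by point: for a standard etale algebra given by [g], fields in which [g]
    splits and the relevant roots carry points of [B].

    The symmetric expressions are the coefficients of the interpolation polynomial
    [\sum_i a_i \prod_(j != i) (X - t_j)], with [a_i] the value at the root [t_i]. At [X = t_i] it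
    equals [a_i g'(t_i)], and [g'(t)] is a unit. As [a] becomes integral over the base only after
    multiplication by a power of [h], the [a_i] carry such a factor. *)

Notation cring := comPzRingType.
Notation nzcring := comNzRingType.
Notation "A ~> B" := {rmorphism A -> B} (at level 90, no associativity) : type_scope.
Notation els vs := [set v | v \in vs].
Notation opre f := (preim_opens (mor_open f)).

(** * Constructions of commutative rings *)

(** Operations on raw representatives together with a congruence. The ring laws hold only up to
    [peq], so that one passage to classes serves quotients, localizations, tensor products and
    subrings alike. *)
Record presented_ring := PresentedRing {
 pcar :> Type;
 peq : pcar -> pcar -> Prop;
 pzero : pcar; pone : pcar;
 padd : pcar -> pcar -> pcar;
 pmul : pcar -> pcar -> pcar;
 popp : pcar -> pcar;
 peq_refl : forall a, peq a a;
 peq_sym : forall a b, peq a b -> peq b a;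
 peq_trans : forall b a c, peq a b -> peq b c -> peq a c;
 padd_eq : forall a a' b b', peq a a' -> peq b b' -> peq (padd a b) (padd a' b');
 pmul_eq : forall a a' b b', peq a a' -> peq b b' -> peq (pmul a b) (pmul a' b');
 popp_eq : forall a a', peq a a' -> peq (popp a) (popp a');
 paddA : forall a b c, peq (padd a (padd b c)) (padd (padd a b) c);
 paddC : forall a b, peq (padd a b) (padd b a);
 padd0 : forall a, peq (padd pzero a) a;
 paddN : forall a, peq (padd (popp a) a) pzero;
 pmulA : forall a b c, peq (pmul a (pmul b c)) (pmul (pmul a b) c);
 pmulC : forall a b, peq (pmul a b) (pmul b a);
 pmul1 : forall a, peq (pmul pone a) a;
 pmulD : forall a b c, peq (pmul (padd a b) c) (padd (pmul a c) (pmul b c)) }.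

Section PresentedRing.
Variable R : presented_ring.

(** A class is a predicate of the form [peq t]: equality of classes is then extensional equality of
    predicates, and representatives come from choice. *)
Definition pquot := {C : set R | exists t, C = peq t}.
HB.instance Definition _ := gen_eqMixin pquot.
HB.instance Definition _ := gen_choiceMixin pquot.

Definition pclass (t : R) : pquot := exist _ (peq t) (ex_intro _ t erefl).
Definition prepr (q : pquot) : R := sval (cid (svalP q)).

Lemma pquot_inj (q q' : pquot) : sval q = sval q' -> q = q'.
case: q q' => [C hC] [C' hC'] /= e; subst C'; congr exist; exact: Prop_irrelevance. Qed.

Lemma preprK q : pclass (prepr q) = q.
by apply: pquot_inj; rewrite /prepr; case: cid. Qed.

Lemma pclassP a b : pclass a = pclass b <-> peq a b.
split=> [/(congr1 sval) /= e | ab]; first by rewrite e; exact: peq_refl.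
apply: pquot_inj; apply/funext => c; apply/propext; split=> /= h. by apply: peq_trans h; exact: peq_sym.
exact: peq_trans ab h. Qed.

Lemma pclassK a : peq (prepr (pclass a)) a.
by apply/pclassP; rewrite preprK. Qed.

Let add (x y : pquot) := pclass (padd (prepr x) (prepr y)).
Let mul (x y : pquot) := pclass (pmul (prepr x) (prepr y)).
Let opp (x : pquot) := pclass (popp (prepr x)).

Let addE a b : add (pclass a) (pclass b) = pclass (padd a b).
by apply/pclassP/padd_eq; exact: pclassK. Qed.
Let mulE a b : mul (pclass a) (pclass b) = pclass (pmul a b).
by apply/pclassP/pmul_eq; exact: pclassK. Qed.
Let oppE a : opp (pclass a) = pclass (popp a).
by apply/pclassP/popp_eq; exact: pclassK. Qed.

Let pquotA : associative add.
move=> x y z; rewrite -(preprK x) -(preprK y) -(preprK z) !addE. exact/pclassP/paddA. Qed.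
Let pquotC : commutative add.
by move=> x y; rewrite -(preprK x) -(preprK y) !addE; exact/pclassP/paddC. Qed.
Let pquot0 : left_id (pclass (pzero R)) add.
by move=> x; rewrite -(preprK x) addE; exact/pclassP/padd0. Qed.
Let pquotN : left_inverse (pclass (pzero R)) opp add.
by move=> x; rewrite -(preprK x) oppE addE; exact/pclassP/paddN. Qed.
Let pquotMA : associative mul.
move=> x y z; rewrite -(preprK x) -(preprK y) -(preprK z) !mulE. exact/pclassP/pmulA. Qed.
Let pquotMC : commutative mul.
by move=> x y; rewrite -(preprK x) -(preprK y) !mulE; exact/pclassP/pmulC. Qed.
Let pquot1 : left_id (pclass (pone R)) mul.
by move=> x; rewrite -(preprK x) mulE; exact/pclassP/pmul1. Qed.
Let pquotD : left_distributive mul add.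
move=> x y z; rewrite -(preprK x) -(preprK y) -(preprK z) !(addE, mulE). exact/pclassP/pmulD. Qed.

HB.instance Definition _ :=
 GRing.isZmodule.Build pquot pquotA pquotC pquot0 pquotN.
HB.instance Definition _ :=
 GRing.Zmodule_isComPzRing.Build pquot pquotMA pquotMC pquot1 pquotD.

Lemma pclassD a b : pclass (padd a b) = pclass a + pclass b.
by rewrite -addE. Qed.
Lemma pclassM a b : pclass (pmul a b) = pclass a * pclass b.
by rewrite -mulE. Qed.
Lemma pclass0 : pclass (pzero R) = 0. by []. Qed.
End PresentedRing.

Lemma rmorph_make (A B : pzRingType) (f : A -> B) :
 {morph f : x y / x + y} -> {morph f : x y / x * y} -> f 1 = 1 -> exists g : A ~> B, g =1 f.
move=> fD fM f1. have f0 : f 0 = 0 by apply: (addrI (f 0)); rewrite -fD !addr0.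
pose h := GRing.isNmodMorphism.Build A B f (conj f0 fD). pose k := GRing.isMonoidMorphism.Build A B f (conj f1 fM).
pose g : A ~> B := HB.pack f h k. by exists g. Qed.

Definition is_ideal (A : cring) (I : set A) : Prop :=
 [/\ I 0, forall a b, I a -> I b -> I (a + b) & forall a b, I b -> I (a * b)].

Lemma idealN (A : cring) (I : set A) a : is_ideal I -> I a -> I (- a).
by case=> _ _ IM Ia; rewrite -mulN1r; apply: IM. Qed.

Lemma ideal_sum (A : cring) (I : set A) (T : Type) (r : seq T) (P : pred T) (F : T -> A) :
 is_ideal I -> (forall i, P i -> I (F i)) -> I (\sum_(i <- r | P i) F i).
by case=> I0 ID _ IF; elim/big_rec: _ => // i x Pi; apply: ID; exact: IF. Qed.

Lemma prime_ideal (A : cring) (P : set A) : is_prime_ideal P -> is_ideal P.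
by case. Qed.

Lemma kernel_ideal (A B : cring) (f : A ~> B) : is_ideal [set a | f a = 0].
split=> [|a b fa fb|a b fb] /=; first exact: rmorph0. by rewrite rmorphD fa fb addr0. by rewrite rmorphM fb mulr0.
Qed.

Section Quotient.
Variables (A : cring) (I : set A) (idI : is_ideal I).

Let eqI (a b : A) := I (a - b).

Let I0 : I 0. by case: idI. Qed.
Let ID a b : I a -> I b -> I (a + b). by case: idI => _ h _; exact: h. Qed.
Let IM a b : I b -> I (a * b). by case: idI => _ _ h; exact: h. Qed.
Let IE a b : a = b -> eqI a b. by move=> ->; rewrite /eqI subrr. Qed.

Definition quotient_presentation : presented_ring.
refine (@PresentedRing A eqI 0 1 +%R *%R -%R _ _ _ _ _ _ _ _ _ _ _ _ _ _).
- by move=> a; exact: IE.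
- by move=> a b h; rewrite /eqI -opprB; exact: idealN.
- by move=> b a c h k; rewrite /eqI -(subrK b a) -addrA; exact: ID.
- move=> a a' b b' h k; rewrite /eqI. by rewrite (_ : _ - _ = (a - a') + (b - b')); [exact: ID | ring].
- move=> a a' b b' h k; rewrite /eqI. have -> : a * b - a' * b' = b * (a - a') + a' * (b - b') by ring.
 by apply: ID; exact: IM.
- move=> a a' h; rewrite /eqI. by rewrite (_ : _ - _ = -1 * (a - a')); [exact: IM | ring].
- by move=> *; apply: IE; ring.
- by move=> *; apply: IE; ring.
- by move=> *; apply: IE; ring.
- by move=> *; apply: IE; ring.
- by move=> *; apply: IE; ring.
- by move=> *; apply: IE; ring.
- by move=> *; apply: IE; ring.
- by move=> *; apply: IE; ring. Defined.

Lemma quotient_ring : exists (Q : cring) (pi : A ~> Q),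
 (forall q, exists a, pi a = q) /\ (forall a, pi a = 0 <-> I a).
pose Q : cring := pquot quotient_presentation. have [pi piE] := @rmorph_make A Q (@pclass quotient_presentation)
 (@pclassD quotient_presentation) (@pclassM quotient_presentation) erefl.
exists Q, pi; split=> [q|a]; first by exists (prepr q); rewrite piE preprK.
by rewrite piE -(pclass0 quotient_presentation) pclassP /= /eqI subr0. Qed.
End Quotient.

Definition mult_set (A : cring) (S : set A) : Prop := S 1 /\ forall a b, S a -> S b -> S (a * b).

Section Localization.
Variables (A : cring) (S : set A) (mS : mult_set S).

Let T := (A * {s : A | S s})%type.
Let den (x : T) : A := sval x.2.
Let denS (x : T) : S (den x). exact: svalP. Qed.
Let mkf (a s : A) (h : S s) : T := (a, exist _ s h).
Let S1 : S 1. by case: mS. Qed.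
Let SM a b : S a -> S b -> S (a * b). by case: mS => _ h; exact: h. Qed.
Let eqf (x y : T) := exists2 u, S u & u * (x.1 * den y - y.1 * den x) = 0.
Let eqfE (x y : T) : x.1 * den y - y.1 * den x = 0 -> eqf x y.
by move=> e; exists 1 => //; rewrite e mulr0. Qed.

Definition localization_presentation : presented_ring.
refine (@PresentedRing T eqf (mkf 0 S1) (mkf 1 S1)
 (fun x y => mkf (x.1 * den y + y.1 * den x) (SM (denS x) (denS y)))
 (fun x y => mkf (x.1 * y.1) (SM (denS x) (denS y))) (fun x => mkf (- x.1) (denS x)) _ _ _ _ _ _ _ _ _ _ _ _ _ _).
- by move=> a; apply: eqfE; rewrite subrr.
- by move=> a b [u Su e]; exists u => //; rewrite -opprB mulrN e oppr0.
- move=> b a c [u Su e] [v Sv k]; exists (u * v * den b). by apply: SM (denS b); exact: SM.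
 rewrite (_ : _ * _ = v * den c * (u * (a.1 * den b - b.1 * den a)) +
  u * den a * (v * (b.1 * den c - c.1 * den b))); last by ring. by rewrite e k !mulr0 addr0.
- move=> a a' b b' [u Su e] [v Sv k]; exists (u * v); first exact: SM. rewrite /den /= -!/(den _).
 rewrite (_ : _ * _ = v * den b * den b' * (u * (a.1 * den a' - a'.1 * den a)) +
  u * den a * den a' * (v * (b.1 * den b' - b'.1 * den b))); last by ring. by rewrite e k !mulr0 addr0.
- move=> a a' b b' [u Su e] [v Sv k]; exists (u * v); first exact: SM. rewrite /den /= -!/(den _).
 rewrite (_ : _ * _ = v * b.1 * den b' * (u * (a.1 * den a' - a'.1 * den a)) +
  u * a'.1 * den a * (v * (b.1 * den b' - b'.1 * den b))); last by ring. by rewrite e k !mulr0 addr0.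
- move=> a a' [u Su e]; exists u => //; rewrite /den /= -!/(den _).
 by rewrite (_ : u * _ = - (u * (a.1 * den a' - a'.1 * den a))); [rewrite e oppr0 | ring].
- by move=> a b c; apply: eqfE; rewrite /den /= -!/(den _); ring.
- by move=> a b; apply: eqfE; rewrite /den /= -!/(den _); ring.
- by move=> a; apply: eqfE; rewrite /den /= -!/(den _); ring.
- by move=> a; apply: eqfE; rewrite /den /= -!/(den _); ring.
- by move=> a b c; apply: eqfE; rewrite /den /= -!/(den _); ring.
- by move=> a b; apply: eqfE; rewrite /den /= -!/(den _); ring.
- by move=> a; apply: eqfE; rewrite /den /= -!/(den _); ring.
- by move=> a b c; apply: eqfE; rewrite /den /= -!/(den _); ring. Defined.

Lemma localization_ring : exists (L : cring) (l : A ~> L), [/\ forall s, S s -> is_unit (l s),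
   forall q, exists a s, S s /\ q * l s = l a & forall a, l a = 0 <-> exists2 s, S s & s * a = 0].
pose L : cring := pquot localization_presentation.
pose cl : localization_presentation -> L := @pclass localization_presentation.
have clE x y : eqf x y -> cl x = cl y by move=> h; exact/pclassP.
have clD x y : cl (mkf (x.1 * den y + y.1 * den x) (SM (denS x) (denS y))) = cl x + cl y.
 exact: (@pclassD localization_presentation x y).
have clM x y : cl (mkf (x.1 * y.1) (SM (denS x) (denS y))) = cl x * cl y.
 exact: (@pclassM localization_presentation x y). have [|||l lE] := @rmorph_make A L (fun a => cl (mkf a S1)).
- by move=> x y; rewrite -clD; apply/clE/eqfE; rewrite /den /=; ring.
- by move=> x y; rewrite -clM; apply/clE/eqfE; rewrite /den /=; ring.
- by []. exists L, l; split.
- move=> s Ss; exists (cl (mkf 1 Ss)). have e1 : cl (mkf 1 S1) = 1 by []. rewrite lE -clM -e1.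
 by apply/clE/eqfE; rewrite /den /=; ring.
- move=> q; pose x : T := prepr q. have <- : cl x = q by exact: preprK.
 exists x.1, (den x); split; first exact: denS. by rewrite !lE -clM; apply/clE/eqfE; rewrite /den /=; ring.
- move=> a; have e0 : cl (mkf 0 S1) = 0 by []. rewrite lE -e0 pclassP.
 by split=> -[s Ss e]; exists s => //; move: e; rewrite /den /= mul0r subr0 mulr1. Qed.
End Localization.

Section Tensor.
Variables (A B C : cring).
Variables (f : A ~> B) (g : A ~> C).

Definition balanced (G : zmodType) (beta : B -> C -> G) : Prop :=
 [/\ forall b b' c, beta (b + b') c = beta b c + beta b' c,
   forall b c c', beta b (c + c') = beta b c + beta b c' & forall a b c, beta (f a * b) c = beta b (g a * c)].

Definition is_tensor (R : cring) (i : B ~> R) (j : C ~> R) : Prop := [/\ forall a, i (f a) = j (g a),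
   forall r, exists s : seq (B * C), r = \sum_(x <- s) i x.1 * j x.2
  & forall (G : zmodType) (beta : B -> C -> G), balanced beta ->
   exists theta : R -> G, {morph theta : x y / x + y} /\ forall b c, theta (i b * j c) = beta b c].

Lemma balancedN (G : zmodType) (beta : B -> C -> G) b c : balanced beta -> beta (- b) c = - beta b c.
case=> Bl _ _; have B0 : beta 0 c = 0. by apply: (addrI (beta 0 c)); rewrite -Bl !addr0.
by apply: (addrI (beta b c)); rewrite -Bl !subrr. Qed.

(* Two formal sums of pure tensors are identified when every balanced map
  into an abelian group agrees on them, which makes the universal property
  for additive maps immediate. *)
Let tsum (G : zmodType) (beta : B -> C -> G) (s : seq (B * C)) := \sum_(x <- s) beta x.1 x.2.
Let eqt (s t : seq (B * C)) := forall (G : zmodType) (beta : B -> C -> G),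
 balanced beta -> tsum beta s = tsum beta t.
Let mult (s t : seq (B * C)) := [seq (x.1 * y.1, x.2 * y.2) | x <- s, y <- t].
Let oppt (s : seq (B * C)) := [seq (- x.1, x.2) | x <- s].

Let tsum_cat (G : zmodType) (beta : B -> C -> G) s t : tsum beta (s ++ t) = tsum beta s + tsum beta t.
by rewrite /tsum big_cat. Qed.
Let tsum_mul (G : zmodType) (beta : B -> C -> G) s t : tsum beta (mult s t) =
  \sum_(x <- s) tsum (fun b c => beta (x.1 * b) (x.2 * c)) t.
rewrite /tsum /mult big_allpairs_dep /=. by apply: eq_bigr. Qed.
Let tsum_opp (G : zmodType) (beta : B -> C -> G) s : balanced beta -> tsum beta (oppt s) = - tsum beta s.
move=> hb; rewrite /tsum /oppt big_map -sumrN. by apply: eq_bigr => x _; rewrite balancedN. Qed.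
Let balanced_mul (G : zmodType) (beta : B -> C -> G) x y : balanced beta ->
 balanced (fun b c => beta (x * b) (y * c)).
case=> h1 h2 h3; split=> [b b' c|b c c'|a b c].
- by rewrite mulrDr h1.
- by rewrite mulrDr h2.
- by rewrite mulrCA h3 mulrCA. Qed.
Let multC (G : zmodType) (beta : B -> C -> G) s t : balanced beta ->
 tsum beta (mult s t) = tsum beta (mult t s).
move=> hb; rewrite !tsum_mul /tsum exchange_big /=.
by apply: eq_bigr => x _; apply: eq_bigr => y _; rewrite mulrC (mulrC y.2). Qed.

Definition tensor_presentation : presented_ring.
refine (@PresentedRing (seq (B * C)) eqt [::] [:: (1, 1)] cat mult oppt _ _ _ _ _ _ _ _ _ _ _ _ _ _).
- by [].
- by move=> s t h G beta hb; rewrite h.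
- by move=> t s u h k G beta hb; rewrite h // k.
- by move=> s s' t t' h k G beta hb; rewrite !tsum_cat h // k.
(* With a pure tensor fixed on the left the map stays balanced, so the right factor can be replaced
   directly; commutativity takes care of the left one. *)
- move=> s s' t t' h k G beta hb. transitivity (tsum beta (mult s t')).
  rewrite !tsum_mul; apply: eq_bigr => x _; apply: k. exact: balanced_mul.
 rewrite multC // [RHS]multC // !tsum_mul; apply: eq_bigr => x _; apply: h. exact: balanced_mul.
- by move=> s s' h G beta hb; rewrite !tsum_opp // h.
- by move=> s t u G beta hb; rewrite !tsum_cat addrA.
- by move=> s t G beta hb; rewrite !tsum_cat addrC.
- by move=> s G beta hb.
- by move=> s G beta hb; rewrite tsum_cat tsum_opp // addNr /tsum big_nil.
- move=> s t u G beta hb; rewrite !tsum_mul /mult [in RHS]big_allpairs_dep /=.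
 apply: eq_bigr => x _; rewrite tsum_mul. apply: eq_bigr => y _; rewrite /tsum.
 by apply: eq_bigr => z _; rewrite !mulrA.
- by move=> s t G beta hb; rewrite multC.
- move=> s G beta hb; rewrite tsum_mul big_seq1 /tsum /=. by apply: eq_bigr => x _; rewrite !mul1r.
- by move=> s t u G beta hb; rewrite tsum_cat !tsum_mul big_cat. Defined.

Lemma tensor_ring : exists (R : cring) (i : B ~> R) (j : C ~> R), is_tensor i j.
pose P := tensor_presentation; pose R : cring := pquot P. pose cl : P -> R := @pclass P.
have clE s t : eqt s t -> cl s = cl t by move=> h; exact/pclassP.
have clD s t : cl (s ++ t) = cl s + cl t := @pclassD P s t.
have clM s t : cl (mult s t) = cl s * cl t := @pclassM P s t. have cl0 : cl [::] = 0 by [].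
have cl1 : cl [:: (1, 1)] = 1 by []. have [|||i iE] := @rmorph_make B R (fun b => cl [:: (b, 1)]).
- move=> x y; rewrite -clD; apply: clE => G beta [hb _ _]. by rewrite /tsum !big_cons !big_nil /= hb !addr0.
- by move=> x y; rewrite -clM; apply: clE => G beta hb; rewrite /mult /= mulr1.
- by []. have [|||j jE] := @rmorph_make C R (fun c => cl [:: (1, c)]).
- move=> x y; rewrite -clD; apply: clE => G beta [_ hb _]. by rewrite /tsum !big_cons !big_nil /= hb !addr0.
- by move=> x y; rewrite -clM; apply: clE => G beta hb; rewrite /mult /= mulr1.
- by []. have ijE b c : i b * j c = cl [:: (b, c)]. by rewrite iE jE -clM /mult /= mulr1 mul1r.
have clsum s : cl s = \sum_(x <- s) i x.1 * j x.2. elim: s => [|[b c] s IH]; first by rewrite big_nil.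
 by rewrite big_cons -IH ijE -clD. exists R, i, j; split.
- move=> a; rewrite iE jE; apply: clE => G beta [_ _ hb]. by rewrite /tsum !big_seq1 /= -[f a]mulr1 hb mulr1.
- by move=> r; exists (prepr r); rewrite -clsum [RHS]preprK.
- move=> G beta hb; exists (fun r => tsum beta (@prepr P r)). have thE s : tsum beta (prepr (cl s)) = tsum beta s.
  by have /(_ G beta hb) : eqt (prepr (cl s)) s by exact: (@pclassK P s).
 split=> [x y|b c]; last by rewrite ijE thE /tsum big_seq1.
 rewrite -[x in LHS](@preprK P) -[y in LHS](@preprK P) -/(cl _) -/(cl _). by rewrite -clD thE tsum_cat. Qed.
End Tensor.

Section TensorTheory.
Variables (A B C R : cring).
Variables (f : A ~> B) (g : A ~> C).
Variables (i : B ~> R) (j : C ~> R).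
Hypothesis tR : is_tensor f g i j.

Lemma tensor_morph_eq (D : cring) (w w' : R ~> D) : w \o i =1 w' \o i -> w \o j =1 w' \o j -> w =1 w'.
case: tR => _ gen _ ei ej r; have [s ->] := gen r. rewrite !rmorph_sum; apply: eq_bigr => x _; rewrite !rmorphM.
by have /= -> := ei x.1; have /= -> := ej x.2. Qed.

Lemma tensor_lift (D : cring) (u : B ~> D) (v : C ~> D) : u \o f =1 v \o g ->
 exists w : R ~> D, w \o i =1 u /\ w \o j =1 v.
case: tR => _ gen up uv. have [|theta [thD thE]] := up D (fun b c => u b * v c).
 split=> [b b' c|b c c'|a b c]; first by rewrite rmorphD mulrDl. by rewrite rmorphD mulrDr.
 by rewrite !rmorphM; have /= -> := uv a; ring.
have th0 : theta 0 = 0 by apply: (addrI (theta 0)); rewrite -thD !addr0.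
have thS (s : seq (B * C)) F : theta (\sum_(x <- s) F x) = \sum_(x <- s) theta (F x).
 exact: (big_morph theta thD th0). have thM : {morph theta : x y / x * y}.
 move=> x y; have [s ->] := gen x; have [t ->] := gen y. rewrite mulr_suml !thS mulr_suml; apply: eq_bigr => p _.
 rewrite mulr_sumr !thS mulr_sumr; apply: eq_bigr => q _.
 rewrite (_ : _ * _ = i (p.1 * q.1) * j (p.2 * q.2)); last by rewrite !rmorphM; ring.
 by rewrite !thE !rmorphM; ring. have th1 : theta 1 = 1.
 by rewrite -[1]mulr1 -{1}(rmorph1 i) -(rmorph1 j) thE !rmorph1 mulr1. have [w wE] := rmorph_make thD thM th1.
exists w; split=> x /=; rewrite wE. by rewrite -[i x]mulr1 -(rmorph1 j) thE rmorph1 mulr1.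
by rewrite -[j x]mul1r -(rmorph1 i) thE rmorph1 mul1r. Qed.
End TensorTheory.

Definition is_subring (A : cring) (S : set A) : Prop :=
 [/\ S 1, forall a b, S a -> S b -> S (a - b) & forall a b, S a -> S b -> S (a * b)].

Section Subring.
Variables (A : cring) (S : set A) (sS : is_subring S).

Let S1 : S 1. by case: sS. Qed.
Let SB a b : S a -> S b -> S (a - b). by case: sS => _ h _; exact: h. Qed.
Let SM a b : S a -> S b -> S (a * b). by case: sS => _ _ h; exact: h. Qed.
Let S0 : S 0. by rewrite -(subrr 1); exact: SB. Qed.
Let SN a : S a -> S (- a). by move=> h; rewrite -sub0r; exact: SB. Qed.
Let SD a b : S a -> S b -> S (a + b).
by move=> h k; rewrite -(opprK b); apply: SB => //; exact: SN. Qed.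

Lemma subringD a b : S a -> S b -> S (a + b). exact: SD. Qed.
Lemma subringN a : S a -> S (- a). exact: SN. Qed.
Lemma subring0 : S 0. exact: S0. Qed.

Definition subring_presentation : presented_ring.
refine (@PresentedRing {a : A | S a} (fun x y => sval x = sval y) (exist _ 0 S0) (exist _ 1 S1)
 (fun x y => exist _ (sval x + sval y) (SD (svalP x) (svalP y)))
 (fun x y => exist _ (sval x * sval y) (SM (svalP x) (svalP y)))
 (fun x => exist _ (- sval x) (SN (svalP x))) _ _ _ _ _ _ _ _ _ _ _ _ _ _).
- by [].
- by move=> x y ->.
- by move=> x y z -> ->.
- by move=> x y z t /= -> ->.
- by move=> x y z t /= -> ->.
- by move=> x y /= ->.
- by move=> x y z /=; rewrite addrA.
- by move=> x y /=; rewrite addrC.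
- by move=> x /=; rewrite add0r.
- by move=> x /=; rewrite addNr.
- by move=> x y z /=; rewrite mulrA.
- by move=> x y /=; rewrite mulrC.
- by move=> x /=; rewrite mul1r.
- by move=> x y z /=; rewrite mulrDl. Defined.

Lemma subring_type : exists (D : cring) (i : D ~> A), injective i /\ (forall a, S a <-> exists d, i d = a).
pose P := subring_presentation; pose D : cring := pquot P. pose cl : P -> D := @pclass P.
have vE x : sval (prepr (cl x)) = sval x by exact: (@pclassK P x).
have clD s t : cl (padd s t) = cl s + cl t := @pclassD P s t.
have clM s t : cl (pmul s t) = cl s * cl t := @pclassM P s t. have clK (d : D) : cl (@prepr P d) = d := @preprK P d.
have [|||i iE] := @rmorph_make D A (fun q => sval (@prepr P q)).
- by move=> x y; rewrite -{1}(clK x) -{1}(clK y) -clD vE.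
- by move=> x y; rewrite -{1}(clK x) -{1}(clK y) -clM vE.
- exact: (vE (pone P)). exists D, i; split=> [x y|a]. by rewrite !iE => e; rewrite -(clK x) -(clK y); apply/pclassP.
split=> [Sa|[d <-]]; last by rewrite iE; exact: svalP. by exists (cl (exist _ a Sa)); rewrite iE vE. Qed.
End Subring.

(** * Prime ideals *)

(** Zorn is applied to the sets [Y] whose union with [X] satisfies [P]. The empty chain then costs
    nothing: it only asks for [P X]. *)
Lemma zorn_set (T : Type) (P : set (set T)) (X : set T) : P X ->
 (forall F : set (set T), F !=set0 -> F `<=` P -> total_on F subset -> P (\bigcup_(Y in F) Y)) ->
 exists A, [/\ P A, X `<=` A & forall B, A `<=` B -> P B -> B = A].
move=> PX chain. have [F FP tF|A [PA Amax]] := @Zorn_bigcup T (fun Y => P (X `|` Y)).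
 have [F0|Fne] := pselect (F !=set0); last first. rewrite (_ : \bigcup_(Y in F) Y = set0) ?setU0 //.
  by rewrite -subset0 => x [Y FY _]; apply: Fne; exists Y.
 rewrite (_ : X `|` _ = \bigcup_(Z in [set X `|` Y | Y in F]) Z). apply: chain.
  - by case: F0 => Y FY; exists (X `|` Y), Y.
  - by move=> _ [Y FY <-]; exact: FP.
  - move=> _ _ [Y FY <-] [Z FZ <-]. by case: (tF _ _ FY FZ) => h; [left|right]; exact: setUS.
 apply/seteqP; split=> [x [Xx|[Y FY Yx]]|x [_ [Y FY <-] [Xx|Yx]]].
 - by case: F0 => Y FY; exists (X `|` Y); [exists Y|left].
 - by exists (X `|` Y); [exists Y|right].
 - by left.
 - by right; exists Y. exists (X `|` A); split=> [//|x|B AB PB]; first by left. have XB : X `|` B = B.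
 by apply/setUidPr => x Xx; apply: AB; left. apply/seteqP; split=> // x Bx; apply: contrapT => nx.
apply: (Amax B); last by rewrite XB. split; first by move=> y Ay; apply: AB; right.
by move=> BA; apply: nx; right; exact: BA. Qed.

Section Krull.
Variables (A : cring) (I S : set A).
Hypotheses (idI : is_ideal I) (mS : mult_set S) (IS : forall a, I a -> ~ S a).

(** An ideal maximal among those that contain [I] and avoid [S] is prime. If it misses [a] and [b],
    both enlarged ideals meet [S], and the product of the two witnesses lies in the ideal as soon as
    [a * b] does. *)
Lemma krull : exists P, [/\ is_prime_ideal P, I `<=` P & forall a, P a -> ~ S a].
have [||P [[idP PS] IP Pmax]] := @zorn_set A (fun J => is_ideal J /\ forall a, J a -> ~ S a) I.
- by [].
- move=> F [J0 FJ0] FP tF; split; last by move=> a [J FJ Ja]; exact: (FP _ FJ).2.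
 split=> [|a b [J FJ Ja] [K FK Kb]|a b [J FJ Jb]].
 + by exists J0 => //; case: (FP _ FJ0) => -[].
 + case: (tF _ _ FJ FK) => h; [exists K|exists J] => //.
   by case: (FP _ FK) => -[_ hD _] _; apply: hD => //; exact: h.
  by case: (FP _ FJ) => -[_ hD _] _; apply: hD => //; exact: h.
 + by exists J => //; case: (FP _ FJ) => -[_ _ hM] _; exact: hM.
exists P; split=> //; have [P0 PD PM] := idP; case: mS => S1 SM. split=> // [P1|a b Pab]; first exact: PS P1 S1.
have ext c : ~ P c -> exists2 s, S s & exists p x, P p /\ s = p + x * c. move=> nPc; apply: contrapT => nex.
 pose J := [set y | exists p x, P p /\ y = p + x * c]. have JP : J = P.
  apply: Pmax => [p Pp|]; first by exists p, 0; rewrite mul0r addr0.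
  split; last by move=> y Jy Sy; apply: nex; exists y.
  split=> [|y z [p [x [Pp ->]]] [q [t [Pq ->]]]|y z [p [x [Pp ->]]]].
  - by exists 0, 0; rewrite mul0r addr0.
  - by exists (p + q), (x + t); split; [exact: PD | ring].
  - by exists (y * p), (y * x); split; [exact: PM | ring].
 by apply: nPc; rewrite -JP; exists 0, 1; rewrite mul1r add0r. apply: contrapT => /not_orP [nPa nPb].
have [s Ss [p [x [Pp es]]]] := ext a nPa. have [t St [q [y [Pq et]]]] := ext b nPb.
apply: PS (SM _ _ Ss St); rewrite es et.
rewrite (_ : _ * _ = (q + y * b) * p + (x * a) * q + (x * y) * (a * b)); last by ring.
by apply: (PD); [apply: (PD)|]; exact: PM. Qed.
End Krull.

Section PrimeTheory.
Variable A : cring.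
Implicit Types (P I : set A).

Lemma primeX P a n : is_prime_ideal P -> P (a ^+ n) -> P a.
case=> _ _ _ P1 PM; elim: n => [|n IH]; first by rewrite expr0. by rewrite exprS => /PM []. Qed.

Lemma primeM P a b : is_prime_ideal P -> ~ P a -> ~ P b -> ~ P (a * b).
by case=> _ _ _ _ PM na nb /PM []. Qed.

Lemma prime_compl_mult P : is_prime_ideal P -> mult_set (~` P).
by move=> pP; split=> [|a b]; [case: pP | exact: primeM]. Qed.

Lemma powers_mult (a : A) : mult_set [set b | exists n, b = a ^+ n].
split; first by exists 0. by move=> _ _ [n ->] [m ->]; exists (n + m)%N; rewrite exprD. Qed.

Lemma radical_of_primes I a : is_ideal I ->
 (forall P, is_prime_ideal P -> I `<=` P -> P a) -> exists n, I (a ^+ n).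
move=> idI h; apply: contrapT => nI. have [|P [pP IP PS]] := krull idI (powers_mult a).
 by move=> b Ib [n e]; apply: nI; exists n; rewrite -e. by apply: (PS a (h _ pP IP)); exists 1. Qed.

Lemma zero_ideal : is_ideal [set 0 : A].
by split=> [//|a b /= -> ->|a b /= ->]; rewrite ?addr0 ?mulr0. Qed.

Lemma nilpotent_of_primes (a : A) : (forall P, is_prime_ideal P -> P a) -> exists n, a ^+ n = 0.
by move=> h; apply: (radical_of_primes zero_ideal) => P pP _; exact: h. Qed.

Lemma prime_containing I : is_ideal I -> ~ I 1 -> exists P, is_prime_ideal P /\ I `<=` P.
move=> idI nI; have [||P [pP IP _]] := @krull A I [set 1] idI.
- by split=> [//|_ _ -> ->]; rewrite mulr1.
- by move=> a Ia /= e; apply: nI; rewrite -e. by exists P. Qed.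

Lemma prime_exists : (1 : A) <> 0 -> exists P : set A, is_prime_ideal P.
by move=> nz; have [//|P [pP _]] := prime_containing zero_ideal; exists P. Qed.

Lemma prime_not_unit P (a : A) : is_prime_ideal P -> is_unit a -> ~ P a.
by case=> _ _ PM P1 _ [b ab] Pa; apply: P1; rewrite -ab mulrC; exact: PM. Qed.

Lemma unit_of_primes (a : A) : (forall P, is_prime_ideal P -> ~ P a) -> is_unit a.
move=> h; apply: contrapT => nu. pose I := [set x | exists b, x = a * b]. have idI : is_ideal I.
 split=> [|_ _ [b ->] [c ->]|c _ [b ->]]; first by exists 0; rewrite mulr0. by exists (b + c); rewrite mulrDr.
 by exists (c * b); rewrite mulrCA. have [|P [pP IP]] := prime_containing idI. by move=> [b e]; apply: nu; exists b.
by apply: (h P pP); apply: IP; exists 1; rewrite mulr1. Qed.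

Lemma preim_prime (B : cring) (f : A ~> B) (Q : set B) : is_prime_ideal Q -> is_prime_ideal (f @^-1` Q).
case=> Q0 QD QM Q1 QP; split=> /= [|a b|a b|//|a b]; rewrite ?rmorph0 //.
- by rewrite rmorphD; exact: QD.
- by rewrite rmorphM; exact: QM.
- by rewrite rmorph1.
- by rewrite rmorphM; exact: QP. Qed.

Lemma kernel_prime (F : fieldType) (f : A ~> F) : is_prime_ideal [set a | f a = 0].
split=> [|a b /= fa fb|a b /= fb|/= /eqP|a b /=]; first exact: rmorph0.
- by rewrite rmorphD fa fb addr0.
- by rewrite rmorphM fb mulr0.
- by rewrite rmorph1 oner_eq0.
- by rewrite rmorphM => /eqP; rewrite mulf_eq0 => /orP [] /eqP; [left|right]. Qed.
End PrimeTheory.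

(** The equality of structures lets [subst] turn a nonzero [cring] into an [nzcring], over which
    polynomials can be formed. *)
Lemma comNzRing_of (A : cring) : (1 : A) <> 0 -> exists A' : nzcring, A = A' :> cring.
case: A => S c; move/eqP => nz. pose A' : nzcring :=
 HB.pack S c (GRing.PzSemiRing_isNonZero.Build (GRing.ComPzRing.Pack c) nz).
by exists A'; rewrite /A'; case: c {A'} nz. Qed.

Lemma field_of_units (L : cring) : (1 : L) <> 0 -> (forall x : L, x <> 0 -> is_unit x) ->
 exists F : fieldType, L = F :> cring.
move=> nz; have [L' ->] := comNzRing_of nz; move=> hu {L nz}.
have invP (x : L') : {y | (x != 0 -> y * x = 1) /\ (x = 0 -> y = 0)}.
 apply: cid; have [->|/eqP x0] := eqVneq x 0; first by exists 0; split.
 by have [y xy] := hu x x0; exists y; split=> // _; rewrite mulrC. pose inv x := sval (invP x).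
have mulVx (x : L') : x != 0 -> inv x * x = 1 by exact: (svalP (invP x)).1.
have inv0 : inv 0 = 0 by exact: (svalP (invP 0)).2. move: inv mulVx inv0; clear. case: L' => S c inv mulVx inv0.
pose L' : nzcring := GRing.ComNzRing.Pack c.
pose F : fieldType := HB.pack S c (GRing.ComNzRing_isField.Build L' mulVx inv0).
exists F; rewrite /F /L'; case: c inv mulVx inv0 {F L'} => *. reflexivity. Qed.

(** The last clause, that every element is a fraction of images, is what lets maps from [A] descend
    to the residue field in [residue_field_lift]. *)
Lemma residue_field (A : cring) (P : set A) : is_prime_ideal P -> exists (F : fieldType) (chi : A ~> F),
  (forall a, chi a = 0 <-> P a) /\ forall z, exists a b, ~ P b /\ z = chi a / chi b.
move=> pP; have [Q [pi [surj ker]]] := quotient_ring (prime_ideal pP). pose S := [set q : Q | q <> 0].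
have mS : mult_set S. split=> [e|a b]; first by case: pP => _ _ _ h _; apply: h; apply/ker; rewrite rmorph1.
 have [x <-] := surj a; have [y <-] := surj b; rewrite /S /= -rmorphM.
 by move=> h k e; have [] := primeM pP (fun p => h ((ker x).2 p)) (fun p => k ((ker y).2 p)) ((ker _).1 e).
have [L [l [lu lsurj lker]]] := localization_ring mS. have l0 q : l q = 0 -> q = 0.
 move=> /lker [s Ss sq]; apply: contrapT => nq. by case: mS => _ h; exact: h Ss nq sq.
have [||F eF] := @field_of_units L.
- by move=> e; case: mS => h _; apply: h; apply: l0; rewrite rmorph1.
- move=> x nx; have [a [s [Ss e]]] := lsurj x. have [|y ay] := lu a; last by exists (l s * y); rewrite mulrA e.
 move=> a0; apply: nx; have [y sy] := lu s Ss. by rewrite -[x]mulr1 -sy mulrA e a0 rmorph0 mul0r.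
subst L; exists F, (l \o pi); split=> [a|z] /=. by rewrite -ker; split=> [|->]; [exact: l0|rewrite !rmorph0].
have [a [s [Ss e]]] := lsurj z. have [x xa] := surj a; have [y ys] := surj s.
exists x, y; split; first by move=> Py; apply: Ss; rewrite -ys; apply/ker.
rewrite xa ys -e mulfK //; apply/eqP => /l0; exact: Ss. Qed.

(** * Integral elements *)

Section Span.
Variables (A B : cring) (phi : A ~> B).
Implicit Types (I J : set A) (V W : set B) (vs ws us : seq B).

(** For an ideal [I], the [A]-submodule [I V] of [B]. With [V] everything it is the extended ideal
    [I B]; with [I] everything it is the span of [V]. *)
Inductive spn I V : B -> Prop :=
| spn0 : spn I V 0
| spnD x y : spn I V x -> spn I V y -> spn I V (x + y)
| spnG a v : I a -> V v -> spn I V (phi a * v).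

Lemma spn_sum I V (T : Type) (r : seq T) (P : pred T) (F : T -> B) :
 (forall i, P i -> spn I V (F i)) -> spn I V (\sum_(i <- r | P i) F i).
move=> h; elim/big_rec: _ => [|i x Pi]; first exact: spn0. by apply: spnD; exact: h. Qed.

Lemma spn_sub I J V W x : I `<=` J -> V `<=` W -> spn I V x -> spn J W x.
move=> IJ VW; elim=> [|y z _ hy _ hz|a v Ia Vv]; [exact: spn0|exact: spnD|]. by apply: spnG; [exact: IJ|exact: VW].
Qed.

Lemma spn_mul I V W U x y : is_ideal I -> (forall v w, V v -> W w -> U (v * w)) ->
 spn I V x -> spn setT W y -> spn I U (x * y).
move=> [_ _ IM] VW; elim=> [|{}x x' _ hx _ hx'|a v Ia Vv] hy.
- by rewrite mul0r; exact: spn0.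
- by rewrite mulrDl; apply: spnD; [exact: hx|exact: hx']. elim: hy => [|{}y y' _ hy _ hy'|b w _ Ww].
- by rewrite mulr0; exact: spn0.
- by rewrite mulrDr; exact: spnD. rewrite mulrACA -rmorphM mulrC (mulrC a) mulrC; apply: spnG; first exact: IM.
exact: VW. Qed.

Lemma spnZ I V a x : is_ideal I -> spn I V x -> spn I V (phi a * x).
case=> _ _ IM; elim=> [|y z _ hy _ hz|b v Ib Vv]; first by rewrite mulr0; exact: spn0.
 by rewrite mulrDr; exact: spnD. by rewrite mulrA -rmorphM; apply: spnG => //; exact: IM. Qed.

Lemma spn_setT_ideal I : is_ideal I -> is_ideal (spn I setT).
move=> idI; split=> [|a b|b x]; [exact: spn0|exact: spnD|].
elim=> [|y z _ hy _ hz|a v Ia _]; first by rewrite mulr0; exact: spn0. by rewrite mulrDr; exact: spnD.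
by rewrite mulrCA; exact: spnG. Qed.

Lemma spn_coef I (vs : seq B) x : is_ideal I -> spn I (els vs) x ->
 exists c : nat -> A, (forall i, I (c i)) /\ x = \sum_(i < size vs) phi (c i) * vs`_i.
case=> I0 ID IM; elim=> [|y z _ [c [Ic ->]] _ [d [Id ->]]|a v Ia /= vV].
- exists (fun=> 0); split=> //. by rewrite big1 // => i _; rewrite rmorph0 mul0r.
- exists (fun i => c i + d i); split=> [i|]; first exact: ID.
 by rewrite -big_split; apply: eq_bigr => i _; rewrite rmorphD mulrDl.
exists (fun i => if i == index v vs then a else 0); split=> [i|]. by case: ifP.
have iv : (index v vs < size vs)%N by rewrite index_mem.
rewrite (bigD1 (Ordinal iv)) //= eqxx nth_index // big1 ?addr0 //.
by move=> i; rewrite -val_eqE /= => /negPf ->; rewrite rmorph0 mul0r. Qed.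

(** A monic equation whose lower coefficients all lie in [I]. For [I] everything this is
    integrality. For an ideal [I] it forces a power of [z] into [I B], and the converse holds when
    [B] is integral, so it also expresses vanishing at all primes above [I]. *)
Definition iint I (z : B) : Prop := exists n, spn I [set w | exists2 i, (i < n)%N & w = z ^+ i] (z ^+ n).

Lemma iint_coef I z : is_ideal I -> iint I z -> exists n (c : nat -> A), (forall i, I (c i)) /\
  z ^+ n = \sum_(i < n) phi (c i) * z ^+ i.
move=> idI [n hn]; exists n; move: hn; pose vs := [seq z ^+ i | i <- iota 0 n]. case: (idI) => I0 ID IM.
elim=> [|x y _ [c [Ic ->]] _ [d [Id ->]]|a v Ia [i lin ->]].
- by exists (fun=> 0); split=> //; rewrite big1 // => i _; rewrite rmorph0 mul0r.
- exists (fun i => c i + d i); split=> [i|]; first exact: ID.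
 by rewrite -big_split; apply: eq_bigr => i _; rewrite rmorphD mulrDl.
exists (fun j => if j == i then a else 0); split=> [j|]; first by case: ifP.
rewrite (bigD1 (Ordinal lin)) //= eqxx big1 ?addr0 //.
by move=> j; rewrite -val_eqE /= => /negPf ->; rewrite rmorph0 mul0r. Qed.

Lemma iint_of_coef I z n (c : nat -> A) : is_ideal I -> (forall i, (i < n)%N -> I (c i)) ->
 z ^+ n + \sum_(i < n) phi (c i) * z ^+ i = 0 -> iint I z.
move=> idI Ic e; exists n. have -> : z ^+ n = \sum_(i < n) phi (- c i) * z ^+ i.
 move/eqP: e; rewrite addr_eq0 => /eqP ->; rewrite -sumrN. by apply: eq_bigr => i _; rewrite rmorphN mulNr.
apply: spn_sum => i _; apply: spnG; last by exists i. by apply: idealN => //; exact: Ic. Qed.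

Lemma zero_ring_hom : (1 : A) = 0 -> forall b : B, b = 0.
by move=> e b; rewrite -[b]mulr1 -(rmorph1 phi) e rmorph0 mulr0. Qed.

(** Cayley-Hamilton: the characteristic polynomial of [M], evaluated at [z], kills every [v k].
    Modulo [I] the matrix is zero, so this polynomial becomes [X^n] there, which puts its lower
    coefficients in [I]. *)
Lemma det_trick I n (M : 'M[A]_n) (v : 'I_n -> B) z : is_ideal I -> (forall i j, I (M i j)) ->
 (forall i, z * v i = \sum_j phi (M i j) * v j) -> exists c : nat -> A, (forall i, (i < n)%N -> I (c i)) /\
  forall k, (z ^+ n + \sum_(i < n) phi (c i) * z ^+ i) * v k = 0.
move=> idI IMij zv. have [A0|/eqP nzA] := pselect ((1 : A) = 0).
 exists (fun=> 0); split=> [i _|k]; first by case: idI. exact: zero_ring_hom.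
pose A' : nzcring := HB.pack A (GRing.PzSemiRing_isNonZero.Build A nzA).
have [B0|/eqP nzB] := pselect ((1 : B) = 0). have b0 (b : B) : b = 0 by rewrite -[b]mulr1 B0 mulr0.
 by exists (fun=> 0); split=> [i _|k]; [case: idI|exact: b0].
pose B' : nzcring := HB.pack B (GRing.PzSemiRing_isNonZero.Build B nzB). pose f : A' ~> B' := phi.
pose N : 'M[A']_n := M; pose p := char_poly N. exists (fun i => p`_i); split=> [i lin|k].
 have [Q [pi [surj ker]]] := quotient_ring idI. apply/ker. have [Q0|/eqP nzQ] := pselect ((1 : Q) = 0).
  by rewrite -[pi _]mulr1 Q0 mulr0. pose Q' : nzcring := HB.pack Q (GRing.PzSemiRing_isNonZero.Build Q nzQ).
 pose g : A' ~> Q' := pi. have -> : pi p`_i = (map_poly g p)`_i by rewrite coef_map.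
 rewrite /p map_char_poly (_ : map_mx g N = 0%:M); last first. apply/matrixP=> a b; rewrite !mxE mul0rn.
  exact/ker/IMij. rewrite /char_poly /char_poly_mx map_scalar_mx /= polyC0 raddf0 subr0 det_scalar.
 by have := coefXn Q' n i; rewrite (ltn_eqF lin) => h; exact: h.
pose x : 'cV[B']_n := \col_i v i; pose z' : B' := z. have e : (z'%:M - map_mx f N) *m x = 0.
 apply/matrixP=> i j; rewrite !mxE. under eq_bigr do rewrite !mxE.
 rewrite (eq_bigr (fun j => (z' *+ (i == j)) * v j - phi (M i j) * v j)); last first. by move=> l _; rewrite mulrBl.
 rewrite sumrB (bigD1 i) //= eqxx big1 ?addr0. by rewrite zv subrr.
 by move=> l; rewrite eq_sym => /negPf ->; rewrite mul0r. have d0 : \det (z'%:M - map_mx f N) *: x = 0.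
 by rewrite -mul_scalar_mx -mul_adj_mx -mulmxA e mulmx0. have dE : \det (z'%:M - map_mx f N) = (map_poly f p).[z'].
 rewrite map_char_poly /char_poly -horner_evalE -det_map_mx; congr (\det _).
 rewrite /char_poly_mx map_mxB map_scalar_mx /= horner_evalE hornerX.
 by congr (_ - _); apply/matrixP => a b; rewrite !mxE /= horner_evalE hornerC.
have h := congr1 (fun m : 'cV[B']_n => m k 0) d0. rewrite !mxE dE in h; rewrite -[RHS]h; congr (_ * _).
have sp : size (map_poly f p) = n.+1. rewrite size_map_poly_id0 ?size_char_poly //.
 by rewrite (monicP (char_poly_monic N)) rmorph1 oner_neq0.
have cf i : (map_poly f p)`_i = f p`_i by exact: coef_map. have pn : p`_n = 1.
 by have := char_poly_monic N; rewrite monicE lead_coefE size_char_poly => /eqP.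
rewrite horner_coef sp big_ord_recr /= addrC cf pn rmorph1 mul1r.
by congr (_ + _); apply: eq_bigr => i _; rewrite cf. Qed.

(** Says that the span of [vs] is a subalgebra of [B], finite as an [A]-module. *)
Definition fin_alg (vs : seq B) : Prop := spn setT (els vs) 1 /\
 forall v w, v \in vs -> w \in vs -> spn setT (els vs) (v * w).

(** The polynomial of [det_trick] kills every generator, hence also 1, which the generators span. *)
Lemma iint_fin_module I vs z : is_ideal I -> spn setT (els vs) 1 ->
 (forall v, v \in vs -> spn I (els vs) (z * v)) -> iint I z.
move=> idI v1 zv; set n := size vs. have hM (i : 'I_n) : exists c : nat -> A, (forall j, I (c j)) /\
  z * vs`_i = \sum_(j < n) phi (c j) * vs`_j. by apply: spn_coef => //; apply: zv; exact: mem_nth.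
have [M HM] := choice hM. have [|i|c [Ic h]] := @det_trick I n (\matrix_(i, j) M i j) (fun i => vs`_i) z idI.
- by move=> i j; rewrite mxE; case: (HM i).
- by rewrite (HM i).2; apply: eq_bigr => j _; rewrite mxE. apply: (iint_of_coef idI Ic); rewrite -[LHS]mulr1.
elim: v1 => [|x y _ hx _ hy|a v _ vvs]; first by rewrite mulr0. by rewrite mulrDr hx hy addr0.
have iv : (index v vs < n)%N by rewrite index_mem.
by have /= := h (Ordinal iv); rewrite nth_index // mulrCA => ->; rewrite mulr0. Qed.

Lemma spn_mulT vs I x y : is_ideal I -> fin_alg vs ->
 spn I (els vs) x -> spn setT (els vs) y -> spn I (els vs) (x * y).
move=> [I0 ID IM] [_ fM]; elim=> [|u w _ hu _ hw|a v Ia Vv] hy.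
- by rewrite mul0r; exact: spn0.
- by rewrite mulrDl; apply: spnD; [exact: hu|exact: hw]. elim: hy => [|u w _ hu _ hw|b w _ Ww].
- by rewrite mulr0; exact: spn0.
- by rewrite mulrDr; exact: spnD. rewrite mulrACA -rmorphM. elim: (fM v w Vv Ww) => [|t t' _ ht _ ht'|c u _ Uu].
- by rewrite mulr0; exact: spn0.
- by rewrite mulrDr; exact: spnD. rewrite mulrA -rmorphM; apply: spnG => //. by rewrite -mulrA mulrC; exact: IM.
Qed.

Lemma idealT : is_ideal [set: A].
by []. Qed.

Lemma spn_mem vs v : v \in vs -> spn setT (els vs) v.
by move=> h; rewrite -[v]mul1r -(rmorph1 phi); exact: spnG. Qed.

Lemma iint_of_spn I vs z : is_ideal I -> fin_alg vs -> spn I (els vs) z -> iint I z.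
move=> idI fv hz; apply: (iint_fin_module idI fv.1) => v vvs. by apply: spn_mulT => //; exact: spn_mem. Qed.

Lemma fin_algX vs x n : fin_alg vs -> spn setT (els vs) x -> spn setT (els vs) (x ^+ n).
move=> fv hx; elim: n => [|n IH]; first by rewrite expr0; case: fv. by rewrite exprS; exact: (spn_mulT idealT). Qed.

Lemma fin_alg_of_iint z : iint setT z -> exists vs, fin_alg vs /\ spn setT (els vs) z.
move=> [n hn]; pose vs := [seq z ^+ i | i <- iota 0 n].
have memv i : (i < n)%N -> spn setT (els vs) (z ^+ i). by move=> h; apply/spn_mem/map_f; rewrite mem_iota.
have hz k : spn setT (els vs) (z ^+ k). elim/ltn_ind: k => k IH; case: (ltnP k n) => [/memv //|nk].
 rewrite -(subnK nk) exprD. elim: hn => [|x y _ hx _ hy|a _ _ [i lin ->]].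
 - by rewrite mulr0; exact: spn0.
 - by rewrite mulrDr; exact: spnD. rewrite mulrCA -exprD; apply: (spnZ _ idealT); apply: IH.
 by rewrite -{2}(subnK nk) ltn_add2l. exists vs; split; last by have := hz 1%N; rewrite expr1.
split; first by have := hz 0%N; rewrite expr0. by move=> _ _ /mapP [i _ ->] /mapP [j _ ->]; rewrite -exprD. Qed.

(** The pairwise products span a finite subalgebra. It contains both given ones because each of them
    contains 1, and this inclusion respects coefficients in an ideal. *)
Lemma fin_alg_mul vs ws : fin_alg vs -> fin_alg ws -> exists us, [/\ fin_alg us,
  forall I x, is_ideal I -> spn I (els vs) x -> spn I (els us) x &
  forall I x, is_ideal I -> spn I (els ws) x -> spn I (els us) x].
move=> [v1 vM] [w1 wM]; pose us := [seq v * w | v <- vs, w <- ws].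
have mulI I x y : is_ideal I -> spn I (els vs) x ->
  spn setT (els ws) y -> spn I (els us) (x * y).
 move=> idI; apply: spn_mul => // v w /= vvs wws. by apply/allpairsP; exists (v, w).
have mulI' I x y : is_ideal I -> spn setT (els vs) x ->
  spn I (els ws) y -> spn I (els us) (x * y).
 move=> idI hx hy; rewrite mulrC; apply: spn_mul hy hx => // v w /= vvs wws.
 by apply/allpairsP; exists (w, v); split=> //; exact: mulrC. exists us; split.
- split; first by rewrite -[1]mulr1; exact: (mulI _ _ _ idealT).
 move=> _ _ /allpairsP [[v w] /= [vvs wws ->]] /allpairsP [[v' w'] /= [vvs' wws' ->]].
 by rewrite mulrACA; apply: (mulI _ _ _ idealT); [exact: vM|exact: wM].
- by move=> I x idI hx; rewrite -[x]mulr1; exact: mulI.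
- by move=> I x idI hx; rewrite -[x]mul1r; exact: mulI'. Qed.

Lemma iint_sub I J z : I `<=` J -> iint I z -> iint J z.
by move=> IJ [n hn]; exists n; exact: spn_sub hn. Qed.

Lemma iint_img I a : I a -> iint I (phi a).
move=> Ia; exists 1%N; rewrite expr1 -[phi a]mulr1. by apply: spnG => //; exists 0%N; rewrite ?expr0. Qed.

Lemma iintX I z n : iint I (z ^+ n) -> (0 < n)%N -> iint I z.
move=> [m hm] n0; exists (n * m)%N; rewrite exprM; apply: spn_sub hm => //.
by move=> _ [i lim ->]; exists (n * i)%N; rewrite ?ltn_pmul2l ?exprM. Qed.

Lemma fin_alg_iint I z : is_ideal I -> iint I z -> exists vs n,
 [/\ fin_alg vs, spn setT (els vs) z & spn I (els vs) (z ^+ n)].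
move=> idI hz; have [vs [fv zv]] := fin_alg_of_iint (iint_sub (@subsetT _ I) hz).
case: hz => n hn; exists vs, n; split=> //.
elim: hn => [|x y _ hx _ hy|a _ Ia [i _ ->]]; [exact: spn0|exact: spnD|]. rewrite -[phi a]mulr1 -mulrA mul1r.
elim: (fin_algX i fv zv) => [|x y _ hx _ hy|b v _ hv].
- by rewrite mulr0; exact: spn0.
- by rewrite mulrDr; exact: spnD. rewrite mulrA -rmorphM; apply: spnG => //.
by rewrite mulrC; case: (idI) => _ _ IM; exact: IM. Qed.

Lemma iint_spn_pow I vs z n : is_ideal I -> fin_alg vs ->
 spn setT (els vs) z -> spn I (els vs) (z ^+ n) -> iint I z.
(* The exponent is raised by one because [iintX] needs a positive exponent and [n] may be 0. *)
move=> idI fv zv hn; apply: (@iintX I z n.+1) => //.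
by apply: (iint_of_spn idI fv); rewrite exprSr; exact: spn_mulT. Qed.

Lemma iint_mul I z w : is_ideal I -> iint I z -> iint setT w -> iint I (z * w).
move=> idI /(fin_alg_iint idI) [vs [n [fv zv zn]]] /fin_alg_of_iint [ws [fw ww]].
have [us [fu vu wu]] := fin_alg_mul fv fw. have {}zv := vu _ _ idealT zv; have {}ww := wu _ _ idealT ww.
apply: (@iint_spn_pow I us _ n) => //; first exact: (spn_mulT idealT).
by rewrite exprMn; apply: spn_mulT => //; [exact: vu|exact: fin_algX]. Qed.

(** In a common finite subalgebra let [z ^+ n] and [w ^+ m] have coefficients in [I]. Every term of
    the binomial expansion of [(z + w) ^+ (n + m)] contains one of these two powers. *)
Lemma iintD I z w : is_ideal I -> iint I z -> iint I w -> iint I (z + w).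
move=> idI /(fin_alg_iint idI) [vs [n [fv zv zn]]]. move=> /(fin_alg_iint idI) [ws [m [fw ww wm]]].
have [us [fu vu wu]] := fin_alg_mul fv fw. have {}zv := vu _ _ idealT zv; have {}ww := wu _ _ idealT ww.
have {}zn := vu _ _ idI zn; have {}wm := wu _ _ idI wm.
apply: (@iint_spn_pow I us _ (n + m)) => //; first exact: spnD. rewrite exprDn; apply: spn_sum => i _.
have key : spn I (els us) (z ^+ (n + m - i) * w ^+ i). case: (leqP m i) => [mi|im].
  rewrite mulrC -(subnK mi) exprD (mulrC (w ^+ _)) -mulrA; apply: spn_mulT => //.
  by apply: (spn_mulT idealT) => //; exact: fin_algX.
 have ni : (n <= n + m - i)%N by rewrite -addnBA ?leq_addr // ltnW.
 rewrite -(subnK ni) exprD (mulrC (z ^+ _)) -mulrA; apply: spn_mulT => //.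
 by apply: (spn_mulT idealT) => //; exact: fin_algX.
by elim: 'C(_, _) => [|k IH]; [rewrite mulr0n; exact: spn0|rewrite mulrS; exact: spnD]. Qed.

Lemma iint0 I : I 0 -> iint I 0.
by move=> I0; rewrite -(rmorph0 phi); exact: iint_img. Qed.

Lemma iintN I z : is_ideal I -> iint I z -> iint I (- z).
move=> idI hz; rewrite -[- z]mulrN1; apply: iint_mul => //. by rewrite -(rmorph1 phi) -rmorphN; exact: iint_img.
Qed.

Lemma iint_sring : is_subring (iint setT).
split=> [|a b ha hb|a b ha hb]; first by rewrite -(rmorph1 phi); exact: iint_img.
 by apply: (iintD idealT) => //; exact: (iintN idealT). exact: (iint_mul idealT). Qed.

Lemma iint_spn_setT I z : is_ideal I -> (forall b, iint setT b) -> spn I setT z -> iint I z.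
move=> idI int; elim=> [|x y _ hx _ hy|a v Ia _].
- by apply: iint0; case: idI.
- exact: iintD. by apply: iint_mul => //; exact: iint_img. Qed.

Lemma fin_alg_seq (bs : seq B) : (forall b, b \in bs -> iint setT b) ->
 exists vs, fin_alg vs /\ forall b, b \in bs -> spn setT (els vs) b.
elim: bs => [|b bs IH] h. have [vs [fv _]] : exists vs, fin_alg vs /\ spn setT (els vs) 1.
  by apply: fin_alg_of_iint; rewrite -(rmorph1 phi); exact: iint_img. by exists vs.
have [c cbs|vs [fv hv]] := IH; first by apply: h; rewrite inE cbs orbT.
have [ws [fw hw]] := fin_alg_of_iint (h b (mem_head _ _)). have [us [fu vu wu]] := fin_alg_mul fv fw.
exists us; split=> // c; rewrite inE => /orP [/eqP ->|cbs]. exact: wu _ _ idealT hw.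
by apply: vu idealT _; exact: hv. Qed.

(** The coefficients [b i] lie in a finite subalgebra; its generators times the powers of [z] below
    [n] span a finite module stable under [z]. *)
Lemma iint_root_integral n (b : nat -> B) z : (forall i, (i < n)%N -> iint setT (b i)) ->
 z ^+ n = \sum_(i < n) b i * z ^+ i -> iint setT z.
move=> hb ez; case: n hb ez => [|n] hb ez. by exists 0%N; rewrite ez big_ord0; exact: spn0.
have [c|vs [fv hv]] := @fin_alg_seq [seq b i | i <- iota 0 n.+1].
 by move=> /mapP [i]; rewrite mem_iota => /= lin ->; exact: hb.
pose ws := [seq v * z ^+ i | v <- vs, i <- iota 0 n.+1].
have key x i : (i < n.+1)%N -> spn setT (els vs) x -> spn setT (els ws) (x * z ^+ i).
 move=> lin; elim=> [|y y' _ hy _ hy'|a v _ vvs].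
 - by rewrite mul0r; exact: spn0.
 - by rewrite mulrDl; exact: spnD. rewrite -mulrA; apply: spnG => //; apply/allpairsP; exists (v, i); split=> //.
 by rewrite mem_iota. apply: (@iint_fin_module _ ws); first exact: idealT.
 by have := key 1 0%N isT fv.1; rewrite mulr1.
move=> _ /allpairsP [[v i] [vvs iin ->]]; rewrite mem_iota add0n /= in iin vvs *.
rewrite mulrCA -exprS; case: (ltnP i.+1 n.+1) => lt. by apply: key => //; exact: spn_mem.
have -> : i.+1 = n.+1 by apply/eqP; rewrite eqn_leq lt iin.
rewrite ez mulr_sumr; apply: spn_sum => j _; rewrite mulrA; apply: key => //.
apply: (spn_mulT idealT) => //; first exact: spn_mem.
by apply: hv; apply/mapP; exists (j : nat); rewrite ?mem_iota ?ltn_ord. Qed.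

(** Lying over relative to an ideal [K] of [B]. The point is that [K + P B] contains no [phi a] with
    [a] outside [P]: an element of [P B] satisfies a monic equation with coefficients in [P], and
    modulo [K] this becomes an equation for [a]. A prime is then produced by [krull]. *)
Lemma lying_over (K : set B) (P : set A) : is_ideal K -> (forall b, iint setT b) ->
 is_prime_ideal P -> (forall a, K (phi a) -> P a) ->
 exists Q, [/\ is_prime_ideal Q, K `<=` Q & forall a, Q (phi a) <-> P a].
move=> idK int pP KP; have idP := prime_ideal pP.
pose J := [set y | exists k x, [/\ K k, spn P setT x & y = k + x]].
have [K0 KD KM] := idK; have [S0 SD SM] := spn_setT_ideal idP. have idJ : is_ideal J.
 split=> [|_ _ [k [x [Kk Sx ->]]] [l [y [Kl Sy ->]]]|b _ [k [x [Kk Sx ->]]]].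
 - by exists 0, 0; rewrite addr0.
 - by exists (k + l), (x + y); split; [exact: KD|exact: SD|ring].
 - by exists (b * k), (b * x); split; [exact: KM|exact: SM|ring]. pose S := [set y | exists2 a, ~ P a & y = phi a].
have mS : mult_set S. split; first by exists 1; [case: pP|rewrite rmorph1].
 by move=> _ _ [a na ->] [b nb ->]; exists (a * b); [exact: primeM|rewrite rmorphM]. have JS b : J b -> ~ S b.
 move=> [k [x [Kk Sx ->]]] [a na e]. have /(iint_coef idP) [n [c [Pc en]]] := iint_spn_setT idP int Sx.
 have xa : x = phi a - k by rewrite -e addrC addKr. apply: na; apply: (@primeX _ _ _ n) => //.
 (* The equation of [x] is transported to [phi a], which agrees with [x] modulo [K]. *)
 have : K (phi (a ^+ n - \sum_(i < n) c i * a ^+ i)). have cong i : exists2 l, K l & phi a ^+ i = x ^+ i + l.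
   elim: i => [|i [l Kl IH]]; first by exists 0; rewrite ?expr0 ?addr0.
   exists (x * l + phi a ^+ i * k); first by apply: KD; exact: KM.
   by rewrite exprS IH (_ : phi a = x + k) ?exprS; [ring|rewrite xa subrK].
  rewrite rmorphB rmorph_sum rmorphXn; have [l Kl ->] := cong n; rewrite en.
  rewrite (_ : _ - _ = l - \sum_(i < n) phi (c i) * (phi a ^+ i - x ^+ i)); last first.
   rewrite addrAC -sumrB addrC; congr (_ + _); rewrite -sumrN; apply: eq_bigr => i _.
   by rewrite rmorphM rmorphXn mulrBr opprB.
  apply: KD => //; apply: idealN => //; apply: ideal_sum => // i _; apply: KM.
  by have [l' Kl' ->] := cong i; rewrite addrAC subrr add0r. move/KP; have [P0 PD PM] := idP => h.
 rewrite -(subrK (\sum_(i < n) c i * a ^+ i) (a ^+ n)); apply: PD => //.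
 by apply: ideal_sum => // i _; rewrite mulrC; exact: PM. have [Q [pQ JQ QS]] := krull idJ mS JS.
exists Q; split=> // [k Kk|a]; first by apply: JQ; exists k, 0; rewrite addr0.
split=> [Qa|Pa]; first by apply: contrapT => na; apply: (QS _ Qa); exists a.
apply: JQ; exists 0, (phi a); split; [exact: K0| |by rewrite add0r]. by rewrite -[phi a]mulr1; exact: spnG. Qed.
End Span.

Lemma iint_comp (A B C : cring) (f : A ~> B) (g : B ~> C) (I : set A) (J : set B) z :
 (forall a, I a -> J (f a)) -> iint (g \o f) I z -> iint g J z.
move=> IJ [n hn]; exists n.
by elim: hn => [|x y _ hx _ hy|a v Ia Vv]; [exact: spn0|exact: spnD|apply: spnG => //; exact: IJ]. Qed.

Lemma iint_map (A B C : cring) (f : A ~> B) (g : B ~> C) (I : set A) z : iint f I z -> iint (g \o f) I (g z).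
move=> [n hn]; exists n; rewrite -rmorphXn.
elim: hn => [|x y _ hx _ hy|a _ Ia [i lin ->]]; first by rewrite rmorph0; exact: spn0.
 by rewrite rmorphD; exact: spnD.
by rewrite rmorphM; apply: (@spnG _ _ (g \o f)) => //; exists i; rewrite ?rmorphXn. Qed.

Lemma iint_inj (A B C : cring) (f : A ~> B) (g : B ~> C)
  (I : set A) z : is_ideal I -> injective g -> iint (g \o f) I (g z) -> iint f I z.
move=> idI ginj /(iint_coef idI) [n [c [Ic e]]]; exists n. have -> : z ^+ n = \sum_(i < n) f (c i) * z ^+ i.
 apply: ginj; rewrite rmorphXn e rmorph_sum; apply: eq_bigr => i _. by rewrite rmorphM rmorphXn.
by apply: spn_sum => i _; apply: spnG => //; exists i. Qed.

Lemma iint_trans (A B C : cring) (f : A ~> C) (g : B ~> C) z :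
 (forall b, iint f setT (g b)) -> iint g setT z -> iint f setT z.
move=> fg /(iint_coef (idealT B)) [n [c [_ e]]]. by apply: (@iint_root_integral _ _ f n (fun i => g (c i))). Qed.

(** * Algebras over a field *)

Section FieldAlgebra.
Variables (k : fieldType) (L : cring) (phi : k ~> L).

Lemma field_hom_inj : (1 : L) <> 0 -> injective phi.
move=> nz; apply: raddf_inj => x fx; apply/eqP; apply: contrapT => /negP nx.
by apply: nz; rewrite -(rmorph1 phi) -(mulVf nx) rmorphM fx mulr0. Qed.

Definition subspace (H : set L) : Prop :=
 [/\ H 0, forall x y, H x -> H y -> H (x + y) & forall a x, H x -> H (phi a * x)].

(** A subspace maximal among those that contain [H0] and omit [v] is a hyperplane complementary to
    the line of [v]; [lam] is the coordinate along that line. *)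
Lemma functional (H0 : set L) (v : L) : subspace H0 -> ~ H0 v ->
 exists lam : L -> k, [/\ {morph lam : x y / x + y},
  forall a x, lam (phi a * x) = a * lam x, forall x, H0 x -> lam x = 0 & lam v = 1].
move=> sH0 nv. have [//| |H [[sH nHv] H0H Hmax]] := @zorn_set L (fun H => subspace H /\ ~ H v) H0.
 move=> F [J0 FJ0] FP tF; split; last by move=> [J FJ Jv]; exact: (FP _ FJ).2.
 split=> [|x y [J FJ Jx] [K FK Ky]|a x [J FJ Jx]].
 - by exists J0 => //; case: (FP _ FJ0) => -[].
 - case: (tF _ _ FJ FK) => h; [exists K|exists J] => //.
   by case: (FP _ FK) => -[_ hD _] _; apply: hD => //; exact: h.
  by case: (FP _ FJ) => -[_ hD _] _; apply: hD => //; exact: h.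
 - by exists J => //; case: (FP _ FJ) => -[_ _ hM] _; exact: hM. have [Hz HD HZ] := sH.
have HN x : H x -> H (- x) by move=> Hx; rewrite -mulN1r -(rmorph1 phi) -rmorphN; exact: HZ.
have dec x : exists c, H (x - phi c * v).
 have [Hx|nHx] := pselect (H x); first by exists 0; rewrite rmorph0 mul0r subr0.
 have [[h [a [Hh ev]]]|nH] := pselect (exists h a, H h /\ v = h + phi a * x). have a0 : a != 0.
   by apply: contra_notN nHv => /eqP a0; rewrite ev a0 rmorph0 mul0r addr0.
  exists a^-1; rewrite ev mulrDr mulrA -rmorphM mulVf // rmorph1 mul1r opprD addrCA subrr addr0. exact/HN/HZ.
 exfalso; apply: nHx. pose J := [set y | exists h a, H h /\ y = h + phi a * x]. have JH : J = H.
  apply: Hmax => [h Hh|]; first by exists h, 0; rewrite rmorph0 mul0r addr0.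
  split; last by move=> [h [a hv]]; apply: nH; exists h, a.
  split=> [|_ _ [h [a [Hh ->]]] [g [b [Hg ->]]]|b _ [h [a [Hh ->]]]].
  - by exists 0, 0; rewrite rmorph0 mul0r addr0.
  - by exists (h + g), (a + b); split; [exact: HD|rewrite rmorphD; ring].
  - by exists (phi b * h), (b * a); split; [exact: HZ|rewrite rmorphM; ring].
 by rewrite -JH; exists 0, 1; rewrite rmorph1 mul1r add0r. have [lam lamP] := choice dec.
have uniq x c : H (x - phi c * v) -> lam x = c.
 move=> hc; apply/eqP; rewrite -subr_eq0; apply: contra_notT nHv => nz.
 rewrite -[v]mul1r -(rmorph1 phi) -(mulVf nz) rmorphM -mulrA; apply: HZ.
 rewrite (_ : _ * _ = (x - phi c * v) + - (x - phi (lam x) * v)). by apply: HD => //; exact: HN.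
 by rewrite rmorphB; ring. exists lam; split.
- move=> x y; apply: uniq; rewrite rmorphD.
 by rewrite (_ : _ - _ = (x - phi (lam x) * v) + (y - phi (lam y) * v)); [exact: HD|ring].
- move=> a x; apply: uniq; rewrite rmorphM.
 by rewrite (_ : _ - _ = phi a * (x - phi (lam x) * v)); [exact: HZ|ring].
- by move=> x Hx; apply: uniq; rewrite rmorph0 mul0r subr0; exact: H0H.
- by apply: uniq; rewrite rmorph1 mul1r subrr. Qed.

Definition free_family n (v : 'I_n -> L) : Prop :=
 forall c : 'I_n -> k, \sum_i phi (c i) * v i = 0 -> forall i, c i = 0.

Lemma dual_functional n (v : 'I_n -> L) l : free_family v -> exists lam : L -> k, [/\ {morph lam : x y / x + y},
  forall a x, lam (phi a * x) = a * lam x & forall i, lam (v i) = (i == l)%:R].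
move=> fv; pose H0 := [set x | exists c : 'I_n -> k, c l = 0 /\ x = \sum_i phi (c i) * v i].
have [||lam [lD lZ l0 l1]] := @functional H0 (v l).
- split=> [|_ _ [c [cl ->]] [d [dl ->]]|a _ [c [cl ->]]].
 + by exists (fun=> 0); split=> //; rewrite big1 // => i _; rewrite rmorph0 mul0r.
 + exists (fun i => c i + d i); rewrite cl dl addr0; split=> //.
  by rewrite -big_split; apply: eq_bigr => i _; rewrite rmorphD mulrDl.
 + exists (fun i => a * c i); rewrite cl mulr0; split=> //.
  by rewrite mulr_sumr; apply: eq_bigr => i _; rewrite rmorphM mulrA.
- move=> [c [cl e]]; have := fv (fun i => c i - (i == l)%:R). have -> : \sum_i phi (c i - (i == l)%:R) * v i = 0.
  under eq_bigr do rewrite rmorphB mulrBl. rewrite sumrB -e (bigD1 l) //= eqxx rmorph1 mul1r big1 ?addr0 ?subrr //.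
  by move=> i /negPf ->; rewrite rmorph0 mul0r.
 by move=> /(_ erefl l); rewrite cl eqxx sub0r => /eqP; rewrite oppr_eq0 oner_eq0.
exists lam; split=> // i; case: eqVneq => [->//|il].
apply: l0; exists (fun j => (j == i)%:R); rewrite eq_sym (negPf il); split=> //.
rewrite (bigD1 i) //= eqxx rmorph1 mul1r big1 ?addr0 //. by move=> j /negPf ->; rewrite rmorph0 mul0r. Qed.

Section TensorFree.
Variables (N T : cring) (psi : k ~> N).
Variables (i : L ~> T) (j : N ~> T).
Hypothesis tT : is_tensor phi psi i j.

(** Contracting the first factor with the functional dual to [v l] gives an additive map from [T] to
    [N] that reads off [y l]. *)
Lemma tensor_free n (v : 'I_n -> L) (y : 'I_n -> N) : free_family v ->
 \sum_l i (v l) * j (y l) = 0 -> forall l, y l = 0.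
move=> fv e l; have [lam [lD lZ lv]] := dual_functional l fv. case: tT => _ _ up.
have [|th [thD thE]] := up N (fun x z => psi (lam x) * z). split=> [b b' c|b c c'|a b c].
 - by rewrite lD rmorphD mulrDl.
 - by rewrite mulrDr.
 - by rewrite lZ rmorphM; ring. have th0 : th 0 = 0 by apply: (addrI (th 0)); rewrite -thD !addr0.
have := congr1 th e; rewrite (big_morph th thD th0) th0 (bigD1 l) //= big1.
 by rewrite thE lv eqxx rmorph1 mul1r addr0. by move=> m /negPf ml; rewrite thE lv ml rmorph0 mul0r. Qed.

Lemma tensor_field_inj : (1 : L) <> 0 -> injective j.
move=> nz; apply: raddf_inj => y jy. apply: (@tensor_free 1 (fun=> 1) (fun=> y) _ _ ord0).
 move=> c; rewrite big_ord1 mulr1 => e l; rewrite (ord1 l). by apply: (field_hom_inj nz); rewrite e rmorph0.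
by rewrite big_ord1 jy mulr0. Qed.
End TensorFree.
End FieldAlgebra.

Lemma compositum (k F G : fieldType) (f : k ~> F) (g : k ~> G) :
 exists (W : fieldType) (u : F ~> W) (v : G ~> W), u \o f =1 v \o g.
have [T [i [j tT]]] := tensor_ring f g. have nzF : (1 : F) <> 0 by apply/eqP; rewrite oner_neq0.
have nz : (1 : T) <> 0. move=> e; have /eqP := oner_neq0 G; apply.
 by apply: (tensor_field_inj tT nzF); rewrite rmorph1 e rmorph0. have [P pP] := prime_exists nz.
have [W [chi _]] := residue_field pP. exists W, (chi \o i), (chi \o j) => x /=. by case: tT => e _ _; rewrite e.
Qed.

Lemma residue_field_lift (A : cring) (k H : fieldType) (chi : A ~> k) (w : A ~> H) :
 (forall z, exists a b, chi b <> 0 /\ z = chi a / chi b) ->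
 (forall a, chi a = 0 <-> w a = 0) -> exists h : k ~> H, h \o chi =1 w.
move=> frac kw. have wn b : chi b <> 0 -> w b != 0 by move=> nb; apply/eqP => /kw.
have nn b : chi b <> 0 -> chi b != 0 by move/eqP.
have fracP z : exists y, forall a b, chi b <> 0 -> z = chi a / chi b -> y = w a / w b.
 have [a [b [nb ->]]] := frac z; exists (w a / w b) => c d nd e. have e1 : chi a * chi d = chi c * chi b.
  by apply/eqP; rewrite -eqr_div; [exact/eqP|exact/eqP|exact/eqP].
 have /kw : chi (a * d - c * b) = 0 by rewrite rmorphB !rmorphM e1 subrr.
 rewrite rmorphB !rmorphM => /eqP; rewrite subr_eq0 => e2. by apply/eqP; rewrite eqr_div ?wn.
have [h hP] := choice fracP. have hE a b : chi b <> 0 -> h (chi a / chi b) = w a / w b by move=> nb; exact: hP.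
have n1 : chi 1 <> 0 by rewrite rmorph1; apply/eqP; rewrite oner_neq0. have [|||h' h'E] := @rmorph_make k H h.
- move=> x y; have [a [b [nb ->]]] := frac x; have [c [d [nd ->]]] := frac y.
 rewrite addf_div ?nn // -!rmorphM -rmorphD !hE //; last first. by rewrite rmorphM; apply/eqP/mulf_neq0; exact: nn.
 by rewrite addf_div ?wn // !rmorphD !rmorphM.
- move=> x y; have [a [b [nb ->]]] := frac x; have [c [d [nd ->]]] := frac y.
 rewrite mulf_div -!rmorphM !hE //; last first. by rewrite rmorphM; apply/eqP/mulf_neq0; exact: nn.
 by rewrite mulf_div !rmorphM.
- by have := hE 1 1 n1; rewrite !rmorph1 !divr1.
by exists h' => a /=; have := hE a 1 n1; rewrite !rmorph1 !divr1 h'E. Qed.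

(** The hypothesis says that the two field points lie over the same prime of [A]. Both then factor
    through its residue field, and they agree in a compositum over it. *)
Lemma point_compositum (A B C : cring) (F G : fieldType) (f : A ~> B) (g : A ~> C) (u : B ~> F) (v : C ~> G) :
 (forall a, u (f a) = 0 <-> v (g a) = 0) -> exists (W : fieldType) (u' : F ~> W) (v' : G ~> W),
  forall a, u' (u (f a)) = v' (v (g a)).
move=> ker; have pP : is_prime_ideal [set a | (u \o f) a = 0] by exact: kernel_prime.
have [k [chi [chi0 chis]]] := residue_field pP. have chis' z : exists a b, chi b <> 0 /\ z = chi a / chi b.
 by have [a [b [nb e]]] := chis z; exists a, b; split=> // /chi0.
have [a|h1 e1] := @residue_field_lift A k F chi (u \o f) chis'; first exact: chi0.
have [a|h2 e2] := @residue_field_lift A k G chi (v \o g) chis'. by rewrite chi0; exact: ker.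
have [W [u' [v' e]]] := compositum h1 h2. exists W, u', v' => a.
by have /= <- := e1 a; have /= <- := e2 a; exact: e. Qed.

Lemma splitting_field (F : fieldType) (p : {poly F}) : p != 0 ->
 exists (K : fieldType) (iota : F ~> K) (rs : seq K),
  map_poly iota p = (iota (lead_coef p)) *: \prod_(r <- rs) ('X - r%:P).
have [n] := ubnP (size p); elim: n => // n IH in F p *; rewrite ltnS => sp p0. case: (leqP (size p) 1) => s1.
 exists F, idfun, [::]; rewrite big_nil alg_polyC map_poly_id //.
 have [c ->] : exists c, p = c%:P by exists p`_0; rewrite -size1_polyC. by rewrite lead_coefC.
have [q iq qp] : exists2 q, irreducible_poly q & q %| p. move: s1; clear -p0; have [m] := ubnP (size p).
 elim: m p p0 => // m IHm p p0; rewrite ltnS => sm s1.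
 have [ip|nip] := pselect (irreducible_poly p); first by exists p.
 have [q [sq qp nqp]] : exists q : {poly F}, [/\ size q != 1, q %| p & ~~ (q %= p)].
  apply: contrapT => nex; apply: nip; split=> // q sq qp. by apply: contrapT => /negP nq; apply: nex; exists q.
 have q0 : q != 0 by apply: contraNneq p0 => q0; rewrite -dvd0p -q0. have lt : (size q < size p)%N.
  by rewrite ltn_neqAle (dvdp_size_eqp qp) nqp dvdp_leq. have [||r ir rq] := IHm q q0; first exact: leq_trans lt sm.
  by rewrite ltn_neqAle eq_sym sq lt0n size_poly_eq0. by exists r => //; exact: dvdp_trans qp.
have [K _ [z zr _]] := irredp_FAdjoin iq. pose i : F ~> K := in_alg K. have pz : root (map_poly i p) z.
 have /dvdpP [r ->] := qp; rewrite rmorphM rootM; apply/orP; right; exact: zr. have /factor_theorem [r er] := pz.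
have r0 : r != 0. apply/eqP => r0; move: er; rewrite r0 mul0r => /eqP. by rewrite map_poly_eq0 (negPf p0).
have sr : (size r < n)%N. have := congr1 (fun q : {poly K} => size q) er.
 rewrite /= size_map_poly size_Mmonic ?monicXsubC // size_XsubC addn2 /= => e. by rewrite e in sp.
have [K' [j [rs ers]]] := IH K r sr r0. exists K', (j \o i), (j z :: rs).
rewrite map_poly_comp er rmorphM /= ers map_polyXsubC big_cons. rewrite mulrC -scalerAr; congr (_ *: _).
have := congr1 (fun q : {poly K} => lead_coef q) er.
by rewrite /= lead_coef_map lead_coefM lead_coefXsubC mulr1 => <-. Qed.

Definition char_exponent (F : fieldType) (q : nat) : Prop :=
 q = 1%N \/ exists p e, p \in [pchar F] /\ q = (p ^ e)%N.

(** Write [d = q * l] with [q] a power of the characteristic exponent and [l] nonzero in [F]. Then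
    [m] becomes [(X^q - r^q)^l], and its coefficient of degree [q (l - 1)] is [- l r^q]; dividing by
    [l] puts [r^q] in [F]. *)
Lemma unique_root_power (F K : fieldType) (iota : F ~> K) (m : {poly F}) (r : K) d :
 (0 < d)%N -> map_poly iota m = ('X - r%:P) ^+ d -> exists q a, [/\ char_exponent F q,
  r ^+ q = iota a & m %| ('X^q - a%:P) ^+ d].
move=> d0 em. have [q [l [cq eq nl]]] : exists q l, [/\ char_exponent F q, d = (q * l)%N & (l%:R : F) != 0].
 have [[p pc]|np] := pselect (exists p, p \in [pchar F]). exists (p ^ logn p d)%N, (d %/ p ^ logn p d)%N; split.
  - by right; exists p, (logn p d).
  - by rewrite mulnC divnK // pfactor_dvdnn.
  - rewrite -(dvdn_pcharf pc); have pp := pcharf_prime pc.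
   by have [l' cl dE] := pfactor_coprime pp d0; rewrite {1}dE mulnK ?expn_gt0 ?prime_gt0 // -prime_coprime.
 exists 1%N, d; split; [by left|by rewrite mul1n|]. apply/negP => dz; apply: np.
 by have [p pc] := natf0_pchar d0 dz; exists p. have XqE : ('X - r%:P) ^+ q = 'X^q - (r ^+ q)%:P :> {poly K}.
 case: cq => [->|[p [e [pc ->]]]]; first by rewrite !expr1.
 have pcK : p \in [pchar {poly K}] by apply: (rmorph_pchar polyC); exact: (rmorph_pchar iota).
 elim: e => [|e IH]; first by rewrite expn0 !expr1.
 rewrite expnSr !exprM IH -(pFrobenius_autE pcK) rmorphB /= !pFrobenius_autE. by rewrite [in RHS]polyC_exp.
have l0 : (0 < l)%N by rewrite lt0n; apply: contraNneq nl => ->. have [a ra] : exists a, r ^+ q = iota a.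
 have ec : (map_poly iota m)`_(q * l.-1) = - (r ^+ q *+ l).
  rewrite em eq exprM XqE (_ : 'X^q - _ = ('X - (r ^+ q)%:P) \Po 'X^q); last first.
   by rewrite comp_polyB comp_polyX comp_polyC. have q0 : (0 < q)%N by move: d0; rewrite eq muln_gt0 => /andP [].
  rewrite -rmorphXn /= coef_comp_poly_Xn // dvdn_mulr // mulKn //.
  have -> : ('X - (r ^+ q)%:P) ^+ l = \prod_(t <- nseq l (r ^+ q)) ('X - t%:P). by rewrite big_nseq iter_mulr_1.
  have := @coefPn_prod_XsubC K (nseq l (r ^+ q)).
  by rewrite size_nseq -lt0n => /(_ l0) ->; rewrite big_nseq iter_addr_0. exists (- (m`_(q * l.-1)) / l%:R).
 rewrite rmorphM rmorphN fmorphV rmorph_nat -coef_map ec opprK -mulr_natr mulfK //.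
 by rewrite -(rmorph_nat iota) fmorph_eq0. exists q, a; split=> //.
rewrite -(dvdp_map iota) em rmorphXn /= rmorphB /= map_polyXn map_polyC /= -ra -XqE -exprM.
rewrite dvdp_exp2l //; rewrite leq_pmull //. by move: d0; rewrite eq muln_gt0 => /andP []. Qed.

Lemma annihilator_exists (F : fieldType) (L : cring) (phi : F ~> L) (z : L) :
 iint phi setT z -> exists2 m : {poly F}, m \is monic & \sum_(i < size m) phi m`_i * z ^+ i = 0.
move=> /(iint_coef (idealT F)) [n [c [_ e]]]. exists ('X^n - \poly_(i < n) c i).
 rewrite monicE lead_coefDl ?lead_coefXn // size_polyN size_polyXn ltnS. exact: size_poly.
rewrite size_polyDl ?size_polyXn; last by rewrite size_polyN ltnS; exact: size_poly.
rewrite big_ord_recr /= !(coefD, coefN, coefXn, coef_poly) eqxx ltnn subr0 rmorph1 mul1r e.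
rewrite -big_split big1 // => i _ /=.
by rewrite !(coefD, coefN, coefXn, coef_poly) ltn_ord ltn_eqF // sub0r rmorphN mulNr addNr. Qed.

Lemma monic_annihilator_min (k : fieldType) (L : nzcring) (phi : k ~> L) (z : L) :
 iint phi setT z -> exists2 m : {poly k}, m \is monic /\ (map_poly phi m).[z] = 0 &
  forall g : {poly k}, (map_poly phi g).[z] = 0 -> m %| g.
move=> /annihilator_exists [m0 mm0 e0].
have ex : exists n, `[< exists m : {poly k}, [/\ m \is monic, (map_poly phi m).[z] = 0 & size m = n] >].
 exists (size m0); apply/asboolP; exists m0; split=> //.
 rewrite horner_coef size_map_poly_id0; last by rewrite (monicP mm0) rmorph1 oner_neq0.
 by rewrite -[RHS]e0; apply: eq_bigr => i _; rewrite coef_map. case: (ex_minnP ex) => n /asboolP [m [mm em sm]] min.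
exists m => // g eg; rewrite /dvdp. have er : (map_poly phi (g %% m)).[z] = 0.
 have := congr1 (fun h => (map_poly phi h).[z]) (divp_eq g m).
 by rewrite /= rmorphD rmorphM hornerD hornerM em mulr0 add0r eg => <-.
apply: contrapT => /negP nr; have lr : lead_coef (g %% m) != 0 by rewrite lead_coef_eq0.
have : (n <= size (g %% m)%R)%N. apply: min; apply/asboolP; exists ((lead_coef (g %% m))^-1 *: (g %% m)); split.
 - by rewrite monicE lead_coefZ mulVf.
 - by rewrite linearZ /= hornerZ er mulr0.
 - by rewrite size_scale // invr_eq0. by rewrite leqNgt -sm ltn_modp monic_neq0. Qed.

(** The polynomial [(X - Y)^n] vanishes on [k[z]] tensor [k[z]], which is [k[X,Y]] modulo [m(X)] and
    [m(Y)] for the minimal polynomial [m] of [z]. Evaluating at two roots of [m] shows that they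
    coincide, so [unique_root_power] applies to [m]. *)
Lemma radicial_power (k : fieldType) (L T : cring) (phi : k ~> L) (i j : L ~> T) (z : L) n :
 (1 : L) <> 0 -> is_tensor phi phi i j -> iint phi setT z -> (i z - j z) ^+ n = 0 ->
 exists q a, char_exponent k q /\ exists d, (z ^+ q - phi a) ^+ d = 0.
move=> nzL tT hz nil. have nzT : (1 : T) <> 0.
 by move=> e; apply: (nzL); apply: (tensor_field_inj tT nzL); rewrite rmorph1 e rmorph0.
have [L' eL] := comNzRing_of nzL; have [T' eT] := comNzRing_of nzT; subst L T.
have [m [mm em] mdiv] := @monic_annihilator_min k L' phi z hz. pose d := (size m).-1.
have sm : size m = d.+1 by rewrite prednK // size_poly_gt0 monic_neq0.
have fv : free_family phi (fun l : 'I_d => z ^+ l).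
 move=> c e l; pose g := \poly_(l < d) (if insub l is Some o then c o else 0). have : m %| g.
  apply: mdiv; rewrite (@horner_coef_wide _ d); last by rewrite size_map_poly; exact: size_poly.
  rewrite -[RHS]e; apply: eq_bigr => o _.
  by rewrite coef_map coef_poly ltn_ord; case: insubP => [u _ /val_inj ->|/negP []].
 move=> mg; have [g0|g0] := eqVneq g 0. have := congr1 (fun h : {poly k} => h`_l) g0.
  rewrite coef0 coef_poly ltn_ord; case: insubP => [u _ /val_inj -> //|/negP []//].
 have := dvdp_leq g0 mg; rewrite sm leqNgt ltnS.
 by rewrite (size_poly d (fun l => if insub l is Some o then c o else 0)).
pose ev : {poly k} ~> L' := horner_eval z \o map_poly phi. pose h : {poly k} ~> T' := j \o ev.
pose theta : {poly {poly k}} ~> T' := horner_eval (i z) \o map_poly h.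
(* [theta] sends the outer variable to [i z] and the inner one to [j z]. The remainder of [p] by
   [m2] has degree below [d] in the outer variable, so freeness of the powers of [z] forces each of
   its coefficients to vanish at [z]. *)
pose p : {poly {poly k}} := ('X - ('X)%:P) ^+ n. pose m2 : {poly {poly k}} := map_poly polyC m.
have mm2 : m2 \is monic by rewrite map_monic. have ijE c : i (phi c) = j (phi c) by case: tT.
have thp : theta p = 0. rewrite rmorphXn rmorphB -[RHS]nil; congr ((_ - _) ^+ _).
  by rewrite /theta /= map_polyX /horner_eval hornerX.
 by rewrite /theta /= map_polyC /horner_eval hornerC /= map_polyX /horner_eval hornerX. have thm : theta m2 = 0.
 rewrite /theta /= -map_poly_comp /horner_eval. have -> : map_poly (h \o polyC) m = map_poly i (map_poly phi m).
  rewrite -map_poly_comp; apply: eq_map_poly => c /=. by rewrite map_polyC /horner_eval hornerC /= -[LHS]ijE.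
 by rewrite horner_map em rmorph0. have pE := Pdiv.RingMonic.rdivp_eq mm2 p.
set Q := Pdiv.CommonRing.rdivp p m2 in pE; set R := Pdiv.CommonRing.rmodp p m2 in pE. have sR : (size R <= d)%N.
 have := Pdiv.Ring.ltn_rmodpN0 p (monic_neq0 mm2). by rewrite -/R size_map_polyC sm ltnS. have thR : theta R = 0.
 by have := congr1 theta pE; rewrite rmorphD rmorphM thp thm mulr0 add0r => <-.
have evR l : (l < d)%N -> ev R`_l = 0. move=> ld; apply: (tensor_free tT fv (y := fun l => ev R`_l) _ (Ordinal ld)).
 rewrite -[RHS]thR /theta /= /horner_eval.
 rewrite (@horner_coef_wide _ d); last by apply: leq_trans sR; exact: size_poly.
 have cm u : (map_poly h R)`_u = h R`_u by exact: coef_map. by apply: eq_bigr => o _; rewrite cm /= rmorphXn mulrC.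
have [K [iota [rs ers]]] := splitting_field (monic_neq0 mm). rewrite (monicP mm) rmorph1 scale1r in ers.
have rootm r : r \in rs -> (map_poly iota m).[r] = 0.
 by move=> rin; apply/eqP; rewrite -/(root _ _) ers root_prod_XsubC. have rs1 r s : r \in rs -> s \in rs -> r = s.
 (* At a pair of roots of [m] both [m2] and the remainder vanish, leaving [(r - s) ^+ n = 0]. *)
 move=> rin sin. pose evs : {poly k} ~> K := horner_eval s \o map_poly iota.
 pose th2 : {poly {poly k}} ~> K := horner_eval r \o map_poly evs. have th2p : th2 p = (r - s) ^+ n.
  rewrite rmorphXn rmorphB; congr ((_ - _) ^+ _). by rewrite /th2 /= map_polyX /horner_eval hornerX.
  by rewrite /th2 /= map_polyC /horner_eval hornerC /= map_polyX /horner_eval hornerX. have th2m : th2 m2 = 0.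
  rewrite /th2 /= -map_poly_comp /horner_eval. have -> : map_poly (evs \o polyC) m = map_poly iota m.
   by apply: eq_map_poly => c /=; rewrite map_polyC /horner_eval hornerC. exact: rootm. have evsR l : evs R`_l = 0.
  case: (ltnP l d) => ld; last by rewrite nth_default ?rmorph0 // (leq_trans sR).
  have /dvdpP [w ->] : m %| R`_l by apply: mdiv; rewrite -[RHS](evR l ld).
  by rewrite rmorphM /= [X in _ * X]/horner_eval rootm // mulr0. have th2R : th2 R = 0.
  rewrite /th2 /= /horner_eval horner_coef big1 // => o _.
  have cm u : (map_poly evs R)`_u = evs R`_u by exact: coef_map. by rewrite cm evsR mul0r.
 have := congr1 th2 pE; rewrite rmorphD rmorphM th2m th2R mulr0 addr0 th2p.
 by move/eqP; rewrite expf_eq0 => /andP [_]; rewrite subr_eq0 => /eqP. have d0 : (0 < d)%N.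
 rewrite lt0n; apply/eqP => dz. have m1 : m = 1. have := mm; rewrite monicE lead_coefE sm dz /= => /eqP e1.
  by rewrite (@size1_polyC _ m) ?sm ?dz // e1. by move: em; rewrite m1 rmorph1 hornerC => /eqP; rewrite oner_eq0.
have srs : size rs = d. by apply/eqP; rewrite -eqSS -sm -(size_map_poly iota) ers size_prod_XsubC.
have [r rsE] : exists r, rs = nseq d r.
 case: rs srs rs1 {ers rootm} => [|r rs] srs rs1; first by rewrite -srs in d0.
 exists r; rewrite -srs; apply/all_pred1P/allP => x xin /=. by apply/eqP/rs1 => //; exact: mem_head.
have emr : map_poly iota m = ('X - r%:P) ^+ d. by rewrite ers rsE big_nseq iter_mulr_1.
have [q [a [cq _ md]]] := unique_root_power d0 emr. exists q, a; split=> //; exists d. have /dvdpP [w ew] := md.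
have := congr1 ev ew; rewrite rmorphM [X in _ * X]em mulr0.
by rewrite rmorphXn rmorphB /= map_polyXn map_polyC /horner_eval hornerXn hornerC. Qed.

(** * Zariski's main theorem *)

Section Monogenic.
Variables (A B : nzcring) (phi : A ~> B) (x : B).

(** Evaluation at [x]. It makes [B] an algebra over [A[X]], and integrality over the subring [A[x]]
    is expressed as integrality along [evp]. *)
Definition evp : {poly A} ~> B := horner_eval x \o map_poly phi.

Lemma evpE (p : {poly A}) : evp p = (map_poly phi p).[x]. by []. Qed.
Lemma evpX : evp 'X = x.
by rewrite evpE map_polyX hornerX. Qed.
Lemma evpC c : evp c%:P = phi c.
by rewrite evpE map_polyC hornerC. Qed.
Lemma evp_coef (p : {poly A}) n : (size p <= n)%N -> evp p = \sum_(i < n) phi p`_i * x ^+ i.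
move=> sp; rewrite evpE (@horner_coef_wide _ n); last by apply: leq_trans sp; exact: size_poly.
have cm i : (map_poly phi p)`_i = phi p`_i by exact: coef_map. by apply: eq_bigr => i _; rewrite cm. Qed.

(** Division with respect to a formal degree [d]: the coefficient of [F] in degree [d] may vanish,
    and its powers clear the denominators. *)
Lemma pseudo_division (F G : {poly A}) d : (size F <= d.+1)%N ->
 exists k (Q R : {poly A}), (size R <= d)%N /\ (F`_d ^+ k)%:P * G = Q * F + R.
move=> sF; have [n] := ubnP (size G); elim: n => // n IH in G *; rewrite ltnS => sG. case: (leqP (size G) d) => sd.
 by exists 0%N, 0, G; rewrite expr0 mul1r mul0r add0r.
pose m := (size G).-1; have sm : size G = m.+1 by rewrite prednK // (leq_trans _ sd).
have dm : (d <= m)%N by rewrite -ltnS -sm. pose G' := (F`_d)%:P * G - (G`_m)%:P * 'X^(m - d) * F.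
have sG' : (size G' <= m)%N. apply/leq_sizeP => l; rewrite leq_eqVlt => /orP [/eqP <-|ml].
  rewrite coefB -mulrA !coefCM coefXnM ltnNge leq_subr /= subKn //. by rewrite mulrC subrr.
 rewrite coefB -mulrA !coefCM coefXnM.
 rewrite [G`_l]nth_default ?sm // mulr0 sub0r; case: ifP => _; first by rewrite mulr0 oppr0.
 by rewrite [F`_(_)]nth_default ?mulr0 ?oppr0 // (leq_trans sF) //; lia.
have [|k [Q [R [sR e]]]] := IH G'; first by rewrite (leq_ltn_trans sG') // -sm.
exists k.+1, (Q + (F`_d ^+ k * G`_m)%:P * 'X^(m - d)), R; split=> //.
rewrite mulrDl -addrA [_ * F + R]addrC addrA -e /G' exprSr !polyCM; ring. Qed.

Hypothesis closed : forall b, iint phi setT b -> exists a, phi a = b.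

(* The idea: dividing reduces to [u F(x) = R(x)] with [deg R < d = deg F], so
  that multiplying by [u] lets one trade powers of [x] for powers of the
  leading coefficient [a]; hence [a^N u] is integral over [A]. *)
Lemma integral_lead_coef u (F R : {poly A}) d : iint evp setT u ->
 (size F <= d.+1)%N -> (size R <= d)%N -> u * evp F = evp R -> exists N, iint phi setT (phi (F`_d ^+ N) * u).
move=> hu sF sR e; set a := F`_d.
have aE : phi a * x ^+ d * u = \sum_(i < d) phi R`_i * x ^+ i - \sum_(i < d) phi F`_i * x ^+ i * u.
 have := e; rewrite (evp_coef sF) (evp_coef sR) big_ord_recr /= => <-. by rewrite -mulr_suml /a; ring.
case: d sF sR @a aE => [|d] sF sR a aE. exists 1%N; rewrite !big_ord0 subrr expr0 mulr1 in aE.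
 by rewrite expr1 aE; exact: iint0.
pose M m : set B := [set w | exists i l, [/\ (i < d.+1)%N, (l <= m)%N & w = x ^+ i * u ^+ l]].
have MS m m' : (m <= m')%N -> M m `<=` M m'.
 by move=> mm w [i [l [hi hl ->]]]; exists i, l; split=> //; exact: leq_trans mm.
have spZ c V w : spn phi setT V w -> spn phi setT V (phi c * w). by apply: spnZ; exact: idealT.
have spP k l V w : (k <= l)%N -> spn phi setT V (phi (a ^+ k) * w) -> spn phi setT V (phi (a ^+ l) * w).
 by move=> kl h; rewrite -(subnK kl) exprD rmorphM -mulrA; exact: spZ.
(* One use of [aE] trades a factor [phi a * x ^+ d.+1 * u] for lower powers of [x] without raising
   the power of [u]. The condition that [j] is at least [n] keeps a factor [u] available at each
   round. *)
have red n : forall j, (n <= j)%N -> spn phi setT (M j) (phi (a ^+ n) * (x ^+ n * u ^+ j)).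
 elim/ltn_ind: n => n IH j nj; case: (ltnP n d.+1) => nd. by apply: spnG => //; exists n, j.
 have j0 : (0 < j)%N by apply: leq_trans nj; apply: leq_trans nd. have n0 : (0 < n)%N by apply: leq_trans nd.
 have -> : phi (a ^+ n) * (x ^+ n * u ^+ j) =
   \sum_(i < d.+1) phi R`_i * (phi (a ^+ n.-1) * (x ^+ (n - d.+1 + i) * u ^+ j.-1)) +
   \sum_(i < d.+1) phi (- F`_i) * (phi (a ^+ n.-1) * (x ^+ (n - d.+1 + i) * u ^+ j)).
  have xn : x ^+ n = x ^+ (n - d.+1) * x ^+ d.+1 by rewrite -exprD subnK.
  have uj : u ^+ j = u ^+ j.-1 * u by rewrite -exprSr prednK.
  have an : a ^+ n = a ^+ n.-1 * a by rewrite -exprSr prednK. rewrite an xn uj rmorphM.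
  rewrite (_ : _ * _ = phi (a ^+ n.-1) * x ^+ (n - d.+1) * u ^+ j.-1 * (phi a * x ^+ d.+1 * u)); last by ring.
  rewrite aE mulrBr !mulr_sumr -sumrN; congr (_ + _); apply: eq_bigr => i _. by rewrite exprD; ring.
  by rewrite exprD rmorphN; ring. have lt (i : 'I_d.+1) : (n - d.+1 + i < n)%N by rewrite -{2}(subnK nd) ltn_add2l.
 have le (i : 'I_d.+1) : (n - d.+1 + i <= n.-1)%N by rewrite -ltnS prednK.
 apply: spnD; apply: spn_sum => i _; apply: spZ.
  apply: (spn_sub (fun _ h => h) (MS _ _ (leq_pred j))); apply: (spP _ _ _ _ (le i)).
  by apply: IH => //; rewrite -ltnS prednK // (leq_trans (lt i)). apply: (spP _ _ _ _ (le i)); apply: IH => //.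
 by rewrite ltnW // (leq_trans (lt i)). have [m [c [_ um]]] := iint_coef (idealT _) hu.
(* [D] bounds the powers of [x] that arise when the equation of [u] over [A[x]] is multiplied by
   [x ^+ i], so that [red] applies to every term. *)
pose D := (\max_(i < m) size (c i) + d.+1)%N. have top i : (i < d.+1)%N ->
  spn phi setT (M (m + D).-1) (phi (a ^+ D) * (x ^+ i * u ^+ (m + D))).
 move=> id1; rewrite exprD um mulr_suml mulr_sumr mulr_sumr; apply: spn_sum => l _.
 have sc : (size (c l) <= \max_(i < m) size (c i))%N by exact: leq_bigmax.
 rewrite (evp_coef sc) !mulr_suml mulr_sumr mulr_sumr; apply: spn_sum => n _.
 rewrite (_ : _ * _ = phi (c l)`_n * (phi (a ^+ D) * (x ^+ (i + n) * u ^+ (l + D)))); last first.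
  by rewrite !exprD; ring. have inD : (i + n <= D)%N by rewrite addnC leq_add // ltnW. apply/spZ/(spP _ _ _ _ inD).
 apply: (spn_sub (fun _ h => h) (MS (l + D)%N _ _)); last first. by apply: red; rewrite (leq_trans inD) // leq_addl.
 by rewrite -ltnS prednK ?ltn_add2r //; rewrite (leq_trans _ (leq_addl _ _)) // /D addnS.
(* The span of [ws] is stable under [phi (a ^+ D) * u]; only the top power of [u] requires [top]. *)
exists D; pose ws := [seq x ^+ i * u ^+ l | i <- iota 0 d.+1, l <- iota 0 (m + D)].
have wsM w : M (m + D).-1 w -> (els ws) w.
 move=> [i [l [hi hl ->]]]; apply/allpairsP; exists (i, l); split=> //; rewrite mem_iota. by [].
 by rewrite /= (leq_ltn_trans hl) // prednK // (leq_trans _ (leq_addl _ _)) // /D addnS.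
have mD : (0 < m + D)%N by rewrite (leq_trans _ (leq_addl _ _)) // /D addnS.
apply: (@iint_fin_module _ _ _ _ ws); first exact: idealT.
 have -> : (1 : B) = phi 1 * (x ^+ 0 * u ^+ 0) by rewrite rmorph1 !expr0 !mulr1.
 by apply: spnG => //; apply: wsM; exists 0%N, 0%N.
move=> _ /allpairsP [[i l] [hi hl ->]]; rewrite !mem_iota !add0n /= in hi hl *.
rewrite (_ : _ * (_ * _) = phi (a ^+ D) * (x ^+ i * u ^+ l.+1)); last by rewrite [u ^+ l.+1]exprS; ring.
apply: (spn_sub (fun _ h => h) wsM); case: (ltnP l.+1 (m + D)%N) => hl'.
 by apply: spnG => //; exists i, l.+1; split=> //; rewrite -ltnS prednK.
have -> : l.+1 = (m + D)%N by apply/eqP; rewrite eqn_leq hl hl'. exact: top. Qed.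

(** Pseudo-division of [G] by [F] replaces [t] by [u], a multiple of [t] by a power of the leading
    coefficient minus an element of [A[x]], with [u F(x)] of degree below [d]. A further power makes
    [u] integral over [A], hence an element of [A], by the hypothesis [closed]. *)
Lemma lead_coef_conductor t (F G : {poly A}) d : iint evp setT t -> (size F <= d.+1)%N -> t * evp F = evp G ->
 exists N H, phi (F`_d ^+ N) * t = evp H.
move=> ht sF e; have [k [Q [R [sR eG]]]] := pseudo_division G sF. pose u := phi (F`_d ^+ k) * t - evp Q.
have hu : iint evp setT u. have [_ hB hM] := iint_sring evp; apply: hB; last exact: iint_img.
 by rewrite -evpC; apply: hM => //; exact: iint_img. have uF : u * evp F = evp R.
 by rewrite mulrBl -mulrA e -evpC -!rmorphM eG rmorphD addrAC subrr add0r.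
have [N /closed [c ec]] := integral_lead_coef hu sF sR uF. exists (N + k)%N, (c%:P + (F`_d ^+ N)%:P * Q).
by rewrite rmorphD rmorphM !evpC ec /u exprD rmorphM; ring. Qed.
End Monogenic.

Lemma factor_inj (D B L : cring) (f : D ~> L) (i : B ~> L) : injective i -> (forall d, exists b, i b = f d) ->
 exists h : D ~> B, i \o h =1 f.
move=> ii /choice [h hE]; have [|||g gE] := @rmorph_make D B h.
- by move=> x y; apply: ii; rewrite rmorphD !hE rmorphD.
- by move=> x y; apply: ii; rewrite rmorphM !hE rmorphM.
- by apply: ii; rewrite hE !rmorph1. by exists g => d /=; rewrite gE. Qed.

Definition radical (A : cring) (I : set A) (a : A) : Prop := exists n, I (a ^+ n).

Lemma radicalP (A : cring) (I : set A) a : is_ideal I ->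
 radical I a <-> forall P, is_prime_ideal P -> I `<=` P -> P a.
move=> idI; split=> [[n In] P pP IP|]; last exact: radical_of_primes. by apply: (@primeX _ P a n) => //; exact: IP.
Qed.

Lemma radical_ideal (A : cring) (I : set A) : is_ideal I -> is_ideal (radical I).
move=> idI; split=> [|a b /(radicalP _ idI) ha /(radicalP _ idI) hb|a b /(radicalP _ idI) hb].
- by exists 1%N; rewrite expr1; case: idI.
- apply/radicalP => // P pP IP; have [_ PD _ _ _] := pP. by apply: PD; [exact: ha|exact: hb].
- apply/radicalP => // P pP IP; have [_ _ PM _ _] := pP. by apply: PM; exact: hb. Qed.

(** The complement of a maximal multiplicative set avoiding [I] is a minimal prime over [I].
    Minimality is recorded in the last clause: adjoining an element [z] of [R] to that set must make
    it meet [I]. *)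
Lemma minimal_prime (A : cring) (I Q : set A) : is_ideal I -> is_prime_ideal Q ->
 I `<=` Q -> exists R, [/\ is_prime_ideal R, I `<=` R, R `<=` Q &
  forall z, R z -> exists s n, ~ R s /\ I (s * z ^+ n)].
move=> idI pQ IQ.
have [||S [[mS IS] QS Smax]] := @zorn_set A (fun S => mult_set S /\ forall a, I a -> ~ S a) (~` Q).
- by split; [exact: prime_compl_mult|move=> a /IQ Qa; apply].
- move=> F [S0 FS0] FP tF; split; last by move=> a Ia [S FS Sa]; exact: (FP _ FS).2 Ia Sa.
 split; first by exists S0 => //; case: (FP _ FS0) => -[]. move=> a b [S FS Sa] [T FT Tb].
 case: (tF _ _ FS FT) => h; [exists T|exists S] => //. by case: (FP _ FT) => -[_ hM] _; apply: hM => //; exact: h.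
 by case: (FP _ FS) => -[_ hM] _; apply: hM => //; exact: h. have [R [pR IR RS]] := krull idI mS IS.
have SR : ~` R = S. apply: Smax; first by move=> a Sa Ra; exact: RS Ra Sa.
 by split; [exact: prime_compl_mult|move=> a /IR Ra; apply]. exists R; split=> // [a Ra|z Rz].
 by apply: contrapT => /QS Sa; exact: RS Ra Sa. apply: contrapT => nex; apply: (RS z Rz).
pose T := [set y | exists s n, S s /\ y = s * z ^+ n]. have TS : T = S.
 case: (mS) => S1 SM; apply: Smax; first by move=> s Ss; exists s, 0%N; rewrite expr0 mulr1.
 split; last by move=> a Ia [s [n [Ss e]]]; apply: nex; exists s, n; rewrite -e; split=> // /RS.
 split; first by exists 1, 0%N; rewrite expr0 mulr1.
 move=> _ _ [s [n [Ss ->]]] [t [m [St ->]]]; exists (s * t), (n + m)%N. by split; [exact: SM|rewrite exprD; ring].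
by rewrite -TS; exists 1, 1%N; rewrite mul1r expr1; case: mS. Qed.

(** In a splitting field the roots of [m] are among those of [Phi], hence integral over [R], and the
    coefficients of [m] are polynomials in them. *)
Lemma monic_factor_integral (R : nzcring) (W : fieldType) (w : R ~> W)
  (Phi : {poly R}) (m : {poly W}) : Phi \is monic -> m \is monic ->
 m %| map_poly w Phi -> forall i, iint w setT m`_i.
move=> mP mm dv i. have [K [iota [rs ers]]] := splitting_field (monic_neq0 mm).
rewrite (monicP mm) rmorph1 scale1r in ers. apply: (@iint_inj _ _ _ w iota) (idealT _) (fmorph_inj _) _.
have -> : iota m`_i = (map_poly iota m)`_i by rewrite coef_map.
have root_int r : r \in rs -> iint (iota \o w) setT r. move=> rin; have rP : (map_poly (iota \o w) Phi).[r] = 0.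
  have /dvdpP [q eq] := dv; rewrite map_poly_comp eq rmorphM /= hornerM ers.
  by apply/eqP; rewrite mulf_eq0; apply/orP; right; rewrite -/(root _ _) root_prod_XsubC.
 have sP : size Phi = (size Phi).-1.+1 by rewrite prednK // size_poly_gt0 monic_neq0.
 apply: (@iint_of_coef _ _ _ _ _ (size Phi).-1 (fun i => Phi`_i)) => //.
 rewrite -[RHS]rP (@horner_coef_wide _ (size Phi).-1.+1); last by rewrite -sP; exact: size_poly.
 rewrite big_ord_recr /= addrC. have cm l : (map_poly (iota \o w) Phi)`_l = (iota \o w) Phi`_l by exact: coef_map.
 rewrite cm -lead_coefE (monicP mP) rmorph1 mul1r; congr (_ + _). by apply: eq_bigr => l _; rewrite cm.
rewrite ers {ers}; elim: rs root_int i => [|r rs IH] h i.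
 rewrite big_nil coef1; case: (i == 0)%N; first by rewrite -(rmorph1 (iota \o w)); exact: iint_img. exact: iint0.
rewrite big_cons mulrBl coefB coefXM mul_polyC coefZ. have [_ hB hM] := iint_sring (iota \o w).
have IHr l : iint (iota \o w) setT (\prod_(j <- rs) ('X - j%:P))`_l.
 by apply: IH => s sin; apply: h; rewrite inE sin orbT.
apply: hB; last by apply: hM => //; apply: h; exact: mem_head. by case: ifP => // _; exact: iint0. Qed.

(** If [Q(T)] is the monic equation of [m] over [A[X]], then [X^N - m] divides [Q(X^N)]. For large
    [N] both are monic in [X], and [monic_factor_integral] gives the coefficients of [X^N - m],
    which are those of [- m] below degree [N]. *)
Lemma integral_poly_coef (A : nzcring) (K : fieldType) (k : A ~> K)
  (m : {poly K}) : iint (map_poly k) setT m -> forall j, iint k setT m`_j.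
move=> /(iint_coef (idealT _)) [n [c [_ e]]] j. have [n0|n0] := posnP n.
 move: e; rewrite n0 big_ord0 expr0 => /eqP; by rewrite oner_eq0.
pose N := (\max_(i < n) size (c i) + size m + j).+1. have sc (i : 'I_n) : (size (c i) < N)%N.
 apply: leq_ltn_trans (leq_bigmax (F := fun i : 'I_n => size (c i)) i) _. by rewrite /N ltnS -addnA leq_addr.
pose p : {poly A} := 'X^(N * n) - \sum_(i < n) c i * 'X^(N * i).
have sS : (size (\sum_(i < n) c i * 'X^(N * i) : {poly A})%R <= N * n)%N.
 apply: (leq_trans (size_sum _ _ _)); apply/bigmax_leqP => i _.
 have [->|ci0] := eqVneq (c i) 0; first by rewrite mul0r size_poly0.
 rewrite size_Mmonic ?monicXn // size_polyXn addnS /=.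
 by apply: (@leq_trans (N * i.+1)); rewrite ?leq_mul // mulnS leq_add2r ltnW. have mp : p \is monic.
 by rewrite monicE lead_coefDl ?lead_coefXn // size_polyN size_polyXn ltnS. pose l := 'X^N - m.
have sm : (size m < N)%N by rewrite ltnS -addnA (leq_trans _ (leq_addl _ _)) // leq_addr. have ml : l \is monic.
 by rewrite monicE lead_coefDl ?lead_coefXn // size_polyN size_polyXn ltnS ltnW. have dv : l %| map_poly k p.
 rewrite rmorphB /= map_polyXn rmorph_sum /=.
 rewrite (eq_bigr (fun i : 'I_n => map_poly k (c i) * ('X^N) ^+ i)); last first.
  by move=> i _; rewrite rmorphM /= map_polyXn exprM.
 rewrite exprM -[X in X - _](subrK (m ^+ n)) {2}e -addrA -sumrB.
 apply: dvdp_add; first by rewrite subrXX dvdp_mulIl.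
 apply: (big_ind (fun q => l %| q)); [exact: dvdp0|exact: dvdp_add|move=> i _].
 by rewrite -mulrBr dvdp_mull // -opprB dvdpNr subrXX dvdp_mulIl. have := monic_factor_integral mp ml dv j.
rewrite coefB coefXn ltn_eqF ?sub0r => [h|]; last by rewrite ltnS leq_addl.
by rewrite -[m`_j]opprK; apply: iintN => //; exact: idealT. Qed.

(** For positive [d] the constant term of the product is zero, so [X] divides one of the two factors
    and can be cancelled. *)
Lemma monic_dvd_monomial (R : idomainType) (m q : {poly R}) (a : R) d :
 a != 0 -> m \is monic -> m * q = a *: 'X^d -> m = 'X^((size m).-1).
move=> a0 mm e. have [n] := ubnP d; elim: n => // n IH in d m q mm e *; rewrite ltnS => dn. have q0 : q != 0.
 apply/eqP => q0; move: e; rewrite q0 mulr0 => /eqP; rewrite eq_sym -mul_polyC mulf_eq0 polyC_eq0 (negPf a0) /=.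
 by rewrite -size_poly_eq0 size_polyXn. case: d e dn => [|d] e dn.
 have : size (m * q) = 1%N by rewrite e expr0 alg_polyC size_polyC a0.
 rewrite size_proper_mul ?(monicP mm) ?mul1r ?lead_coef_eq0 //.
 have := size_poly_gt0 q; have := size_poly_gt0 m; rewrite (monic_neq0 mm) q0.
 move=> sm sq h; have s1 : size m = 1%N by lia. have m1 : m = 1.
  have := mm; rewrite monicE lead_coefE s1 /= => /eqP e1. by rewrite (@size1_polyC _ m) ?s1 // e1.
 by rewrite s1 expr0. have c0 : m`_0 * q`_0 = 0.
 by have := congr1 (fun p : {poly R} => p`_0) e; rewrite /= coef0M coefZ coefXn mulr0.
have divX (p : {poly R}) : p`_0 = 0 -> exists p', p = p' * 'X.
 move=> p0; have : root p 0 by rewrite rootE horner_coef0 p0.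
 by move=> /factor_theorem [p' ->]; exists p'; rewrite polyC0 subr0.
move/eqP: c0; rewrite mulf_eq0 => /orP [] /eqP /divX [p' ep].
 have mp' : p' \is monic by rewrite -(monicMr _ (monicX R)) -ep. have e' : p' * q = a *: 'X^d.
  by apply: (mulIf (negbT (polyX_eq0 R))); rewrite mulrAC -ep e -scalerAl -exprSr.
 rewrite ep size_mulX ?monic_neq0 //= (IH d p' q mp' e' dn) -exprSr size_polyXn /=.
 by rewrite prednK // size_poly_gt0 monic_neq0. apply: (IH d m p' mm _ dn); apply: (mulIf (negbT (polyX_eq0 R))).
by rewrite -mulrA -ep e -scalerAl -exprSr. Qed.

(** Here [tau] embeds [K[X]] in its fraction field. This is the rational root argument: in lowest
    terms the denominator divides a power of the numerator, hence is a unit. *)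
Lemma poly_integrally_closed (K W : fieldType) (tau : {poly K} ~> W) w :
 injective tau -> (forall z, exists a b, tau b <> 0 /\ z = tau a / tau b) ->
 iint tau setT w -> exists p, tau p = w.
move=> ti frac /(iint_coef (idealT _)) [n [c [_ e]]]. have [a0 [b0 [nb0 ew0]]] := frac w.
have b00 : b0 != 0 by apply/eqP => b0E; apply: nb0; rewrite b0E rmorph0.
pose g := gcdp a0 b0; have g0 : g != 0 by rewrite gcdp_eq0 negb_and b00 orbT. pose a := a0 %/ g; pose b := b0 %/ g.
have ea : a0 = a * g by rewrite divpK // dvdp_gcdl. have eb : b0 = b * g by rewrite divpK // dvdp_gcdr.
have tn p : p != 0 -> tau p != 0. by move=> p0; apply: contra p0 => /eqP; rewrite -(rmorph0 tau) => /ti ->.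
have b_n0 : b != 0 by apply: contraNneq b00 => b0E; rewrite eb b0E mul0r. have ew : w = tau a / tau b.
 by rewrite ew0 ea eb !rmorphM -mulf_div divff ?mulr1 // tn.
have cop : coprimep a b by apply: coprimep_div_gcd; rewrite b00 orbT.
have an : a ^+ n = \sum_(i < n) c i * a ^+ i * b ^+ (n - i). apply: ti; rewrite rmorphXn rmorph_sum.
 have -> : tau a ^+ n = w ^+ n * tau b ^+ n by rewrite ew expr_div_n divfK // expf_neq0 // tn.
 rewrite e mulr_suml; apply: eq_bigr => i _.
 have bn : tau b ^+ n = tau b ^+ i * tau b ^+ (n - i) by rewrite -exprD subnKC // ltnW.
 rewrite !rmorphM !rmorphXn ew expr_div_n bn -!mulrA; congr (_ * (_ * _)). by rewrite mulKf // expf_neq0 // tn.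
have bu : b %| a ^+ n. rewrite an; apply: (big_ind (fun q => b %| q)); [exact: dvdp0|exact: dvdp_add|move=> i _].
 by rewrite dvdp_mull // dvdp_exp ?subn_gt0. have : coprimep (a ^+ n) b by exact: coprimep_expl.
rewrite coprimep_sym => /coprimepP /(_ b (dvdpp b) bu); rewrite -size_poly_eq1 => /size_poly1P [u u0 eu].
have tb : tau b * tau u^-1%:P = 1 by rewrite eu -rmorphM -polyCM mulfV // polyC1 rmorph1.
exists (u^-1 *: a); rewrite -mul_polyC rmorphM ew mulrC; congr (_ * _).
by apply: (mulfI (tn _ b_n0)); rewrite tb mulfV // tn. Qed.

Lemma clear_denominators (A : nzcring) (K : fieldType) (k : A ~> K) :
 (forall z, exists a b, k b <> 0 /\ z = k a / k b) ->
 forall G : {poly K}, exists d F, k d <> 0 /\ k d *: G = map_poly k F.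
move=> frac; elim/poly_ind => [|G c [d [F [nd e]]]].
 by exists 1, 0; rewrite rmorph0 scaler0 rmorph1; split=> //; apply/eqP; rewrite oner_neq0.
have [a [b [nb ->]]] := frac c. exists (d * b), (F * 'X * b%:P + (d * a)%:P); split.
 by rewrite rmorphM; apply/eqP; rewrite mulf_neq0 //; apply/eqP.
have -> : map_poly k (F * 'X * b%:P + (d * a)%:P) = (k d *: G) * 'X * (k b)%:P + (k d * k a)%:P.
 by rewrite e rmorphD !rmorphM /= map_polyX !map_polyC. have -> : k d * k a = k d * k b * (k a / k b).
 by rewrite -mulrA; congr (_ * _); rewrite mulrC divfK //; apply/eqP. by rewrite rmorphM -!mul_polyC !polyCM; ring.
Qed.

Section GoingDown.
Variables (A B : nzcring) (phi : A ~> B) (x : B).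
Hypothesis int : forall b, iint (evp phi x) setT b.
Variables (r q : set B).
Hypotheses (pr : is_prime_ideal r) (pq : is_prime_ideal q) (rq : r `<=` q).
Hypothesis transc : forall F, r (evp phi x F) -> forall i, r (phi F`_i).
Let p : set A := phi @^-1` q.

(* Going-down for the polynomial ring over [A / (r n A)]: the minimal
  polynomial of [u] over [K(x)], [K] the fraction field, has coefficients
  integral over [A]; modulo a prime over [q] it divides a power of [T], up to
  the factor [F^d], hence it is a power of [T] and [u] lies in [q]. *)
Lemma no_residually_algebraic u (F : {poly A}) l0 : ~ q u -> ~ p F`_l0 -> ~ spn phi p setT (u * evp phi x F).
move=> nu nF hspn. have [r0 rD rM _ _] := pr. have pp : is_prime_ideal p by exact: preim_prime.
have idp := prime_ideal pp. have [L1 [chi [chi0 _]]] := residue_field pr.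
have [K [k0 [k00 k0s]]] := residue_field (preim_prime phi pr).
have k0s' z : exists a b, k0 b <> 0 /\ z = k0 a / k0 b.
 by have [a [b [nb e]]] := k0s z; exists a, b; split=> // /k00.
have [a|iota iotaE] := @residue_field_lift A K L1 k0 (chi \o phi) k0s'. by rewrite k00 /= chi0. pose xi := chi x.
pose evK : {poly K} ~> L1 := horner_eval xi \o map_poly iota.
have evKE (G : {poly A}) : evK (map_poly k0 G) = chi (evp phi x G).
 rewrite /evK /= /horner_eval -map_poly_comp (eq_map_poly iotaE). by rewrite -horner_map -map_poly_comp.
have evK_inj : injective evK. apply: raddf_inj => G G0; have [d [H [nd eH]]] := clear_denominators k0s' G.
 have H0 : map_poly k0 H = 0. apply/polyP => l; rewrite coef_map coef0 /=; apply/k00; apply: transc; apply/chi0.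
  by rewrite -evKE -eH -mul_polyC rmorphM G0 mulr0.
 move/eqP: eH; rewrite H0 -mul_polyC mulf_eq0 polyC_eq0 => /orP [] /eqP //.
have [W [tau [tau0 taus]]] := residue_field (kernel_prime evK).
have taus' z : exists a b, tau b <> 0 /\ z = tau a / tau b.
 by have [a [b [nb e]]] := taus z; exists a, b; split=> // /tau0. have tau_inj : injective tau.
 by apply: raddf_inj => G /tau0 G0; apply: evK_inj; rewrite G0 rmorph0.
have [G|j jE] := @residue_field_lift _ W L1 tau evK taus'; first exact: tau0. pose v := chi u.
pose w0 : {poly A} ~> W := tau \o map_poly k0.
have w0E G : j (w0 G) = chi (evp phi x G) by rewrite -evKE; exact: jE.
have [e [c [_ ue]]] := iint_coef (idealT _) (int u). pose Phi : {poly {poly A}} := 'X^e - \poly_(i < e) c i.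
have mPhi : Phi \is monic. by rewrite monicE lead_coefDl ?lead_coefXn // size_polyN size_polyXn ltnS size_poly.
have evPhi : (map_poly j (map_poly w0 Phi)).[v] = 0.
 rewrite -map_poly_comp rmorphB /= map_polyXn hornerD hornerN hornerXn. rewrite (@horner_coef_wide _ e); last first.
  by apply: leq_trans (size_poly e (fun i => c i)); exact: size_poly.
 have cm l : (map_poly (j \o w0) (\poly_(i < e) c i))`_l = (j \o w0) (\poly_(i < e) c i)`_l. exact: coef_map.
 rewrite -rmorphXn ue rmorph_sum; apply/eqP; rewrite subr_eq0; apply/eqP.
 by apply: eq_bigr => i _; rewrite cm coef_poly ltn_ord /= w0E rmorphM rmorphXn. have iv : iint j setT v.
 have : iint (chi \o evp phi x) setT v by exact: iint_map. move=> h; apply: (@iint_comp _ _ _ w0 j setT setT) => //.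
 have [n [d [_ dE]]] := iint_coef (idealT _) h. exists n; rewrite dE; apply: spn_sum => i _.
 rewrite /= -w0E; apply: (@spnG _ _ (j \o w0)) => //; by exists i.
have [mu [mmu emu] mumin] := monic_annihilator_min iv. have dPhi : mu %| map_poly w0 Phi by exact: mumin.
have muint i : iint w0 setT mu`_i by exact: (monic_factor_integral mPhi).
have muK i : exists m : {poly K}, tau m = mu`_i. apply: poly_integrally_closed => //.
 apply: (@iint_comp _ _ _ (map_poly k0 : _ ~> _) tau setT setT); first by []. exact: muint.
(* [O], extracted from [O'], is the integral closure of the image of [A] in [K]. The coefficients of
   [mu] are integral over [A[x]], so they lie in [K[x]] and then in [O[x]]. *)
have [O' [i0 [i0i i0E]]] := subring_type (iint_sring k0). have O1 : (1 : O') <> 0.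
 by move=> /(congr1 i0); rewrite rmorph1 rmorph0 => /eqP; rewrite oner_eq0.
have [O eO] := comNzRing_of O1; subst O' => {O1}. have [a|al alE] := @factor_inj A O K k0 i0 i0i.
 by apply/i0E; exact: iint_img. have muO i : exists m : {poly O}, tau (map_poly i0 m) = mu`_i.
 have [m em] := muK i; have hm j' : exists o, i0 o = m`_j'. apply/i0E; apply: integral_poly_coef.
  apply: (@iint_inj _ _ _ (map_poly k0) tau) (idealT _) tau_inj _. by rewrite em; exact: muint.
 have [o oE] := choice hm; exists (\poly_(l < size m) o l); rewrite -em; congr (tau _).
 apply/polyP => l; rewrite coef_map coef_poly /=. by case: ltnP => ls; [exact: oE|rewrite rmorph0 nth_default].
have [mo moE] := choice muO. have sizemu : size mu = (size mu).-1.+1 by rewrite prednK // size_poly_gt0 monic_neq0.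
set e' := (size mu).-1 in sizemu. pose muo : {poly {poly O}} := 'X^e' + \poly_(i < e') mo i.
have mmuo : muo \is monic. by rewrite monicE lead_coefDl ?lead_coefXn // size_polyXn ltnS size_poly.
pose t0 : {poly O} ~> W := tau \o map_poly i0. have t0_inj : injective t0.
 move=> a b /tau_inj /polyP h; apply/polyP => l; apply: i0i. by have := h l; rewrite !coef_map.
have muoE : map_poly t0 muo = mu.
 apply/polyP => l; have cm (P : {poly {poly O}}) : (map_poly t0 P)`_l = t0 P`_l by exact: coef_map.
 rewrite cm coefD coefXn coef_poly; case: (ltngtP l e') => le.
 - by rewrite add0r; exact: moE.
 - by rewrite addr0 rmorph0 nth_default // sizemu.
 - by rewrite addr0 rmorph1 le -lead_coefE (monicP mmu).
(* the second equation, with leading coefficient [F^d] and the others in [p[x]] *)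
pose pX : set {poly A} := [set G | forall l, p G`_l]. have idpX : is_ideal pX.
 have [p0 pD pM] := idp; split=> [l|G H hG hH l|G H hH l]; first by rewrite coef0. by rewrite coefD; apply: pD.
 by rewrite coefM; apply: ideal_sum => // i _; exact: pM. have yint : iint (evp phi x) pX (u * evp phi x F).
 apply: iint_spn_setT => //; elim: hspn => [|b b' _ hb _ hb'|a b pa _]; [exact: spn0|exact: spnD|].
 rewrite -(evpC phi x); apply: spnG => //= l; rewrite coefC. by case: ifP => // _; case: idp.
have [d [g [pg ye]]] := iint_coef idpX yint.
pose Psi : {poly {poly A}} := (F ^+ d) *: 'X^d - \poly_(i < d) (g i * F ^+ i).
have evPsi : (map_poly j (map_poly w0 Psi)).[v] = 0.
 rewrite -map_poly_comp rmorphB /= -mul_polyC rmorphM /= map_polyXn map_polyC /= hornerD hornerN hornerM hornerXn hornerC.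
 rewrite (@horner_coef_wide _ d); last first.
  by apply: leq_trans (size_poly d (fun i => g i * F ^+ i)); exact: size_poly.
 have cm l : (map_poly (j \o w0) (\poly_(i < d) (g i * F ^+ i)))`_l = (j \o w0) (\poly_(i < d) (g i * F ^+ i))`_l.
  exact: coef_map. have yE : evp phi x (F ^+ d) * u ^+ d = \sum_(i < d) evp phi x (g i) * (u * evp phi x F) ^+ i.
  by rewrite -ye exprMn mulrC rmorphXn. rewrite w0E /v -(rmorphXn chi) -(rmorphM chi) yE.
 rewrite rmorph_sum; apply/eqP; rewrite subr_eq0; apply/eqP.
 apply: eq_bigr => i _; rewrite cm coef_poly ltn_ord /= w0E -(rmorphXn chi) -(rmorphM chi); congr (chi _).
 by rewrite exprMn rmorphM rmorphXn; ring. have dPsi : mu %| map_poly w0 Psi by exact: mumin.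
pose PsiO : {poly {poly O}} := map_poly (map_poly al) Psi. have PsiOE : map_poly t0 PsiO = map_poly w0 Psi.
 rewrite /PsiO -map_poly_comp; apply: eq_map_poly => G /=; congr (tau _).
 by rewrite -map_poly_comp; exact: eq_map_poly. have := Pdiv.RingMonic.rdivp_eq mmuo PsiO.
(* The division by the monic [muo] leaves no remainder, because it leaves none over the field
   [W]. *)
set Q := Pdiv.CommonRing.rdivp _ _; set R := Pdiv.CommonRing.rmodp _ _ => eQ. have R0 : R = 0.
 have sR : (size (map_poly t0 R) < size mu)%N. rewrite -muoE !size_map_inj_poly ?rmorph0 //.
  exact: Pdiv.Ring.ltn_rmodpN0 (monic_neq0 mmuo). have dR : mu %| map_poly t0 R.
  have -> : map_poly t0 R = map_poly w0 Psi - map_poly t0 Q * mu.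
   by rewrite -PsiOE eQ rmorphD rmorphM /= muoE addrAC subrr add0r. by rewrite dvdp_subl // dvdp_mull.
 have := dvdp_leq _ dR; rewrite leqNgt sR; case: eqVneq => [h _|_ /(_ isT) //].
 apply/polyP => l; rewrite coef0; apply: t0_inj.
 by have := congr1 (fun P : {poly W} => P`_l) h; rewrite coef_map coef0 rmorph0. rewrite R0 addr0 in eQ.
(* [B1] is the integral closure of the image of [B] in [L1]. It receives [O], so the relation
   satisfied by [u] can be reduced modulo a prime [Q1] of [B1] above [q]. *)
have [B1 [i1 [i1i i1E]]] := subring_type (iint_sring chi).
have [b|be beE] := @factor_inj B B1 L1 chi i1 i1i; first by apply/i1E; exact: iint_img.
have beint b : iint be setT b. apply: (@iint_inj _ _ _ be i1) (idealT _) i1i _.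
 have [n [cc [_ hcc]]] : exists n (cc : nat -> B), (forall i, [set: B] (cc i)) /\
   i1 b ^+ n = \sum_(i < n) chi (cc i) * i1 b ^+ i. by apply: iint_coef; [exact: idealT|apply/i1E; exists b].
 exists n; rewrite hcc; apply: spn_sum => i _; have /= <- := beE (cc i).
 by apply: (@spnG _ _ (i1 \o be)) => //; exists i.
have [b /= b0|Q1 [pQ1 _ Q1E]] := lying_over (zero_ideal B1) beint pq.
 by apply: rq; apply/chi0; have /= <- := beE b; rewrite b0 rmorph0.
have [o|h hE] := @factor_inj O B1 L1 (iota \o i0) i1 i1i.
 apply/i1E; have [n [cc [_ hcc]]] : exists n (cc : nat -> A), (forall i, [set: A] (cc i)) /\
   i0 o ^+ n = \sum_(i < n) k0 (cc i) * i0 o ^+ i. by apply: iint_coef; [exact: idealT|apply/i0E; exists o].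
 exists n; rewrite /= -(rmorphXn iota) hcc rmorph_sum; apply: spn_sum => i _.
 rewrite rmorphM rmorphXn; have /= -> := iotaE (cc i). by apply: spnG => //; exists i.
have halE a : h (al a) = be (phi a).
 apply: i1i; have /= -> := hE (al a); have /= -> := alE a; have /= -> := iotaE a. by have /= -> := beE (phi a).
have [f0 [c1 [c10 _]]] := residue_field pQ1. pose hb : O ~> f0 := c1 \o h.
have hbp a : hb (al a) = 0 <-> p a by rewrite /hb /= halE c10 Q1E. pose hbX : {poly O} ~> {poly f0} := map_poly hb.
have hbXp G : hbX (map_poly al G) = 0 <-> pX G. split=> [G0 l|hG].
  by apply/hbp; have := congr1 (fun P : {poly f0} => P`_l) G0; rewrite !coef_map coef0.
 by apply/polyP => l; rewrite !coef_map coef0; apply/hbp.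
(* The lower coefficients of [Psi] lie in [p[x]] and disappear modulo [Q1]; a monic factor of a
   monomial is left. *)
have mb : map_poly hbX muo * map_poly hbX Q = hbX (map_poly al (F ^+ d)) *: 'X^d.
 rewrite mulrC -rmorphM -eQ /PsiO /Psi !rmorphB /= -mul_polyC !rmorphM /= !map_polyXn !map_polyC /= -mul_polyC.
 rewrite [X in _ - X](_ : _ = 0) ?subr0 //; apply/polyP => l.
 have cm (P : {poly {poly O}}) : (map_poly hbX P)`_l = hbX P`_l by exact: coef_map.
 have cm' (P : {poly {poly A}}) : (map_poly (map_poly al) P)`_l = map_poly al P`_l by exact: coef_map.
 rewrite cm cm' coef0 coef_poly; case: ifP => _; last by rewrite !rmorph0.
 by apply/hbXp => l'; have [_ _ pXM] := idpX; rewrite mulrC; apply: pXM; exact: pg.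
have nFd : hbX (map_poly al (F ^+ d)) != 0.
 rewrite !rmorphXn expf_eq0 negb_and; apply/orP; right; apply/eqP => /hbXp /(_ l0) //.
have mmb : map_poly hbX muo \is monic by exact: monic_map. have muX := monic_dvd_monomial nFd mmb mb.
set s := (size _).-1 in muX. have cmh l : (map_poly hbX muo)`_l = hbX muo`_l by exact: coef_map. have se : s = e'.
 have := congr1 (fun P : {poly {poly f0}} => P`_e') muX.
 rewrite cmh /muo coefD !coefXn coef_poly eqxx ltnn addr0 rmorph1. by case: eqVneq => [//|_ /eqP]; rewrite oner_eq0.
have Qmo l k : (l < e')%N -> Q1 (h (mo l)`_k).
 move=> le; apply/c10; have := congr1 (fun P : {poly {poly f0}} => P`_l) muX.
 rewrite cmh /muo coefD !coefXn coef_poly le se ltn_eqF // add0r => h0.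
 by have := congr1 (fun P : {poly f0} => P`_k) h0; rewrite coef_map coef0.
have jt m : j (t0 m) = i1 (\sum_(k < size m) h m`_k * be x ^+ k).
 have /= -> := jE (map_poly i0 m); rewrite /evK /= /horner_eval -map_poly_comp.
 rewrite (@horner_coef_wide _ (size m)); last exact: size_poly.
 have cm l : (map_poly (iota \o i0) m)`_l = (iota \o i0) m`_l by exact: coef_map.
 rewrite rmorph_sum; apply: eq_bigr => k _; rewrite cm rmorphM rmorphXn.
 by have /= -> := hE m`_k; have /= -> := beE x.
have rel : be u ^+ e' + \sum_(l < e') (\sum_(k < size (mo l)) h (mo l)`_k * be x ^+ k) * be u ^+ l = 0.
 apply: i1i; rewrite rmorph0 -[RHS]emu -muoE -map_poly_comp. have smu : (size (map_poly (j \o t0) muo) <= e'.+1)%N.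
  apply: leq_trans (size_poly _ _) _; rewrite /muo (leq_trans (size_polyD _ _)) //.
  by rewrite geq_max size_polyXn leqnn /= ltnW // ltnS size_poly.
 rewrite (horner_coef_wide _ smu) big_ord_recr /= addrC rmorphD rmorphXn.
 have cm l : (map_poly (j \o t0) muo)`_l = (j \o t0) muo`_l by exact: coef_map. have /= -> := beE u; congr (_ + _).
  by rewrite cm /muo coefD coefXn coef_poly eqxx ltnn addr0 /= !rmorph1 mul1r.
 rewrite rmorph_sum; apply: eq_bigr => l _. rewrite cm /muo coefD coefXn coef_poly ltn_ord ltn_eqF // add0r /= jt.
 by rewrite (rmorphM i1) rmorphXn; have /= -> := beE u. have idQ := prime_ideal pQ1; have [q0 qD qM] := idQ.
apply: nu; apply/Q1E; apply: (@primeX _ Q1 (be u) e') => //.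
move/eqP: rel; rewrite addr_eq0 => /eqP ->; apply: idealN => //.
apply: ideal_sum => // l _; rewrite mulrC; apply: (qM).
by apply: ideal_sum => // k _; rewrite mulrC; apply: (qM); exact: Qmo. Qed.
End GoingDown.

Definition conductor (A B : nzcring) (phi : A ~> B) (x : B) : set B :=
 [set b | forall b', exists H, b * b' = evp phi x H].

Section Core.
Variables (A B : nzcring) (phi : A ~> B) (x : B) (bs : seq B).
Hypothesis closed : forall b, iint phi setT b -> exists a, phi a = b.
Hypothesis int : forall b, iint (evp phi x) setT b.
Hypothesis gen : forall b, spn (evp phi x) setT (els bs) b.
Let J := conductor phi x.

Lemma conductor_ideal : is_ideal J.
split=> [b'|a b ha hb b'|a b hb b'].
- by exists 0; rewrite mul0r rmorph0.
- have [F eF] := ha b'; have [G eG] := hb b'. by exists (F + G); rewrite rmorphD -eF -eG mulrDl.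
- by have [F eF] := hb (a * b'); exists F; rewrite -eF; ring. Qed.

Lemma conductor_pow M s (F : {poly A}) d : (size F <= d.+1)%N ->
 (exists H, s * evp phi x F ^+ M = evp phi x H) -> exists N H, phi (F`_d ^+ N) * s = evp phi x H.
move=> sF; elim: M s => [|M IH] s [H e]. by exists 0%N, H; rewrite expr0 rmorph1 mul1r -e expr0 mulr1.
have [|N [G eG]] := @lead_coef_conductor A B phi x closed (s * evp phi x F ^+ M) F H d (int _) sF.
 by rewrite -e exprSr mulrA. have [|N' [G' eG']] := IH (phi (F`_d ^+ N) * s); first by exists G; rewrite -eG mulrA.
by exists (N' + N)%N, G'; rewrite exprD rmorphM -mulrA. Qed.

(** A power of [b F(x)] carries each module generator of [B] into [A[x]]. By [conductor_pow] the
    factors [F(x)] are exchanged for powers of the leading coefficient, and one exponent serves all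
    of the finitely many generators. *)
Lemma conductor_lead b (F : {poly A}) d : (size F <= d.+1)%N ->
 radical J (b * evp phi x F) -> radical J (b * phi F`_d).
move=> sF [M hM]. have [N hN] : exists N, forall v, v \in bs ->
  exists H, phi (F`_d ^+ N) * (b ^+ M * v) = evp phi x H. elim: (bs) => [|v vs [N hN]]; first by exists 0%N.
 have [|N' [H eH]] := @conductor_pow M (b ^+ M * v) F d sF.
  by have [H eH] := hM v; exists H; rewrite -eH exprMn; ring.
 exists (N + N')%N => w; rewrite inE => /orP [/eqP ->|/hN [G eG]].
  by exists ((F`_d ^+ N)%:P * H); rewrite rmorphM evpC -eH exprD rmorphM; ring.
 by exists ((F`_d ^+ N')%:P * G); rewrite rmorphM evpC -eG exprD rmorphM; ring.
have JaN : J (phi (F`_d ^+ N) * b ^+ M). move=> b'; rewrite -mulrA.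
 elim: (gen b') => [|y z _ [G eG] _ [G' eG']|c v _ vbs].
 - by exists 0; rewrite !mulr0 rmorph0.
 - by exists (G + G'); rewrite rmorphD -eG -eG'; ring.
 - by have [G eG] := hN v vbs; exists (c * G); rewrite rmorphM -eG; ring.
exists (N + M)%N; rewrite (_ : _ ^+ _ = phi F`_d ^+ M * b ^+ N * (phi (F`_d ^+ N) * b ^+ M)).
 by case: conductor_ideal => _ _ JM; exact: JM. by rewrite exprMn rmorphXn !exprD; ring. Qed.

(** Subtracting the leading term keeps the product in the radical of the conductor, so the
    coefficients come off one at a time. *)
Lemma conductor_coef b (F : {poly A}) : radical J (b * evp phi x F) -> forall i, radical J (b * phi F`_i).
have [r0 rD rM] := radical_ideal conductor_ideal.
have [n] := ubnP (size F); elim: n => // n IH in F *; rewrite ltnS => sF hF i. case: n IH sF => [|d] IH sF.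
 by rewrite [F`_i]nth_default ?rmorph0 ?mulr0 // (leq_trans sF). have lead := conductor_lead sF hF.
case: (ltngtP i d) => [id|di|->]; last 2 first.
- by rewrite [F`_i]nth_default ?rmorph0 ?mulr0 // (leq_trans sF).
- by []. pose F' := F - (F`_d)%:P * 'X^d. have -> : F`_i = F'`_i.
 by rewrite /F' coefB coefCM coefXn ltn_eqF // mulr0 subr0. apply: IH; first rewrite ltnS.
 apply/leq_sizeP => l; rewrite leq_eqVlt => /orP [/eqP <-|dl]. by rewrite /F' coefB coefCM coefXn eqxx mulr1 subrr.
 by rewrite /F' coefB coefCM coefXn gtn_eqF // mulr0 subr0 nth_default // (leq_trans sF).
rewrite (_ : _ * _ = b * evp phi x F + (- x ^+ d) * (b * phi F`_d)). by apply: rD => //; exact: rM.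
by rewrite /F' rmorphB rmorphM rmorphXn evpC evpX; ring. Qed.

Variable q : set B.
Hypothesis pq : is_prime_ideal q.
Let p : set A := phi @^-1` q.
(** Quasi-finiteness at [q] in two pieces: the class of [x] is algebraic over the residue field at
    [p], and [q] is minimal in its fibre. *)
Hypothesis residual : exists (F : {poly A}) l, q (evp phi x F) /\ ~ p F`_l.
Hypothesis isolated : forall q0, is_prime_ideal q0 -> q0 `<=` q -> (forall a, p a -> q0 (phi a)) -> q `<=` q0.

(** Otherwise take a minimal prime [r] over the conductor inside [q]. By [conductor_coef], [x] is
    transcendental modulo [r]. But [q] is minimal over [p B], so some [u] outside [q] times a power
    of an algebraic relation of [x] lies in [p B]; [no_residually_algebraic] excludes this. *)
Lemma conductor_not_sub : ~ (J `<=` q).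
move=> Jq; have [r [pr Jr rq rmin]] := minimal_prime conductor_ideal pq Jq. have [r0 rD rM _ rP] := pr.
have transc F : r (evp phi x F) -> forall i, r (phi F`_i). move=> /rmin [s [n [ns Js]]] i.
 have : radical J (s * evp phi x F).
  exists n.+1; rewrite (_ : _ ^+ _ = s ^+ n * evp phi x F * (s * evp phi x F ^+ n)).
   by case: conductor_ideal => _ _ JM; exact: JM. by rewrite exprMn !exprS; ring.
 move=> /conductor_coef /(_ i) [m /Jr hm]. by case: (rP _ _ (primeX pr hm)) => // /ns.
have [F0 [l [qF nF]]] := residual. have pp : is_prime_ideal p by exact: preim_prime. have idp := prime_ideal pp.
have [|R [pR IR Rq Rmin]] := @minimal_prime _ (spn phi p setT) q (spn_setT_ideal phi idp) pq.
 move=> b; case: pq => q0 qD qM _ _.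
 by elim=> [|y z _ hy _ hz|a v pa _]; [exact: q0|exact: qD|rewrite mulrC; exact: qM]. have qR : q `<=` R.
 by apply: isolated => // a pa; apply: IR; rewrite -[phi a]mulr1; exact: spnG.
have [u [n [nu un]]] := Rmin _ (qR _ qF). have [k [chi [chi0 _]]] := residue_field pp.
have Fn0 : map_poly chi (F0 ^+ n) != 0. rewrite rmorphXn expf_eq0 negb_and; apply/orP; right; apply/eqP => h.
 apply: nF; apply/chi0. by have := congr1 (fun P : {poly k} => P`_l) h; rewrite coef_map coef0.
have [l0 nl0] : exists l0, ~ p (F0 ^+ n)`_l0.
 apply: contrapT => nex; move/eqP: Fn0; apply; apply/polyP => l0; rewrite coef_map coef0.
 by apply/chi0; apply: contrapT => nl; apply: nex; exists l0. have nuq : ~ q u by move=> qu; exact: nu (qR _ qu).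
by apply: (no_residually_algebraic int pr pq rq transc nuq nl0); rewrite rmorphXn. Qed.

(** The leading coefficient times [x] is integral over [A], hence equal to some [phi c]. If the
    leading coefficient is outside [p] this is the desired relation. If it is in [p], then so is
    [c], and replacing the leading term by [c X^d] lowers the degree without making the relation
    trivial modulo [p]. *)
Lemma monogenic_relation (F : {poly A}) l : evp phi x F = 0 -> ~ p F`_l ->
 exists s c, ~ p s /\ phi s * x = phi c.
have pp : is_prime_ideal p by exact: preim_prime. have [p0 pD pM _ _] := pp.
have [n] := ubnP (size F); elim: n => // n IH in F *; rewrite ltnS => sF F0 nl. have lF : (l < size F)%N.
 by rewrite ltnNge; apply/negP => h; apply: nl; rewrite nth_default.
case: n IH sF => [|d] IH sF; first by have := leq_trans lF sF. case: d IH sF => [|d] IH sF.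
 exfalso; apply: nl; have := leq_trans lF sF; rewrite ltnS leqn0 => /eqP ->.
 by rewrite /p /= -(evpC phi x) -size1_polyC // F0; case: pq. have [c ec] : exists c, phi c = phi F`_d.+1 * x.
 apply: closed; pose c i := F`_i * F`_d.+1 ^+ (d - i). apply: (@iint_of_coef _ _ _ _ _ d.+1 c) => //.
 have := F0; rewrite (evp_coef phi x sF) big_ord_recr /= => e.
 have -> : \sum_(i < d.+1) phi (c i) * (phi F`_d.+1 * x) ^+ i =
  phi F`_d.+1 ^+ d * \sum_(i < d.+1) phi F`_i * x ^+ i.
  rewrite mulr_sumr; apply: eq_bigr => i _; rewrite /c rmorphM rmorphXn exprMn.
  have id : (i <= d)%N by rewrite -ltnS.
  have -> : phi F`_d.+1 ^+ d = phi F`_d.+1 ^+ (d - i) * phi F`_d.+1 ^+ i by rewrite -exprD subnK. ring.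
 by move/eqP: e; rewrite addr_eq0 => /eqP ->; rewrite exprMn exprSr; ring.
have [pd|npd] := pselect (p F`_d.+1); last by exists F`_d.+1, c.
have pc : p c by rewrite /p /= ec mulrC; case: pq => _ _ qM _ _; exact: qM.
pose F' : {poly A} := F - (F`_d.+1)%:P * 'X^(d.+1) + c%:P * 'X^d. apply: (IH F').
- rewrite ltnS; apply/leq_sizeP => i; rewrite leq_eqVlt => /orP [/eqP <-|di].
  by rewrite /F' coefD coefB !coefCM !coefXn eqxx mulr1 subrr add0r gtn_eqF // mulr0.
 rewrite /F' coefD coefB !coefCM !coefXn !gtn_eqF ?mulr0 ?subr0 ?addr0 //; last exact: ltnW.
 by rewrite nth_default // (leq_trans sF).
- by rewrite /F' rmorphD rmorphB !rmorphM !rmorphXn !evpC evpX F0 ec exprS; ring.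
- have ld : l != d.+1 by apply/eqP => le; apply: nl; rewrite le.
 rewrite /F' coefD coefB !coefCM !coefXn (negPf ld) mulr0 subr0 => h; apply: nl.
 rewrite -[F`_l](addrK (c * (l == d)%:R)); apply: pD => //. by rewrite -mulrN mulrC; exact: pM. Qed.

(** Some [g] outside [q] lies in the conductor, so [B] and [A[x]] agree near [q]. If [x] satisfied
    no relation that is nontrivial modulo [p], then [p A[x]] would give a prime of [B] in the fibre,
    strictly below [q] as [x] is algebraic there. Hence there is a relation, and
    [monogenic_relation] makes [x] a fraction. *)
Theorem zmt_monogenic : exists s, ~ p s /\ forall b, exists n c, phi (s ^+ n) * b = phi c.
have pp : is_prime_ideal p by exact: preim_prime. have [p0 pD pM p1 pP] := pp. have [q0 qD qM q1 qP] := pq.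
have [g [Jg nqg]] : exists g, J g /\ ~ q g. apply: contrapT => nex; apply: conductor_not_sub => g Jg.
 by apply: contrapT => nq; apply: nex; exists g.
have [F [l [F0 nF]]] : exists (F : {poly A}) l, evp phi x F = 0 /\ ~ p F`_l. apply: contrapT => nrel.
 have rel (F : {poly A}) : evp phi x F = 0 -> forall l, p F`_l.
  by move=> F0 l; apply: contrapT => nF; apply: nrel; exists F, l. have [k [chi [chi0 _]]] := residue_field pp.
 have pXE (F : {poly A}) : (forall l, p F`_l) <-> map_poly chi F = 0.
  split=> [h|h l]; first by apply/polyP => l; rewrite coef_map coef0; apply/chi0.
  by apply/chi0; have := congr1 (fun P : {poly k} => P`_l) h; rewrite coef_map coef0.
 (* [P0] is the ideal [p A[x]], prime in [A[x]] because relations of [x] are assumed trivial modulo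
    [p]. As [g B] lies in [A[x]], the set [Q0] is the corresponding prime of [B]. *)
 pose P0 : set B := [set b | exists F : {poly A}, (forall l, p F`_l) /\ b = evp phi x F].
 have P0E (F : {poly A}) : P0 (evp phi x F) <-> forall l, p F`_l. split=> [[G [pG e]]|h]; last by exists F.
  have : evp phi x (F - G) = 0 by rewrite rmorphB e subrr.
  move=> /rel hFG; apply/pXE; rewrite -(subrK G F) rmorphD /=. by rewrite (pXE (F - G)).1 // (pXE G).1 // addr0.
 have P0q b : P0 b -> q b. move=> [G [pG ->]]; rewrite (evp_coef phi x (leqnn _)); apply: ideal_sum; first by split.
  by move=> i _; rewrite mulrC; apply: qM; exact: pG. pose Q0 : set B := [set b | P0 (g * b)].
 have gE b : exists H, g * b = evp phi x H by exact: Jg.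
 have [G eG] : exists G, g = evp phi x G by have [G eG] := gE 1; exists G; rewrite -eG mulr1.
 have pQ0 : is_prime_ideal Q0. have P0D b c : P0 b -> P0 c -> P0 (b + c).
   move=> [H [pH ->]] [K [pK ->]]; exists (H + K); rewrite rmorphD; split=> // i. by rewrite coefD; exact: pD.
  have P0M (H : {poly A}) c : P0 c -> P0 (evp phi x H * c).
   move=> [K [pK ->]]; rewrite -rmorphM; apply/P0E/pXE; rewrite rmorphM /=. by rewrite (pXE K).1 // mulr0.
  have P0P (H K : {poly A}) : P0 (evp phi x H * evp phi x K) -> P0 (evp phi x H) \/ P0 (evp phi x K).
   rewrite -rmorphM !P0E !pXE rmorphM => /eqP; rewrite mulf_eq0. by case/orP => /eqP; [left|right].
  have P0g : ~ P0 g by move=> /P0q. split; rewrite /Q0 /=.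
  - by rewrite mulr0; exists 0; rewrite rmorph0; split=> // l; rewrite coef0.
  - by move=> a b; rewrite mulrDr; exact: P0D.
  - move=> a b h; have [H eH] := gE (a * b); have [K eK] := gE a. have : P0 (g * (g * (a * b))).
    by rewrite (_ : g * _ = (g * a) * (g * b)); [rewrite eK; exact: P0M|ring]. rewrite eH {1}eG => /P0P [|//].
   by rewrite -eG => /P0g.
  - by rewrite mulr1.
  - move=> a b h; have [H eH] := gE a; have [K eK] := gE b.
   rewrite eH eK; apply: P0P; rewrite -eH -eK (_ : _ * _ = g * (g * (a * b))); last by ring.
   by rewrite {1}eG; exact: P0M. have [F0 [l [qF nF]]] := residual. have Q0F : Q0 (evp phi x F0).
  apply: isolated => // [b /P0q /qP [/nqg //|//]|a pa].
  rewrite /Q0 /= eG -(evpC phi x) -rmorphM P0E pXE rmorphM /= map_polyC /=. by rewrite (chi0 a).2 // mulr0.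
 move: Q0F; rewrite /Q0 /= {1}eG -rmorphM P0E pXE rmorphM => /eqP. rewrite mulf_eq0 => /orP [] /eqP /pXE.
  by rewrite -P0E -eG => /P0q. by move=> /(_ l). have [s [c [ns sx]]] := monogenic_relation F0 nF.
have sX (H : {poly A}) : exists n c, phi (s ^+ n) * evp phi x H = phi c.
 elim/poly_ind: H => [|H a [n [d e]]]; first by exists 0%N, 0; rewrite !rmorph0 mulr0.
 exists n.+1, (d * c + s ^+ n.+1 * a).
 rewrite rmorphD rmorphM evpX evpC rmorphD !rmorphM -e -sx exprSr rmorphM; ring.
have [G eG] := Jg 1; have [N [y ey]] := sX G; rewrite -eG mulr1 in ey. have ny : ~ p y.
 rewrite /p /= -ey => /qP []; last by []. by move=> /(primeX pp) /ns. exists (s * y); split=> [/pP [/ns|/ny] //|b].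
have [H eH] := Jg b; have [n [d ed]] := sX H. exists n.+1, (s * y ^+ n * s ^+ N * d).
rewrite !rmorphM -ed -eH -[phi (s ^+ N) in RHS]mulr1. rewrite exprMn !rmorphM !rmorphXn !exprS -ey rmorphXn; ring.
Qed.
End Core.

Section AlgGen.
Variables (A B : cring) (phi : A ~> B).

Definition alg_gen (X : set B) (b : B) : Prop :=
 forall S, is_subring S -> (forall a, S (phi a)) -> X `<=` S -> S b.

Lemma alg_gen_subring X : is_subring (alg_gen X).
split=> [S [S1 _ _]//|a b ha hb S sS Sp SX|a b ha hb S sS Sp SX].
 by case: (sS) => _ SB _; apply: SB; [exact: ha|exact: hb].
by case: (sS) => _ _ SM; apply: SM; [exact: ha|exact: hb]. Qed.
Lemma alg_gen_img X a : alg_gen X (phi a).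
by move=> S _ Sp _. Qed.
Lemma alg_gen_mem X b : X b -> alg_gen X b.
by move=> Xb S _ _; exact. Qed.
End AlgGen.

Lemma range_subring (A B : cring) (f : A ~> B) : is_subring [set b | exists a, f a = b].
split=> [|_ _ [a <-] [b <-]|_ _ [a <-] [b <-]]; first by exists 1; rewrite rmorph1.
 by exists (a - b); rewrite rmorphB. by exists (a * b); rewrite rmorphM. Qed.

(* [iint idfun S z] expresses integrality over the subset [S]. *)
Lemma iint_range (A B : cring) (f : A ~> B) (S : set B) z :
 (forall s, S s -> exists a, f a = s) -> iint (idfun : B ~> B) S z -> iint f setT z.
move=> Sf [n hn]; exists n. elim: hn => [|x y _ hx _ hy|s v Ss Vv]; [exact: spn0|exact: spnD|].
by have [a <-] := Sf s Ss; exact: spnG. Qed.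

Lemma range_iint (A B : cring) (f : A ~> B) (S : set B) z :
 (forall a, S (f a)) -> iint f setT z -> iint (idfun : B ~> B) S z.
move=> fS [n hn]; exists n. elim: hn => [|x y _ hx _ hy|a v _ Vv]; [exact: spn0|exact: spnD|].
exact: (@spnG _ _ (idfun : B ~> B)). Qed.

Lemma subring_nz (A : nzcring) (S : set A) : is_subring S -> exists (D : nzcring) (i : D ~> A),
 injective i /\ (forall a, S a <-> exists d, i d = a).
move=> sS; have [D [i [ii iE]]] := subring_type sS. have [|D' eD] := @comNzRing_of D; last by subst D; exists D', i.
by move=> /(congr1 i); rewrite rmorph1 rmorph0 => /eqP; rewrite oner_eq0. Qed.

Lemma evp_map (A B C : nzcring) (f : A ~> B) (g : B ~> C) (h : A ~> C) (F : {poly A}) y : g \o f =1 h ->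
 g (evp f y F) = evp h (g y) F.
move=> gf; rewrite (evp_coef f y (leqnn _)) (evp_coef h (g y) (leqnn _)) rmorph_sum.
by apply: eq_bigr => i _; rewrite rmorphM rmorphXn -gf. Qed.

(** The induction is on the number of [xs]. The generators [ys] of [B] are only asked to be integral
    over the subalgebra of the [xs], since this is the form that survives when one of the [xs] is
    removed and [B] is replaced by a subalgebra that agrees with it near [q]. *)
Theorem zariski_main n : forall (A B : nzcring) (phi : A ~> B) (xs ys : seq B) (q : set B), size xs = n ->
 (forall b, alg_gen phi (els ys) b) ->
 (forall y, y \in ys -> iint (idfun : B ~> B) (alg_gen phi (els xs)) y) -> is_prime_ideal q ->
 (forall b, exists (F : {poly A}) l, q (evp phi b F) /\ ~ q (phi F`_l)) ->
 (forall q0, is_prime_ideal q0 -> q0 `<=` q -> (forall a, q (phi a) -> q0 (phi a)) -> q `<=` q0) ->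
 exists s, [/\ iint phi setT s, ~ q s & forall b, exists n, iint phi setT (s ^+ n * b)].
elim: n => [|n IH] A B phi xs ys q. move=> /size0nil -> gen int pq _ _; exists 1; split.
 - by rewrite -(rmorph1 phi); exact: iint_img.
 - by case: pq. move=> b; exists 0%N; rewrite mul1r; apply: gen; first exact: iint_sring.
  by move=> a; exact: iint_img.
 move=> y /int; apply: iint_range => s hs; apply: (hs [set b | exists a, phi a = b]) => //. exact: range_subring.
 by move=> a; exists a. case: xs => // x xs [sxs] gen int pq residual isolated. have [q0 qD qM q1 qP] := pq.
pose S0 := alg_gen phi (els xs).
have [D0 [i0 [i0i i0E]]] := subring_nz (alg_gen_subring phi (els xs)).
(* [A1] is the integral closure in [B] of the algebra of the remaining [xs]. Over it only [x] is
   left, and the monogenic case applies. *)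
have [A1 [j1 [j1i j1E]]] := subring_nz (iint_sring i0). have j1S s : S0 s -> exists a, j1 a = s.
 by move=> /i0E [d <-]; apply/j1E; exact: iint_img.
have [a|rho rhoE] := @factor_inj A A1 B phi j1 j1i; first by apply: j1S; exact: alg_gen_img.
have closed b : iint j1 setT b -> exists a, j1 a = b.
 by move=> h; apply/j1E; apply: iint_trans h => a; apply/j1E; exists a.
have [e_sub e_hom e_x] : [/\ is_subring [set b | exists F, evp j1 x F = b],
  forall a, exists F, evp j1 x F = phi a & exists F, evp j1 x F = x].
 split; [exact: range_subring| |by exists 'X; exact: evpX].
 by move=> a; exists (rho a)%:P; rewrite -[RHS]rhoE; exact: evpC. have inty y : y \in ys -> iint (evp j1 x) setT y.
 move=> /int; apply: iint_range => s hs; apply: (hs [set b | exists F, evp j1 x F = b]) => //.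
 move=> z /=; rewrite in_cons; case/orP => [/eqP ->|zxs]; first exact: e_x.
 by have [a ea] := j1S z (@alg_gen_mem _ _ phi (els xs) z zxs); exists a%:P; rewrite -ea; exact: evpC.
have intb b : iint (evp j1 x) setT b. apply: gen; [exact: iint_sring| |exact: inty].
 by move=> a; have [F <-] := e_hom a; exact: iint_img. have [bs [[b1 bM] hb]] := fin_alg_seq inty.
have genb b : spn (evp j1 x) setT (els bs) b. have fb : fin_alg (evp j1 x) bs by [].
 apply: gen; [split=> // u v hu hv| |exact: hb].
 - by apply: spnD => //; rewrite -mulN1r -(rmorph1 (evp j1 x)) -rmorphN; apply: spnZ.
 - exact: (spn_mulT (idealT _)).
 - by move=> a; have [F <-] := e_hom a; rewrite -[evp _ _ _]mulr1; apply: spnZ.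
have [|q' pq' q'q pq'E|s1 [ns1 s1P]] := zmt_monogenic closed intb genb pq.
- have [F [l [qF nF]]] := residual x; exists (map_poly rho F), l; split.
  rewrite (_ : evp j1 x (map_poly rho F) = evp phi x F) //.
  by rewrite !evpE -map_poly_comp; congr (_.[_]); exact: eq_map_poly.
 by rewrite coef_map /=; have /= -> := rhoE F`_l.
- by apply: isolated => // a qa; have /= <- := rhoE a; apply: pq'E; rewrite /=; have /= -> := rhoE a.
pose sg := j1 s1; have nsg : ~ q sg by [].
have [nb nbP] : exists nb : B -> nat, forall b, exists c, j1 (s1 ^+ nb b) * b = j1 c.
 (* [A1] need not be finitely generated. The subalgebra [A2] of the [zs] is, its generators are
    integral over the algebra of the [xs], and it agrees with [B] once [sg] is inverted. *)
 by have [f hf] := choice s1P; exists f. pose zs := xs ++ sg :: [seq sg ^+ nb y * y | y <- ys].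
have [A2 [i2 [i2i i2E]]] := subring_nz (alg_gen_subring phi (els zs)).
pose S2 := alg_gen phi (els zs). have zsj z : z \in zs -> exists a, j1 a = z.
 rewrite mem_cat inE => /orP [zxs|/orP [/eqP ->|/mapP [y _ ->]]].
 - by apply: j1S; exact: alg_gen_mem.
 - by exists s1.
 - by have [c ec] := nbP y; exists c; rewrite -ec rmorphXn.
have [a|rho2 rho2E] := @factor_inj A A2 B phi i2 i2i; first by apply/i2E; exact: alg_gen_img.
have [lf lfP] : exists lf : B -> A2, forall b, S2 b -> i2 (lf b) = b. have ex b : exists d, S2 b -> i2 d = b.
  have [/i2E [d ed]|nS] := pselect (S2 b); first by exists d. by exists 0 => /nS.
 by have [f hf] := choice ex; exists f.
have lfz z : z \in zs -> i2 (lf z) = z by move=> hz; apply: lfP; exact: alg_gen_mem.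
have xsz z : z \in xs -> z \in zs by move=> h; rewrite mem_cat h.
have sgz : sg \in zs by rewrite mem_cat mem_head orbT. pose sg2 := lf sg; have sg2E : i2 sg2 = sg by exact: lfz.
have absorb b : exists N d, i2 d = sg ^+ N * b. apply: (gen b [set b | exists N d, i2 d = sg ^+ N * b]).
 - split; first by exists 0%N, 1; rewrite rmorph1 mulr1.
   move=> u v [N [d ed]] [M [e ee]]; exists (N + M)%N, (sg2 ^+ M * d - sg2 ^+ N * e).
   by rewrite rmorphB !rmorphM !rmorphXn sg2E ed ee exprD; ring.
  move=> u v [N [d ed]] [M [e ee]]; exists (N + M)%N, (d * e). by rewrite rmorphM ed ee exprD; ring.
 - by move=> a; exists 0%N, (rho2 a); rewrite expr0 mul1r; exact: rho2E.
 - move=> y yin; exists (nb y), (lf (sg ^+ nb y * y)); apply: lfz.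
  by rewrite mem_cat inE; apply/orP; right; apply/orP; right; apply/mapP; exists y.
pose q2 : set A2 := i2 @^-1` q; have pq2 : is_prime_ideal q2 by exact: preim_prime.
have alg2 d : alg_gen rho2 [set z | z \in map lf zs] d. have : S2 (i2 d) by apply/i2E; exists d.
 move=> /(_ [set b | exists e, i2 e = b /\ alg_gen rho2 [set z | z \in map lf zs] e]).
 have [g1 gB gM] := alg_gen_subring rho2 [set z | z \in map lf zs]. case.
 - split; first by exists 1; rewrite rmorph1.
   by move=> _ _ [u [<- hu]] [v [<- hv]]; exists (u - v); rewrite rmorphB; split=> //; exact: gB.
  by move=> _ _ [u [<- hu]] [v [<- hv]]; exists (u * v); rewrite rmorphM; split=> //; exact: gM.
 - by move=> a; exists (rho2 a); split; [exact: rho2E|exact: alg_gen_img].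
 - by move=> z zin; exists (lf z); split; [exact: lfz|apply: alg_gen_mem; exact: map_f]. by move=> e [/i2i ->].
have [s2 [s2i ns2 s2P]] : exists s, [/\ iint rho2 setT s, ~ q2 s & forall d, exists n, iint rho2 setT (s ^+ n * d)].
 apply: (IH A A2 rho2 (map lf xs) (map lf zs)) => //; first by rewrite size_map.
 - move=> _ /mapP [z zin ->]. have [D3 [k [ki kE]]] := subring_nz (alg_gen_subring rho2 [set z | z \in map lf xs]).
  apply: (range_iint (f := k)); first by move=> d; apply/kE; exists d.
  apply: (iint_inj (idealT _) i2i); rewrite lfz //.
  have [a <-] := zsj z zin; have : iint i0 setT (j1 a) by apply/j1E; exists a. move=> /(range_iint (S := S0)) h.
  apply: (@iint_range _ _ (i2 \o k) S0); last by apply: h => d; apply/i0E; exists d.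
  move=> s hs; apply: (hs [set b | exists d, i2 (k d) = b]).
  + exact: (range_subring (i2 \o k)).
  + move=> b; have /kE [d ed] := @alg_gen_img _ _ rho2 [set z | z \in map lf xs] b.
   by exists d; rewrite ed; exact: rho2E.
  + move=> y yin; have /kE [d ed] : alg_gen rho2 [set z | z \in map lf xs] (lf y).
    by apply: alg_gen_mem; exact: map_f. by exists d; rewrite ed lfz // xsz.
 - move=> d; have [F [l [qF nF]]] := residual (i2 d); exists F, l.
  by split; rewrite /q2 /= ?(evp_map _ _ rho2E) //; have /= -> := rho2E F`_l.
 - move=> Q pQ Qq2 QA d qd; have [Q0 QD QM Q1 QP] := pQ.
  have nQsg N : ~ Q (sg2 ^+ N) by move=> /(primeX pQ) /Qq2; rewrite /q2 /= sg2E.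
  (* The extension of [Q] to [B]. Contracting it returns [Q], because [sg] lies outside [Q]. *)
  pose Q' := [set b | exists N d, i2 d = sg ^+ N * b /\ Q d]. have Q'E e : Q' (i2 e) -> Q e.
   move=> [N [f [ef Qf]]]; have ef' : f = sg2 ^+ N * e. by apply: i2i; rewrite ef rmorphM rmorphXn sg2E.
   by move: Qf; rewrite ef' => /QP [/nQsg|]. apply: (Q'E); apply: isolated => //.
  + split.
   * by exists 0%N, 0; rewrite rmorph0 mulr0.
   * move=> u v [N [f [ef Qf]]] [M [e [ee Qe]]]. exists (N + M)%N, (sg2 ^+ M * f + sg2 ^+ N * e); split.
     by rewrite rmorphD !rmorphM !rmorphXn sg2E ef ee exprD; ring. by apply: QD; exact: QM.
   * move=> u v [N [f [ef Qf]]]; have [M [e ee]] := absorb u. exists (M + N)%N, (e * f); split; last exact: QM.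
    by rewrite rmorphM ef ee exprD; ring.
   * move=> [N [f [ef Qf]]]; apply: (nQsg N). suff -> : sg2 ^+ N = f by [].
    by apply: i2i; rewrite ef mulr1 rmorphXn sg2E.
   * move=> u v [N [f [ef Qf]]]; have [M [e ee]] := absorb u; have [K [g eg]] := absorb v. have : Q (e * g).
     apply: Q'E; exists N, (sg2 ^+ (M + K) * f); split; last exact: QM.
     by rewrite !rmorphM rmorphXn sg2E ef ee eg exprD; ring.
    by move=> /QP [Qe|Qg]; [left; exists M, e|right; exists K, g].
  + move=> b [N [f [ef /Qq2]]]; rewrite /q2 /= ef => /qP [|//]. by move=> /(primeX pq).
  + move=> a qa; exists 0%N, (rho2 a); split; first by rewrite mul1r; exact: rho2E.
   by apply: QA; rewrite /q2 /=; have /= -> := rho2E a. pose t := i2 s2.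
have push d : iint rho2 setT d -> iint phi setT (i2 d). move=> [m hm]; exists m; rewrite -rmorphXn.
 elim: hm => [|u v _ hu _ hv|a _ _ [i im ->]]; first by rewrite rmorph0; exact: spn0.
  by rewrite rmorphD; exact: spnD. rewrite rmorphM rmorphXn; have /= -> := rho2E a; apply: spnG => //; by exists i.
have [N2 hN2] := s2P sg2. have [_ _ iM] := iint_sring phi.
have iX m z : iint phi setT z -> iint phi setT (z ^+ m).
 by move=> hz; elim: m => [|m hm]; [rewrite expr0; case: (iint_sring phi)|rewrite exprS; exact: iM].
have it : iint phi setT t by exact: push.
have its : iint phi setT (t ^+ N2 * sg) by have := push _ hN2; rewrite rmorphM rmorphXn sg2E. have nt : ~ q t by [].
(* Both factors are integral over [A]: [t] comes from the induction, and [N2] was chosen for the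
   second. Powers of [sg] move an element into [A2], powers of [t] then make it integral. *)
exists (t * (t ^+ N2 * sg)); split.
- exact: iM.
- by move=> /qP [//|/qP [/(primeX pq)|]]. move=> b; have [M [d ed]] := absorb b; have [N' /push hN'] := s2P d.
rewrite rmorphM rmorphXn ed -/t in hN'. exists (M + N')%N.
rewrite (_ : _ * b = (t ^+ N2 * sg) ^+ N' * (t ^+ N2) ^+ M * t ^+ M * (t ^+ N' * (sg ^+ M * b))).
 apply: (iM) => //; apply: (iM); last exact: (iX). by apply: (iM); [exact: (iX)|apply: (iX); exact: (iX)].
by rewrite !exprMn !exprD; ring. Qed.

(** * Etale algebras are locally standard etale *)

Section Units.
Variables (A B : cring) (f : A ~> B).

Lemma unit_cancel (u x y : A) : is_unit u -> u * x = u * y -> x = y.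
by move=> [v uv] /(congr1 ( *%R v)); rewrite !mulrA [v * u]mulrC uv !mul1r. Qed.
Lemma is_unit1 : is_unit (1 : A).
by exists 1; rewrite mulr1. Qed.
Lemma is_unitM (u v : A) : is_unit u -> is_unit v -> is_unit (u * v).
by move=> [a ua] [b vb]; exists (a * b); rewrite mulrACA ua vb mulr1. Qed.
Lemma is_unitX (u : A) n : is_unit u -> is_unit (u ^+ n).
by move=> uu; elim: n => [|n IH]; [rewrite expr0; exact: is_unit1|rewrite exprS; exact: is_unitM]. Qed.
Lemma unit_morph (u : A) : is_unit u -> is_unit (f u).
by move=> [v uv]; exists (f v); rewrite -rmorphM uv rmorph1. Qed.
Lemma unit_factor (u v : A) : is_unit (u * v) -> is_unit u.
by move=> [w uvw]; exists (v * w); rewrite mulrA. Qed.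
End Units.

Lemma factor_surj (A Q D : cring) (pi : A ~> Q) (f : A ~> D) :
 (forall q, exists a, pi a = q) -> (forall a, pi a = 0 -> f a = 0) -> exists g : Q ~> D, g \o pi =1 f.
move=> surj ker; have [r rE] := choice surj. have fr a : f (r (pi a)) = f a.
 by apply/subr0_eq; rewrite -rmorphB; apply: ker; rewrite rmorphB rE subrr.
have [|||g gE] := @rmorph_make Q D (f \o r).
- by move=> x y /=; rewrite -[x in LHS]rE -[y in LHS]rE -rmorphD fr rmorphD.
- by move=> x y /=; rewrite -[x in LHS]rE -[y in LHS]rE -rmorphM fr rmorphM.
- by rewrite /= -(rmorph1 pi) fr rmorph1. by exists g => a; rewrite /= gE /= fr. Qed.

(** A form of the universal property of localization in which [B] is described only by what is at
    hand: its elements are fractions over [P], and [sg] kills the kernel of [rho]. *)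
Lemma fraction_lift (P B D : cring) (rho : P ~> B) (sg : P ~> D) (S : set P) :
 (forall s, S s -> is_unit (sg s)) -> (forall b, exists s x, S s /\ rho s * b = rho x) ->
 (forall x, rho x = 0 -> sg x = 0) -> exists w : B ~> D, w \o rho =1 sg.
move=> uS frac ker. have keq x y : rho x = rho y -> sg x = sg y.
 by move=> e; apply/subr0_eq; rewrite -rmorphB; apply: ker; rewrite rmorphB e subrr.
have ex b : exists d, forall s x, S s -> rho s * b = rho x -> sg s * d = sg x.
 have [s [x [Ss e]]] := frac b; have [v hv] := uS _ Ss.
 exists (v * sg x) => s' x' Ss' e'; apply: (unit_cancel (uS _ Ss)).
 rewrite (_ : _ * _ = sg s * v * (sg s' * sg x)); last by ring.
 by rewrite hv mul1r -!rmorphM; apply: keq; rewrite !rmorphM -e -e'; ring. have [w wP] := choice ex.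
have wE b s x : S s -> rho s * b = rho x -> forall d, sg s * d = sg x -> w b = d.
 by move=> Ss e d ed; apply: (unit_cancel (uS _ Ss)); rewrite ed; exact: (wP b). have wrho x : w (rho x) = sg x.
 have [s [y [Ss e]]] := frac 1; apply: (wE _ s (s * x)) => //; last by rewrite rmorphM. by rewrite rmorphM.
have wmul s b x : S s -> rho s * b = rho x -> sg s * w b = sg x by exact: wP. have [|||g gE] := @rmorph_make B D w.
- move=> a b; have [s [x [Ss e]]] := frac a; have [t [y [St e']]] := frac b.
 apply: (unit_cancel (is_unitM (uS _ Ss) (uS _ St))). have [r [z [Sr e'']]] := frac (a + b).
 apply: (unit_cancel (uS _ Sr)).
 rewrite (_ : sg r * (sg s * sg t * w (a + b)) = sg s * sg t * (sg r * w (a + b))); last by ring.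
 rewrite (wmul _ _ _ Sr e''). rewrite (_ : sg r * (sg s * sg t * (w a + w b)) =
  sg r * (sg t * (sg s * w a) + sg s * (sg t * w b))); last by ring.
 rewrite (wmul _ _ _ Ss e) (wmul _ _ _ St e') -!rmorphM -rmorphD -rmorphM.
 by apply: keq; rewrite rmorphM -e'' rmorphM [RHS]rmorphM rmorphD !rmorphM -e -e'; ring.
- move=> a b; have [s [x [Ss e]]] := frac a; have [t [y [St e']]] := frac b.
 apply: (unit_cancel (is_unitM (uS _ Ss) (uS _ St))). have [r [z [Sr e'']]] := frac (a * b).
 apply: (unit_cancel (uS _ Sr)).
 rewrite (_ : sg r * (sg s * sg t * w (a * b)) = sg s * sg t * (sg r * w (a * b))); last by ring.
 rewrite (wmul _ _ _ Sr e''). rewrite (_ : sg r * (sg s * sg t * (w a * w b)) =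
  sg r * ((sg s * w a) * (sg t * w b))); last by ring. rewrite (wmul _ _ _ Ss e) (wmul _ _ _ St e') -!rmorphM.
 by apply: keq; rewrite rmorphM -e'' rmorphM [RHS]rmorphM rmorphM -e -e'; ring.
- by rewrite -(rmorph1 rho) wrho rmorph1. by exists g => x; rewrite /= gE wrho. Qed.

(** The determinant trick with multiplier 1: the monic polynomial with coefficients in [J],
    evaluated at 1, has the form [1 + c]. *)
Lemma idempotent_of_square (R : cring) (J : set R) (ds : seq R) : is_ideal J ->
 (forall d, d \in ds -> spn (idfun : R ~> R) J (els ds) d) ->
 exists c, J c /\ forall d, d \in ds -> (1 + c) * d = 0.
move=> idJ hJ; set n := size ds. have hM (i : 'I_n) : exists c : nat -> R, (forall j, J (c j)) /\
  ds`_i = \sum_(j < n) c j * ds`_j.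
 have [|c [Jc e]] := @spn_coef R R idfun J ds ds`_i idJ; first by apply: hJ; exact: mem_nth. by exists c.
have [M HM] := choice hM.
have [|i|c [Jc h]] := @det_trick R R idfun J n (\matrix_(i, j) M i j) (fun i => ds`_i) 1 idJ.
- by move=> i j; rewrite mxE; case: (HM i).
- by rewrite mul1r (HM i).2; apply: eq_bigr => j _; rewrite mxE. exists (\sum_(i < n) c i * 1 ^+ i); split.
 apply: ideal_sum => // i _; rewrite expr1n mulr1; exact: Jc.
move=> d dds; have id : (index d ds < n)%N by rewrite index_mem.
by have /= := h (Ordinal id); rewrite nth_index // expr1n. Qed.

(* An element [e] of [B \otimes_A B] with [(b \otimes 1) e = (1 \otimes b) e] and [mu e = 1],
  tested only against balanced maps. *)
Lemma separability_family (A B : cring) (phi : A ~> B) (ys : seq B) :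
 formally_etale phi -> (forall b, alg_gen phi (els ys) b) ->
 exists s : seq (B * B), \sum_(x <- s) x.1 * x.2 = 1 /\
  forall (G : zmodType) (beta : B -> B -> G), balanced phi phi beta ->
   forall b, \sum_(x <- s) beta (b * x.1) x.2 = \sum_(x <- s) beta x.1 (b * x.2).
move=> et gen; have [R [i [j tR]]] := tensor_ring phi phi. have [ij span uni] := tR.
have [mu [mui muj]] := tensor_lift tR (u := idfun) (v := idfun) (fun a => erefl).
pose J : set R := [set r | mu r = 0]; have idJ : is_ideal J by exact: kernel_ideal. pose idR : R ~> R := idfun.
have idJ2 : is_ideal (spn idR J J). by split=> [|x y|x y]; [exact: spn0|exact: spnD|exact: (@spnZ R R idR)].
have [Q [pi [surj ker]]] := quotient_ring idJ2. have [|nu nuE] := factor_surj surj (f := mu).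
 move=> a /ker; elim=> [|x y _ hx _ hy|x y Jx Jy]; first exact: rmorph0. by rewrite rmorphD hx hy addr0.
 by rewrite rmorphM /= Jx mul0r. have ijJ2 b : spn idR J J (i b - j b).
 apply/ker; suff e : pi (i b) = pi (j b) by rewrite rmorphB e subrr.
 (* [pi \o i] and [pi \o j] both lift the identity of [B] along the square-zero extension [Q], so
    they coincide. Thus each [i b - j b] lies in the square of [J]. *)
 have [d|x y|a|w [_ _ uw]] := et Q B nu (pi \o i \o phi) idfun.
 - by exists (pi (i d)); have /= -> := nuE (i d); exact: mui.
 - have [x' <-] := surj x; have [y' <-] := surj y. have /= -> := nuE x'; have /= -> := nuE y'; move=> hx hy.
  by rewrite -rmorphM; apply/ker; exact: (@spnG R R idR).
 - by rewrite /=; have /= -> := nuE (i (phi a)); exact: mui.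
 have e1 := uw (pi \o i) (fun _ => erefl) (fun b => etrans (nuE (i b)) (mui b)).
 have e2 := uw (pi \o j) (fun a => congr1 pi (esym (ij a))) (fun b => etrans (nuE (j b)) (muj b)).
 by rewrite -[LHS]/((pi \o i) b) e1 -e2. pose ds := [seq i y - j y | y <- ys]; pose D := (els ds).
have idT := idealT R. have ijD b : spn idR setT D (i b - j b).
 apply: (gen b [set b | spn idR setT D (i b - j b)]); last first.
 - by move=> y yin /=; rewrite -[_ - _]mul1r; apply: spnG => //; exact: (map_f (fun y => i y - j y)).
 - by move=> a /=; rewrite ij subrr; exact: spn0. split=> /=; first by rewrite !rmorph1 subrr; exact: spn0.
  move=> a c ha hc; rewrite (_ : _ - _ = (i a - j a) + (-1) * (i c - j c)); last first. by rewrite !rmorphB; ring.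
  by apply: spnD => //; exact: (@spnZ R R idR).
 move=> a c ha hc; rewrite (_ : _ - _ = i a * (i c - j c) + j c * (i a - j a)); last first.
  by rewrite !rmorphM; ring. by apply: spnD; exact: (@spnZ R R idR). have JD r : J r -> spn idR setT D r.
 have [s ->] := span r; rewrite /J /= rmorph_sum => h.
 rewrite (_ : \sum_(x <- s) _ = \sum_(x <- s) (- i x.1) * (i x.2 - j x.2)).
  by apply: spn_sum => x _; exact: (@spnZ R R idR).
 apply/subr0_eq; rewrite -sumrB -[RHS](rmorph0 i) -h rmorph_sum; apply: eq_bigr => x _.
 by rewrite rmorphM; have /= -> := mui x.1; have /= -> := muj x.2; rewrite rmorphM; ring.
(* The finite list [ds] generates [J] and lies in its square. The resulting [1 + c] kills [J] and
   maps to 1: it is the separability element. *)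
have [|c [Jc hc]] := idempotent_of_square (ds := ds) idJ.
 move=> _ /mapP [y _ ->]; elim: (ijJ2 y) => [|u v _ hu _ hv|u v Ju /JD hv].
 - exact: spn0.
 - exact: spnD. elim: hv => [|v1 v2 _ h1 _ h2|a z _ Dz]; first by rewrite mulr0; exact: spn0.
  by rewrite mulrDr; exact: spnD. rewrite (_ : _ * _ = (a * u) * z); last by rewrite /=; ring.
 by apply: (@spnG R R idR) => //; case: idJ => _ _; exact. have hD x : spn idR setT D x -> (1 + c) * x = 0.
 elim=> [|u v _ hu _ hv|a v _ /hc h]; first exact: mulr0. by rewrite mulrDr hu hv addr0. by rewrite mulrCA h mulr0.
have [s es] := span (1 + c); exists s; split. have : mu (1 + c) = 1 by rewrite rmorphD rmorph1 Jc addr0.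
 rewrite es rmorph_sum => <-; apply: eq_bigr => x _.
 by rewrite rmorphM; have /= -> := mui x.1; have /= -> := muj x.2.
move=> G beta bb b; have [th [thD thE]] := uni G beta bb.
have th0 : th 0 = 0 by apply: (addrI (th 0)); rewrite -thD !addr0.
have thS (F : B * B -> R) : th (\sum_(x <- s) F x) = \sum_(x <- s) th (F x). by apply: (big_morph th thD th0).
have : th (i b * (1 + c)) = th (j b * (1 + c)). by congr th; apply/subr0_eq; rewrite -mulrBl mulrC hD.
rewrite es !mulr_sumr !thS => e; transitivity (\sum_(x <- s) th (i b * (i x.1 * j x.2))).
 by apply: eq_bigr => x _; rewrite mulrA -rmorphM thE.
by rewrite e; apply: eq_bigr => x _; rewrite mulrCA -rmorphM thE. Qed.

Lemma free_spanning (k : fieldType) (L : cring) (phi : k ~> L) (vs : seq L) :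
 exists n (w : 'I_n -> L), [/\ free_family phi w, forall i, w i \in vs &
  forall v, v \in vs -> exists c : 'I_n -> k, v = \sum_i phi (c i) * w i].
elim: vs => [|v vs [n [w [fw win hw]]]]. by exists 0%N, (fun=> 0); split=> // [c _|] [].
have [[c ec]|nc] := pselect (exists c : 'I_n -> k, v = \sum_i phi (c i) * w i).
 exists n, w; split=> // [i|x]; first by rewrite in_cons win orbT.
 by rewrite inE => /orP [/eqP ->|/hw //]; exists c.
exists n.+1, (fun i => if unlift ord0 i is Some i' then w i' else v). have rl (F : 'I_n.+1 -> k) :
 \sum_i phi (F i) * (if unlift ord0 i is Some i' then w i' else v) =
 phi (F ord0) * v + \sum_(i < n) phi (F (lift ord0 i)) * w i. rewrite big_ord_recl unlift_none; congr (_ + _).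
 by apply: eq_bigr => i _; rewrite liftK. split=> [c|i|x]; last 2 first.
- by case: unliftP => [j _|_]; rewrite in_cons ?eqxx // win orbT.
- rewrite inE => /orP [/eqP ->|/hw [c ->]].
  exists (fun i => (i == ord0)%:R); rewrite rl eqxx rmorph1 mul1r big1 ?addr0 // => i _.
  by rewrite -(inj_eq val_inj) /= rmorph0 mul0r. exists (fun i => if unlift ord0 i is Some i' then c i' else 0).
 by rewrite rl unlift_none rmorph0 mul0r add0r; apply: eq_bigr => i _; rewrite liftK.
- rewrite rl => e; have [c0|c0] := eqVneq (c ord0) 0.
  move: e; rewrite c0 rmorph0 mul0r add0r => e i; case: (unliftP ord0 i) => [j ->|-> //].
  exact: (fw (fun i => c (lift ord0 i))). exfalso; apply: nc; exists (fun i => - (c ord0)^-1 * c (lift ord0 i)).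
 have := congr1 (fun y => phi (c ord0)^-1 * y) e; rewrite mulr0 mulrDr mulrA -rmorphM mulVf //.
 rewrite rmorph1 mul1r => /eqP; rewrite addr_eq0 => /eqP ->.
 rewrite mulr_sumr -sumrN; apply: eq_bigr => i _; rewrite rmorphM rmorphN; ring. Qed.

(** The fibre of [B] at [p], obtained by localizing [B / p B] at the complement of [p]. Compared
    with a tensor product over [k], this makes the kernel explicit. *)
Lemma fibre_ring (A B : cring) (phi : A ~> B) (p : set A) (k : fieldType) (c : A ~> k) : is_prime_ideal p ->
 (forall a, c a = 0 <-> p a) -> (forall z, exists a b, ~ p b /\ z = c a / c b) ->
 exists (M : cring) (l : B ~> M) (kap : k ~> M), kap \o c =1 l \o phi /\
  forall b, l b = 0 <-> exists y, ~ p y /\ spn phi p setT (phi y * b).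
move=> pp cker cfrac; have idI := spn_setT_ideal phi (prime_ideal pp).
have [Q [pi [surj ker]]] := quotient_ring idI. pose S := [set z | exists y, ~ p y /\ z = pi (phi y)].
have mS : mult_set S. have [m1 mM] := prime_compl_mult pp; split; first by exists 1; rewrite !rmorph1.
 by move=> _ _ [a [na ->]] [b [nb ->]]; exists (a * b); rewrite !rmorphM; split=> //; exact: mM.
have [M [l [lu lfrac lker]]] := localization_ring mS.
have [||a|kap kapE] := @fraction_lift A k M c (l \o pi \o phi) [set y | ~ p y].
- by move=> s /= ns; apply: lu; exists s.
- move=> z; have [a [b [nb ->]]] := cfrac z; exists b, a; split=> //.
 by rewrite mulrCA divff ?mulr1 //; apply/eqP => /cker.
- move=> /cker pa; rewrite /= (_ : pi (phi a) = 0) ?rmorph0 //; apply/ker. by rewrite -[phi a]mulr1; apply: spnG.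
exists M, (l \o pi), kap; split=> // b; rewrite /= lker; split.
 by move=> [_ [y [ny ->]]]; rewrite -rmorphM => /ker h; exists y.
by move=> [y [ny h]]; exists (pi (phi y)); [exists y|rewrite -rmorphM; exact/ker]. Qed.

Lemma common_denominator (A : cring) (k : fieldType) (c : A ~> k)
  (T : eqType) (F : T -> k) (s : seq T) : (forall z, exists a b, c b <> 0 /\ z = c a / c b) ->
 exists d, c d <> 0 /\ forall x, x \in s -> exists a, c d * F x = c a.
move=> frac; elim: s => [|x s [d [nd hd]]]. by exists 1; rewrite rmorph1; split=> // /eqP; rewrite oner_eq0.
have [a [b [nb e]]] := frac (F x); exists (b * d); split.
 by rewrite rmorphM => /eqP; rewrite mulf_eq0 => /orP [] /eqP. move=> y; rewrite inE => /orP [/eqP ->|/hd [a' ea']].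
 exists (a * d); rewrite e !rmorphM; field; exact/eqP. by exists (b * a'); rewrite !rmorphM -mulrA ea'. Qed.

Lemma evp_behead (A B : nzcring) (phi : A ~> B) (F : {poly A}) b :
 evp phi b F = phi F`_0 + b * evp phi b (Poly (behead F)).
rewrite !evpE -{1 2}(polyseqK F); case: (polyseq F) => [|x s] /=.
 by rewrite map_poly0 coef0 horner0 rmorph0 mulr0 addr0.
rewrite cons_poly_def rmorphD rmorphM /= map_polyX map_polyC hornerD hornerM hornerX hornerC.
by rewrite -cons_poly_def coef_cons /= addrC mulrC. Qed.

(** While the constant term lies in [q], so does [b] times the value of the shifted polynomial, and
    [b] can be cancelled. The coefficient of index [l] stops this after at most [l] rounds. *)
Lemma strip_root (A B : nzcring) (phi : A ~> B) (q : set B) (F : {poly A}) l b :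
 is_prime_ideal q -> q (evp phi b F) -> ~ q (phi F`_l) -> ~ q b ->
 exists G : {poly A}, ~ q (phi G`_0) /\ q (evp phi b G).
move=> [q0 qD qM q1 qP]; elim: l F => [|l IH] F qF nF nb; first by exists F.
have [qF0|nF0] := pselect (q (phi F`_0)); last by exists F. apply: (IH (Poly (behead F))) => //.
 have : q (b * evp phi b (Poly (behead F))); last by move=> /qP [].
 rewrite (_ : b * _ = evp phi b F + (-1) * phi F`_0); first by apply: qD => //; exact: qM.
 by rewrite [evp phi b F]evp_behead; ring. by rewrite coef_Poly nth_behead. Qed.

Lemma inverse_poly (k K : fieldType) (h : k ~> K) z : z != 0 -> iint h setT z -> exists P, z^-1 = evp h z P.
move=> nz /annihilator_exists [m mm em]. have pK : is_prime_ideal [set x : K | x = 0].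
 split=> //= [a b -> ->|a b ->|/eqP|a b /eqP]; rewrite ?addr0 ?mulr0 ?oner_eq0 //.
 by rewrite mulf_eq0 => /orP [] /eqP; [left|right]. have [|||G [nG eG]] := @strip_root k K h _ m (size m).-1 z pK.
- by rewrite /= -em; exact: evp_coef.
- by rewrite /= -/(lead_coef m) (monicP mm) rmorph1; apply/eqP; rewrite oner_eq0.
- by move=> /= /eqP; apply/negP. have nG0 : h G`_0 != 0 by apply/eqP. exists ((- (G`_0)^-1)%:P * Poly (behead G)).
rewrite evpE rmorphM /= map_polyC hornerM hornerC -evpE.
have : h G`_0 + z * evp h z (Poly (behead G)) = 0 by rewrite -evp_behead.
move=> /eqP; rewrite addrC addr_eq0 => /eqP e; apply: (mulfI nz); rewrite mulfV //.
have e2 : h (- (G`_0)^-1) * h G`_0 = -1. have nG1 : G`_0 != 0 by apply/eqP => g0; move: nG0; rewrite g0 raddf0 eqxx.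
 have hN : h (- (G`_0)^-1) = - h (G`_0)^-1 by exact: rmorphN. by rewrite hN mulNr -rmorphM mulVf // rmorph1.
by rewrite mulrCA e mulrN e2 opprK. Qed.

Section SeparableFibre.
Variables (A B : cring) (phi : A ~> B) (s : seq (B * B)).
Hypothesis s1 : \sum_(x <- s) x.1 * x.2 = 1.
Hypothesis sB : forall (G : zmodType) (beta : B -> B -> G), balanced phi phi beta ->
 forall b, \sum_(x <- s) beta (b * x.1) x.2 = \sum_(x <- s) beta x.1 (b * x.2).
Variables (k K : fieldType) (c : A ~> k) (chi : B ~> K).
Variable (h : k ~> K).
Hypothesis hE : forall a, h (c a) = chi (phi a).

Let vs := [seq chi x.2 | x <- s].

(** Expand the first components of the separability element in a free family [w]. The identity that
    moves [b] from one side to the other, contracted with the functional dual to [w i], expresses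
    [chi b] times a summand of 1 by the second components. *)
Lemma fibre_spanned b : spn h setT (els vs) (chi b).
have [n [w [fw win hw]]] := free_spanning h [seq chi x.1 | x <- s].
have [C CE] : exists C : B * B -> 'I_n -> k, forall x, x \in s -> chi x.1 = \sum_i h (C x i) * w i.
 have ex (x : B * B) : exists c0 : 'I_n -> k, x \in s -> chi x.1 = \sum_i h (c0 i) * w i.
  have [xs|] := boolP (x \in s); last by exists (fun=> 0).
  by have [c0 e] := hw _ (map_f (fun x => chi x.1) xs); exists c0. by have [C hC] := choice ex; exists C.
have e1 : 1 = \sum_(i < n) w i * \sum_(x <- s) h (C x i) * chi x.2. rewrite -(rmorph1 chi) -s1 rmorph_sum.
 rewrite (eq_big_seq (fun x => \sum_(i < n) h (C x i) * w i * chi x.2)); last first.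
  by move=> x xs; rewrite rmorphM (CE x xs) mulr_suml.
 rewrite exchange_big; apply: eq_bigr => i _; rewrite mulr_sumr; apply: eq_bigr => x _; ring.
rewrite -[chi b]mulr1 e1 mulr_sumr; apply: spn_sum => i _. have /mapP [y ys wy] := win i.
have [lam [lamD lamZ lamw]] := dual_functional i fw. have lamC x : x \in s -> C x i = lam (chi x.1).
 move=> xs; rewrite (CE x xs). have lam0 : lam 0 = 0 by apply: (addrI (lam 0)); rewrite -lamD !addr0.
 rewrite (big_morph lam lamD lam0) (bigD1 i) //= lamZ lamw eqxx mulr1 big1 ?addr0 // => j ji.
 by rewrite lamZ lamw (negbTE ji) mulr0. have bb : balanced phi phi (fun a b0 : B => h (lam (chi a)) * chi b0).
 split=> [a a' b0|a b0 b'|a b0 b'] /=; first by rewrite rmorphD lamD rmorphD mulrDl. by rewrite rmorphD mulrDr.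
 by rewrite !rmorphM -hE lamZ rmorphM; ring. have := sB bb (b * y.1) => /= e.
rewrite mulrA wy mulr_sumr (_ : \sum_(x <- s) _ =
 \sum_(x <- s) h (lam (chi (b * y.1 * x.1))) * chi x.2); last first.
 rewrite e; apply: eq_big_seq => x xs; rewrite (lamC x xs) !rmorphM; ring.
rewrite big_seq; apply: spn_sum => x xs; apply: spnG => //=; exact: map_f. Qed.

Lemma fibre_integral b : iint h setT (chi b).
have idT := idealT k; apply: (@iint_fin_module _ _ h setT vs) => //.
 by rewrite -(rmorph1 chi); exact: fibre_spanned.
by move=> _ /mapP [x _ ->]; rewrite -rmorphM; exact: fibre_spanned. Qed.

(** [eps] is the separability element with its second factor contracted by a functional, up to a
    denominator. In the fibre, multiplying it by [x] moves [x] into the contracted factor, where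
    [chi x = 0]. So [eps] is nonzero at the point [chi] and kills its ideal there: the point is
    isolated in the fibre. *)
Lemma fibre_isolating (p : set A) : is_prime_ideal p ->
 (forall a, c a = 0 <-> p a) -> (forall z, exists a b, ~ p b /\ z = c a / c b) ->
 exists eps, chi eps <> 0 /\ forall x, chi x = 0 -> exists y, ~ p y /\ spn phi p setT (phi y * (eps * x)).
move=> pp cker cfrac; have [M [l [kap [kapE lker]]]] := fibre_ring phi pp cker cfrac.
have [n [w [fw win hw]]] := free_spanning h vs. have [C CE] : exists C : B * B -> 'I_n -> k, forall x, x \in s ->
  chi x.2 = \sum_i h (C x i) * w i.
 have ex (x : B * B) : exists c0 : 'I_n -> k, x \in s -> chi x.2 = \sum_i h (c0 i) * w i.
  have [xs|] := boolP (x \in s); last by exists (fun=> 0).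
  by have [c0 e] := hw _ (map_f (fun x => chi x.2) xs); exists c0. by have [C hC] := choice ex; exists C.
have [i ni] : exists i : 'I_n, \sum_(x <- s) chi x.1 * h (C x i) <> 0.
 apply: contrapT => nex; have /eqP := oner_neq0 K; apply. rewrite -(rmorph1 chi) -s1 rmorph_sum.
 rewrite (eq_big_seq (fun x => \sum_(i < n) chi x.1 * h (C x i) * w i)); last first.
  by move=> x xs; rewrite rmorphM (CE x xs) mulr_sumr; apply: eq_bigr => i _; rewrite mulrA.
 rewrite exchange_big; apply: big1 => i _; rewrite -mulr_suml.
 by rewrite (_ : \sum_(x <- s) _ = 0) ?mul0r //; apply: contrapT => ni; apply: nex; exists i.
have [lam [lamD lamZ lamw]] := dual_functional i fw.
have lam0 : lam 0 = 0 by apply: (addrI (lam 0)); rewrite -lamD !addr0.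
have lamC x : x \in s -> C x i = lam (chi x.2). move=> xs; rewrite (CE x xs).
 rewrite (big_morph lam lamD lam0) (bigD1 i) //= lamZ lamw eqxx mulr1 big1 ?addr0 // => j ji.
 by rewrite lamZ lamw (negbTE ji) mulr0. have bb : balanced phi phi (fun a b0 : B => l a * kap (lam (chi b0))).
 split=> [a a' b0|a b0 b'|a b0 b'] /=; first by rewrite rmorphD mulrDl. by rewrite rmorphD lamD rmorphD mulrDr.
 by rewrite !rmorphM -hE lamZ rmorphM; have /= -> := kapE a; ring.
have [|d [nd dP]] := @common_denominator A k c _ (fun x : B * B => lam (chi x.2)) s.
 by move=> z; have [a [b [nb ->]]] := cfrac z; exists a, b; split=> // /cker.
have [N NE] : exists N : B * B -> A, forall x, x \in s -> c d * lam (chi x.2) = c (N x).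
 have ex (x : B * B) : exists a, x \in s -> c d * lam (chi x.2) = c a.
  by have [/dP [a ea]|] := boolP (x \in s); [exists a|exists 0]. by have [N hN] := choice ex; exists N.
pose eps := \sum_(x <- s) x.1 * phi (N x).
have leps : l eps = kap (c d) * \sum_(x <- s) l x.1 * kap (lam (chi x.2)).
 rewrite rmorph_sum mulr_sumr; apply: eq_big_seq => x xs.
 by rewrite rmorphM; have /= <- := kapE (N x); rewrite -(NE x xs) rmorphM; ring. exists eps; split.
 rewrite (_ : chi eps = h (c d) * \sum_(x <- s) chi x.1 * h (C x i)).
  by move=> /eqP; rewrite mulf_eq0 fmorph_eq0 => /orP [] /eqP.
 rewrite rmorph_sum mulr_sumr; apply: eq_big_seq => x xs.
 by rewrite rmorphM -hE -(NE x xs) -(lamC x xs) rmorphM; ring.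
move=> x qx; apply/lker; rewrite rmorphM leps -mulrA mulr_suml.
rewrite (_ : \sum_(y <- s) _ = \sum_(y <- s) l (x * y.1) * kap (lam (chi y.2))); last first.
 by apply: eq_bigr => y _; rewrite rmorphM; ring. have /= -> := sB bb x; rewrite big1 ?mulr0 // => y _.
by rewrite rmorphM qx mul0r lam0 rmorph0 mulr0. Qed.

Lemma evp_subring (A0 B0 : nzcring) (f : A0 ~> B0) (S : set B0) z P :
 is_subring S -> (forall a, S (f a)) -> S z -> S (evp f z P).
move=> sS Sf Sz; have [S1 SB SM] := sS; rewrite (evp_coef f z (leqnn _)).
apply: (big_ind S); [exact: subring0|by move=> x y; exact: subringD|move=> i _].
apply: (SM) => //; elim: (nat_of_ord i) => [|n IH]; first by rewrite expr0. by rewrite exprS; exact: SM. Qed.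

(** [k[th]] is a field [k']. In the tensor product of [K] and [O] over [k'] the image of the
    separability element takes the value 1 at every field point, because [th] separates them; so it
    is a unit. It kills the differences of the two images of [chi b], which therefore agree, and a
    functional that vanishes on [k'] shows that [chi b] belongs to [k']. *)
Lemma primitive_of_separated (O : fieldType) (iota : K ~> O) (th : K) : iint h setT th ->
 (forall (F : fieldType) (u : K ~> F) (j : O ~> F),
   (forall a, u (h a) = j (iota (h a))) -> u th = j (iota th) -> forall v, v \in vs -> u v = j (iota v)) ->
 forall b, exists P : {poly k}, chi b = evp h th P.
move=> ith sep b; have [D [i0 [i0i i0E]]] := subring_type (range_subring (evp h th)).
have inth z : (exists P, evp h th P = z) -> iint h setT z.
 move=> [P <-]; apply: evp_subring => //; first exact: iint_sring. by move=> a; exact: iint_img.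
have hD a : exists d, i0 d = h a by apply/i0E; exists a%:P; exact: evpC. have Dnz : (1 : D) <> 0.
 by move=> /(congr1 i0); rewrite rmorph1 rmorph0 => /eqP; rewrite oner_eq0. have [|k' eD] := field_of_units Dnz.
 move=> x nx; have nix : i0 x != 0 by apply/eqP; rewrite -(rmorph0 i0) => /i0i.
 have ix : exists P, evp h th P = i0 x by apply/i0E; exists x. have [P eP] := inverse_poly nix (inth _ ix).
 have /i0E [y ey] : exists Q, evp h th Q = (i0 x)^-1. rewrite eP.
  have := @evp_subring k K h [set x | exists Q, evp h th Q = x] (i0 x) P (range_subring _).
  by apply=> // a; exists a%:P; exact: evpC. by exists y; apply: i0i; rewrite rmorphM ey mulfV // rmorph1.
subst D; have [T [i [j tT]]] := tensor_ring i0 (iota \o i0); have [ij _ uni] := tT.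
have ijh a : i (h a) = j (iota (h a)) by have [d <-] := hD a; exact: ij.
pose e := \sum_(x <- s) i (chi x.1) * j (iota (chi x.2)). have eb y : (i (chi y) - j (iota (chi y))) * e = 0.
 have bb : balanced phi phi (fun a b0 : B => i (chi a) * j (iota (chi b0))).
  split=> [a a' b0|a b0 b'|a b0 b'] /=; first by rewrite !rmorphD mulrDl. by rewrite !rmorphD mulrDr.
  by rewrite !rmorphM -!hE ijh; ring. rewrite mulrBl !mulr_sumr; apply/eqP; rewrite subr_eq0; apply/eqP.
 have /= := sB bb y; under eq_bigr => x _ do rewrite !rmorphM -mulrA.
 by move=> ->; apply: eq_bigr => x _; rewrite !rmorphM; ring. have ue : is_unit e.
 apply: unit_of_primes => Q pQ; have [F [w [wker _]]] := residue_field pQ.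
 have vE v : v \in vs -> w (i v) = w (j (iota v)).
  apply: (sep F (w \o i) (w \o j)) => /= [a|]; first by rewrite ijh.
  have /i0E [d <-] : exists P, evp h th P = th by exists 'X; exact: evpX. by have /= -> := ij d.
 move=> /wker; rewrite (_ : w e = 1); first by move/eqP; rewrite oner_eq0.
 rewrite rmorph_sum -(rmorph1 w) -(rmorph1 i) -(rmorph1 chi) -s1 !rmorph_sum.
 apply: eq_big_seq => x xs; rewrite !rmorphM; congr (_ * _); rewrite -vE //. exact: (map_f (fun x => chi x.2)).
have ijb : i (chi b) = j (iota (chi b)). apply/subr0_eq; apply: (unit_cancel ue); by rewrite mulr0 mulrC eb.
suff : exists d, i0 d = chi b by move/i0E => [P eP]; exists P. apply: contrapT => nb.
have [||lam [lamD lamZ lam0 lam1]] := @functional k' K i0 [set x | exists d, i0 d = x] (chi b).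
- split=> [|_ _ [x <-] [y <-]|a _ [x <-]].
 + by exists 0; rewrite rmorph0.
 + by exists (x + y); rewrite rmorphD.
 + by exists (a * x); rewrite rmorphM.
- exact: nb. have [|t [tD tE]] := uni O (fun x y => iota (i0 (lam x)) * y).
 split=> [a a' b0|a b0 b'|a b0 b']; first by rewrite lamD !rmorphD mulrDl. by rewrite mulrDr.
 by rewrite lamZ !rmorphM /=; ring. have := tE (chi b) 1; rewrite rmorph1 mulr1 lam1 rmorph1 rmorph1 mulr1 ijb.
have := tE 1 (iota (chi b)); rewrite rmorph1 mul1r lam0; last by exists 1; rewrite rmorph1.
by move=> ->; rewrite !rmorph0 mul0r => /eqP; rewrite eq_sym oner_eq0. Qed.

Lemma finite_or_infinite (T : eqType) :
 (exists es : seq T, forall x, x \in es) \/ forall n, exists es : seq T, uniq es /\ size es = n.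
have [fin|inf] := pselect (exists es : seq T, forall x, x \in es); [by left|right].
elim=> [|n [es [ues <-]]]; first by exists [::]. have [x nx] : exists x, x \notin es.
 apply: contrapT => nx; apply: inf; exists es => x. by case: (boolP (x \in es)) => // xn; case: nx; exists x.
by exists (x :: es); rewrite /= nx ues. Qed.

(** The candidate is [\sum_i c0^i v_i] over the spanning list [vs]. Conjugates of the [v_i] range
    over the finite set of roots [rs], so only finitely many scalars fail to separate them. *)
Lemma primitive_infinite : (forall n, exists es : seq k, uniq es /\ size es = n) ->
 exists th, iint h setT th /\ forall b, exists P : {poly k}, chi b = evp h th P.
move=> inf; pose m := size vs.
have [f fP] : exists f : K -> {poly k}, forall v, v \in vs -> f v \is monic /\ evp h v (f v) = 0.
 have ex v : exists g : {poly k}, v \in vs -> g \is monic /\ evp h v g = 0.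
  have [/mapP [x _ ->]|] := boolP (v \in vs); last by exists 0.
  have [g gm ge] := annihilator_exists (fibre_integral x.2).
  by exists g => _; split=> //; rewrite -ge; exact: evp_coef. by have [f hf] := choice ex; exists f.
pose F := \prod_(v <- vs) f v. have Fm : F \is monic by rewrite /F big_seq; apply: monic_prod => v /fP [].
have F0 : map_poly h F != 0 by rewrite map_poly_eq0 monic_neq0. have [O [iota [rs rsE]]] := splitting_field F0.
have rootsE (W : fieldType) (u : K ~> W) (j : O ~> W) :
  (forall a, u (h a) = j (iota (h a))) -> forall v, v \in vs -> exists2 r, r \in rs & u v = j r.
 move=> uj v vvs; have [_ fv] := fP v vvs. have e : (map_poly j (map_poly iota (map_poly h F))).[u v] = 0.
  rewrite -!map_poly_comp (eq_map_poly (g := u \o h)); last by move=> a /=; rewrite uj.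
  rewrite map_poly_comp horner_map /= /F (big_rem v) //= rmorphM hornerM -evpE fv mul0r. by rewrite rmorph0.
 move: e; rewrite rsE map_polyZ hornerZ => /eqP.
 rewrite mulf_eq0 !fmorph_eq0 lead_coef_eq0 (negbTE F0) /= -(prod_map_poly j rs predT) -rootE root_prod_XsubC.
 (* For an assignment [r] of roots to the members of [vs], the value of [Pr r] at a scalar is the
    difference of the two candidates built from the roots and from [vs]. The scalar [c0] must avoid
    the roots of all nonzero [Pr r]. *)
 by move=> /mapP [r rin e]; exists r. pose Pr (r : {ffun 'I_m -> 'I_(size rs)}) : {poly O} :=
 \poly_(i < m) (if insub i is Some i' then rs`_(r i') - iota vs`_i else 0). pose big := \prod_(r | Pr r != 0) Pr r.
have big0 : big != 0 by apply/prodf_neq0. have [es [ues ses]] := inf (size big).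
have [c0 nc] : exists c0, ~~ root big (iota (h c0)). apply: contrapT => nex.
 have := @max_poly_roots O big (map (iota \o h) es) big0.
 rewrite size_map ses ltnn => /(_ _ _) -H; suff : false by [].
 apply: H; last by rewrite map_inj_uniq //; apply: inj_comp; exact: fmorph_inj.
 apply/allP => _ /mapP [x _ ->]; case: (boolP (root big _)) => // nr; case: nex. by exists x.
exists (\sum_(i < m) h c0 ^+ i * vs`_i). have iS := iint_sring h.
have ith : iint h setT (\sum_(i < m) h c0 ^+ i * vs`_i). have [i1 _ iM] := iS.
 apply: (big_ind (iint h setT)); [exact: subring0|by move=> x y; exact: subringD|move=> i _].
 apply: (iM); first by rewrite -rmorphXn; exact: iint_img.
 by have /mapP [x _ ->] := mem_nth 0 (ltn_ord i); exact: fibre_integral.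
split=> //; apply: (primitive_of_separated (iota := iota)) => // W u j uj uth.
have [r0 r0P] : exists r0 : 'I_m -> 'I_(size rs), forall i : 'I_m, u vs`_i = j rs`_(r0 i).
 have ex (i : 'I_m) : exists l : 'I_(size rs), u vs`_i = j rs`_l.
  have [r rin e] := rootsE W u j uj vs`_i (mem_nth 0 (ltn_ord i)).
  have lr : (index r rs < size rs)%N by rewrite index_mem. by exists (Ordinal lr); rewrite e /= nth_index.
 by have [r0 h0] := choice ex; exists r0. pose r := [ffun i => r0 i]. have Pr0 : Pr r = 0.
 apply: contrapT => /eqP nP; move: nc; rewrite rootE horner_prod => /eqP; apply.
 rewrite (bigD1 r) //= (_ : (Pr r).[_] = 0) ?mul0r //.
 apply: (fmorph_inj j); rewrite rmorph0 horner_poly rmorph_sum.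
 have := uth; rewrite !rmorph_sum => /eqP; rewrite -subr_eq0 -sumrB => /eqP e; rewrite -[RHS]e.
 apply: eq_bigr => i _; rewrite (_ : insub (nat_of_ord i) = Some i) ?ffunE; last exact: valK.
 by rewrite !rmorphM !rmorphXn rmorphB -r0P uj; ring.
move=> v vvs; have iv : (index v vs < m)%N by rewrite index_mem.
have := congr1 (fun p : {poly O} => p`_(Ordinal iv)) Pr0.
rewrite coef0 coef_poly iv (_ : insub (nat_of_ord (Ordinal iv)) = Some (Ordinal iv)); last exact: valK.
rewrite /= ffunE nth_index // => /eqP; rewrite subr_eq0 => /eqP e.
by have := r0P (Ordinal iv); rewrite /= nth_index // => ->; rewrite -e. Qed.

(** Over a finite field the values [chi b] form a finite set. Its nonzero members are stable under
    multiplication, hence are roots of unity of order their number, and a primitive root is a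
    generator. *)
Lemma primitive_finite (es : seq k) : (forall x, x \in es) ->
 exists th, iint h setT th /\ forall b, exists P : {poly k}, chi b = evp h th P.
move=> esT; pose m := size vs. pose L := [seq \sum_(i < m) h (es`_(r i)) * vs`_i | r : {ffun 'I_m -> 'I_(size es)}].
have inL b : chi b \in L. have [c0 [_ ->]] := spn_coef (idealT k) (fibre_spanned b).
 have lt i : (index (c0 i) es < size es)%N by rewrite index_mem.
 apply/mapP; exists [ffun i : 'I_m => Ordinal (lt i)]; first by rewrite mem_enum.
 by apply: eq_bigr => i _; rewrite ffunE /= nth_index.
pose E := undup [seq z <- L | (z != 0) && `[< exists b, chi b = z >]].
have EP z : z \in E <-> z != 0 /\ exists b, chi b = z.
 rewrite mem_undup mem_filter; split=> [/andP [/andP [nz /asboolP ez] _] //|[nz [b eb]]].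
 by rewrite -eb inL andbT eb nz /=; apply/asboolP; exists b. have uE : uniq E by exact: undup_uniq.
have E1 : 1 \in E by apply/EP; rewrite oner_neq0; split=> //; exists 1; rewrite rmorph1.
have n0 : (0 < size E)%N by case: (E) E1. have rE : all (size E).-unity_root E.
 apply/allP => x xE; have /EP [nx [b eb]] := xE; rewrite unity_rootE. have perm : perm_eq [seq x * y | y <- E] E.
  apply: uniq_perm => //; first by rewrite map_inj_uniq //; exact: mulfI.
  have [|||? esub] := @uniq_min_size _ [seq x * y | y <- E] E.
  - by rewrite map_inj_uniq //; exact: mulfI.
  - move=> _ /mapP [y /EP [ny [d ed]] ->]; apply/EP; rewrite mulf_neq0 //; split=> //.
   by exists (b * d); rewrite rmorphM eb ed.
  - by rewrite size_map.
  - exact: esub. have : \prod_(y <- [seq x * y | y <- E]) y = \prod_(y <- E) y by exact: perm_big.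
 rewrite big_map big_split /= big_const_seq count_predT iter_mulr_1 => e.
 have nzp : \prod_(y <- E) y != 0 by rewrite prodf_seq_neq0; apply/allP => y /EP [].
 by apply/eqP; apply: (mulIf nzp); rewrite mul1r. have /hasP [th thE prim] := has_prim_root n0 rE uE (leqnn _).
have /EP [_ [b0 eb0]] := thE. exists th; split; first by rewrite -eb0; exact: fibre_integral.
move=> b; have [->|nb] := eqVneq (chi b) 0; first by exists 0; rewrite raddf0.
have bE : chi b \in E by apply/EP; split=> //; exists b.
have [i ->] := prim_rootP prim (unity_rootP (allP rE _ bE)). by exists 'X^i; rewrite evpE map_polyXn hornerXn. Qed.

Lemma primitive_element : exists th, [/\ th != 0, iint h setT th &
 forall b, exists P : {poly k}, chi b = evp h th P].
have [th [ith thP]] : exists th, iint h setT th /\ forall b, exists P : {poly k}, chi b = evp h th P.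
 by have [[es /primitive_finite]|/primitive_infinite] := finite_or_infinite k.
(* If [th] is 0 then all values already lie in [k], and 1 is a nonzero generator. *)
have [th0|nth] := eqVneq th 0; last by exists th. exists 1; split; first exact: oner_neq0.
 by rewrite -(rmorph1 h); exact: iint_img. move=> b; have [P ->] := thP b; exists (P`_0)%:P.
by rewrite th0 evp_behead mul0r addr0; symmetry; exact: evpC. Qed.
End SeparableFibre.

(** The universal property sends [P] to the subalgebra generated by the variables; composed with the
    inclusion this must be the identity of [P]. *)
Lemma polynomial_algebra_gen (A P : cring) n (c : A ~> P) (X : 'I_n -> P) :
 is_polynomial_algebra c X -> forall z, alg_gen c [set y | y \in codom X] z.
move=> UP z; have [D [i [ii iE]]] := subring_type (alg_gen_subring c [set y | y \in codom X]).
have [a|u uE] := @factor_inj A D P c i ii; first by apply/iE; exact: alg_gen_img.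
have ex l : exists y, i y = X l by apply/iE; apply: alg_gen_mem; exact: codom_f. have [y yE] := choice ex.
have [w [wc wX _]] := UP D u y; have [v [vc vX vu]] := UP P c X. have e1 : i \o w =1 v.
 by apply: vu => [a|l] /=; [have /= -> := wc a; exact: uE|have /= -> := wX l; exact: yE].
have e2 : (idfun : P ~> P) =1 v by apply: vu. have <- : i (w z) = z by rewrite -[LHS]/((i \o w) z) e1 -e2.
by apply/iE; exists (w z). Qed.

Lemma finitely_presented_gen (A B : cring) (phi : A ~> B) :
 finitely_presented phi -> exists ys : seq B, forall b, alg_gen phi (els ys) b.
move=> [n [P [c [X [q [UP qc surj _]]]]]]; exists (map q (codom X)) => b S sS Sp Sy.
have [S1 SB SM] := sS; have [a <-] := surj b. apply: (@polynomial_algebra_gen _ _ _ _ _ UP a [set a | S (q a)]).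
- split=> /= [|x y hx hy|x y hx hy]; rewrite ?rmorph1 ?rmorphB ?rmorphM //; first exact: SB. exact: SM.
- by move=> a' /=; have /= -> := qc a'; exact: Sp.
- by move=> y yin /=; apply: Sy; exact: map_f. Qed.

Lemma alg_gen_type (A : cring) (B : nzcring) (phi : A ~> B) (zs : seq B) :
 exists (F : nzcring) (i : F ~> B) (rho : A ~> F) (ws : seq F),
  [/\ injective i, i \o rho =1 phi, map i ws = zs & forall f, alg_gen rho (els ws) f].
have [F [i [ii iE]]] := subring_nz (alg_gen_subring phi (els zs)).
have [a|rho rhoE] := @factor_inj A F B phi i ii; first by apply/iE; exact: alg_gen_img.
have ex b : exists d, b \in zs -> i d = b. have [bz|] := boolP (b \in zs); last by exists 0.
 have /iE [d ed] : alg_gen phi (els zs) b by apply: alg_gen_mem. by exists d. have [lf lfP] := choice ex.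
exists F, i, rho, (map lf zs); split=> //. by rewrite -map_comp -[RHS]map_id; apply/eq_in_map => z /lfP.
move=> d; have : alg_gen phi (els zs) (i d) by apply/iE; exists d.
move=> /(_ [set b | exists e, i e = b /\ alg_gen rho [set z | z \in map lf zs] e]).
have [g1 gB gM] := alg_gen_subring rho [set z | z \in map lf zs]. case.
- split; first by exists 1; rewrite rmorph1.
  by move=> _ _ [u [<- hu]] [v [<- hv]]; exists (u - v); rewrite rmorphB; split=> //; exact: gB.
 by move=> _ _ [u [<- hu]] [v [<- hv]]; exists (u * v); rewrite rmorphM; split=> //; exact: gM.
- by move=> a; exists (rho a); split; [exact: rhoE|exact: alg_gen_img].
- by move=> z zin; exists (lf z); split; [exact: lfP|apply: alg_gen_mem; exact: map_f]. by move=> e [/ii ->]. Qed.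

Lemma alg_gen_finite (A B : cring) (phi : A ~> B) (zs : seq B) :
 (forall b, alg_gen phi (els zs) b) -> (forall z, z \in zs -> iint phi setT z) ->
 exists vs : seq B, forall b, spn phi setT (els vs) b.
move=> gen int; have [vs [fv hv]] := fin_alg_seq int; exists vs => b. have [b1 bM] := fv.
apply: (gen b (spn phi setT (els vs))); last exact: hv.
- split=> // u v hu hw; last exact: (spn_mulT (idealT _)).
 by apply: spnD => //; rewrite -mulN1r -(rmorph1 phi) -rmorphN; apply: spnZ.
- by move=> a; rewrite -[phi a]mulr1; apply: spnZ. Qed.

Lemma alg_gen_integral (A B : cring) (phi : A ~> B) (zs : seq B) :
 (forall b, alg_gen phi (els zs) b) -> (forall z, z \in zs -> iint phi setT z) ->
 forall b, iint phi setT b.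
by move=> gen int b; apply: gen => //; [exact: iint_sring|move=> a; exact: iint_img]. Qed.

(** Solving an annihilating polynomial for its lowest nonzero term writes a power [z ^+ r] as a
    multiple of [z ^+ r.+1]; this is then iterated. *)
Lemma stable_power (k : fieldType) (M : cring) (kap : k ~> M) z :
 iint kap setT z -> exists r, forall n, exists g, z ^+ r = z ^+ (r + n) * g.
move=> /annihilator_exists [m mm em]. have key n : forall j (c : nat -> k), (exists2 i, (i < n)%N & c i <> 0) ->
  \sum_(i < n) kap (c i) * z ^+ (i + j) = 0 -> exists r g, z ^+ r = z ^+ r.+1 * g.
 elim: n => [|n IH] j c [i li ni]; first by []. rewrite big_ord_recl => e; have [c0|c0] := eqVneq (c 0%N) 0.
  apply: (IH j.+1 (fun i => c i.+1)). by case: i li ni => [|i] // li ni; exists i.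
  rewrite -[RHS]e c0 rmorph0 mul0r add0r; apply: eq_bigr => l _. by rewrite /= /bump /= addnS add1n.
 exists j, (- \sum_(l < n) kap ((c 0%N)^-1 * c l.+1) * z ^+ l).
 have : kap (c 0%N)^-1 * kap (c 0%N) = 1 by rewrite -rmorphM mulVf // rmorph1.
 move=> e1; rewrite -[LHS]mul1r -e1 -mulrA. move/eqP: e; rewrite addr_eq0 => /eqP; rewrite add0n => ->.
 rewrite !mulrN; congr (- _); rewrite !mulr_sumr; apply: eq_bigr => l _.
 by rewrite rmorphM /= /bump /= add1n !exprS exprD; ring. have [||r [g e]] := key (size m) 0%N (fun i => m`_i).
- exists (size m).-1; last by rewrite -/(lead_coef m) (monicP mm); apply/eqP; exact: oner_neq0.
 by rewrite prednK // lt0n size_poly_eq0 monic_neq0.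
- by rewrite -[RHS]em; apply: eq_bigr => i _; rewrite addn0.
exists r; elim=> [|n [g' e']]; first by exists 1; rewrite addn0 mulr1.
exists (g' * g); rewrite {1}e' exprD -[z ^+ r]/(z ^+ r) {1}e addnS !exprS exprD; ring. Qed.

Lemma spn_generated (A B : cring) (phi : A ~> B) (I : set A) (V : set B) x :
 is_ideal I -> (forall b, spn phi setT V b) -> spn phi I setT x -> spn phi I V x.
move=> [_ _ IM] gen; elim=> [|y z _ hy _ hz|a v Ia _]; [exact: spn0|exact: spnD|].
elim: (gen v) => [|y z _ hy _ hz|b u _ Vu]; first by rewrite mulr0; exact: spn0. by rewrite mulrDr; exact: spnD.
by rewrite mulrA -rmorphM mulrC (mulrC a) mulrC; apply: spnG => //; exact: IM. Qed.

(* Nakayama: a finite algebra which is generated by [t] modulo [p] near the prime [ker w]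
  is generated by [t] near that prime. *)
Lemma nakayama_monogenic (A F : nzcring) (rho : A ~> F) (K : fieldType)
  (w : F ~> K) (vs : seq F) (t : F) (p : set A) : is_ideal p -> (forall a, p a -> w (rho a) = 0) ->
 (forall b, spn rho setT (els vs) b) -> (forall f, exists (S G : {poly A}), w (evp rho t S) <> 0 /\
   spn rho p setT (evp rho t S * f - evp rho t G)) ->
 exists H : {poly A}, w (evp rho t H) <> 0 /\ forall f, exists G, evp rho t H * f = evp rho t G.
move=> idp pw gen near; pose n := size vs. have [S0 /choice [G0 h0]] := choice near.
pose S := \prod_(i < n) S0 vs`_i. have nS : w (evp rho t S) != 0.
 rewrite rmorph_prod rmorph_prod; apply/prodf_neq0 => i _; apply/eqP. by have [] := h0 vs`_i.
pose T (i : 'I_n) := \prod_(j < n | j != i) S0 vs`_j.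
have ST i : S = T i * S0 vs`_i by rewrite /S (bigD1 i) //= mulrC.
have hM (i : 'I_n) : exists c : nat -> A, (forall j, p (c j)) /\
  evp rho t S * vs`_i - evp rho t (T i * G0 vs`_i) = \sum_(j < n) rho (c j) * vs`_j.
 apply: spn_coef => //; apply: spn_generated => //.
 rewrite (_ : _ - _ = evp rho t (T i) * (evp rho t (S0 vs`_i) * vs`_i - evp rho t (G0 vs`_i))).
  by have [_ _] := spn_setT_ideal rho idp; apply; have [] := h0 vs`_i. by rewrite (ST i) !rmorphM; ring.
have [M HM] := choice hM. pose N0 : 'M[{poly A}]_n := S%:M - \matrix_(i, j) (M i j)%:P.
pose v : 'cV[F]_n := \col_i vs`_i. have N0E i j : evp rho t (N0 i j) = evp rho t S *+ (i == j) - rho (M i j).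
 by rewrite !mxE rmorphB rmorphMn; congr (_ - _); exact: evpC. pose N := map_mx (evp rho t) N0.
have Nv : N *m v = \col_i evp rho t (T i * G0 vs`_i). apply/matrixP => i j; rewrite !mxE.
 rewrite (eq_bigr (fun l : 'I_n => evp rho t S *+ (i == l) * vs`_l - rho (M i l) * vs`_l)).
  rewrite sumrB (bigD1 i) //= eqxx mulr1n big1 ?addr0; last first.
   by move=> l; rewrite eq_sym => /negbTE ->; rewrite mulr0n mul0r. by have [_ <-] := HM i; ring.
 by move=> l _; rewrite mxE N0E mxE mulrBl. exists (\det N0); split.
 have -> : w (evp rho t (\det N0)) = \det (map_mx (w \o evp rho t) N0) by rewrite det_map_mx.
 have -> : map_mx (w \o evp rho t) N0 = (w (evp rho t S))%:M.
  apply/matrixP => i j; rewrite [LHS]mxE [RHS]mxE [LHS](congr1 w (N0E i j)) rmorphB rmorphMn.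
  by rewrite pw ?subr0 //; have [] := HM i. by rewrite det_scalar; apply/eqP; rewrite expf_neq0.
have hv (i : 'I_n) : exists G, evp rho t (\det N0) * vs`_i = evp rho t G.
 have := congr1 (mulmx (\adj N)) Nv; rewrite mulmxA mul_adj_mx mul_scalar_mx => /matrixP /(_ i 0).
 rewrite [LHS]mxE [v i 0]mxE [RHS]mxE det_map_mx => ->; exists (\sum_j \adj N0 i j * (T j * G0 vs`_j)).
 rewrite rmorph_sum; apply: eq_bigr => j _; rewrite /N -map_mx_adj [map_mx _ _ i j]mxE [X in _ * X]mxE; symmetry; exact: rmorphM.
move=> f; elim: (gen f) => [|x y _ [G eG] _ [G' eG']|a u _ /= uvs].
- by exists 0; rewrite mulr0 rmorph0.
- by exists (G + G'); rewrite mulrDr eG eG' rmorphD. have iu : (index u vs < n)%N by rewrite index_mem.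
have [G] := hv (Ordinal iu); rewrite /= nth_index // => eG.
exists (a%:P * G); transitivity (rho a * (evp rho t (\det N0) * u)); first by ring.
have ea : evp rho t a%:P = rho a by exact: evpC. by rewrite eG -ea -rmorphM. Qed.

Lemma iint_eq_hom (A B : cring) (f g : A ~> B) (I : set A) z : f =1 g -> iint f I z -> iint g I z.
move=> fg [n hn]; exists n.
by elim: hn => [|x y _ hx _ hy|a v Ia Vv]; [exact: spn0|exact: spnD|rewrite fg; exact: spnG]. Qed.

(** By Zariski's main theorem [B] agrees near [q] with a finite [A]-algebra [F]. A suitable multiple
    of a primitive element of the residue field at [q], chosen to vanish on the rest of the fibre,
    generates [F] modulo [p] near [q], and [nakayama_monogenic] removes the reduction modulo [p]. *)
Lemma etale_monogenic (A B : nzcring) (phi : A ~> B) (q : set B) : etale_ring_hom phi -> is_prime_ideal q ->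
 exists (t : B) (H : {poly A}), [/\ iint phi setT t, ~ q (evp phi t H) &
  forall b, exists N G, evp phi t H ^+ N * b = evp phi t G].
move=> [et fp] pq; have [ys gen] := finitely_presented_gen fp. have [s [s1 sB]] := separability_family et gen.
have [q0 qD qM q1 qP] := pq; pose p := phi @^-1` q. have pp : is_prime_ideal p by exact: preim_prime.
have [k [c [cker cfrac]]] := residue_field pp. have [K [chi [chiker chifrac]]] := residue_field pq.
have [||h hE] := @residue_field_lift A k K c (chi \o phi).
- by move=> z; have [a [b [nb ->]]] := cfrac z; exists a, b; split=> // /cker.
- by move=> a; rewrite cker /= chiker. have cfrac' z : exists a b, c b <> 0 /\ z = c a / c b.
 by have [a [b [nb ->]]] := cfrac z; exists a, b; split=> // /cker. have hE' a : h (c a) = chi (phi a) by exact: hE.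
have resid b : exists (F : {poly A}) l, q (evp phi b F) /\ ~ q (phi F`_l).
 have [m mm em] := annihilator_exists (fibre_integral s1 sB hE' b).
 have [d [F [nd eF]]] := clear_denominators cfrac' m. have cF i : c F`_i = c d * m`_i by rewrite -coefZ eF coef_map.
 exists F, (size m).-1; split. apply/chiker; rewrite (evp_coef phi b (leq_maxl (size F) (size m))) rmorph_sum.
  rewrite (eq_bigr (fun i : 'I_(maxn (size F) (size m)) => h (c d) * (h m`_i * chi b ^+ i))).
   rewrite -mulr_sumr -(evp_coef h (chi b) (leq_maxr (size F) (size m))).
   by rewrite (evp_coef h (chi b) (leqnn _)) em mulr0.
  by move=> i _; rewrite rmorphM rmorphXn -hE' cF rmorphM mulrA.
 rewrite -chiker -hE' cF -/(lead_coef m) (monicP mm) mulr1 => /eqP; rewrite fmorph_eq0. by move/eqP.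
have [eps [neps epsP]] := fibre_isolating s1 sB hE' pp cker cfrac.
have isol Q : is_prime_ideal Q -> Q `<=` q -> (forall a, q (phi a) -> Q (phi a)) -> q `<=` Q.
 move=> [Q0 QD QM Q1 QP] Qq QA x /chiker /epsP [y [ny hy]]. have : Q (phi y * (eps * x)).
  by elim: hy => [|u v _ hu _ hv|a v pa _] //; [exact: QD|rewrite mulrC; apply: QM; exact: QA].
 by move=> /QP [/Qq //|/QP [/Qq /chiker //|]].
have [|s0 [is0 ns0 s0P]] := zariski_main (n := size ys) erefl gen _ pq resid isol.
 by move=> y yin; apply: (@iint_img _ _ (idfun : B ~> B)); apply: alg_gen_mem. have [nb nbP] := choice s0P.
(* The algebra [F] of the [zs] is finite over [A], being generated by finitely many integral
   elements, and agrees with [B] once [s0] is inverted. *)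
pose zs := s0 :: [seq s0 ^+ nb y * y | y <- ys]. have [F [i [rho [ws [ii irho iws genF]]]]] := alg_gen_type phi zs.
have irho' a : i (rho a) = phi a by exact: irho.
have lift z : z \in zs -> exists f, i f = z by rewrite -iws => /mapP [f _ ->]; exists f.
have [s1' es1] : exists f, i f = s0 by apply: lift; exact: mem_head.
have iphi z : iint phi setT (i z) -> iint rho setT z.
 move=> hz; apply: (iint_inj (idealT _) ii); apply: iint_eq_hom hz => a. by rewrite /= irho'.
have intF : forall f, iint rho setT f. apply: (alg_gen_integral genF) => w win; apply: iphi.
 have : i w \in zs by rewrite -iws; exact: map_f. by rewrite inE => /orP [/eqP -> //|/mapP [y _ ->]]; exact: nbP.
have [vs spanF] := alg_gen_finite genF (fun w _ => intF w). have absorb b : exists N f, i f = s0 ^+ N * b.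
 apply: (gen b [set b | exists N f, i f = s0 ^+ N * b]).
 - split; first by exists 0%N, 1; rewrite rmorph1 mulr1.
   move=> u v [N [d ed]] [M [e ee]]; exists (N + M)%N, (s1' ^+ M * d - s1' ^+ N * e).
   by rewrite rmorphB !rmorphM !rmorphXn es1 ed ee exprD; ring.
  move=> u v [N [d ed]] [M [e ee]]; exists (N + M)%N, (d * e). by rewrite rmorphM ed ee exprD; ring.
 - by move=> a; exists 0%N, (rho a); rewrite expr0 mul1r irho'.
 - move=> y yin; have [|f ef] := lift (s0 ^+ nb y * y); last by exists (nb y), f.
  by rewrite inE; apply/orP; right; apply/mapP; exists y.
have absorbI z : spn phi p setT z -> exists N f, spn rho p setT f /\ i f = s0 ^+ N * z.
 elim=> [|u v _ [N [d [hd ed]]] _ [M [e [he ee]]]|a b pa _].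
 - by exists 0%N, 0; rewrite rmorph0 mulr0; split=> //; exact: spn0.
 - have [_ sD sM] := spn_setT_ideal rho (prime_ideal pp).
  exists (N + M)%N, (s1' ^+ M * d + s1' ^+ N * e); split; first by apply: sD; exact: sM.
  by rewrite rmorphD !rmorphM !rmorphXn es1 ed ee exprD; ring.
 have [N [f ef]] := absorb b; exists N, (rho a * f); split; first exact: spnG. by rewrite rmorphM irho' ef; ring.
have [M [lF [kap [kapE lker]]]] := fibre_ring rho pp cker cfrac. have [N0 [e1 ee1]] := absorb eps.
(* In the fibre [s1' ^+ r] is a multiple of every higher power of [s1']; it thus absorbs the unknown
   powers that [absorbI] introduces. The resulting [w] is nonzero at [q] and multiplies the ideal of
   [q] into [p F], up to elements outside [p]. *)
have [r rP] : exists r, forall n, exists g, lF s1' ^+ r = lF s1' ^+ (r + n) * g. apply: (stable_power (kap := kap)).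
 have h1 : iint (kap \o c) setT (lF s1') by apply: iint_eq_hom (iint_map lF (intF s1')) => a; rewrite [RHS]kapE.
 exact: iint_comp h1. pose w := s1' ^+ r * e1.
have wP x : q (i x) -> exists y, ~ p y /\ spn rho p setT (rho y * (w * x)).
 move=> /chiker /epsP [y [ny /absorbI [N [f [hf ef]]]]]; apply/lker. have l0 : lF (s1' ^+ N * (e1 * x)) = 0.
  apply/lker; exists y; split=> //. have -> : rho y * (s1' ^+ N * (e1 * x)) = s1' ^+ N0 * f.
   by apply: ii; rewrite !rmorphM !rmorphXn irho' es1 ef ee1; ring.
  by have [_ _] := spn_setT_ideal rho (prime_ideal pp); apply. have [g eg] := rP N.
 rewrite /w -mulrA rmorphM rmorphXn eg -rmorphXn exprD rmorphM.
 rewrite (_ : _ * _ * _ * _ = lF (s1' ^+ r) * g * (lF (s1' ^+ N) * lF (e1 * x))); last by ring.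
 by rewrite -[lF (s1' ^+ N) * _]rmorphM l0 mulr0. have ns0' : chi s0 != 0 by apply/eqP => /chiker.
have nw : chi (i w) != 0. rewrite !rmorphM !rmorphXn es1 ee1 rmorphM rmorphXn !mulf_neq0 ?expf_neq0 //. exact/eqP.
have [th [nth ith thP]] := primitive_element s1 sB hE'. have scal z : exists f d, ~ p d /\ chi (i f) = h (c d) * z.
 pose G := [set z | exists f d, ~ p d /\ chi (i f) = h (c d) * z]. have np1 : ~ p 1 by case: pp.
 have sG : is_subring G. split; first by exists 1, 1; rewrite !rmorph1 mulr1.
   move=> u v [f [d [nd ef]]] [g [e [ne eg]]]; exists (rho e * f - rho d * g), (d * e). split; first exact: primeM.
   by rewrite rmorphB !rmorphM rmorphB !rmorphM !irho' -!hE' ef eg; ring.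
  move=> u v [f [d [nd ef]]] [g [e [ne eg]]]; exists (f * g), (d * e).
  by split; [exact: primeM|rewrite !rmorphM ef eg; ring].
 have GF f : G (chi (i f)) by exists f, 1; rewrite !rmorph1 mul1r. have Gk x : G (h x).
  have [a [b [nb' ->]]] := cfrac x; exists (rho a), b; split=> //.
  by rewrite irho' -hE' -rmorphM mulrCA divff ?mulr1 //; apply/eqP => /cker. have [b0 [b1 [nb1 ->]]] := chifrac z.
 have [M0 [f0 ef0]] := absorb b0; have [M1 [f1 ef1]] := absorb b1. have nf1 : chi (i f1) != 0.
  by rewrite ef1 rmorphM rmorphXn mulf_neq0 ?expf_neq0 //; apply/eqP => /chiker.
 have [P eP] : exists P, (chi (i f1))^-1 = evp h (chi (i f1)) P.
  by apply: inverse_poly => //; exact: (fibre_integral s1 sB hE').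
 have -> : chi b0 / chi b1 = chi (i (s1' ^+ M1 * f0)) * (chi s0 ^+ M0)^-1 * (chi (i f1))^-1.
  rewrite !rmorphM !rmorphXn es1 ef0 ef1 !rmorphM !rmorphXn; field.
  by rewrite expf_neq0 ?ns0' ?expf_neq0 //= ?andbT; apply/eqP => /chiker.
 have [Q eQ] : exists P, (chi s0 ^+ M0)^-1 = evp h (chi s0 ^+ M0) P. apply: inverse_poly; first exact: expf_neq0.
  by rewrite -rmorphXn; exact: (fibre_integral s1 sB hE').
 have [_ _ GM] := sG; apply: (GM); first apply: (GM) => //.
  by rewrite eQ; apply: evp_subring => //; rewrite -es1 -!rmorphXn. by rewrite eP; exact: evp_subring.
(* Dividing by the value of [w] beforehand makes [t] a multiple of [w] whose value at [q] is a
   scalar multiple of the primitive element. *)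
have [th' [d [nd eth']]] := scal (th / chi (i w)). pose t := w * th'. have et' : chi (i t) = h (c d) * th.
 by rewrite /t [i _]rmorphM [chi _]rmorphM eth'; move: (chi (i w)) nw => z nz; field.
have hcd : h (c d) != 0 by rewrite fmorph_eq0; apply/eqP => /cker.
have nt : chi (i t) != 0 by rewrite et' mulf_neq0. have tP b : exists P : {poly k}, chi b = evp h (chi (i t)) P.
 have [P ->] := thP b. have [|||Q <-] := @evp_subring k K h [set x | exists Q, evp h (chi (i t)) Q = x] th P.
 - exact: range_subring.
 - by move=> a; exists a%:P; exact: evpC.
 - exists ((c d)^-1 *: 'X); rewrite evpE map_polyZ map_polyX hornerZ hornerX et' mulrA -rmorphM.
  by rewrite mulVf ?rmorph1 ?mul1r //; apply/eqP => /cker.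
 - by exists Q. have [||f|H [nH HP]] := @nakayama_monogenic A F rho K (chi \o i) vs t p _ _ spanF.
- exact: prime_ideal.
- by move=> a pa; rewrite /= irho'; apply/chiker.
- have [P eP] := tP (i f); have [d' [G [nd' eG]]] := clear_denominators cfrac' P.
 have eGt z : evp (h \o c) z G = h (c d') * evp h z P. by rewrite evpE map_poly_comp -eG map_polyZ hornerZ.
 pose x := rho d' * f - evp rho t G. have qx : q (i x).
  apply/chiker; rewrite /x !rmorphB !rmorphM irho' -hE' eP -eGt; apply/eqP; rewrite subr_eq0.
  apply/eqP; rewrite -[RHS]/((chi \o i) _); symmetry; apply: evp_map => a. by rewrite /= irho' hE'.
 (* The variable [X] contributes a factor [t], hence a factor [w], which brings the error [x] into
    [p F]. *)
 have [y [ny hy]] := wP x qx. exists ((y * d')%:P * 'X), (y%:P * 'X * G).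
 have eC a : evp rho t a%:P = rho a by exact: evpC. have eX : evp rho t 'X = t by exact: evpX.
 have eS : evp rho t ((y * d')%:P * 'X) = rho (y * d') * t by rewrite rmorphM eC eX.
 have eG' : evp rho t (y%:P * 'X * G) = rho y * t * evp rho t G by rewrite !rmorphM eC eX. rewrite eS eG'; split.
  rewrite /= [i _]rmorphM [chi _]rmorphM irho' -hE' => /eqP. rewrite mulf_eq0 (negbTE nt) orbF fmorph_eq0.
  by rewrite rmorphM mulf_eq0 => /orP [/eqP /cker //|/eqP //]. rewrite rmorphM.
 rewrite (_ : _ - _ = th' * (rho y * (w * x))); last by rewrite /x /t; ring.
 by have [_ _] := spn_setT_ideal rho (prime_ideal pp); apply. have [P eP] := HP s1'.
have it P' : evp phi (i t) P' = i (evp rho t P') by symmetry; apply: evp_map. exists (i t), (H * P); split.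
- by apply: iint_eq_hom (iint_map i (intF t)) => a; exact: irho.
- rewrite it rmorphM -eP => /chiker; rewrite !rmorphM es1 => /eqP; rewrite !mulf_eq0.
 by rewrite (negbTE ns0') orbF orbb => /eqP. move=> b; have [N [f ef]] := absorb b; have [Q eQ] := HP f.
exists N.+1, (H ^+ N.*2 * P * Q). have eHP : evp phi (i t) (H * P) = i (evp rho t H) * (i (evp rho t H) * s0).
 by rewrite it rmorphM -eP [i _]rmorphM [i (_ * s1')]rmorphM es1. have -> : evp phi (i t) (H ^+ N.*2 * P * Q) =
  i (evp rho t H) ^+ N.*2 * (i (evp rho t H) * s0) * (i (evp rho t H) * (s0 ^+ N * b)).
 by rewrite it !rmorphM -eP -eQ rmorphXn !rmorphM rmorphXn es1 ef. by rewrite eHP exprS !exprMn -addnn exprD; ring.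
Qed.

Lemma poly_taylor (A : nzcring) (Q : cring) (s1 s2 : {poly A} ~> Q) P :
 (forall c, s1 c%:P = s2 c%:P) -> (s1 'X - s2 'X) * (s1 'X - s2 'X) = 0 ->
 s1 P = s2 P + s2 P^`() * (s1 'X - s2 'X).
move=> sc d2; elim/poly_ind: P => [|P c IH]. by rewrite deriv0 !rmorph0 mul0r addr0.
rewrite derivD derivM derivX derivC mulr1 addr0 !rmorphD !rmorphM sc IH.
transitivity (s2 P * s2 'X + s2 c%:P + (s2 P^`() * s2 'X + s2 P) * (s1 'X - s2 'X) +
 s2 P^`() * ((s1 'X - s2 'X) * (s1 'X - s2 'X))); first by ring. by rewrite d2 mulr0 addr0; ring. Qed.

Lemma poly_hom_eq (A : nzcring) (Q : cring) (s1 s2 : {poly A} ~> Q) :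
 (forall c, s1 c%:P = s2 c%:P) -> s1 'X = s2 'X -> s1 =1 s2.
move=> sc sX P; rewrite (poly_taylor _ sc); last by rewrite sX subrr mul0r. by rewrite sX subrr mulr0 addr0. Qed.

Lemma loc_epi (B E D : cring) (s : B) (l : B ~> E)
  (w w' : E ~> D) : is_localization s l -> w \o l =1 w' \o l -> w =1 w'.
move=> [us frac _] ww e; have [n [x ex]] := frac e. apply: (unit_cancel (unit_morph w (is_unitX n us))).
rewrite -rmorphM mulrC ex (_ : w (l s ^+ n) = w' (l s ^+ n)). by rewrite -rmorphM mulrC ex; exact: ww.
by rewrite -rmorphXn; exact: ww. Qed.

Lemma loc_lift (B E D : cring) (s : B) (l : B ~> E) (f : B ~> D) :
 is_localization s l -> is_unit (f s) -> exists w : E ~> D, w \o l =1 f.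
move=> [us frac ker] uf. apply: (@fraction_lift _ _ _ l f [set x | exists n, x = s ^+ n]).
- by move=> _ [n ->]; rewrite rmorphXn; exact: is_unitX.
- move=> b; have [n [x e]] := frac b; exists (s ^+ n), x; split; first by exists n. by rewrite rmorphXn mulrC.
move=> x /ker [n e]; apply: (unit_cancel (is_unitX n uf)). by rewrite mulr0 -rmorphXn -rmorphM e rmorph0. Qed.

Lemma formally_etale_loc (A B E : cring) (phi : A ~> B) (s : B) (l : B ~> E) :
 formally_etale phi -> is_localization s l -> formally_etale (l \o phi).
move=> et loc C D q u v surj sq e. have [|w [wphi qw wu]] := et C D q u (v \o l) surj sq; first exact: e.
have us : is_unit (w s). have [us _ _] := loc; have [d ed] := unit_morph v us; have [c ec] := surj d.
 have n0 : q (w s * c - 1) = 0. by rewrite rmorphB rmorphM rmorph1 ec; have /= -> := qw s; rewrite ed subrr.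
 (* Newton's step: if [c] inverts [a] modulo a square-zero ideal, then [c (2 - a c)] inverts it
    exactly. *)
 have := sq _ _ n0 n0; move: (w s) => a {n0} n2; exists (c * (2%:R - a * c)).
 by apply/subr0_eq; rewrite -[RHS]oppr0 -n2; ring. have [w' w'E] := loc_lift loc us; exists w'; split.
- by move=> a /=; have /= -> := w'E (phi a); exact: wphi.
- apply: (loc_epi (w := q \o w') (w' := v) loc) => b /=. by have /= -> := w'E b; exact: qw.
move=> w'' h1 h2; apply: (loc_epi loc) => b /=; have /= -> := w'E b.
apply: (wu (w'' \o l)) => [a|b'] /=; first exact: h1. by rewrite -[LHS]/((q \o w'') (l b')) h2. Qed.

(** If every relation of [t] had its derivative in [q], then sending [t] to [chi t + X] would define
    a map from [B] to the dual numbers [D = K[X]/(X^2)]. It lifts [chi] over [A], as does the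
    constant lift, and they differ at [t]; this contradicts uniqueness of lifts. *)
Lemma unramified_simple_root (A B : nzcring) (phi : A ~> B) (q : set B) t H :
 formally_etale phi -> is_prime_ideal q -> ~ q (evp phi t H) ->
 (forall b, exists N G, evp phi t H ^+ N * b = evp phi t G) ->
 exists f, evp phi t f = 0 /\ ~ q (evp phi t f^`()).
move=> et pq nH frac; apply: contrapT => nex. have ram f : evp phi t f = 0 -> q (evp phi t f^`()).
 by move=> f0; apply: contrapT => nf; apply: nex; exists f. have [K [chi [chiker _]]] := residue_field pq.
pose I := [set P : {poly K} | P`_0 = 0 /\ P`_1 = 0].
have c0M (P Q : {poly K}) : (P * Q)`_0 = P`_0 * Q`_0 by rewrite coefM big_ord_recl big_ord0 addr0.
have c1M (P Q : {poly K}) : (P * Q)`_1 = P`_0 * Q`_1 + P`_1 * Q`_0. by rewrite coefM !big_ord_recl big_ord0 addr0.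
have idI : is_ideal I. split=> [|P Q [P0 P1] [Q0 Q1]|P Q [Q0 Q1]]; rewrite /I /=; first by rewrite !coef0.
  by rewrite !coefD P0 P1 Q0 Q1 addr0. by rewrite c0M c1M Q0 Q1 !mulr0 addr0.
have [D [pi [surj ker]]] := quotient_ring idI. pose E : {poly A} ~> {poly K} :=
 evp (polyC \o chi \o phi : A ~> {poly K}) ('X + (chi t)%:P).
have EE P : E P = map_poly (chi \o phi) P \Po ('X + (chi t)%:P). by rewrite /E evpE /comp_poly -map_poly_comp.
have evchi P : (map_poly (chi \o phi) P).[chi t] = chi (evp phi t P).
 by symmetry; exact: (@evp_map A B K phi chi (chi \o phi) P t). have E0 P : (E P)`_0 = chi (evp phi t P).
 by rewrite EE -horner_coef0 horner_comp hornerD hornerX hornerC add0r evchi.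
have E1 P : (E P)`_1 = chi (evp phi t P^`()). have -> : (E P)`_1 = (E P)^`()`_0 by rewrite coef_deriv mulr1n.
 rewrite EE deriv_comp derivD derivX derivC addr0 mulr1 -horner_coef0 horner_comp.
 by rewrite hornerD hornerX hornerC add0r deriv_map evchi. have unitD (P : {poly K}) : P`_0 != 0 -> is_unit (pi P).
 move=> nP; pose Q := (P`_0)^-1%:P - (P`_1 / P`_0 ^+ 2)%:P * 'X.
 have Q0 : Q`_0 = (P`_0)^-1 by rewrite coefB c0M !coefC coefX /= mulr0 subr0. have Q1 : Q`_1 = - (P`_1 / P`_0 ^+ 2).
  by rewrite coefB c1M !coefC !coefX /= mulr1 mul0r addr0 add0r.
 exists (pi Q); apply/subr0_eq; rewrite -rmorphM -(rmorph1 pi) -rmorphB; apply/ker.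
 rewrite /I /= !coefB c0M c1M Q0 Q1 !coefC /=. by split; field.
have [|||w wE] := @fraction_lift {poly A} B D (evp phi t) (pi \o E) [set P | exists N, P = H ^+ N].
- move=> _ [N ->]; apply: unitD; rewrite E0 rmorphXn; rewrite -[_ != 0]/(~~ _).
 by apply/eqP => /chiker /(primeX pq).
- move=> b; have [N [G e]] := frac b; exists (H ^+ N), G; split; first by exists N. by rewrite rmorphXn.
- move=> P P0; apply/ker; split; first by rewrite E0 P0 rmorph0. by rewrite E1; apply/chiker; exact: ram.
have [|nu nuE] := factor_surj surj (f := horner_eval 0).
 by move=> P /ker [P0 _]; rewrite /= /horner_eval horner_coef0.
have nupi (P : {poly K}) : nu (pi P) = P`_0 by rewrite -horner_coef0; exact: nuE.
have wr P : w (evp phi t P) = pi (E P) by exact: wE. have EC a : E a%:P = (chi (phi a))%:P by rewrite /E evpC.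
have EX : E 'X = 'X + (chi t)%:P by rewrite /E evpX. have wphi a : w (phi a) = pi (chi (phi a))%:P.
 by rewrite -EC -wr; congr (w _); symmetry; exact: evpC. have nuw b : nu (w b) = chi b. have [N [G e]] := frac b.
 have nuwP P : nu (w (evp phi t P)) = chi (evp phi t P). by rewrite wr nupi E0.
 have nz : chi (evp phi t H ^+ N) != 0. by apply/eqP => /chiker /(primeX pq).
 apply: (mulfI nz); rewrite -rmorphM e -[in LHS]rmorphXn -nuwP -!rmorphM rmorphXn e. by rewrite nuwP.
have [||a|w0 [_ _ wu]] := et D K nu (pi \o polyC \o chi \o phi) chi.
- by move=> z; exists (pi z%:P); rewrite nupi coefC.
- move=> x y; have [P <-] := surj x; have [Q <-] := surj y; rewrite !nupi => P0 Q0.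
 by rewrite -rmorphM; apply/ker; rewrite /I /= c0M c1M P0 Q0 !(mulr0, mul0r, addr0).
- by rewrite /= nupi coefC. have e1 := wu w wphi nuw. have e2 := wu (pi \o polyC \o chi) (fun=> erefl).
have e3 : (pi \o polyC \o chi) t = w t. by rewrite e1; apply: e2 => b; rewrite /= nupi coefC.
have wt : w t = pi ('X + (chi t)%:P). by rewrite -EX -wr; congr (w _); symmetry; exact: evpX.
have /ker [_] : pi 'X = 0. by apply: (addIr (pi (chi t)%:P)); rewrite -rmorphD -wt -e3 add0r.
by rewrite coefX /= => /eqP; rewrite oner_eq0. Qed.

Lemma iint_monic (A B : nzcring) (phi : A ~> B) t : iint phi setT t ->
 exists2 f : {poly A}, f \is monic & evp phi t f = 0.
move=> /(iint_coef (idealT A)) [n [c [_ e]]]. have sz : (size (\poly_(i < n) c i) < size ('X^n : {poly A}))%N.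
 by rewrite size_polyXn ltnS size_poly. exists ('X^n - \poly_(i < n) c i).
 by rewrite monicE lead_coefDl ?size_polyN // lead_coefXn.
rewrite rmorphB rmorphXn (evp_coef phi t (size_poly n c)) (_ : evp phi t 'X = t); last exact: evpX.
by rewrite e -sumrB big1 // => i _; rewrite coef_poly ltn_ord subrr. Qed.

(** Adding to [f] a high power of [X f1], with [f1] monic and zero at [t], makes it monic and
    changes neither its value nor its derivative at [t]. The factor [X] ensures that the degrees of
    the powers grow. *)
Lemma monic_simple_root (A B : nzcring) (phi : A ~> B) (q : set B) t f :
 iint phi setT t -> evp phi t f = 0 -> ~ q (evp phi t f^`()) ->
 exists2 g : {poly A}, g \is monic & evp phi t g = 0 /\ ~ q (evp phi t g^`()).
move=> /iint_monic [f1 m1 e1] f0 nf. pose m := (size f).+1; pose h := ('X * f1) ^+ m.+1.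
have mX : 'X * f1 \is monic by rewrite monicMl ?monicX. have mh : h \is monic by exact: monic_exp.
have h0 : evp phi t h = 0 by rewrite rmorphXn rmorphM e1 mulr0 expr0n. have sz : (size f < size h)%N.
 have nX : size ('X * f1) = (size f1).+1 by rewrite mulrC size_mulX ?monic_neq0.
 have s1 : (0 < size f1)%N by rewrite lt0n size_poly_eq0 monic_neq0.
 rewrite /h; move: mX nX s1; move: ('X * f1) => g mg sg s1.
 have : (forall k, (k < size (g ^+ k))%N); last by move=> /(_ m.+1); rewrite /m; lia.
 elim=> [|k IH]; first by rewrite expr0 size_poly1.
 by rewrite exprS size_monicM ?sg //; [lia|rewrite monic_neq0 // monic_exp].
exists (h + f); first by rewrite monicE lead_coefDl. rewrite rmorphD h0 f0 add0r; split=> //.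
have y0 : evp phi t ('X * f1) = 0 by rewrite rmorphM e1 mulr0.
rewrite derivD rmorphD /h deriv_exp rmorphMn rmorphM rmorphXn y0 expr0n /=. by rewrite mulr0 mul0rn add0r. Qed.

(** Polynomial values from a sequence of coefficients; unlike evaluation of [{poly A}], this makes
    sense for zero rings as well. *)
Definition pv (A S : cring) (u : A -> S) (c : nat -> A) k (x : S) := \sum_(i < k) u (c i) * x ^+ i.

(* [E] is generated by a root [t] of a monic polynomial [g], universal among the roots of [g]
  at which [h] is invertible; [g'(t)] is a unit. *)
Definition std_etale (A E : cring) (phi : A ~> E) : Prop := exists (t : E) n (g : nat -> A) m (h : nat -> A),
 [/\ g n = 1, pv phi g n.+1 t = 0, is_unit (pv phi h m t) /\ is_unit (pv phi (fun i => g i.+1 *+ i.+1) n t),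
   forall e, exists N k c, pv phi h m t ^+ N * e = pv phi c k t & forall (S : cring) (u : A ~> S) (x : S),
    pv u g n.+1 x = 0 -> is_unit (pv u h m x) -> exists w : E ~> S, w \o phi =1 u /\ w t = x].

Lemma evp_pv (A S : nzcring) (u : A ~> S) (P : {poly A}) k x :
 (size P <= k)%N -> evp u x P = pv u (fun i => P`_i) k x.
exact: evp_coef. Qed.

Lemma standard_ring (A : nzcring) (g H : {poly A}) : exists (R : cring) (rho : {poly A} ~> R),
  [/\ rho g = 0, is_unit (rho H), forall r, exists N G, rho H ^+ N * r = rho G &
   forall P, rho P = 0 -> exists N Q, H ^+ N * P = Q * g].
pose I := [set P | exists Q, P = Q * g]. have idI : is_ideal I.
 split=> [|_ _ [Q ->] [Q' ->]|P _ [Q ->]]; first by exists 0; rewrite mul0r. by exists (Q + Q'); rewrite mulrDl.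
 by exists (P * Q); rewrite mulrA. have [Q0 [pi [surj ker]]] := quotient_ring idI.
have [R [l [lu lfrac lker]]] := localization_ring (powers_mult (pi H)). exists R, (l \o pi); split=> /=.
- by rewrite (_ : pi g = 0) ?rmorph0 //; apply/ker; exists 1; rewrite mul1r.
- by apply: lu; exists 1%N.
- move=> r; have [a [s [[N ->] e]]] := lfrac r; have [G eG] := surj a. by exists N, G; rewrite eG -e rmorphXn mulrC.
by move=> P /lker [_ [N ->]]; rewrite -rmorphXn -rmorphM => /ker [Q e]; exists N, Q. Qed.

Section StandardPresentation.
Variables (A E R : nzcring) (phi : A ~> E) (t : E) (g H : {poly A}).
Variables (rho : {poly A} ~> R).
Hypothesis et : formally_etale phi.
Hypothesis gt : evp phi t g = 0.
Hypothesis uH : is_unit (evp phi t H).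
Hypothesis ug : exists D, H = D * g^`().
Hypothesis fracE : forall e, exists N G, evp phi t H ^+ N * e = evp phi t G.
Hypothesis rhog : rho g = 0.
Hypothesis urho : is_unit (rho H).
Hypothesis rhofrac : forall r, exists N G, rho H ^+ N * r = rho G.
Hypothesis rhoker : forall P, rho P = 0 -> exists N Q, H ^+ N * P = Q * g.
Variable psi : R ~> E.
Hypothesis psiE : psi \o rho =1 evp phi t.

Lemma presentation_surj e : exists r, psi r = e.
have [N [G eG]] := fracE e; have [v hv] := urho; exists (v ^+ N * rho G).
have psiP P : psi (rho P) = evp phi t P by exact: psiE. apply: (unit_cancel (is_unitX N uH)).
by rewrite eG -[evp phi t H]psiP -[RHS]psiP -rmorphXn -rmorphM mulrA -exprMn hv expr1n mul1r. Qed.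

Lemma presentation_hom_eq (D : cring) (w w' : R ~> D) : w \o rho =1 w' \o rho -> w =1 w'.
move=> ww r; have [N [G eG]] := rhofrac r. apply: (unit_cancel (unit_morph w (is_unitX N urho))).
rewrite -rmorphM eG (_ : w (rho H ^+ N) = w' (rho H ^+ N)). by rewrite -rmorphM eG; exact: ww.
by rewrite -rmorphXn; exact: ww. Qed.

(** Let [I] be the kernel of [psi]. Formal etaleness lifts the identity of [E] to [R / I^2]. The
    lift of [t] and the class of [X] are roots of [g] with square-zero difference, so Taylor's
    formula and invertibility of [g'] make them equal. Then [R] maps to [R / I^2] through [E], and
    [I] dies there. *)
Lemma presentation_kernel_square r : psi r = 0 ->
 spn (idfun : R ~> R) [set x | psi x = 0] [set x | psi x = 0] r.
pose idR : R ~> R := idfun. pose I := [set x | psi x = 0]; have idI : is_ideal I by exact: kernel_ideal.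
have idI2 : is_ideal (spn idR I I). by split=> [|x y|x y]; [exact: spn0|exact: spnD|exact: (@spnZ R R idR)].
have [Q [pi [surj ker]]] := quotient_ring idI2. have [|nu nuE] := factor_surj surj (f := psi).
 move=> a /ker; elim=> [|x y _ hx _ hy|x y Jx Jy]; first exact: rmorph0. by rewrite rmorphD hx hy addr0.
 by rewrite rmorphM /= Jx mul0r. have nupi x : nu (pi x) = psi x by exact: nuE.
have psiP P : psi (rho P) = evp phi t P by exact: psiE. have sq x y : nu x = 0 -> nu y = 0 -> x * y = 0.
 have [x' <-] := surj x; have [y' <-] := surj y; rewrite !nupi => hx hy.
 by rewrite -rmorphM; apply/ker; exact: (@spnG _ _ idR).
have [e|//|a|w [wphi nuw _]] := et (q := nu) (u := pi \o rho \o polyC) (v := idfun).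
- by have [r' <-] := presentation_surj e; exists (pi r').
- by rewrite /= nupi psiP; exact: evpC. move=> psir; apply/ker.
suff e : w \o psi =1 pi by rewrite -e /= psir rmorph0. apply: presentation_hom_eq.
have sc c : (w \o evp phi t) c%:P = (pi \o rho) c%:P.
 rewrite -[RHS]/((pi \o rho \o polyC) c) -wphi /=; congr (w _); exact: evpC.
have d2 : ((w \o evp phi t) 'X - (pi \o rho) 'X) * ((w \o evp phi t) 'X - (pi \o rho) 'X) = 0.
 have n0 : nu ((w \o evp phi t) 'X - (pi \o rho) 'X) = 0.
  by rewrite rmorphB -[nu (pi _)]/((nu \o pi) _) nuE /= psiP -[nu (w _)]/((nu \o w) _) nuw subrr. exact: sq.
have := poly_taylor g sc d2; rewrite /= rhog rmorph0 add0r -/(evp phi t g).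
rewrite (_ : w (evp phi t g) = 0); last by rewrite gt rmorph0. have ud : is_unit (pi (rho g^`())).
 have [D eD] := ug; have := unit_morph pi urho; rewrite eD mulrC !rmorphM. exact: unit_factor.
move=> e0; have d0 : (w \o evp phi t) 'X = (pi \o rho) 'X.
 by apply/subr0_eq; apply: (unit_cancel ud); rewrite mulr0 -e0.
move=> P; rewrite -[RHS](poly_hom_eq sc d0) /=; congr (w _); exact: psiP. Qed.

(** The finite presentation belongs to [B], of which [E] is a localization. The list [ds] transports
    it: once its members vanish, [E] maps back to the quotient of [R], inversely to [psi]. *)
Lemma presentation_kernel_fg (B : cring) (f : A ~> B) (s tB : B) (l : B ~> E) :
 finitely_presented f -> is_localization s l -> l \o f =1 phi -> l tB = t ->
 exists ds : seq R, (forall d, d \in ds -> psi d = 0) /\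
  forall r, psi r = 0 -> spn (idfun : R ~> R) setT (els ds) r.
move=> [n [P [c [X [q [UP qc qsurj [m [k kP]]]]]]]] loc lf lt.
have psiP G : psi (rho G) = evp phi t G by exact: psiE.
have [xs xsP] := choice (fun i => presentation_surj (l (q (X i)))). have [W [Wc WX _]] := UP R (rho \o polyC) xs.
have psiW : psi \o W =1 l \o q. have [v [_ _ vu]] := UP E phi (l \o q \o X).
 move=> a; rewrite (vu (psi \o W)) ?(vu (l \o q)) // => [b|b|i] /=.
 - by have /= -> := qc b; exact: lf.
 - by have /= -> := Wc b; rewrite psiP; exact: evpC.
 - by have /= -> := WX i. have [sg esg] := qsurj s; have [tau etau] := qsurj tB.
have [us _ _] := loc; have [v hv] := us; have [y ey] := presentation_surj v.
(* Modulo these elements the image of [s] is invertible, [X] is the image of [tB], and the defining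
   relations of [B] hold. *)
pose ds := (W sg * y - 1) :: (rho 'X - W tau) :: codom (W \o k). exists ds; split.
 move=> d; rewrite !inE => /or3P [/eqP ->|/eqP ->|/codomP [j ->]].
 - by rewrite rmorphB rmorphM rmorph1 ey; have /= -> := psiW sg; rewrite esg hv subrr.
 - rewrite rmorphB psiP; have /= -> := psiW tau; rewrite etau lt.
  by apply/eqP; rewrite subr_eq0; apply/eqP; exact: evpX.
 - have /= -> := psiW (k j); rewrite (_ : q (k j) = 0) ?rmorph0 //; apply/kP.
  exists (fun i => (i == j)%:R); rewrite (bigD1 j) //= eqxx mul1r big1 ?addr0 // => i ij.
  by rewrite (negbTE ij) mul0r. pose idR : R ~> R := idfun. have idJ : is_ideal (spn idR setT (els ds)).
 by split=> [|a b|a b]; [exact: spn0|exact: spnD|exact: (@spnZ R R idR _ _ _ _ (idealT R))].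
have [Q [pi [surj ker]]] := quotient_ring idJ. have pids d : d \in ds -> pi d = 0.
 by move=> h; apply/ker; rewrite -[d]mul1r; apply: (@spnG _ _ idR).
have [|beta betaE] := factor_surj qsurj (f := pi \o W). move=> a /kP [k' ->]; rewrite rmorph_sum big1 // => j _ /=.
 rewrite !rmorphM (_ : pi (W (k j)) = 0) ?mulr0 //; apply: pids.
 by rewrite !inE; apply/orP; right; apply/orP; right; apply/codomP; exists j.
have betaq a : beta (q a) = pi (W a) by exact: betaE. have [|gam gamE] := loc_lift loc (f := beta).
 have e0 : pi (W sg * y - 1) = 0 by apply: pids; exact: mem_head.
 by exists (pi y); rewrite -esg betaq -rmorphM; move: e0; rewrite rmorphB rmorph1 => /subr0_eq.
have gl b : gam (l b) = beta b by exact: gamE. have e1 : gam \o psi =1 pi. apply: presentation_hom_eq => G.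
 rewrite -[RHS]/((pi \o rho) G) -(@poly_hom_eq A Q (gam \o evp phi t) (pi \o rho)).
 - by rewrite /=; congr (gam _); exact: psiP.
 - move=> a; rewrite -[LHS]/(gam (evp phi t a%:P)) (_ : evp phi t a%:P = l (f a)).
   by rewrite gl -[f a]qc betaq; congr (pi _); exact: Wc. by rewrite -[RHS]/((l \o f) a) lf; exact: evpC.
 rewrite -[LHS]/(gam (evp phi t 'X)) (_ : evp phi t 'X = l tB); last by rewrite lt; exact: evpX.
 rewrite gl -etau betaq; have : pi (rho 'X - W tau) = 0 by apply: pids; rewrite !inE eqxx orbT.
 by rewrite rmorphB => /subr0_eq. by move=> r r0; apply/ker; rewrite -e1 /= r0 rmorph0. Qed.

(** The kernel of [psi] is finitely generated and equal to its square, so some [1 + c] with [c] in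
    the kernel annihilates it. Inverting [1 + c] turns [R] into [E]; this is achieved by multiplying
    [H] by a numerator [P0] of [1 + c]. *)
Lemma presentation_std (ds : seq R) : g \is monic -> (forall d, d \in ds -> psi d = 0) ->
 (forall r, psi r = 0 -> spn (idfun : R ~> R) setT (els ds) r) -> std_etale phi.
move=> mg ds0 dsP; pose idR : R ~> R := idfun.
pose I := [set x | psi x = 0]; have idI : is_ideal I by exact: kernel_ideal.
have psiP P : psi (rho P) = evp phi t P by exact: psiE. have [|c [Ic hc]] := idempotent_of_square (ds := ds) idI.
 move=> d /ds0 /presentation_kernel_square; elim=> [|u v _ hu _ hv|u v Iu /dsP hv].
 - exact: spn0.
 - exact: spnD. elim: hv => [|v1 v2 _ h1 _ h2|a z _ Dz]; first by rewrite mulr0; exact: spn0.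
  by rewrite mulrDr; exact: spnD. rewrite (_ : _ * _ = (a * u) * z); last by rewrite /=; ring.
 by apply: (@spnG R R idR) => //; case: idI => _ _; exact. have hI r : psi r = 0 -> (1 + c) * r = 0.
 move=> /dsP; elim=> [|u v _ hu _ hv|a v _ /hc h]; first exact: mulr0. by rewrite mulrDr hu hv addr0.
 by rewrite mulrCA h mulr0. have [N0 [P0 eP0]] := rhofrac (1 + c). have EP0 : evp phi t P0 = evp phi t H ^+ N0.
 by rewrite -!psiP -eP0 rmorphM rmorphD rmorph1 Ic addr0 mulr1 rmorphXn. pose h := H * P0.
have eh : evp phi t h = evp phi t H ^+ N0.+1 by rewrite rmorphM EP0 exprS.
have sg1 : size g = (size g).-1.+1 by rewrite prednK // lt0n size_poly_eq0 monic_neq0.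
exists t, (size g).-1, (fun i => g`_i), (size h), (fun i => h`_i); split.
- by rewrite -/(lead_coef g) (monicP mg).
- by rewrite -evp_pv -?sg1.
- rewrite -evp_pv // eh; split; first exact: is_unitX.
 have [D eD] := ug; apply: (@unit_factor _ _ (evp phi t D)).
 rewrite (_ : pv _ _ _ _ = evp phi t g^`()) -?rmorphM 1?mulrC -?eD //.
 rewrite (@evp_pv _ _ phi _ (size g).-1); last by rewrite -ltnS -sg1 lt_size_deriv // monic_neq0.
 by apply: eq_bigr => i _; rewrite coef_deriv.
- move=> e; have [N [G eG]] := fracE e. exists N, (size (H ^+ (N0 * N) * G)), (fun i => (H ^+ (N0 * N) * G)`_i).
 by rewrite -!evp_pv // eh rmorphM rmorphXn -eG -exprM mulSn exprD; ring.
move=> S u x; have [e|nz] := pselect ((1 : S) = 0). have S0 (z : S) : z = 0 by rewrite -[z]mul1r e mul0r.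
 move=> _ _; have [|||w _] := @rmorph_make E S (fun=> 0).
 - by move=> a b; rewrite addr0.
 - by move=> a b; rewrite mulr0.
 - by rewrite e. by exists w; split=> [a|]; rewrite [LHS]S0 [RHS]S0. have [S' eS] := comNzRing_of nz; subst S.
rewrite -evp_pv -?sg1 // => gx; rewrite -evp_pv // => hx.
have [|||w wE] := @fraction_lift {poly A} E S' (evp phi t) (evp u x) [set P | exists N, P = H ^+ N].
- move=> _ [N ->]; rewrite rmorphXn; apply: is_unitX. by move: hx; rewrite rmorphM; exact: unit_factor.
- move=> b; have [N [G e]] := fracE b; exists (H ^+ N), G; split; first by exists N. by rewrite rmorphXn.
- move=> P P0'; have /hI h0 : psi (rho P) = 0 by rewrite psiP. have /rhoker [N [Q eQ]] : rho (P0 * P) = 0.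
  by rewrite rmorphM -eP0 -mulrA h0 mulr0. apply: (@unit_cancel _ (evp u x (H ^+ N * P0))).
  move: hx; rewrite !rmorphM !rmorphXn => /[dup] /unit_factor uHx.
  rewrite mulrC => /unit_factor uP0; apply: is_unitM => //; exact: is_unitX.
 by rewrite mulr0 -rmorphM -mulrA eQ rmorphM gx mulr0. exists w; split=> [a|].
 rewrite /= -(evpC phi t a); have /= -> := wE a%:P; exact: evpC.
by rewrite -{1}(evpX phi t); have /= -> := wE 'X; exact: evpX. Qed.
End StandardPresentation.

(** The element [s] is the value at [t] of [H g']: inverting [H] makes everything a fraction in [t],
    inverting [g'] makes the root simple. *)
Theorem etale_locally_standard (A B : cring) (phi : A ~> B) (q : set B) :
 etale_ring_hom phi -> is_prime_ideal q -> exists s, ~ q s /\ forall (E : cring) (l : B ~> E),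
  is_localization s l -> std_etale (l \o phi).
move=> et pq; have Bnz : (1 : B) <> 0 by move=> e; case: pq => q0 _ _ q1 _; apply: q1; rewrite e.
have Anz : (1 : A) <> 0 by move=> e; apply: Bnz; rewrite -(rmorph1 phi) e rmorph0.
have [A' eA] := comNzRing_of Anz; subst A; have [B' eB] := comNzRing_of Bnz; subst B.
have [t [H [int nH frac]]] := etale_monogenic et pq. have [f [f0 nf]] := unramified_simple_root et.1 pq nH frac.
have [g mg [g0 ng]] := monic_simple_root int f0 nf. pose H1 := H * g^`(); exists (evp phi t H1); split.
 by rewrite rmorphM; apply: (primeM pq). move=> E l loc; have Enz : (1 : E) <> 0.
 case: (loc) => _ _ ker; rewrite -(rmorph1 l) => /ker [n]; rewrite mulr1 => e.
 case: (pq) => q0 _ _ _ _; move: q0; rewrite -e => /(primeX pq). by rewrite rmorphM; apply: (primeM pq).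
have [E' eE] := comNzRing_of Enz; subst E. have lev P : l (evp phi t P) = evp (l \o phi) (l t) P by exact: evp_map.
have [us lfrac lker] := loc. have fracE e : exists N G, evp (l \o phi) (l t) H1 ^+ N * e = evp (l \o phi) (l t) G.
 have [n [b eb]] := lfrac e; have [N [G eG]] := frac b. exists (n + N)%N, (g^`() ^+ N * G); rewrite -!lev.
 rewrite exprD -mulrA mulrCA mulrA (_ : _ * e = e * l (evp phi t H1) ^+ n * l (evp phi t H1) ^+ N).
  rewrite eb -rmorphXn -rmorphM; congr (l _); rewrite !rmorphM rmorphXn -eG exprMn. by ring. by ring.
have [R [rho [rhog urho rhofrac rhoker]]] := standard_ring g H1.
have rho_ker P : rho P = 0 -> evp (l \o phi) (l t) P = 0.
 move=> /rhoker [N [Q e]]; apply: (unit_cancel (is_unitX N (unit_morph idfun us))).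
 by rewrite /= mulr0 lev -rmorphXn -rmorphM e rmorphM -[X in _ * X]lev g0 rmorph0 mulr0.
have [|||psi psiE] := @fraction_lift {poly A'} R E' rho (evp (l \o phi) (l t)) [set P | exists N, P = H1 ^+ N].
- by move=> _ [N ->]; rewrite rmorphXn -lev; exact: is_unitX.
- move=> b; have [N [G e]] := rhofrac b; exists (H1 ^+ N), G; split; first by exists N. by rewrite rmorphXn.
- exact: rho_ker. have Rnz : (1 : R) <> 0.
 by move=> /(congr1 psi); rewrite rmorph1 rmorph0 => /eqP; rewrite oner_eq0.
have [R' eR] := comNzRing_of Rnz; subst R. have etE := formally_etale_loc et.1 loc.
have gt : evp (l \o phi) (l t) g = 0 by rewrite -lev g0 rmorph0.
have uH : is_unit (evp (l \o phi) (l t) H1) by rewrite -lev. have ug : exists D, H1 = D * g^`() by exists H.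
have [ds [ds0 dsP]] := presentation_kernel_fg uH fracE urho rhofrac psiE et.2 loc (fun=> erefl) erefl.
exact: (presentation_std etE gt uH ug fracE rhog urho rhofrac rhoker psiE mg ds0 dsP). Qed.

(** * Rings of functions *)

(** Functions on [U] are total functions that vanish outside [U], so their type does not depend on
    [U] and equality is pointwise. The unit is accordingly the indicator of [U]. *)
Record function_class (X : Type) (K : X -> cring) (U : set X) := FunctionClass {
 fclass :> set (forall x, K x);
 fclass1 : fclass (fun x => if `[< U x >] then 1 else 0);
 fclassB : forall f g, fclass f -> fclass g -> fclass (fun x => f x - g x);
 fclassM : forall f g, fclass f -> fclass g -> fclass (fun x => f x * g x);
 fclass_supp : forall f x, fclass f -> ~ U x -> f x = 0 }.

Module FunctionRings.
Section FunctionRing.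
Variables (X : Type) (K : X -> cring) (U : set X) (G : function_class K U).

Definition fring := {f : forall x, K x | fclass G f}.
#[export] HB.instance Definition _ := gen_eqMixin fring.
#[export] HB.instance Definition _ := gen_choiceMixin fring.

Lemma fring_eq (f g : fring) : (forall x, sval f x = sval g x) -> f = g.
case: f g => [f Gf] [g Gg] /= fg; have e : f = g by apply: functional_extensionality_dep.
by subst g; congr exist; exact: Prop_irrelevance. Qed.

Let G0 : fclass G (fun=> 0).
rewrite (_ : (fun=> 0) = fun x => (if `[< U x >] then 1 else 0) - (if `[< U x >] then 1 else 0) : K x).
 by apply: fclassB; exact: fclass1. by apply: functional_extensionality_dep => x; rewrite subrr. Qed.
Let GN f : fclass G f -> fclass G (fun x => - f x).
move=> Gf; rewrite (_ : (fun x => - f x) = fun x => 0 - f x); first exact: fclassB.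
by apply: functional_extensionality_dep => x; rewrite sub0r. Qed.
Let GD f g : fclass G f -> fclass G g -> fclass G (fun x => f x + g x).
move=> Gf Gg; rewrite (_ : (fun x => f x + g x) = fun x => f x - - g x). by apply: fclassB => //; exact: GN.
by apply: functional_extensionality_dep => x; rewrite opprK. Qed.

Let add (f g : fring) : fring := exist _ _ (GD (svalP f) (svalP g)).
Let opp (f : fring) : fring := exist _ _ (GN (svalP f)).
Let mul (f g : fring) : fring := exist _ _ (fclassM (svalP f) (svalP g)).
Let zero : fring := exist _ _ G0.
Let one : fring := exist _ _ (fclass1 G).

Let fringA : associative add. by move=> f g h; apply: fring_eq => x /=; rewrite addrA. Qed.
Let fringC : commutative add. by move=> f g; apply: fring_eq => x /=; rewrite addrC. Qed.
Let fring0 : left_id zero add. by move=> f; apply: fring_eq => x /=; rewrite add0r. Qed.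
Let fringN : left_inverse zero opp add.
by move=> f; apply: fring_eq => x /=; rewrite addNr. Qed.
Let fringMA : associative mul. by move=> f g h; apply: fring_eq => x /=; rewrite mulrA. Qed.
Let fringMC : commutative mul. by move=> f g; apply: fring_eq => x /=; rewrite mulrC. Qed.
Let fring1 : left_id one mul.
move=> f; apply: fring_eq => x /=; case: asboolP => Ux; first by rewrite mul1r.
by rewrite mul0r (fclass_supp (svalP f) Ux). Qed.
Let fringMD : left_distributive mul add.
by move=> f g h; apply: fring_eq => x /=; rewrite mulrDl. Qed.

#[export] HB.instance Definition _ := GRing.isZmodule.Build fring fringA fringC fring0 fringN.
#[export] HB.instance Definition _ := GRing.Zmodule_isComPzRing.Build fring fringMA fringMC fring1 fringMD.

Lemma fringD (f g : fring) x : sval (f + g) x = sval f x + sval g x. by []. Qed.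
Lemma fringM (f g : fring) x : sval (f * g) x = sval f x * sval g x. by []. Qed.
Lemma fring_one x : sval (1 : fring) x = if `[< U x >] then 1 else 0. by []. Qed.
Lemma fring_oneE x : U x -> sval (1 : fring) x = 1.
by rewrite fring_one => Ux; case: asboolP. Qed.

Lemma fring_eval x : U x -> exists pr : fring ~> K x, forall f, pr f = sval f x.
move=> Ux; have [//|//||pr prE] := @rmorph_make fring (K x) (fun f => sval f x). exact: fring_oneE. by exists pr.
Qed.

Lemma fring_hom (R : pzRingType) (F : R -> forall x, K x) :
 (forall r, fclass G (F r)) -> (forall a b x, F (a + b) x = F a x + F b x) ->
 (forall a b x, F (a * b) x = F a x * F b x) -> (forall x, U x -> F 1 x = 1) ->
 exists f : R ~> fring, forall r, sval (f r) = F r.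
move=> FG FD FM F1. have [|||f fE] := @rmorph_make R fring (fun r => exist _ (F r) (FG r)).
- by move=> a b; apply: fring_eq => x /=; exact: FD.
- by move=> a b; apply: fring_eq => x /=; exact: FM.
- apply: fring_eq => x /=; case: asboolP => Ux; first exact: F1. exact: (fclass_supp (FG 1)).
by exists f => r; rewrite fE. Qed.
End FunctionRing.
End FunctionRings.
Export FunctionRings.

Definition all_functions (X : Type) (K : X -> cring) : function_class K setT.
by exists setT => // f x _; case. Defined.

(** * Radicial integral extensions of standard etale algebras *)

(** Injectivity on field-valued points, that is, [eta] is radicial. *)
Definition field_unique (E B : cring) (eta : E ~> B) : Prop :=
 forall (F : fieldType) (u v : B ~> F), u \o eta =1 v \o eta -> u =1 v.

Definition spec_surj (E B : cring) (eta : E ~> B) : Prop :=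
 forall P, is_prime_ideal P -> exists Q, is_prime_ideal Q /\ eta @^-1` Q = P.

Lemma field_point_lift (E B : cring) (eta : E ~> B) (F : fieldType) (e : E ~> F) : spec_surj eta ->
 exists (W : fieldType) (j : F ~> W) (w : B ~> W), w \o eta =1 j \o e.
move=> surj; have [Q [pQ eQ]] := surj _ (kernel_prime e). have [k [chi [chiker _]]] := residue_field pQ.
have [|W [u [v uv]]] := @point_compositum E E B F k idfun eta e chi. move=> a; rewrite chiker /=.
 by rewrite -[X in X <-> _]/([set a | e a = 0] a) -eQ. by exists W, u, (v \o chi) => a; rewrite /= -uv. Qed.

Section RadicialOverStandard.
Variables (C E B : nzcring) (phi : C ~> E) (t : E) (g h : {poly C}).
Variable eta : E ~> B.
Hypothesis gm : g \is monic.
Hypothesis gt : evp phi t g = 0.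
Hypothesis uh : is_unit (evp phi t h).
Hypothesis ug : is_unit (evp phi t g^`()).
Hypothesis frac : forall e, exists N P, evp phi t h ^+ N * e = evp phi t P.
Hypothesis univ : forall (S : nzcring) (u : C ~> S) (x : S),
 evp u x g = 0 -> is_unit (evp u x h) -> exists w : E ~> S, w \o phi =1 u /\ w t = x.
Hypothesis int : forall b, iint eta setT b.
Hypothesis surj : spec_surj eta.
Hypothesis uniq : field_unique eta.
Hypothesis red : reduced_ring B.
Variable a : B.

Let n := (size g).-1.
Let hE : E := evp phi t h.

Lemma standard_hom_eq (S : cring) (u v : E ~> S) : u \o phi =1 v \o phi -> u t = v t -> u =1 v.
move=> uv ut; have ev P : u (evp phi t P) = v (evp phi t P).
 apply: (poly_hom_eq (s1 := u \o evp phi t) (s2 := v \o evp phi t)) => [c|] /=.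
  have -> : horner_eval t (map_poly phi c%:P) = phi c by exact: evpC. exact: uv.
 by have -> : horner_eval t (map_poly phi 'X) = t by exact: evpX. move=> e; have [N [P eP]] := frac e.
have uN : is_unit (u (evp phi t h ^+ N)) by apply: unit_morph; exact: is_unitX. apply: (unit_cancel uN).
have e1 : u (evp phi t h ^+ N * e) = v (evp phi t h ^+ N * e) by rewrite eP.
move: e1; rewrite !rmorphM => ->; congr (_ * _). by rewrite !rmorphXn; congr (_ ^+ _); symmetry; exact: ev. Qed.

(** A field over the residue field at [P] in which [g] splits and in which every root with [h]
    nonzero carries a point of [B]. [rf_val i b] is the value of [b] at the point of the root [i],
    with default 0 where [h] vanishes. *)
Record root_field (P : set C) := RootField {
 rf_field : fieldType;
 rf_ev : C ~> rf_field;
 rf_ker : forall c, rf_ev c = 0 <-> P c;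
 rf_root : 'I_n -> rf_field;
 rf_split : map_poly rf_ev g = \prod_i ('X - (rf_root i)%:P);
 rf_val : 'I_n -> B -> rf_field;
 rf_val0 : forall i, evp rf_ev (rf_root i) h = 0 -> forall b, rf_val i b = 0;
 rf_valP : forall i, evp rf_ev (rf_root i) h <> 0 -> exists w : B ~> rf_field,
  [/\ w =1 rf_val i, w \o eta \o phi =1 rf_ev & w (eta t) = rf_root i] }.

(** Starting from a splitting field of [g], the roots are treated one at a time: a root with [h]
    nonzero gives a point of [E], which lifts to [B] after a further extension. *)
Lemma root_field_exists (P : set C) : is_prime_ideal P -> exists r : root_field P, True.
move=> pP; have [k [chi [chiker _]]] := residue_field pP. have gk : map_poly chi g \is monic by exact: monic_map.
have [K [iota [rs rsE]]] := splitting_field (monic_neq0 gk).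
have rsE' : map_poly (iota \o chi) g = \prod_(r <- rs) ('X - r%:P).
 by rewrite map_poly_comp rsE (monicP gk) rmorph1 scale1r. have srs : size rs = n.
 have := congr1 (fun p : {poly K} => (size p).-1) rsE'; rewrite size_prod_XsubC /= => <-.
 by rewrite size_map_poly_id0 // (monicP gm) rmorph1 oner_neq0.
have [W [j hj]] : exists (W : fieldType) (j : K ~> W), forall r, r \in rs ->
  evp (iota \o chi) r h <> 0 -> exists w : B ~> W, w \o eta \o phi =1 j \o iota \o chi /\ w (eta t) = j r.
 have : {subset rs <= rs} by []. elim: {1 3}rs => [_|r s IH sub]; first by exists K, idfun.
 have [x xs|W [j hj]] := IH; first by apply: sub; rewrite inE xs orbT.
 have [z0|nz] := pselect (evp (iota \o chi) r h = 0). by exists W, j => x; rewrite inE => /orP [/eqP -> //|/hj].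
 have [||e [ephi et]] := @univ K (iota \o chi) r.
 - rewrite evpE rsE'; apply/eqP; rewrite -rootE root_prod_XsubC; apply: sub; exact: mem_head.
 - by exists (evp (iota \o chi) r h)^-1; rewrite mulfV //; exact/eqP.
 have [W' [j' [w hw]]] := field_point_lift (j \o e) surj.
 exists W', (j' \o j) => x; rewrite inE => /orP [/eqP ->|xs] nx; last first.
  have [w0 [w0phi w0t]] := hj x xs nx; exists (j' \o w0); split=> [c|] /=.
   by rewrite -[w0 _]/((w0 \o eta \o phi) c) w0phi. by rewrite w0t. exists w; split=> [c|].
  by rewrite /= -[w _]/((w \o eta) (phi c)) hw /= -[e _]/((e \o phi) c) ephi.
 by rewrite -[w _]/((w \o eta) t) hw /= et. pose ev : C ~> W := j \o iota \o chi.
pose tau (i : 'I_n) : W := j rs`_i. have evh (i : 'I_n) : evp ev (tau i) h = j (evp (iota \o chi) rs`_i h).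
 by symmetry; apply: evp_map. have ex (i : 'I_n) : exists v : B -> W, (evp ev (tau i) h = 0 -> forall b, v b = 0) /\
  (evp ev (tau i) h <> 0 -> exists w : B ~> W, [/\ w =1 v, w \o eta \o phi =1 ev & w (eta t) = tau i]).
 have [z0|nz] := pselect (evp ev (tau i) h = 0); first by exists (fun=> 0).
 have nz' : evp (iota \o chi) rs`_i h <> 0 by move=> z0; apply: nz; rewrite evh z0 rmorph0.
 have irs : rs`_i \in rs by apply: mem_nth; rewrite srs.
 by have [w [h1 h2]] := hj _ irs nz'; exists w; split=> // _; exists w. have [v hv] := choice ex.
unshelve eexists (@RootField P W ev _ tau _ v _ _) => //.
- move=> c; rewrite -chiker /ev /=; split=> [/eqP|->]; last by rewrite !rmorph0. by rewrite !fmorph_eq0 => /eqP.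
- have -> : map_poly ev g = map_poly j (map_poly (iota \o chi) g) by rewrite -map_poly_comp.
 rewrite rsE' map_prod_XsubC. by rewrite (big_nth 0) big_mkord srs.
- by move=> i; case: (hv i).
- by move=> i; case: (hv i). Qed.

Section Descent.
Variables (I : Type) (Pt : I -> set C) (rf : forall x, root_field (Pt x)).
Hypothesis allP : forall P, is_prime_ideal P -> exists x, Pt x = P.

Let Om x : cring := rf_field (rf x).
Let Pi := fring (all_functions Om).

Lemma rf_val_cases x i : (forall b, rf_val (rf x) i b = 0) \/
 exists w : B ~> rf_field (rf x), [/\ w =1 rf_val (rf x) i,
  w \o eta \o phi =1 rf_ev (rf x) & w (eta t) = rf_root (rf x) i].
have [z|nz] := pselect (evp (rf_ev (rf x)) (rf_root (rf x) i) h = 0). by left; exact: rf_val0.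
by right; exact: rf_valP. Qed.

Lemma hom_evp (W : nzcring) (w : B ~> W) (u : C ~> W) y P :
 w \o eta \o phi =1 u -> w (eta t) = y -> w (eta (evp phi t P)) = evp u y P.
move=> wu wt; rewrite -[LHS]/((w \o eta) (evp phi t P)).
by rewrite -wt; exact: (@evp_map _ _ _ phi (w \o eta) u P t). Qed.

Let betaf i b : Pi := exist _ (fun x => rf_val (rf x) i b) Logic.I.
Let tauf i : Pi := exist _ (fun x => rf_root (rf x) i) Logic.I.

Let betafD i b b' : betaf i (b + b') = betaf i b + betaf i b'.
apply: fring_eq => x; rewrite fringD /=; have [z|[w [wE _ _]]] := rf_val_cases x i. by rewrite !z addr0.
by rewrite -!wE rmorphD. Qed.
Let betafM i b b' : betaf i (b * b') = betaf i b * betaf i b'.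
apply: fring_eq => x; rewrite fringM /=; have [z|[w [wE _ _]]] := rf_val_cases x i. by rewrite !z mulr0.
by rewrite -!wE rmorphM. Qed.
Let betaf0 i : betaf i 0 = 0.
by apply: (addrI (betaf i 0)); rewrite -betafD !addr0. Qed.
Let betafS i (T : Type) (r : seq T) (F : T -> B) : betaf i (\sum_(j <- r) F j) = \sum_(j <- r) betaf i (F j).
by apply: big_morph; [exact: betafD|exact: betaf0]. Qed.

(** [D] is the integral closure of [C] in the product of the chosen fields, and the [d k] are the
    coefficients of the interpolation polynomial of [a], multiplied by [h^(N0+1)], at the roots of
    [g]. They are symmetric in the roots, hence have equal values at two field points of [D] over
    the same point of [C]. If they come from [C], evaluating at [t] recovers [a], up to a unit. *)
Lemma standard_descent : exists (D : nzcring) (lam : C ~> D)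
  (pr : forall x, D ~> rf_field (rf x)) (d : nat -> D),
 [/\ forall z, iint lam setT z, forall x c, pr x (lam c) = rf_ev (rf x) c,
   forall k (F : fieldType) (u v : D ~> F), u \o lam =1 v \o lam -> u (d k) = v (d k)
  & forall gam : nat -> C, (forall k x, rf_ev (rf x) (gam k) = pr x (d k)) -> exists e, eta e = a].
have [|||x _|evPi evPiE] := @fring_hom I Om setT (all_functions Om) C (fun c x => rf_ev (rf x) c).
- by [].
- by move=> c c' x; rewrite rmorphD.
- by move=> c c' x; rewrite rmorphM.
- by rewrite rmorph1. have evE c x : sval (evPi c) x = rf_ev (rf x) c by rewrite evPiE.
have [D [iD [iDi iDE]]] := subring_type (iint_sring evPi). have Dnz : (1 : D) <> 0.
 move=> e; have [P pP] := @prime_exists C (elimN eqP (oner_neq0 C)).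
 have [x _] := allP pP; have [prx prxE] := fring_eval (all_functions Om) (x := x) Logic.I.
 have := congr1 (fun z => prx (iD z)) e; rewrite !rmorph1 !rmorph0 => /eqP. by rewrite oner_eq0.
have [D' eD] := comNzRing_of Dnz; subst D; rename D' into D.
have [c|lam lamE] := @factor_inj C D Pi evPi iD iDi; first by apply/iDE; exact: iint_img.
have ilam c : iD (lam c) = evPi c by exact: lamE. have intD z : iint lam setT z.
 have hz : iint evPi setT (iD z) by apply/iDE; exists z.
 by apply: (iint_inj (idealT C) iDi); apply: iint_eq_hom hz => c; rewrite /= ilam.
have exq x : exists q : D ~> rf_field (rf x), forall z, q z = sval (iD z) x.
 have [prx prxE] := fring_eval (all_functions Om) (x := x) Logic.I. by exists (prx \o iD) => z /=; rewrite prxE.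
pose pr x := sval (cid (exq x)); have prE x z : pr x z = sval (iD z) x by exact: (svalP (cid (exq x))).
have prlam x c : pr x (lam c) = rf_ev (rf x) c by rewrite prE ilam evE.
have Deq z z' : (forall x, pr x z = pr x z') -> z = z'.
 by move=> e; apply: iDi; apply: fring_eq => x; have := e x; rewrite !prE.
have int_sum (J : finType) (Fn : J -> Pi) : (forall j, iint evPi setT (Fn j)) -> iint evPi setT (\sum_j Fn j).
 move=> hF; apply: (big_ind (iint evPi setT)) => //; first exact: (subring0 (iint_sring evPi)).
 by move=> u v; exact: (subringD (iint_sring evPi)).
have int_mul u v : iint evPi setT u -> iint evPi setT v -> iint evPi setT (u * v).
 by case: (iint_sring evPi) => _ _ hM hu hv; exact: hM. have int_tau i : iint evPi setT (tauf i).
 have rt x : evp (rf_ev (rf x)) (rf_root (rf x) i) g = 0.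
  rewrite evpE rf_split horner_prod (bigD1 i) //= hornerXsubC subrr mul0r. by [].
 have sg : size g = n.+1 by rewrite /n prednK // lt0n size_poly_eq0 monic_neq0.
 apply: (@iint_root_integral _ _ evPi n (fun j => evPi (- g`_j))). by move=> j _; exact: iint_img.
 have vX (z : Pi) j x : sval (z ^+ j) x = sval z x ^+ j.
  by elim: j => [|j IH]; [rewrite !expr0 fring_oneE|rewrite !exprS fringM IH].
 have vS (Fn : 'I_n -> Pi) x : sval (\sum_j Fn j) x = \sum_j (sval (Fn j) x : Om x).
  by apply: (big_morph (fun z : Pi => sval z x : Om x)). apply: fring_eq => x; rewrite vS vX.
 under eq_bigr => j _ do rewrite fringM vX evE.
 have := rt x; rewrite (@evp_coef _ _ _ _ g n.+1) ?sg // big_ord_recr /=.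
 rewrite (_ : g`_n = 1) ?rmorph1 ?mul1r; last by rewrite /n -/(lead_coef g) (monicP gm).
 move=> /eqP; rewrite addrC addr_eq0 => /eqP ->; rewrite -sumrN; apply: eq_bigr => j _. by rewrite rmorphN mulNr.
have int_e i : iint evPi setT (betaf i 1).
 apply: (@iint_root_integral _ _ evPi 2 (fun j => if j == 1%N then 1 else 0)).
  move=> [|[|j]] // _; first exact: (subring0 (iint_sring evPi)). by case: (iint_sring evPi).
 by rewrite !big_ord_recl big_ord0 /= mul0r mul1r add0r addr0 expr1 expr2 -betafM mulr1.
have beta_poly i P : betaf i (eta (evp phi t P)) = betaf i 1 * \sum_(j < size P) evPi P`_j * tauf i ^+ j.
 have vX (z : Pi) j x : sval (z ^+ j) x = sval z x ^+ j.
  by elim: j => [|j IH]; [rewrite !expr0 fring_oneE|rewrite !exprS fringM IH].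
 apply: fring_eq => x; rewrite fringM /=; have [z|[w [wE wphi wt]]] := rf_val_cases x i. by rewrite !z mul0r.
 rewrite -!wE rmorph1 mul1r (hom_evp P wphi wt) (evp_coef _ _ (leqnn _)).
 rewrite (big_morph (fun z : Pi => sval z x : Om x) (id1 := 0) (op1 := +%R)) //.
 by apply: eq_bigr => j _; rewrite fringM vX evE. have int_poly i P : iint evPi setT (betaf i (eta (evp phi t P))).
 rewrite beta_poly; apply: (int_mul) => //; apply: int_sum => j; apply: (int_mul). exact: iint_img.
 elim: (nat_of_ord j) => [|l IH]; first by rewrite expr0; case: (iint_sring evPi).
 by rewrite exprS; exact: int_mul.
(* The coefficients of an integral equation of [b] over [E] are polynomials in [t] divided by powers
   of [h]. Scaling [b] by a power of [h] clears them, and values of polynomials in [t] are integral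
   over [C]. *)
have conduct b : exists N, forall i, iint evPi setT (betaf i (eta (hE ^+ N) * b)).
 have [m [c [_ eb]]] := iint_coef (idealT E) (int b).
 have [N hN] : exists N, forall j, (j < m)%N -> exists P, hE ^+ N * c j = evp phi t P.
  elim: m {eb} => [|m [N hN]]; first by exists 0%N. have [M [P eP]] := frac (c m); exists (N + M)%N => j.
  rewrite ltnS leq_eqVlt => /orP [/eqP ->|/hN [Q eQ]].
   by exists (h ^+ N * P); rewrite rmorphM rmorphXn -eP exprD mulrA.
  by exists (h ^+ M * Q); rewrite rmorphM rmorphXn -eQ exprD -/hE; ring. exists N => i; set al := eta (hE ^+ N) * b.
 have m0 : (0 < m)%N. case: m eb {hN} => // /eqP; rewrite big_ord0 expr0 oner_eq0; by [].
 have bX x j : betaf i (x * al ^+ j) = betaf i x * betaf i al ^+ j.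
  elim: j => [|j IH]; first by rewrite !expr0 !mulr1. by rewrite 2!exprSr mulrA betafM IH -mulrA.
 have eal : al ^+ m = \sum_(j < m) eta (hE ^+ (N * (m - j)) * c j) * al ^+ j.
  rewrite /al exprMn eb mulr_sumr; apply: eq_bigr => j _. rewrite exprMn rmorphM -!rmorphXn -!exprM.
  have -> : (N * m = N * (m - j) + N * j)%N by rewrite -mulnDr subnK // ltnW. by rewrite exprD rmorphM; ring.
 apply: (@iint_root_integral _ _ evPi m (fun j => betaf i (eta (hE ^+ (N * (m - j)) * c j)))).
  move=> j lj; have [P eP] := hN j lj. have -> : hE ^+ (N * (m - j)) * c j = evp phi t (h ^+ (N * (m - j.+1)) * P).
   rewrite rmorphM rmorphXn -eP mulrA -exprD -mulnSr; congr (_ ^+ _ * _). by rewrite subnSK. exact: int_poly.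
 have e1 : betaf i (al ^+ m) = betaf i al ^+ m. by rewrite -(prednK m0) !exprS bX.
 by rewrite -e1 eal betafS; apply: eq_bigr => j _; rewrite bX. have [N0 hN0] := conduct a.
pose al0 := eta (hE ^+ N0) * a. have lift_tau i : exists z, iD z = tauf i by apply/iDE.
have [dtau dtauE] := choice lift_tau. have lift_del i : exists z, iD z = betaf i al0 by apply/iDE; exact: hN0.
have [del0 del0E] := choice lift_del. have lift_e i : exists z, iD z = betaf i 1 by apply/iDE.
have [de deE] := choice lift_e. have dh i : exists P : D, P = evp lam (dtau i) h by eexists.
(* The extra factor makes [del i] vanish at the points of [D] where [h] vanishes at the root, since
   there [del0 i] is not controlled by a point of [B]. *)
pose del i := evp lam (dtau i) h * del0 i. have pr_tau x i : pr x (dtau i) = rf_root (rf x) i by rewrite prE dtauE.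
have pr_evp x i P : pr x (evp lam (dtau i) P) = evp (rf_ev (rf x)) (rf_root (rf x) i) P.
 by rewrite -pr_tau; apply: evp_map => c /=; exact: prlam.
have beta_evp i P z : iD z = betaf i (eta (evp phi t P)) -> z = de i * evp lam (dtau i) P.
 move=> ez; apply: Deq => x; rewrite rmorphM pr_evp !prE ez deE /=.
 have [v0|[w [wE wphi wt]]] := rf_val_cases x i; first by rewrite !v0 mul0r.
 by rewrite -!wE rmorph1 mul1r; exact: hom_evp. have he i : evp lam (dtau i) h * de i = evp lam (dtau i) h.
 apply: Deq => x; rewrite rmorphM pr_evp [pr x (de i)]prE deE -[sval _ x]/(rf_val (rf x) i 1).
 have [z0|nz] := pselect (evp (rf_ev (rf x)) (rf_root (rf x) i) h = 0); first by rewrite z0 mul0r.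
 by have [w [wE _ _]] := rf_valP nz; rewrite -wE rmorph1 mulr1.
(* a point of D at which h(tau_i) does not vanish induces a point of B *)
have lift_pt (F : fieldType) (u : D ~> F) i : u (evp lam (dtau i) h) <> 0 ->
  exists w : B ~> F, [/\ w \o eta \o phi =1 u \o lam, w (eta t) = u (dtau i) & w al0 = u (del0 i)].
 move=> nz; have ue : u (de i) = 1. by apply: (mulfI (introN eqP nz)); rewrite -rmorphM he mulr1.
 (* On [B0] the value maps land in [D], so [u] gives a map from [B0]. It extends to [B], because
    powers of [h] bring every element into [B0] and [h] is invertible at this root. *)
 pose B0 := [set b | iint evPi setT (betaf i b)]. have sB0 : is_subring B0.
  split=> [|b b' hb hb'|b b' hb hb']; rewrite /B0 /=; first exact: int_e.
   have -> : betaf i (b - b') = betaf i b - betaf i b'.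
    have := betafD i (b - b') b'; rewrite subrK => ->; by rewrite addrK.
   by case: (iint_sring evPi) => _ h1 _; exact: h1. by rewrite betafM; exact: int_mul.
 have [R [i0 [i0i i0E]]] := subring_type sB0.
 have lift_b r : exists z, iD z = betaf i (i0 r) by apply/iDE; apply/(i0E _).2; exists r.
 have [db dbE] := choice lift_b. have [|||f fE] := @rmorph_make R F (fun r => u (db r)).
 - move=> r r'; rewrite -rmorphD; congr (u _); apply: iDi. by rewrite rmorphD !dbE rmorphD betafD.
 - move=> r r'; rewrite -rmorphM; congr (u _); apply: iDi. by rewrite rmorphM !dbE rmorphM betafM.
 - rewrite (_ : db 1 = de i) ?ue //; apply: iDi. by rewrite dbE deE rmorph1.
 have fb r P : i0 r = eta (evp phi t P) -> f r = u (evp lam (dtau i) P).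
  move=> er; rewrite fE; have -> : db r = de i * evp lam (dtau i) P. by apply: beta_evp; rewrite dbE er.
  by rewrite rmorphM ue mul1r. have [|||w wE] := @fraction_lift R B F i0 f [set r | exists M, i0 r = eta (hE ^+ M)].
 - move=> r /= [M er]; have -> : f r = u (evp lam (dtau i) h) ^+ M.
   by rewrite (@fb r (h ^+ M)) ?rmorphXn // er rmorphXn.
  by apply: is_unitX; exists (u (evp lam (dtau i) h))^-1; rewrite mulfV //; exact/eqP.
 - move=> b; have [M hM] := conduct b. have /i0E [r er] : B0 (eta (hE ^+ M)).
   by rewrite /B0 /= -rmorphXn; exact: int_poly. have /i0E [r' er'] : B0 (eta (hE ^+ M) * b) by exact: hM.
  by exists r, r'; split; [exists M|rewrite er er'].
 - by move=> r; rewrite -(rmorph0 i0) => /i0i ->; rewrite rmorph0. have wr r : w (i0 r) = f r by exact: wE.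
 have wP P : w (eta (evp phi t P)) = u (evp lam (dtau i) P).
  have /i0E [r er] : B0 (eta (evp phi t P)) by exact: int_poly. by rewrite -er wr; exact: fb.
 exists w; split=> [c||].
 - have e1 : evp phi t c%:P = phi c by exact: evpC. by rewrite /= -e1 wP; congr (u _); exact: evpC.
 - have e1 : evp phi t 'X = t by exact: evpX. by rewrite -[in LHS]e1 wP; congr (u _); exact: evpX.
 have /i0E [r er] : B0 al0 by exact: hN0. by rewrite -er wr fE; congr (u _); apply: iDi; rewrite dbE er del0E.
have prodD : \prod_i ('X - (dtau i)%:P) = map_poly lam g. apply/polyP => k; apply: Deq => x.
 have e1 : \prod_i ('X - (pr x (dtau i))%:P) = map_poly (rf_ev (rf x)) g.
  by rewrite rf_split; apply: eq_bigr => i _; rewrite pr_tau.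
 have e2 : map_poly (pr x) (map_poly lam g) = map_poly (rf_ev (rf x)) g.
  by rewrite -map_poly_comp; apply: eq_map_poly => c /=; exact: prlam.
 have := congr1 (fun p : {poly rf_field (rf x)} => p`_k) (etrans e1 (esym e2)).
 (* The interpolation numerator: at the root [dtau i] only the summand of index [i] survives, and
    its product is [g'] there. *)
 by rewrite -map_prod_XsubC !(coef_map (pr x)). pose S := \sum_i (del i)%:P * \prod_(j | j != i) ('X - (dtau j)%:P).
have mapS (F : fieldType) (u : D ~> F) :
  map_poly u S = \sum_i (u (del i))%:P * \prod_(j | j != i) ('X - (u (dtau j))%:P).
 rewrite rmorph_sum; apply: eq_bigr => i _. by rewrite rmorphM /= map_polyC map_prod_XsubC.
exists D, lam, pr, (fun k => S`_k); split=> //. move=> k F u v uv.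
 suff mm : map_poly u S = map_poly v S by rewrite -(coef_map u) -(coef_map v) mm. rewrite !mapS.
 have uvP P i j : u (dtau i) = v (dtau j) -> u (evp lam (dtau i) P) = v (evp lam (dtau j) P).
  move=> e; have -> : u (evp lam (dtau i) P) = evp (u \o lam) (u (dtau i)) P by exact: evp_map.
  have -> : v (evp lam (dtau j) P) = evp (v \o lam) (v (dtau j)) P by exact: evp_map.
  by rewrite e !evpE; congr (_.[_]); exact: eq_map_poly.
 (* As [u] and [v] agree on [C], their lists of roots differ by a permutation. It also matches the
    [del], since a point of [B] is determined by its restriction to [C] and the image of [t]. *)
 have [sg sgE] : exists sg : 'S_n, forall i, v (dtau i) = u (dtau (sg i)).
  have : perm_eq [tuple v (dtau i) | i < n] [tuple u (dtau i) | i < n]. apply: prod_XsubC_eq; rewrite !big_tuple.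
   rewrite (eq_bigr (fun i => 'X - (v (dtau i))%:P)); last by move=> i _; rewrite tnth_mktuple.
   rewrite [RHS](eq_bigr (fun i => 'X - (u (dtau i))%:P)); last by move=> i _; rewrite tnth_mktuple.
   rewrite -!map_prod_XsubC prodD -!map_poly_comp; apply: eq_map_poly => c /=. by symmetry; exact: uv.
  move=> /tuple_permP [sg e]; exists sg => i.
  have e' : [tuple v (dtau i) | i < n] = [tuple tnth [tuple u (dtau j) | j < n] (sg i) | i < n]. exact: val_inj.
  by have := congr1 (fun s => tnth s i) e'; rewrite !tnth_mktuple. have dE i : v (del i) = u (del (sg i)).
  rewrite !rmorphM -(uvP h _ _ (esym (sgE i))).
  have [z0|nz] := pselect (u (evp lam (dtau (sg i)) h) = 0); first by rewrite z0 !mul0r.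
  have [w [wphi wt wal]] := lift_pt F u (sg i) nz.
  have nz' : v (evp lam (dtau i) h) <> 0 by rewrite -(uvP h _ _ (esym (sgE i))).
  have [w' [wphi' wt' wal']] := lift_pt F v i nz'.
  congr (_ * _); rewrite -wal -wal'; apply: uniq; apply: standard_hom_eq.
   by move=> c; rewrite -[LHS]/((w' \o eta \o phi) c) wphi' -[RHS]/((w \o eta \o phi) c) wphi uv.
  by rewrite /= wt wt' sgE.
 rewrite (reindex_inj (@perm_inj _ sg)) /=; apply: eq_big => // i _; rewrite dE; congr (_ * _).
 rewrite (reindex_inj (@perm_inj _ sg)) /=; apply: eq_big => j; first by rewrite (inj_eq perm_inj). by rewrite sgE.
(* [e] is the polynomial [S] at [t], with coefficients taken from [C]. The identity to prove is
   [e = g'(t) h^(N0+1) a] in [B]; as [B] is reduced it is checked at every prime. *)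
move=> gam hgam. pose e := \sum_(k < size S) phi (gam k) * t ^+ k.
have uX : is_unit (evp phi t g^`() * hE ^+ N0.+1) by apply: is_unitM => //; exact: is_unitX.
have [v hv] := uX; exists (v * e). suff key : eta e = eta (evp phi t g^`() * hE ^+ N0.+1) * a.
 by rewrite rmorphM key mulrA -rmorphM [v * _]mulrC hv rmorph1 mul1r. apply/subr0_eq.
have [|m hm] := @nilpotent_of_primes B (eta e - eta (evp phi t g^`() * hE ^+ N0.+1) * a); last exact: red hm.
move=> Q pQ; have [k [chi [chiker _]]] := residue_field pQ; apply/chiker.
have pP : is_prime_ideal ((eta \o phi) @^-1` Q) by exact: preim_prime. have [x ex] := allP pP.
have [|W [u [v' uv]]] := @point_compositum C C C (rf_field (rf x)) k idfun idfun (rf_ev (rf x)) (chi \o eta \o phi).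
 by move=> c; rewrite rf_ker ex /= chiker. pose uD : D ~> W := u \o pr x. pose wQ : B ~> W := v' \o chi.
pose tQ := wQ (eta t). have uDlam c : uD (lam c) = wQ (eta (phi c)) by rewrite /uD /= prlam; exact: uv.
have wQP P : wQ (eta (evp phi t P)) = evp (uD \o lam) tQ P. by apply: hom_evp => // c; symmetry; exact: uDlam.
have [i0 ti0] : exists i0, tQ = uD (dtau i0). have : evp (uD \o lam) tQ g = 0 by rewrite -wQP gt !rmorph0.
 rewrite evpE map_poly_comp -prodD map_prod_XsubC => /eqP.
 rewrite horner_prod prodf_seq_eq0 => /hasP [i _]; rewrite /= hornerXsubC subr_eq0 => /eqP e1. by exists i.
have uDP P : uD (evp lam (dtau i0) P) = evp (uD \o lam) tQ P. by rewrite ti0; exact: evp_map.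
have unz P : is_unit (evp phi t P) -> wQ (eta (evp phi t P)) <> 0.
 move=> uP e1; have [z ez] := unit_morph wQ (unit_morph eta uP).
 by move: ez; rewrite e1 mul0r => /eqP; rewrite eq_sym oner_eq0.
have nzh : uD (evp lam (dtau i0) h) <> 0 by rewrite uDP -wQP; exact: unz.
have [w [wphi wt wal]] := lift_pt W uD i0 nzh. have wE : w =1 wQ.
 apply: uniq; apply: standard_hom_eq => [c|] /=; last by rewrite wt -ti0.
 by rewrite -[LHS]/((w \o eta \o phi) c) wphi; exact: uDlam. have wQe : wQ (eta e) = (map_poly uD S).[tQ].
 have sS : (size (map_poly uD S) <= size S)%N by exact: size_poly. rewrite (horner_coef_wide _ sS).
 transitivity (\sum_(l < size S) wQ (eta (phi (gam l) * t ^+ l))); first by rewrite /e !rmorph_sum.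
 apply: eq_bigr => l _; rewrite !rmorphM !rmorphXn coef_map -uDlam. by congr (_ * _); rewrite /uD /= prlam hgam.
have gd : (map_poly (uD \o lam) g)^`().[tQ] = \prod_(j | j != i0) (tQ - uD (dtau j)).
 rewrite map_poly_comp -prodD map_prod_XsubC (bigD1 i0) //= derivM derivXsubC mul1r hornerD hornerM.
 by rewrite hornerXsubC ti0 subrr mul0r addr0 horner_prod; apply: eq_bigr => j _; rewrite hornerXsubC.
have vS : (map_poly uD S).[tQ] = uD (del i0) * \prod_(j | j != i0) (tQ - uD (dtau j)).
 rewrite mapS horner_sum (bigD1 i0) //= [X in _ + X]big1 ?addr0; last first.
  move=> i ii0; rewrite hornerM horner_prod (bigD1 i0) 1?eq_sym //=. by rewrite hornerXsubC ti0 subrr mul0r mulr0.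
 by rewrite hornerM hornerC horner_prod; congr (_ * _); apply: eq_bigr => j _; rewrite hornerXsubC.
apply: (fmorph_inj v'); rewrite rmorph0 -[LHS]/(wQ _) rmorphB wQe vS -gd deriv_map -evpE.
have -> : eta (evp phi t g^`() * hE ^+ N0.+1) * a = eta (evp phi t g^`()) * (eta hE * al0).
 by rewrite /al0 exprS !rmorphM; ring.
have ed : uD (del i0) = evp (uD \o lam) tQ h * uD (del0 i0) by rewrite -uDP -rmorphM.
rewrite [wQ (eta _ * _)]rmorphM [wQ (eta hE * _)]rmorphM !wQP -[wQ al0]wE wal ed. by ring. Qed.
End Descent.
End RadicialOverStandard.

Lemma iint_field_vanish (C D : cring) (F : fieldType) (lam : C ~> D) (P : set C) (u : D ~> F) z : is_ideal P ->
 (forall c, P c -> u (lam c) = 0) -> iint lam P z -> u z = 0.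
move=> idP uP /(iint_coef idP) [n [c [Pc e]]]. have : u z ^+ n = 0.
 rewrite -rmorphXn e rmorph_sum big1 // => i _; rewrite rmorphM uP ?mul0r //; exact: Pc.
by move=> /eqP; rewrite expf_eq0 => /andP [_ /eqP]. Qed.

(** Each term of the derivative omits a single factor [X - r], which [p] supplies; the roots may
    repeat. *)
Lemma prod_dvd_deriv (F : fieldType) (p : {poly F}) (rs : seq F) : all (root p) rs ->
 \prod_(r <- rs) ('X - r%:P) %| p * (\prod_(r <- rs) ('X - r%:P))^`().
elim: rs => [|r rs IH] /=; first by rewrite !big_nil dvd1p.
move=> /andP [pr /IH h]; rewrite !big_cons derivM derivXsubC mul1r mulrDr dvdp_add //.
 by rewrite dvdp_mul // dvdp_XsubCl. by rewrite mulrCA dvdp_mul. Qed.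

(** For a nilpotent value [P1(t)], the polynomial [P1] vanishes at the roots of [g] with [h]
    nonzero, and a factor [h] takes care of the others. Hence [g] divides [P1 g'] over every residue
    field of [C], the remainder has nilpotent coefficients, so it is zero, and [g'(t)] can be
    cancelled. *)
Lemma standard_reduced (C E : nzcring) (phi : C ~> E) t (g h : {poly C}) :
 g \is monic -> evp phi t g = 0 -> is_unit (evp phi t h) -> is_unit (evp phi t g^`()) ->
 (forall e, exists N P, evp phi t h ^+ N * e = evp phi t P) -> (forall (S : nzcring) (u : C ~> S) (x : S),
   evp u x g = 0 -> is_unit (evp u x h) -> exists w : E ~> S, w \o phi =1 u /\ w t = x) ->
 reduced_ring C -> reduced_ring E.
move=> gm gt uh ug frac univ red e m em. have sj : spec_surj (idfun : E ~> E) by move=> P pP; exists P.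
have [N [P0 eP0]] := frac e; pose P1 := h * P0. have nilP : evp phi t P1 ^+ m = 0.
 by rewrite rmorphM -eP0 mulrA exprMn em mulr0.
have [k [Q [R [sR eR]]]] := @pseudo_division C g (P1 * g^`()) (size g).-1 (leqSpred _).
have eR' : R = P1 * g^`() - Q * g. move: eR; rewrite -/(lead_coef g) (monicP gm) expr1n mul1r => ->; ring.
have R0 : R = 0. apply/polyP => l; rewrite coef0. have [|r er] := @nilpotent_of_primes C R`_l; last exact: red er.
 move=> P pP; have [[F ev ker rt split val val0 valP] _] := root_field_exists gm univ sj pP.
 apply/ker; have P1r i : (map_poly ev P1).[rt i] = 0.
   rewrite -evpE; have [z0|nz] := pselect (evp ev (rt i) h = 0); first by rewrite rmorphM z0 mul0r.
  have [w [_ wphi wt]] := valP i nz. have ew : w (evp phi t P1) = evp ev (rt i) P1 by rewrite -wt; exact: evp_map.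
  rewrite -ew; apply/eqP; have : w (evp phi t P1) ^+ m == 0 by rewrite -rmorphXn nilP rmorph0.
  by rewrite expf_eq0 => /andP []. have dv : map_poly ev g %| map_poly ev R.
  have -> : map_poly ev R = map_poly ev P1 * map_poly ev g^`() - map_poly ev Q * map_poly ev g.
   by rewrite eR' -!rmorphM -rmorphB. apply: dvdp_sub; last by rewrite dvdp_mull.
  have -> : map_poly ev g = \prod_(r <- [seq rt i | i <- index_enum _]) ('X - r%:P). by rewrite split big_map.
  rewrite -deriv_map; have -> : map_poly ev g = \prod_(r <- [seq rt i | i <- index_enum _]) ('X - r%:P).
   by rewrite split big_map. by apply: prod_dvd_deriv; apply/allP => _ /mapP [i _ ->]; rewrite rootE P1r.
 have sg : size (map_poly ev g) = (size g).-1.+1.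
  by rewrite size_map_poly_id0 ?(monicP gm) ?rmorph1 ?oner_neq0 // prednK // lt0n size_poly_eq0 monic_neq0.
 have : map_poly ev R = 0. apply/eqP; apply: contraTT dv => nz; apply/negP => /(dvdp_leq nz); rewrite sg.
  by move=> /leq_trans /(_ (size_poly _ _)) /leq_trans /(_ sR); rewrite ltnn.
 by move=> /(congr1 (fun p : {poly F} => p`_l)); rewrite coef_map coef0. have e1 : evp phi t P1 = 0.
 have e2 : P1 * g^`() = R + Q * g by rewrite eR' subrK.
 by apply: (unit_cancel ug); rewrite mulr0 mulrC -rmorphM e2 R0 add0r rmorphM gt mulr0.
have uN : is_unit (evp phi t h ^+ N.+1) by exact: is_unitX.
by apply: (unit_cancel uN); rewrite mulr0 exprS -mulrA eP0 -rmorphM. Qed.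

Lemma spec_surj_inj (E B : cring) (eta : E ~> B) : spec_surj eta -> reduced_ring E -> injective eta.
move=> surj red; apply: raddf_inj => e e0; have [|n en] := @nilpotent_of_primes E e.
 move=> P pP; have [Q [[Q0 _ _ _ _] <-]] := surj P pP. by rewrite /preimage /= e0. exact: red en. Qed.

(** * Universal homeomorphisms of affine schemes *)

Definition spec_injective (R S : cring) (f : R ~> S) : Prop :=
 forall Q1 Q2, is_prime_ideal Q1 -> is_prime_ideal Q2 -> f @^-1` Q1 = f @^-1` Q2 -> Q1 = Q2.

Definition spec_closed (R S : cring) (f : R ~> S) : Prop :=
 forall J : set S, exists I : set R, forall P, is_prime_ideal P ->
  (exists Q, [/\ is_prime_ideal Q, f @^-1` Q = P & J `<=` Q]) <-> I `<=` P.

Definition spec_homeo (R S : cring) (f : R ~> S) : Prop :=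
 [/\ spec_injective f, spec_surj f & spec_closed f].

Definition universal_homeo (E B : cring) (eta : E ~> B) : Prop :=
 forall (A T : cring) (c : E ~> A) (i : B ~> T) (j : A ~> T), is_tensor eta c i j -> spec_homeo j.

Lemma universal_surj (E B : cring) (eta : E ~> B) : universal_homeo eta -> spec_surj eta.
move=> uh P pP; have [T [i [j tT]]] := tensor_ring eta idfun.
have [_ sj _] := uh _ _ _ _ _ tT; have [Q [pQ eQ]] := sj P pP; exists (i @^-1` Q). split; first exact: preim_prime.
have [ij _ _] := tT; rewrite -eQ; apply/seteqP; split=> e /=; first by rewrite ij. by rewrite ij. Qed.

(** After base change along [u \o eta], both [u] and [v] become points over the single prime of [F],
    so they have the same kernel. That kernel contains the difference of [b] and the scalar
    [u b]. *)
Lemma universal_field_unique (E B : cring) (eta : E ~> B) : universal_homeo eta -> field_unique eta.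
move=> uh F u v uv b; have [T [i [j tT]]] := tensor_ring eta (u \o eta). have [inj _ _] := uh _ _ _ _ _ tT.
have [|hu [hui huj]] := tensor_lift tT (u := u) (v := idfun); first by [].
have [|hv [hvi hvj]] := tensor_lift tT (u := v) (v := idfun). by move=> e; rewrite /= -[RHS]/((u \o eta) e) uv.
have e1 := inj _ _ (kernel_prime hu) (kernel_prime hv). have : [set r | hv r = 0] (i b - j (u b)).
 rewrite -e1 /=; first by rewrite rmorphB -[hu (i b)]/((hu \o i) b) hui -[hu (j _)]/((hu \o j) _) huj subrr.
 apply/seteqP; split=> x /=; rewrite -[hu (j x)]/((hu \o j) x) -[hv (j x)]/((hv \o j) x) huj hvj //.
by rewrite /= rmorphB -[hv (i b)]/((hv \o i) b) hvi -[hv (j _)]/((hv \o j) _) hvj => /subr0_eq. Qed.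

(* The closed set [b \beta = 1] of [Spec (B \otimes E[\beta])], [\beta = 1/b], dominates
  [Spec E[\beta]], so it surjects onto it and [\beta] is invertible in [E[\beta]]. *)
Lemma universal_integral (E B : cring) (eta : E ~> B) : universal_homeo eta -> forall b, iint eta setT b.
move=> uh b; have [L [l [lu lfrac lker]]] := localization_ring (powers_mult b).
have [|be hbe] := lu b; first by exists 1%N. pose G := alg_gen (l \o eta) [set be].
have [A [i0 [i0i i0E]]] := subring_type (alg_gen_subring (l \o eta) [set be] : is_subring G).
have [e|c cE] := @factor_inj E A L (l \o eta) i0 i0i; first by apply/i0E; exact: alg_gen_img.
have c0 e : i0 (c e) = l (eta e) by exact: cE.
have [be' ebe'] : exists be', i0 be' = be by apply/i0E; apply: alg_gen_mem.
have [T [i [j tT]]] := tensor_ring eta c. have [_ _ cl] := uh _ _ _ _ _ tT.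
have [h [hi hj]] := tensor_lift tT (u := l) (v := i0) (fun e => esym (c0 e)).
have [I hI] := cl [set i b * j be' - 1]. have ube : is_unit be'. apply: unit_of_primes => P pP Pbe.
 have IP : I `<=` P. move=> a Ia; have [|n an] := @nilpotent_of_primes L (i0 a).
   move=> Q pQ; have pQ0 : is_prime_ideal (i0 @^-1` Q) by exact: preim_prime.
   have : I `<=` i0 @^-1` Q; last by move=> /(_ a Ia).
   apply/hI => //; exists (h @^-1` Q); split; first exact: preim_prime.
    by apply/seteqP; split=> x /=; rewrite -[h (j x)]/((h \o j) x) hj.
   move=> _ -> /=; rewrite rmorphB rmorphM -[h (i b)]/((h \o i) b) hi -[h (j _)]/((h \o j) _) hj.
   by rewrite ebe' hbe rmorph1 subrr; case: pQ.
  apply: (@primeX _ _ _ n) => //; rewrite (_ : a ^+ n = 0); first by case: pP.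
  by apply: i0i; rewrite rmorphXn an rmorph0. have [Q [pQ eQ JQ]] := (hI P pP).2 IP.
 have Q1 := JQ _ erefl; have : Q (j be') by rewrite -[Q _]/((j @^-1` Q) be') eQ.
 case: pQ => _ QD QM Qn1 _ Qj; apply: Qn1. rewrite (_ : 1 = i b * j be' + (-1) * (i b * j be' - 1)); last by ring.
 by apply: QD; exact: QM. have [ga hga] := ube. have lb : l b = i0 ga.
 by rewrite -[LHS]mulr1 -(rmorph1 i0) -hga rmorphM ebe' mulrA hbe mul1r. have idT := idealT E.
pose V m := [set x | exists2 i, (i < m.+1)%N & x = l b ^+ i].
have spV x m k : spn (l \o eta) setT (V m) x -> spn (l \o eta) setT (V (m + k)%N) (x * l b ^+ k).
 elim=> [|u v _ hu _ hv|e _ _ [r rm ->]]; first by rewrite mul0r; exact: spn0. by rewrite mulrDl; exact: spnD.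
 rewrite -mulrA -exprD; apply: spnG => //; exists (r + k)%N => //. by rewrite ltnS leq_add2r -ltnS.
(* An element of [E[be]] times a high power of [b] is a polynomial in [b] of no larger degree.
   Applied to [ga], whose image is [b], this yields a monic equation for [b] up to a power of
   [b]. *)
have [m hm] : exists m, spn (l \o eta) setT (V m) (i0 ga * l b ^+ m). have hG : G (i0 ga) by apply/i0E; exists ga.
 apply: (hG [set x | exists m, spn (l \o eta) setT (V m) (x * l b ^+ m)]); first split.
 - exists 0%N; rewrite mulr1 -(rmorph1 (l \o eta)) -[X in spn _ _ _ X]mulr1; apply: spnG => //. by exists 0%N.
 - move=> x y [m hx] [k hy]; exists (m + k)%N. rewrite mulrBl {1}exprD mulrA addnC exprD mulrA; rewrite -mulN1r.
  rewrite -(rmorph1 (l \o eta)) -rmorphN; apply: spnD; last by apply: spnZ => //; exact: spV.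
  by rewrite addnC; exact: spV.
 - move=> x y [m hx] [k hy]; exists (m + k)%N; rewrite exprD mulrACA.
  apply: (spn_mul idT _ hx hy) => _ _ [r rm ->] [q qm ->]; exists (r + q)%N; last by rewrite exprD.
  by rewrite ltnS leq_add.
 - move=> e; exists 0%N; rewrite mulr1 -[X in spn _ _ _ X]mulr1; apply: spnG => //. by exists 0%N.
 - move=> _ ->; exists 1%N; rewrite expr1 mulrC hbe -(rmorph1 (l \o eta)).
  by rewrite -[X in spn _ _ _ X]mulr1; apply: spnG => //; exists 0%N.
have [y [hy ey]] : exists y, spn eta setT [set x | exists2 i, (i < m.+1)%N & x = b ^+ i] y /\
  l y = i0 ga * l b ^+ m. elim: hm => [|u v _ [y [hy <-]] _ [z [hz <-]]|e _ _ [r rm ->]].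
 - by exists 0; rewrite rmorph0; split=> //; exact: spn0.
 - by exists (y + z); rewrite rmorphD; split=> //; exact: spnD.
 - exists (eta e * b ^+ r); rewrite rmorphM rmorphXn; split=> //. by apply: spnG => //; exists r.
have /lker [_ [K ->] hK] : l (b ^+ m.+1 - y) = 0. by rewrite rmorphB ey rmorphXn -lb -exprS subrr.
exists (K + m.+1)%N; rewrite exprD. have -> : b ^+ K * b ^+ m.+1 = b ^+ K * y by apply/subr0_eq; rewrite -mulrBr.
elim: hy => [|u v _ hu _ hv|e _ _ [r rm ->]]; first by rewrite mulr0; exact: spn0. by rewrite mulrDr; exact: spnD.
rewrite mulrCA -exprD; apply: spnG => //; exists (K + r)%N => //. by rewrite ltn_add2l. Qed.

(* [1] or a power of the characteristic of the residue field at [P] *)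
Definition pexp (C : cring) (P : set C) (q : nat) : Prop :=
 q = 1%N \/ exists p e, [/\ prime p, q = (p ^ e)%N & P p%:R].

(** The values of [z] at points above [P] are purely inseparable over the residue field: there
    [z ^+ q] equals the fraction [a / b]. That the difference vanishes at all these points is
    expressed by [iint lam P]. *)
Definition radicial_at (C R : cring) (lam : C ~> R) (P : set C) (z : R) : Prop :=
 exists q b a, [/\ pexp P q, ~ P b & iint lam P (lam b * z ^+ q - lam a)].

Lemma pexp_gt0 (C : cring) (P : set C) q : pexp P q -> (0 < q)%N.
by move=> [->|[p [e [pp -> _]]]] //; rewrite expn_gt0 prime_gt0. Qed.

Lemma pexp_preim (C C' : cring) (f : C ~> C') (P : set C) (P' : set C') q :
 (forall c, P c -> P' (f c)) -> pexp P q -> pexp P' q.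
move=> PP [->|[p [e [pp -> Pp]]]]; [by left|right; exists p, e; split=> //]. by rewrite -(rmorph_nat f); exact: PP.
Qed.

Lemma pexpD (C : cring) (F : fieldType) (u : C ~> F) (P : set C) q (x y : F) :
 (forall c, P c -> u c = 0) -> pexp P q -> (x + y) ^+ q = x ^+ q + y ^+ q.
move=> uP [->|[p [e [pp -> /uP]]]]; first by rewrite !expr1. rewrite rmorph_nat => p0; apply: exprDn_pchar.
by rewrite pnatX pnatE //= inE pp p0 eqxx orTb. Qed.

Lemma pexp_inj (C : cring) (F : fieldType) (u : C ~> F) (P : set C) q (x y : F) :
 (forall c, P c -> u c = 0) -> pexp P q -> x ^+ q = y ^+ q -> x = y.
move=> uP Pq e; have : (x - y) ^+ q = 0. by apply: (addIr (y ^+ q)); rewrite add0r -(pexpD _ _ uP Pq) subrK.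
by move/eqP; rewrite expf_eq0 => /andP [_]; rewrite subr_eq0 => /eqP. Qed.

(** Two exponents other than 1 belong to the same prime number, as two distinct prime numbers in [P]
    would generate 1. *)
Lemma pexp_common (C : cring) (P : set C) q1 q2 : is_prime_ideal P ->
 pexp P q1 -> pexp P q2 -> exists r1 r2, (q1 * r1 = q2 * r2)%N /\ pexp P (q1 * r1)%N.
move=> pP [->|[p [e [pp -> Pp]]]] h2. by exists q2, 1%N; rewrite mul1n muln1.
case: h2 => [->|[p' [e' [pp' -> Pp']]]].
 by exists 1%N, (p ^ e)%N; rewrite mul1n muln1; split=> //; right; exists p, e. have [epp|npp] := eqVneq p p'.
 subst p'; exists (p ^ e')%N, (p ^ e)%N; rewrite mulnC; split=> //. by right; exists p, (e' + e)%N; rewrite expnD.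
exfalso; have [P0 PD PM P1 _] := pP; apply: P1. have cop : coprime p p' by rewrite prime_coprime // dvdn_prime2.
have [k l e1 _] := egcdnP p' (prime_gt0 pp). have : (k * p)%:R = (l * p')%:R + 1 :> C by rewrite e1 (eqP cop) natrD.
move=> e2; rewrite (_ : 1 = (k * p)%:R + (-1) * (l * p')%:R); last by rewrite e2; ring.
by rewrite !natrM; apply: PD; [exact: (PM)|apply: (PM); exact: (PM)]. Qed.

(** Vanishing at all primes above [P] puts a power of [z] in [P D], which integrality turns into an
    equation with coefficients in [P]. Membership can thus be tested at points. *)
Lemma iint_of_primes (C D : cring) (lam : C ~> D) (P : set C) z : is_ideal P -> (forall d, iint lam setT d) ->
 (forall Q, is_prime_ideal Q -> (forall c, P c -> Q (lam c)) -> Q z) -> iint lam P z.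
move=> idP int h; have [|n hn] := radical_of_primes (a := z) (spn_setT_ideal lam idP).
 move=> Q pQ sQ; apply: h => // c Pc; apply: sQ. by rewrite -[lam c]mulr1; apply: spnG.
have hz := iint_spn_setT idP int hn. case: n hz {hn} => [|n] hz; last exact: (iintX (n := n.+1)).
by rewrite -[z]mul1r; apply: iint_mul. Qed.

Lemma integral_closure (C R : cring) (lam : C ~> R) : exists (D : cring) (i : D ~> R) (mu : C ~> D),
  [/\ injective i, i \o mu =1 lam, forall d, iint mu setT d & forall z, iint lam setT z -> exists d, i d = z].
have [D [i [ii iE]]] := subring_type (iint_sring lam).
have [c|mu muE] := @factor_inj C D R lam i ii; first by apply/iE; exact: iint_img.
exists D, i, mu; split=> // [d|z /iE //]. have hz : iint lam setT (i d) by apply/iE; exists d.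
by apply: (iint_inj (idealT C) ii); apply: iint_eq_hom hz => c; rewrite [RHS]muE. Qed.

Lemma iint_of_fields (C D : cring) (lam : C ~> D) (P : set C) z : is_ideal P -> (forall d, iint lam setT d) ->
 (forall (F : fieldType) (u : D ~> F), (forall c, P c -> u (lam c) = 0) -> u z = 0) -> iint lam P z.
move=> idP int h; apply: iint_of_primes => // Q pQ PQ.
have [F [u [uker _]]] := residue_field pQ; apply/uker; apply: h => c /PQ. by move/uker. Qed.

(** [radicial_at] without denominator. It implies integrality, and therefore the tests at points
    that prove stability under the ring operations. *)
Definition rad1 (C R : cring) (lam : C ~> R) (P : set C) (z : R) : Prop :=
 exists q a, pexp P q /\ iint lam P (z ^+ q - lam a).

Section Radicial.
Variables (C R : cring) (lam : C ~> R) (P : set C).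
Hypothesis pP : is_prime_ideal P.
Let idP := prime_ideal pP.

Lemma rad1_integral z : rad1 lam P z -> iint lam setT z.
move=> [q [a [Pq h]]]; apply: (@iintX _ _ lam setT _ q); last exact: pexp_gt0 Pq.
rewrite -[z ^+ q](subrK (lam a)); apply: (subringD (iint_sring lam)); last exact: iint_img. exact: iint_sub h.
Qed.

Lemma rad1_img c : rad1 lam P (lam c).
exists 1%N, c; split; first by left. by rewrite expr1 subrr; apply: iint0; case: idP. Qed.

(** In the integral closure the condition is tested at field points above [P], where raising to a
    common exponent is additive and multiplicative. *)
Lemma rad1_sub_mul z w : rad1 lam P z -> rad1 lam P w -> rad1 lam P (z - w) /\ rad1 lam P (z * w).
move=> rz rw; have [D [i [mu [ii imu int lift]]]] := integral_closure lam.
have [z' ez] := lift _ (rad1_integral rz); have [w' ew] := lift _ (rad1_integral rw).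
have imuE c : i (mu c) = lam c by exact: imu. have toD x : iint lam P (i x) -> iint mu P x.
 move=> hx; apply: (iint_inj idP ii); apply: iint_eq_hom hx => c. by rewrite /= imuE.
have ofD x : iint mu P x -> iint lam P (i x).
 by move=> hx; apply: iint_eq_hom (iint_map i hx) => c; rewrite /= imuE.
subst z w; case: rz rw => [q1 [a1 [P1 h1]]] [q2 [a2 [P2 h2]]].
have {}h1 : iint mu P (z' ^+ q1 - mu a1) by apply: toD; rewrite rmorphB rmorphXn imuE.
have {}h2 : iint mu P (w' ^+ q2 - mu a2) by apply: toD; rewrite rmorphB rmorphXn imuE.
have [r1 [r2 [er Pq]]] := pexp_common pP P1 P2.
have at_field (F : fieldType) (u : D ~> F) : (forall c, P c -> u (mu c) = 0) ->
  u z' ^+ (q1 * r1) = u (mu a1) ^+ r1 /\ u w' ^+ (q1 * r1) = u (mu a2) ^+ r2.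
 move=> uP; rewrite exprM er exprM -!rmorphXn.
 have := iint_field_vanish idP uP h1; have := iint_field_vanish idP uP h2.
 by rewrite !rmorphB !rmorphXn => /subr0_eq -> /subr0_eq ->.
split; exists (q1 * r1)%N; [exists (a1 ^+ r1 - a2 ^+ r2)|exists (a1 ^+ r1 * a2 ^+ r2)]; split=> //.
 rewrite -rmorphB -rmorphXn -imuE -rmorphB; apply: ofD; apply: iint_of_fields => // F u uP.
 have [e1 e2] := at_field F u uP. have eq1 : u (z' - w') ^+ (q1 * r1) = u z' ^+ (q1 * r1) - u w' ^+ (q1 * r1).
  by apply/eqP; rewrite eq_sym subr_eq -(pexpD (u := u \o mu) _ _ uP Pq) -rmorphD subrK.
 by rewrite rmorphB rmorphXn eq1 e1 e2 !rmorphB !rmorphXn subrr.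
rewrite -rmorphM -rmorphXn -imuE -rmorphB; apply: ofD; apply: iint_of_fields => // F u uP.
have [e1 e2] := at_field F u uP.
by rewrite rmorphB rmorphXn [u (z' * w')]rmorphM exprMn e1 e2 !rmorphM !rmorphXn subrr. Qed.

(* near a point where [y] does not vanish, [1/y] is a polynomial in [y] over the base *)
Lemma rad1_inverse (S : set R) y a : is_subring S -> (forall c, S (lam c)) -> S y ->
 ~ P a -> iint lam P (y - lam a) -> exists e r, [/\ ~ P e, S r & y * r = lam e].
move=> sS Sl Sy na /(iint_coef idP) [m [c [Pc e]]]. have [S1 SB SM] := sS.
have zi i : exists r, S r /\ (y - lam a) ^+ i = lam ((- a) ^+ i) + y * r. elim: i => [|i [r [Sr er]]].
  by exists 0; rewrite mulr0 addr0 !expr0 rmorph1; split=> //; exact: subring0.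
 exists ((y - lam a) * r + lam ((- a) ^+ i)); split. by apply: subringD => //; apply: (SM) => //; exact: SB.
 by rewrite !exprS er rmorphM rmorphN; ring. have [r0 [Sr0 e0]] := zi m. have [ri hri] := choice (fun i => zi i).
have [P0 PD PM P1 PP] := pP.
exists (\sum_(i < m) c i * (- a) ^+ i - (- a) ^+ m), (r0 - \sum_(i < m) lam (c i) * ri i); split.
- move=> h; apply: na; have : P (- a). apply: (@primeX _ P _ m) => //.
  rewrite (_ : (- a) ^+ m = \sum_(i < m) c i * (- a) ^+ i +
   (-1) * (\sum_(i < m) c i * (- a) ^+ i - (- a) ^+ m)); last by ring. apply: PD; last exact: (PM).
  by apply: ideal_sum => // i _; rewrite mulrC; apply: (PM); exact: Pc. by move=> /(PM (-1)); rewrite mulN1r opprK.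
- apply: subringD => //; apply: subringN => //.
 apply: (big_ind S); [exact: subring0|by move=> u v; exact: subringD|move=> i _].
 by apply: (SM) => //; have [] := hri i. rewrite mulrBr rmorphB rmorph_sum mulr_sumr.
have -> : y * r0 = (y - lam a) ^+ m - lam ((- a) ^+ m) by rewrite e0; ring.
rewrite e addrAC -sumrB; congr (_ - _); apply: eq_bigr => i _. have [_ ->] := hri i; rewrite rmorphM; ring. Qed.
End Radicial.

(** After any base change: integrality persists and gives closedness by [lying_over]; injectivity
    follows by comparing [q]-th powers in a compositum of two residue fields; surjectivity by
    forming a point in a compositum. *)
Lemma radicial_universal (C C' : cring) (lam : C ~> C') : (forall z, iint lam setT z) -> spec_surj lam ->
 (forall P, is_prime_ideal P -> forall z, radicial_at lam P z) -> universal_homeo lam.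
move=> int surj rad A T c i j tT; have [ij span _] := tT. have intT r : iint j setT r.
 have [s ->] := span r; apply: (big_ind (iint j setT)).
 - exact: (subring0 (iint_sring j)).
 - by move=> u v; exact: (subringD (iint_sring j)).
 move=> x _; have [_ _ iM] := iint_sring j; apply: (iM); last exact: iint_img.
 apply: (@iint_comp C A T c j setT setT) => //. apply: iint_eq_hom (iint_map i (int x.1)) => z; exact: ij. split.
- move=> Q1 Q2 p1 p2 e12. have [F1 [u1 [k1 _]]] := residue_field p1; have [F2 [u2 [k2 _]]] := residue_field p2.
 have [|W [v1 [v2 v12]]] := @point_compositum A T T F1 F2 j j u1 u2.
  move=> a; rewrite k1 k2 -[Q1 _]/((j @^-1` Q1) a) e12; by [].
 have pP : is_prime_ideal ((j \o c) @^-1` Q1) by exact: preim_prime. have [idP0 _ _ _ _] := pP.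
 have PW z : ((j \o c) @^-1` Q1) z -> v1 (u1 (i (lam z))) = 0. by rewrite ij => /k1 ->; rewrite rmorph0.
 have PW2 z : ((j \o c) @^-1` Q1) z -> v2 (u2 (i (lam z))) = 0. by move=> /PW; rewrite ij v12.
 have e1 : (v1 \o u1) \o i =1 (v2 \o u2) \o i. move=> z /=; have [q [b [a [Pq nb h]]]] := rad _ pP z.
  have idP := prime_ideal pP. have := @iint_field_vanish C C' W lam _ (v1 \o u1 \o i) _ idP PW h.
  have := @iint_field_vanish C C' W lam _ (v2 \o u2 \o i) _ idP PW2 h.
  rewrite /= !rmorphB !rmorphM !rmorphXn !ij !v12 => /subr0_eq h2 /subr0_eq h1.
  apply: (pexp_inj (u := v1 \o u1 \o i \o lam) PW Pq). have nz : v2 (u2 (j (c b))) != 0.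
   rewrite -v12 fmorph_eq0; apply/eqP => /k1; exact: nb. by apply: (mulfI nz); rewrite h1 h2.
 have e2 : v1 \o u1 =1 v2 \o u2 by apply: (tensor_morph_eq tT) => // a /=; rewrite v12. apply/seteqP; split=> r.
  by move=> /k1 h; apply/k2; apply: (fmorph_inj v2); rewrite -[LHS]/((v2 \o u2) r) -e2 /= h !rmorph0.
 by move=> /k2 h; apply/k1; apply: (fmorph_inj v1); rewrite -[LHS]/((v1 \o u1) r) e2 /= h !rmorph0.
- move=> P pP; have pP0 : is_prime_ideal (c @^-1` P) by exact: preim_prime. have [Q [pQ eQ]] := surj _ pP0.
 have [F1 [u1 [k1 _]]] := residue_field pQ; have [F2 [u2 [k2 _]]] := residue_field pP.
 have [|W [v1 [v2 v12]]] := @point_compositum C C' A F1 F2 lam c u1 u2.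
  move=> a; rewrite k1 k2 -[Q _]/((lam @^-1` Q) a) eQ; by [].
 have [w [wi wj]] := tensor_lift tT (u := v1 \o u1) (v := v2 \o u2) v12.
 exists [set r | w r = 0]; split; first exact: kernel_prime.
 apply/seteqP; split=> a /=; rewrite -[w (j a)]/((w \o j) a) wj /=. by move=> /eqP; rewrite fmorph_eq0 => /eqP /k2.
 (* [K] is the intersection of the primes that contain [J]. The image of the closed set of [J] is
    cut out by the contraction of [K]. *)
 by move=> /k2 ->; rewrite rmorph0. move=> J; pose K := [set r | forall Q, is_prime_ideal Q -> J `<=` Q -> Q r].
have idK : is_ideal K. split=> [Q [] //|x y hx hy Q pQ JQ|x y hy Q pQ JQ].
  by case: (pQ) => _ QD _ _ _; apply: QD; [exact: hx|exact: hy]. by case: (pQ) => _ _ QM _ _; apply: QM; exact: hy.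
exists [set a | K (j a)] => P pP; split=> [[Q [pQ <- JQ]] a Ka|KP]; first exact: Ka.
have [|Q [pQ KQ eQ]] := lying_over idK intT pP; first by move=> a Ka; exact: KP.
exists Q; split=> //; first by apply/seteqP; split=> a /eQ. move=> r Jr; apply: KQ => Q' _; exact. Qed.

(** In the tensor square of the fibre at [P] the difference of the two copies of [d] vanishes at
    every field point, so it is nilpotent and [radicial_power] applies. Denominators in the residue
    field and from the fibre ring are collected in [b]. *)
Lemma radicial_of_field_points (C D : cring) (lam : C ~> D) d : (forall z, iint lam setT z) ->
 (forall (F : fieldType) (u v : D ~> F), u \o lam =1 v \o lam -> u d = v d) ->
 forall P, is_prime_ideal P -> radicial_at lam P d.
move=> int uni P pP; have idP := prime_ideal pP. have [k [c [cker cfrac]]] := residue_field pP.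
have [L [l [kap [kapE lker]]]] := fibre_ring lam pP cker cfrac. have kapc z : kap (c z) = l (lam z) by exact: kapE.
have small y x : ~ P y -> spn lam P setT (lam y * x) -> iint lam P (lam y * x). by move=> _; exact: iint_spn_setT.
have [L0|Lnz] := pselect ((1 : L) = 0). have /lker [y [ny hy]] : l 1 = 0 by rewrite rmorph1.
 exists 1%N, y, 0; split=> //; first by left. rewrite rmorph0 subr0 expr1 -[lam y]mulr1; apply: iint_mul => //.
 exact: small. have [T [i [j tT]]] := tensor_ring kap kap; have [ij _ _] := tT.
have [|n hn] := @nilpotent_of_primes T (i (l d) - j (l d)).
 move=> Q pQ; have [F [u [uker _]]] := residue_field pQ; apply/uker.
 rewrite rmorphB; apply/eqP; rewrite subr_eq0; apply/eqP. apply: (uni F (u \o i \o l) (u \o j \o l)) => z /=.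
 by rewrite -kapc ij. have il : iint kap setT (l d). apply: (@iint_comp C k L c kap setT setT) => //.
 by apply: iint_eq_hom (iint_map l (int d)) => z; rewrite [RHS]kapc.
have [q [al [kq [m hm]]]] := radicial_power Lnz tT il hn. have [a [b [nb eal]]] := cfrac al. have Pq : pexp P q.
 case: kq => [->|[p [e [pk ->]]]]; first by left.
 right; exists p, e; move: pk; rewrite inE => /andP [pp /eqP p0]; split=> //. by apply/cker; rewrite rmorph_nat.
have l0 : l ((lam b * d ^+ q - lam a) ^+ m) = 0. rewrite rmorphXn rmorphB rmorphM rmorphXn -!kapc.
 have -> : kap (c a) = kap (c b) * kap al. by rewrite -rmorphM eal mulrCA divff ?mulr1 //; apply/eqP => /cker.
 by rewrite -mulrBr exprMn hm mulr0. have /lker [y [ny hy]] := l0.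
exists q, (y * b), (y * a); split=> //; first exact: primeM.
have -> : lam (y * b) * d ^+ q - lam (y * a) = lam y * (lam b * d ^+ q - lam a). by rewrite !rmorphM; ring.
case: m hm l0 hy => [|m] hm l0 hy.
 have hy1 : iint lam P (lam y * 1) by apply: small; [exact: ny|move: hy; rewrite expr0].
 by rewrite -[lam y]mulr1; apply: iint_mul.
apply: (@iintX _ _ lam P _ m.+1) => //; rewrite exprMn exprS -mulrA mulrCA.
rewrite mulrC; apply: iint_mul => //; exact: small. Qed.

(** * Germs *)

Definition capO (X : topologicalType) (U V : opens X) : opens X := Opens (openI (oset_open U) (oset_open V)).
Definition topO (X : topologicalType) : opens X := Opens (@openT X).

Lemma capl (X : topologicalType) (U V : opens X) : capO U V `<=` U. by move=> x []. Qed.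
Lemma capr (X : topologicalType) (U V : opens X) : capO U V `<=` V. by move=> x []. Qed.
Lemma subOt (X : topologicalType) (U V W : opens X) : W `<=` V -> V `<=` U -> W `<=` U.
by move=> h h' x /h /h'. Qed.
Lemma subO (X : topologicalType) (U : opens X) : U `<=` U. by []. Qed.

Section Germs.
Variable X : ringed_space.
Implicit Types U V W : opens X.

Lemma restr_pi U V (h h' : V `<=` U) (s : sections U) : restr h s = restr h' s.
by congr (restr _ s); exact: Prop_irrelevance. Qed.

Lemma restrR U V W (h1 : V `<=` U) (h2 : W `<=` V) (h3 : W `<=` U) (s : sections U) :
 restr h2 (restr h1 s) = restr h3 s.
exact: restr_comp. Qed.

(** Equality of germs at [x], without forming the stalk. *)
Definition geqg (x : X) U V (s : sections U) (t : sections V) : Prop :=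
 exists W (h : W `<=` U) (h' : W `<=` V), oset W x /\ restr h s = restr h' t.

Lemma geq_refl x U (s : sections U) : oset U x -> geqg x s s.
by move=> Ux; exists U, (@subO _ U), (@subO _ U). Qed.

Lemma geq_sym x U V (s : sections U) (t : sections V) : geqg x s t -> geqg x t s.
by move=> [W [h [h' [Wx e]]]]; exists W, h', h. Qed.

Lemma geq_restr x U V (h : V `<=` U) (s : sections U) : oset V x -> geqg x (restr h s) s.
by move=> Vx; exists V, (@subO _ V), h; rewrite restr_id. Qed.

Lemma geq_trans x U V W (s : sections U) (t : sections V) (r : sections W) :
 geqg x s t -> geqg x t r -> geqg x s r.
move=> [A [h [h' [Ax e]]]] [B [k [k' [Bx e']]]]; exists (capO A B).
exists (subOt (@capl _ A B) h), (subOt (@capr _ A B) k'); split=> //.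
rewrite -(restrR h (@capl _ A B)) e -(restrR k' (@capr _ A B)) -e'.
rewrite (restrR h' _ (subOt (@capl _ A B) h')) (restrR k _ (subOt (@capr _ A B) k)). exact: restr_pi. Qed.

Lemma geq2 x U V (s s' : sections U) (t t' : sections V) (op : forall R : cring, R -> R -> R) :
 (forall (R S : cring) (f : R ~> S) a b, f (op R a b) = op S (f a) (f b)) ->
 geqg x s t -> geqg x s' t' -> geqg x (op _ s s') (op _ t t').
move=> opf [A [h [h' [Ax e]]]] [B [k [k' [Bx e']]]]; exists (capO A B).
exists (subOt (@capl _ A B) h), (subOt (@capl _ A B) h'); split=> //. rewrite !opf; congr (op _ _ _).
 by rewrite -(restrR h (@capl _ A B)) e (restrR h' _ (subOt (@capl _ A B) h')).
rewrite (restr_pi _ (subOt (@capr _ A B) k)) (restr_pi _ (subOt (@capr _ A B) k')).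
by rewrite -(restrR k (@capr _ A B)) e' (restrR k' _ (subOt (@capr _ A B) k')). Qed.

Lemma geqM x U V (s s' : sections U) (t t' : sections V) :
 geqg x s t -> geqg x s' t' -> geqg x (s * s') (t * t').
by apply: (geq2 (op := fun R a b => a * b)) => R S f a b; rewrite rmorphM. Qed.
Lemma geqD x U V (s s' : sections U) (t t' : sections V) :
 geqg x s t -> geqg x s' t' -> geqg x (s + s') (t + t').
by apply: (geq2 (op := fun R a b => a + b)) => R S f a b; rewrite rmorphD. Qed.
Lemma geq1 x U V : oset U x -> oset V x -> geqg x (1 : sections U) (1 : sections V).
by move=> Ux Vx; exists (capO U V), (@capl _ U V), (@capr _ U V); rewrite !rmorph1. Qed.

Lemma geq_eq U (s t : sections U) : (forall x, oset U x -> geqg x s t) -> s = t.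
move=> e; pose I := {x : X | oset U x}.
have ex (i : I) : exists W (h : W `<=` U), oset W (sval i) /\ restr h s = restr h t.
 have [W [h [h' [Wx eW]]]] := e _ (svalP i); exists W, h; split=> //. by rewrite eW; exact: restr_pi.
pose W i := sval (cid (ex i)); pose hW i := sval (cid (svalP (cid (ex i)))).
have [r [_ uni]] := @restr_glue X I U W hW (fun i => restr (hW i) t)
 (fun x Ux => ex_intro2 _ _ (exist _ x Ux) Logic.I (svalP (cid (svalP (cid (ex (exist _ x Ux)))))).1)
 (fun i j V hi hj => etrans (restrR _ _ (subOt hi (hW i)) _)
   (etrans (restr_pi _ _ _) (esym (restrR _ _ (subOt hj (hW j)) _)))).
by rewrite -(uni s) ?(uni t) // => i; case: (svalP (cid (svalP (cid (ex i))))). Qed.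

(** The family is indexed by the points of [U] themselves, so sections chosen near each point can be
    glued as they are, and compatibility is a statement about germs. *)
Lemma glue_germs U (F : forall x, oset U x -> {V : opens X & sections V}) :
 (forall x (Ux : oset U x), oset (projT1 (F x Ux)) x) ->
 (forall x y (Ux : oset U x) (Uy : oset U y) z, oset (projT1 (F x Ux)) z ->
   oset (projT1 (F y Uy)) z -> geqg z (projT2 (F x Ux)) (projT2 (F y Uy))) ->
 exists t : sections U, forall x (Ux : oset U x), geqg x t (projT2 (F x Ux)).
move=> Fx compat; pose I := {x : X | oset U x}. pose FF (i : I) := F (proj1_sig i) (proj2_sig i).
pose W (i : I) := capO U (projT1 (FF i)).
have [//|i j V hi hj|t [ht _]] := @restr_glue X I U W (fun i => @capl _ U (projT1 (FF i)))
 (fun i => restr (@capr _ U (projT1 (FF i))) (projT2 (FF i))).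
- by move=> x Ux; exists (exist _ x Ux) => //; split=> //; exact: Fx.
- apply: geq_eq => x Vx; have [Ux Fix] := hi x Vx; have [_ Fjx] := hj x Vx.
 apply: (geq_trans (geq_restr _ _ Vx)); apply: (geq_trans (geq_restr _ _ _)) => //.
 apply: geq_sym; apply: (geq_trans (geq_restr _ _ Vx)); apply: (geq_trans (geq_restr _ _ _)) => //. exact: compat.
exists t => x Ux; have := ht (exist _ x Ux) => /= e. have Wx : oset (W (exist _ x Ux)) x by split=> //; exact: Fx.
apply: (geq_trans (geq_sym (geq_restr (@capl _ _ _) t Wx))). by rewrite e; exact: (geq_restr _ _ Wx). Qed.

Lemma germ_unit_geq x U V (s : sections U) (t : sections V) : geqg x s t -> germ_unit s x -> germ_unit t x.
move=> [A [h [h' [Ax e]]]] [B [k [Bx uB]]]; exists (capO A B), (subOt (@capl _ A B) h'); split=> //.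
rewrite -(restrR h' (@capl _ A B)) -e (restrR h _ (subOt (@capr _ A B) k)).
rewrite -(restrR k (@capr _ A B)); exact: unit_morph. Qed.

Lemma germ_unit_sub x U (s : sections U) : germ_unit s x -> oset U x.
by move=> [V [h [Vx _]]]; exact: h. Qed.

Lemma is_unit_germ x U (s : sections U) : is_unit s -> oset U x -> germ_unit s x.
by move=> us Ux; exists U, (@subO _ U); rewrite restr_id. Qed.

Lemma germ_unitM x U (s t : sections U) : germ_unit (s * t) x <-> germ_unit s x /\ germ_unit t x.
split=> [[V [h [Vx]]]|[[V [h [Vx us]]] [W [k [Wx ut]]]]].
 rewrite rmorphM => u; split; exists V, h; split=> //; first exact: unit_factor u.
 by move: u; rewrite mulrC; exact: unit_factor.
exists (capO V W), (subOt (@capl _ V W) h); split=> //; rewrite rmorphM; apply: is_unitM.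
 by rewrite -(restrR h (@capl _ V W)); exact: unit_morph.
rewrite (restr_pi _ (subOt (@capr _ V W) k)) -(restrR k (@capr _ V W)). exact: unit_morph. Qed.

Lemma germ_unit_open U (s : sections U) : open [set x | germ_unit s x].
rewrite openE => x [V [h [Vx us]]]; rewrite /interior nbhsE /=.
by exists (oset V); [split=> //; exact: oset_open|move=> y Vy; exists V, h]. Qed.

(** Inverses are unique, so the local ones agree as germs and glue. *)
Lemma is_unit_local U (s : sections U) : (forall x, oset U x -> germ_unit s x) -> is_unit s.
move=> us; have ex x : oset U x -> exists V (h : V `<=` U) (t : sections V), oset V x /\ restr h s * t = 1.
 by move=> /us [V [h [Vx [t et]]]]; exists V, h, t. pose F x (Ux : oset U x) : {V : opens X & sections V} :=
 existT _ (sval (cid (ex x Ux))) (sval (cid (svalP (cid (svalP (cid (ex x Ux))))))).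
have FP x (Ux : oset U x) : exists h : projT1 (F x Ux) `<=` U, oset (projT1 (F x Ux)) x /\
  restr h s * projT2 (F x Ux) = 1.
 by exists (sval (cid (svalP (cid (ex x Ux))))); exact: (svalP (cid (svalP (cid (svalP (cid (ex x Ux))))))).
have key x V (h : V `<=` U) (t : sections V) : oset V x -> restr h s * t = 1 -> forall W (k : W `<=` U)
  (r : sections W), oset W x -> restr k s * r = 1 -> geqg x t r.
 move=> Vx e W k r Wx e'; exists (capO V W), (@capl _ V W), (@capr _ V W); split=> //.
 have e1 := congr1 (restr (@capl _ V W)) e; have e2 := congr1 (restr (@capr _ V W)) e'.
 rewrite rmorphM rmorph1 (restrR _ _ (subOt (@capl _ V W) h)) in e1.
 rewrite rmorphM rmorph1 (restrR _ _ (subOt (@capl _ V W) h)) in e2.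
 by rewrite -[LHS]mulr1 -e2 mulrCA mulrA e1 mul1r. have [|x y Ux Uy z Fxz Fyz|t tP] := @glue_germs U F.
- by move=> x Ux; case: (FP x Ux) => h [].
- have [h [_ e]] := FP x Ux; have [k [_ e']] := FP y Uy. exact: key Fxz e _ _ _ Fyz e'.
exists t; apply: geq_eq => x Ux; have [h [Fx e]] := FP x Ux. have g1 : geqg x (s * t) (restr h s * projT2 (F x Ux)).
 by apply: geqM; [apply: geq_sym; exact: geq_restr|exact: tP]. by apply: (geq_trans g1); rewrite e; exact: geq1.
Qed.

(** On an affine open this is the prime ideal corresponding to [x]; see [affine_elim]. *)
Definition nonunits U (x : X) : set (sections U) := [set s | ~ germ_unit s x].
End Germs.
Arguments nonunits {X} U x _.

(** * Affine opens *)

Definition basicO (X : ringed_space) (N : opens X) (a : sections N) : opens X := Opens (germ_unit_open a).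
Arguments basicO {X N} a.
Lemma bsub (X : ringed_space) (N : opens X) (a : sections N) : basicO a `<=` N.
by move=> x; exact: germ_unit_sub. Qed.
Arguments bsub {X N} a.

Section Affine.
Variable X : ringed_space.
Implicit Types U V W N : opens X.

Lemma affine_make N : (forall x, oset N x -> is_prime_ideal (nonunits N x)) ->
 (forall P, is_prime_ideal P -> exists x, oset N x /\ nonunits N x = P) ->
 (forall x y, oset N x -> oset N y -> nonunits N x = nonunits N y -> x = y) ->
 (forall x (V : set X), open V -> V x -> oset N x -> exists a : sections N, germ_unit a x /\
   forall y, germ_unit a y -> V y) ->
 (forall a : sections N, is_localization a (restr (bsub a))) -> affine_open N.
move=> pr surj inj base loc; exists (fun x => nonunits N x); split=> //.
- move=> P pP; have [x [Nx ex]] := surj P pP; exists x; split=> // y [Ny ey]. by apply: inj => //; rewrite ex ey.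
- move=> V VN; split=> [oV|[E ->]]. exists [set a | forall y, germ_unit a y -> V y]; apply/seteqP; split=> x.
   move=> Vx; split; first exact: VN. by have [a [ua ha]] := base x V oV Vx (VN _ Vx); exists a => // /(_ ua).
  by move=> [_ [a ha] /contrapT ua]; exact: ha.
 rewrite openE => x [Nx [a Ea /contrapT ua]]; rewrite /interior nbhsE /=.
 exists [set y | germ_unit a y]; first by split=> //; exact: germ_unit_open.
 by move=> y uy; split; [exact: germ_unit_sub uy|exists a => // /(_ uy)]. move=> a V h eV; have [l1 l2 l3] := loc a.
have VD : V `<=` basicO a by rewrite eV => x [_ /contrapT].
have DV : basicO a `<=` V by rewrite eV => x ux; split; [exact: germ_unit_sub ux|move=> /(_ ux)].
have rE s : restr h s = restr VD (restr (bsub a) s) by rewrite (restrR _ _ h).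
have rK (t : sections V) : restr VD (restr DV t) = t by rewrite (restrR _ _ (@subO _ V)) restr_id.
have rK' (t : sections (basicO a)) : restr DV (restr VD t) = t.
 by rewrite (restrR _ _ (@subO _ (basicO a))) restr_id. split; first by rewrite rE; exact: unit_morph.
 move=> b; have [n [s e]] := l2 (restr DV b); exists n, s. by rewrite !rE -e rmorphM rmorphXn rK.
by move=> s; rewrite rE => /(congr1 (restr DV)); rewrite rK' rmorph0; exact: l3. Qed.

(** The homeomorphism onto the spectrum is forced: [phi x] is the set of sections that are nonunits
    at [x]. So affineness can be stated with [nonunits] and [germ_unit] and without a choice of
    [phi]. *)
Lemma affine_elim N : affine_open N -> [/\ forall x, oset N x -> is_prime_ideal (nonunits N x),
 forall P, is_prime_ideal P -> exists x, oset N x /\ nonunits N x = P,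
 forall x y, oset N x -> oset N y -> nonunits N x = nonunits N y -> x = y,
 forall x (V : set X), open V -> V x -> oset N x -> exists a : sections N, germ_unit a x /\
   forall y, germ_unit a y -> V y
 & forall (a : sections N) V (h : V `<=` N), oset V = [set x | germ_unit a x] -> is_localization a (restr h)].
move=> [phi [pr uni top loc]]. have oD (a : sections N) : open [set x | oset N x /\ ~ phi x a].
 apply/top; first by move=> x []. exists [set a]; apply/seteqP; split=> x [Nx h]; split=> //; first by exists a.
 by case: h => b ->. have unitE x a : oset N x -> (germ_unit a x <-> ~ phi x a).
 move=> Nx; split=> [[V [h [Vx [r er]]]] pa|na]. have /top [|E eE] : open (oset V) by exact: oset_open. exact: h.
  have : [set x | oset N x /\ exists2 a, E a & ~ phi x a] x by rewrite -eE. move=> [_ [b Eb nb]].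
  (* On a basic open of some [b] inside [V], the inverse of [a] is a fraction [c / b^n]. Then
     [a c = b^n] up to a power of [b], so [b] would belong to [phi x] together with [a]. *)
  have Db : [set x | oset N x /\ ~ phi x b] `<=` oset V. by rewrite eE => y [Ny ny]; split=> //; exists b.
  pose D := Opens (oD b); have hD : D `<=` N by move=> y []. have DV : D `<=` V by exact: Db.
  have [_ lf lk] := loc b D hD erefl. have [n [c ec]] := lf (restr DV r). have e1 : restr hD (a * c - b ^+ n) = 0.
   rewrite rmorphB rmorphM rmorphXn -ec mulrA -(restrR h DV hD a) -rmorphM er rmorph1 mul1r. by rewrite subrr.
  have [m em] := lk _ e1; have [P0 PD PM P1 PP] := pr x Nx.
  apply: nb; apply: (@primeX _ _ _ (m + n)); first exact: pr.
  rewrite exprD (_ : _ * _ = b ^+ m * c * a); first exact: PM.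
  by apply/eqP; rewrite -subr_eq0 -oppr_eq0 -em; apply/eqP; ring.
 pose D := Opens (oD a); have hD : D `<=` N by move=> y [].
 by exists D, hD; split=> //; have [] := loc a D hD erefl. have pE x : oset N x -> nonunits N x = phi x.
 move=> Nx; apply/seteqP; split=> a; rewrite /nonunits /= unitE // => h. exact: contrapT. by move=> /(_ h). split.
- by move=> x Nx; rewrite pE //; exact: pr.
- by move=> P /uni [x [[Nx ex] _]]; exists x; rewrite pE.
- move=> x y Nx Ny; rewrite !pE // => e; have [z [_ hz]] := uni _ (pr x Nx). by rewrite -(hz x) ?(hz y).
- move=> x V oV Vx Nx; have /top [|E eE] : open (V `&` oset N) by apply: openI => //; exact: oset_open.
  by move=> y []. have : [set x | oset N x /\ exists2 a, E a & ~ phi x a] x by rewrite -eE.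
 move=> [_ [a Ea na]]; exists a; split; first exact/unitE.
 move=> y uy; have Ny := germ_unit_sub uy; have : (V `&` oset N) y.
  by rewrite eE; split=> //; exists a => //; exact/unitE. by case.
move=> a V h eV; apply: loc; rewrite eV; apply/seteqP; split=> x /=.
 by move=> ux; have Nx := germ_unit_sub ux; split=> //; exact/unitE. by move=> [Nx /unitE]; exact. Qed.

Lemma affine_frac N x U (s : sections U) : affine_open N -> oset N x -> oset U x ->
 exists (a : sections N) n (c : sections N) (h : basicO a `<=` U),
  germ_unit a x /\ restr h s * restr (bsub a) a ^+ n = restr (bsub a) c.
move=> /affine_elim [_ _ _ base loc] Nx Ux. have [a [ua ha]] := base x (oset U) (oset_open U) Ux Nx.
have [_ lf _] := loc a (basicO a) (bsub a) erefl.
by have [n [c e]] := lf (restr (ha : basicO a `<=` U) s); exists a, n, c, ha. Qed.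
End Affine.

(** [U] is arbitrary. Near [x] each section is a fraction over an affine open with invertible
    denominator, so being a unit is read off from the numerator, where primality is known. *)
Lemma nonunits_prime (X : scheme) (U : opens X) x : oset U x -> is_prime_ideal (nonunits U x).
move=> Ux; have [N Nx aN] := scheme_affine_cover x.
have [pr _ _ _ _] := affine_elim aN; have [P0 PD PM P1 PP] := pr x Nx.
have num (s : sections U) : exists a n (c : sections N), [/\ germ_unit a x,
  geqg x c (s : sections U) -> True & exists (h : basicO a `<=` U),
  restr h s * restr (bsub a) a ^+ n = restr (bsub a) c].
 by have [a [n [c [h [ua e]]]]] := affine_frac s aN Nx Ux; exists a, n, c; split=> //; exists h.
have unitc (s : sections U) (a c : sections N) n (h : basicO a `<=` U) : germ_unit a x ->
  restr h s * restr (bsub a) a ^+ n = restr (bsub a) c -> germ_unit s x <-> germ_unit c x.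
 move=> ua e; have Dx : oset (basicO a) x by []. have uD : germ_unit (restr (bsub a) a ^+ n) x.
  apply: is_unit_germ => //; apply: is_unitX; apply: is_unit_local => y uy.
  by apply: germ_unit_geq (uy); apply: geq_sym; exact: geq_restr. split=> u.
  apply: (germ_unit_geq (geq_restr (bsub a) c Dx)); rewrite -e; apply/germ_unitM; split=> //.
  by apply: germ_unit_geq u; apply: geq_sym; exact: geq_restr. apply: (germ_unit_geq (geq_restr h s Dx)).
 have : germ_unit (restr h s * restr (bsub a) a ^+ n) x.
  by rewrite e; apply: germ_unit_geq u; apply: geq_sym; exact: geq_restr. by move=> /germ_unitM []. split.
- move=> [V [h [Vx]]]; rewrite rmorph0 => -[r]; rewrite mul0r => e.
 apply: P1; apply: (contrapT); move=> /contrapT _; apply: P0.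
 exists (capO V N), (@capr _ V N); split=> //; rewrite rmorph0; exists 0.
 have := congr1 (restr (@capl _ V N)) e; rewrite rmorph0 rmorph1 => <-; by rewrite mulr0.
- move=> s t ns nt ust; have [a [n [c [h [ua e]]]]] := affine_frac s aN Nx Ux.
 have [b [m [d [k [ub e']]]]] := affine_frac t aN Nx Ux. pose V := capO (basicO a) (basicO b).
 have gs : geqg x s (restr (@capl _ _ _ : V `<=` basicO a) (restr h s)).
  apply: geq_sym; apply: (geq_trans (geq_restr _ _ _)); first by split. exact: geq_restr.
 have Vx : oset V x by split. have g1 : geqg x (restr (subOt (@capl _ _ _ : V `<=` basicO a) h) (s + t)
   * (restr (subOt (@capl _ _ _ : V `<=` basicO a) (bsub a)) a ^+ n *
    restr (subOt (@capl _ _ _ : V `<=` basicO a) (bsub a)) b ^+ m)) (c * b ^+ m + d * a ^+ n).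
  exists V, (@subO _ V), (subOt (@capl _ _ _ : V `<=` basicO a) (bsub a)); split=> //.
  rewrite restr_id !rmorphD !rmorphM !rmorphXn. have e1 := congr1 (restr (@capl _ _ _ : V `<=` basicO a)) e.
  have e2 := congr1 (restr (@capr _ _ _ : V `<=` basicO b)) e'.
  rewrite rmorphM rmorphXn !(restrR _ _ (subOt (@capl _ _ _ : V `<=` basicO a) (bsub a)))
   (restrR _ _ (subOt (@capl _ _ _ : V `<=` basicO a) h)) in e1.
  rewrite rmorphM rmorphXn !(restrR _ _ (subOt (@capl _ _ _ : V `<=` basicO a) (bsub a)))
   (restrR _ _ (subOt (@capl _ _ _ : V `<=` basicO a) h)) in e2. by rewrite -e1 -e2; ring.
 have uab : germ_unit (restr (subOt (@capl _ _ _ : V `<=` basicO a) (bsub a)) a ^+ n *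
    restr (subOt (@capl _ _ _ : V `<=` basicO a) (bsub a)) b ^+ m) x.
  apply: is_unit_germ => //; apply: is_unitM; apply: is_unitX; apply: is_unit_local => y [ya yb].
   by apply: germ_unit_geq (ya); apply: geq_sym; exact: geq_restr.
  by apply: germ_unit_geq (yb); apply: geq_sym; exact: geq_restr. have : germ_unit (c * b ^+ m + d * a ^+ n) x.
  apply: (germ_unit_geq g1); apply/germ_unitM; split=> //.
  by apply: germ_unit_geq ust; apply: geq_sym; exact: geq_restr. apply: PD.
  by move=> /germ_unitM [uc _]; apply: ns; apply/(unitc s a c n h ua e).
 by move=> /germ_unitM [ud _]; apply: nt; apply/(unitc t b d m k ub e').
- by move=> s t nt /germ_unitM [].
- by apply; apply: is_unit_germ => //; exact: is_unit1.
by move=> s t nst; have [us|] := pselect (germ_unit s x); [right=> ut; apply: nst; apply/germ_unitM|left]. Qed.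

(** Primes over the basic open of [a] are the primes over [N] that avoid [a]. A section over it is
    [c / a^n], and its own basic open is that of [c * a] in [N], where the localization clause is
    known. *)
Lemma affine_basic (X : scheme) (N : opens X) (a : sections N) : affine_open N -> affine_open (basicO a).
move=> aN; have [pr surj inj base loc] := affine_elim aN. set D := basicO a; set r := restr (bsub a).
have [ua lf lk] := loc a D (bsub a) erefl; rewrite -/r in ua lf lk.
have gr s x : oset D x -> (germ_unit (r s) x <-> germ_unit s x).
 move=> Dx; split; apply: germ_unit_geq; first exact: geq_restr. by apply: geq_sym; exact: geq_restr.
have num (s : sections D) : exists c n, s * r a ^+ n = r c /\ forall x, oset D x ->
  (germ_unit s x <-> germ_unit c x).
 have [n [c e]] := lf s; exists c, n; split=> // x Dx; rewrite -(gr c) // -e; split=> [us|/germ_unitM []//].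
 by apply/germ_unitM; split=> //; apply: is_unit_germ => //; exact: is_unitX. apply: affine_make.
- by move=> x Dx; exact: nonunits_prime.
- move=> P pP; have pP' : is_prime_ideal (r @^-1` P) by exact: preim_prime. have [x [Nx ex]] := surj _ pP'.
 have Dx : germ_unit a x. apply: contrapT => na; have : (nonunits N x) a by [].
  by rewrite ex /=; exact: prime_not_unit.
 exists x; split=> //; apply/seteqP; split=> s; have [c [n [e uc]]] := num s; have [_ _ PM _ PP] := pP.
  rewrite /nonunits /= uc // => nc; have : (nonunits N x) c by [].
  rewrite ex /= -e => /PP [//|/(primeX pP)]; by move/(prime_not_unit pP ua).
 move=> Ps; rewrite /nonunits /= uc // -/(nonunits N x c).
 by rewrite -[~ _]/(nonunits N x c) ex /= -e mulrC; exact: PM.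
- move=> x y Dx Dy e; apply: inj; [exact: germ_unit_sub Dx|exact: germ_unit_sub Dy|].
 apply/seteqP; split=> s; rewrite /nonunits /=.
  by rewrite -!(gr s) // => h; have : nonunits D x (r s) by []; rewrite e.
 by rewrite -!(gr s) // => h; have : nonunits D y (r s) by []; rewrite -e.
- move=> x V oV Vx Dx; have [b [ub hb]] := base x V oV Vx (germ_unit_sub Dx). exists (r b); split; first exact/gr.
 by move=> y uy; apply: hb; apply/gr => //; exact: germ_unit_sub uy. move=> s; have [c [n [e uc]]] := num s.
have hV : basicO s `<=` N by move=> x /germ_unit_sub /germ_unit_sub.
have eV : oset (basicO s) = [set x | germ_unit (c * a) x]. apply/seteqP; split=> x /=.
  by move=> us; have Dx := germ_unit_sub us; apply/germ_unitM; split=> //; exact/uc.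
 by move=> /germ_unitM [uc' ua']; apply/uc. have [uca lf' lk'] := loc (c * a) (basicO s) hV eV.
have rr t : restr (bsub s) (r t) = restr hV t by exact: restrR. have [al hal] := ua. split.
- apply: is_unit_local => x ux; apply: (germ_unit_geq (geq_sym (geq_restr (bsub s) s ux))). exact: ux.
- move=> b; have [k [d ed]] := lf' b; exists k, (r d * (al ^+ n * al) ^+ k).
 rewrite rmorphM rr -ed -rr rmorphM -e; rewrite !rmorphM !rmorphXn !exprMn -!rmorphXn.
 have h1 : restr (bsub s) (r a) * restr (bsub s) al = 1 by rewrite -rmorphM hal rmorph1.
 rewrite !rmorphXn !rmorphM !rmorphXn.
 transitivity (b * restr (bsub s) s ^+ k * ((restr (bsub s) (r a) * restr (bsub s) al) ^+ (n * k) * (restr (bsub s) (r a) * restr (bsub s) al) ^+ k)).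
  by rewrite h1 !expr1n !mulr1. by rewrite !exprMn !exprM; ring. move=> t et; have [c' [m [e' _]]] := num t.
have : restr hV c' = 0 by rewrite -rr -e' rmorphM et mul0r. move=> /lk' [k ek]; exists k.
have : r ((c * a) ^+ k * c') = 0 by rewrite ek rmorph0. rewrite rmorphM rmorphXn rmorphM -e -e' => h0.
have uu : is_unit ((r a ^+ n * r a) ^+ k * r a ^+ m).
 by apply: is_unitM; apply: is_unitX => //; apply: is_unitM => //; exact: is_unitX.
apply: (unit_cancel uu); rewrite mulr0 -[RHS]h0 !exprMn; ring. Qed.

Lemma affine_nbhd (X : scheme) (U : opens X) x : oset U x ->
 exists N : opens X, [/\ oset N x, affine_open N & N `<=` U].
move=> Ux; have [N Nx aN] := scheme_affine_cover x. have [_ _ _ base _] := affine_elim aN.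
have [a [ua ha]] := base x (oset U) (oset_open U) Ux Nx. by exists (basicO a); split=> //; exact: affine_basic. Qed.

Lemma affine_nbhd_in (X : scheme) (N U : opens X) x : affine_open N -> oset N x -> oset U x ->
 exists a : sections N, germ_unit a x /\ basicO a `<=` U.
by move=> /affine_elim [_ _ _ base _] Nx Ux; exact: (base x (oset U) (oset_open U) Ux Nx). Qed.

(** * Morphisms of schemes *)

Lemma rmorph_ext (A B : cring) (f g : A ~> B) : f =1 g -> f = g.
case: f g => [f [[f1] [f2]]] [g [[g1] [g2]]] /= e. have {}e : f = g by apply/funext.
by subst g; rewrite (Prop_irrelevance f1 g1) (Prop_irrelevance f2 g2). Qed.

Section MorTheory.
Variables W Z : scheme.

Lemma mor_geq (f : mor W Z) w (U V : opens Z) (s : sections U) (t : sections V) :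
 geqg (f w) s t -> geqg w (mor_sec f U s) (mor_sec f V t).
move=> [A [h [h' [Ax e]]]]. have k : opre f A `<=` opre f U by move=> y /h.
have k' : opre f A `<=` opre f V by move=> y /h'.
by exists (opre f A), k, k'; split=> //; rewrite -(mor_nat h) e (mor_nat h'). Qed.

Lemma mor_germ_unit (f : mor W Z) w (V : opens Z) (s : sections V) :
 oset V (f w) -> germ_unit (mor_sec f V s) w <-> germ_unit s (f w).
move=> Vw; split; first exact: mor_local. move=> [A [h [Ax us]]]. have k : opre f A `<=` opre f V by move=> y /h.
exists (opre f A), k; split=> //; rewrite -(mor_nat h). exact: unit_morph. Qed.

Lemma mor_ext (f g : mor W Z) : (forall w, f w = g w) ->
 (forall (V : opens Z) (s : sections V) w, oset V (f w) -> geqg w (mor_sec f V s) (mor_sec g V s)) -> f = g.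
case: f g => [f fo fs fn fl] [g go gs gn gl] /= e es. have {}e : f = g by apply/funext.
subst g; have eo : fo = go by exact: Prop_irrelevance. subst go; have {}es : fs = gs.
 apply: functional_extensionality_dep => V; apply: rmorph_ext => s; apply: geq_eq => w Vw. exact: es.
by subst gs; rewrite (Prop_irrelevance fn gn) (Prop_irrelevance fl gl). Qed.

Section Make.
Variables (f : W -> Z) (rho : forall (w : W) (V : opens Z), sections V -> forall O : opens W, sections O -> Prop).
Hypothesis fo : forall V : set Z, open V -> open (f @^-1` V).
Hypothesis rex : forall (V : opens Z) (s : sections V) w, oset V (f w) ->
 exists (O : opens W) (t : sections O), [/\ oset O w, oset O `<=` f @^-1` oset V &
  forall w', oset O w' -> rho w' s t].
Hypothesis runiq : forall w (V : opens Z) (s : sections V) (O O' : opens W) (t : sections O) (t' : sections O'),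
 rho w s t -> rho w s t' -> geqg w t t'.
Hypothesis rgeq : forall w (V : opens Z) (s : sections V) (O O' : opens W) (t : sections O) (t' : sections O'),
 rho w s t -> geqg w t t' -> rho w s t'.
Hypothesis rnat : forall w (V V' : opens Z) (h : V' `<=` V) (s : sections V) (O : opens W) (t : sections O),
 oset V' (f w) -> rho w s t -> rho w (restr h s) t.
Hypothesis rD : forall w (V : opens Z) (s s' : sections V) (O : opens W) (t t' : sections O),
 rho w s t -> rho w s' t' -> rho w (s + s') (t + t').
Hypothesis rM : forall w (V : opens Z) (s s' : sections V) (O : opens W) (t t' : sections O),
 rho w s t -> rho w s' t' -> rho w (s * s') (t * t').
Hypothesis r1 : forall w (V : opens Z) (O : opens W), oset V (f w) -> oset O w ->
 rho w (1 : sections V) (1 : sections O).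
Hypothesis rloc : forall w (V : opens Z) (s : sections V) (O : opens W) (t : sections O),
 oset V (f w) -> rho w s t -> germ_unit t w -> germ_unit s (f w).

Let pre := preim_opens fo.

Let sec_exists (V : opens Z) (s : sections V) : exists t : sections (pre V),
 forall w, oset V (f w) -> rho w s t.
pose F w (Vw : oset (pre V) w) : {O : opens W & sections O} :=
 existT _ (sval (cid (rex s Vw))) (sval (cid (svalP (cid (rex s Vw))))).
have FP w (Vw : oset (pre V) w) : [/\ oset (projT1 (F w Vw)) w, oset (projT1 (F w Vw)) `<=` f @^-1` oset V &
  forall w', oset (projT1 (F w Vw)) w' -> rho w' s (projT2 (F w Vw))].
 exact: (svalP (cid (svalP (cid (rex s Vw))))). have [|x y Ux Uy z Fx Fy|t tP] := @glue_germs W (pre V) F.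
- by move=> x Ux; case: (FP x Ux).
- by apply: (@runiq z V s); [case: (FP x Ux) => _ _; exact|case: (FP y Uy) => _ _; exact].
exists t => w Vw; have [Fw _ h] := FP w Vw. exact: rgeq (h w Fw) (geq_sym (tP w Vw)). Qed.

Let sec V s := sval (cid (@sec_exists V s)).
Let secP V s w : oset V (f w) -> rho w s (@sec V s).
exact: (svalP (cid (@sec_exists V s))). Qed.
Let sec_uniq V (s : sections V) (t : sections (pre V)) : (forall w, oset V (f w) -> rho w s t) -> t = sec s.
by move=> h; apply: geq_eq => w Vw; apply: (runiq (h w Vw)); exact: secP. Qed.

Let sec_hom V : exists g : sections V ~> sections (pre V), g =1 @sec V.
apply: rmorph_make.
- by move=> s t; symmetry; apply: sec_uniq => w Vw; apply: rD; exact: secP.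
- by move=> s t; symmetry; apply: sec_uniq => w Vw; apply: rM; exact: secP.
- by symmetry; apply: sec_uniq => w Vw; exact: r1. Qed.

(** [rho w s t] reads: the germ of [t] at [w] is the pull-back of [s]. Local existence and
    uniqueness of such germs let them glue to comorphisms; the remaining hypotheses on [rho] make
    these natural, multiplicative and local. *)
Lemma mor_make : exists g : mor W Z, (forall w, g w = f w) /\
 forall (V : opens Z) (s : sections V) w, oset V (f w) -> rho w s (mor_sec g V s).
pose gs V := sval (cid (sec_hom V)). have gsE V s : gs V s = sec s by exact: (svalP (cid (sec_hom V))).
have nat (V V' : opens Z) (h : V' `<=` V) (h' : pre V' `<=` pre V) (s : sections V) :
  gs V' (restr h s) = restr h' (gs V s). rewrite !gsE; symmetry; apply: sec_uniq => w Vw.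
 apply: rnat => //; apply: rgeq (secP s (h _ Vw)) _. by apply: geq_sym; exact: geq_restr.
have loc (V : opens Z) (s : sections V) w : oset V (f w) -> germ_unit (gs V s) w -> germ_unit s (f w).
 by move=> Vw; rewrite gsE; apply: rloc => //; exact: secP. exists (@Mor W Z f fo gs nat loc); split=> // V s w Vw.
by rewrite /= gsE; exact: secP. Qed.
End Make.
End MorTheory.

(* [c/a] represents the germ of [s] *)
Definition grel (X : ringed_space) (x : X) (U V : opens X) (s : sections U) (a c : sections V) : Prop :=
 exists A : opens X, oset A x /\ (A `<=` U /\ A `<=` V) /\
  forall (B : opens X) (h : B `<=` U) (k : B `<=` V), B `<=` A -> restr h s * restr k a = restr k c.

Lemma grel_intro (X : ringed_space) (x : X) (U V A : opens X) (s : sections U) (a c : sections V)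
  (h : A `<=` U) (k : A `<=` V) : oset A x -> restr h s * restr k a = restr k c -> grel x s a c.
move=> Ax e; exists A; split=> //; split=> // B h' k' BA.
by have := congr1 (restr BA) e; rewrite rmorphM !(restrR _ _ h') !(restrR _ _ k'). Qed.

Section Grel.
Variables (X : ringed_space) (x : X).

Lemma grel_geq (U U' V V' : opens X) (s : sections U) (s' : sections U') (a c : sections V) (a' c' : sections V') :
 geqg x s s' -> geqg x a a' -> geqg x c c' -> grel x s a c -> grel x s' a' c'.
move=> [A [h [h' [Ax e]]]] [A1 [h1 [h1' [Ax1 e1]]]] [A2 [h2 [h2' [Ax2 e2]]]] [B [Bx [[k k'] hB]]].
pose C := capO (capO A A1) (capO A2 B). have CA : C `<=` A by move=> y [[]]. have CA1 : C `<=` A1 by move=> y [[]].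
have CA2 : C `<=` A2 by move=> y [_ []]. have CB : C `<=` B by move=> y [_ []].
apply: (@grel_intro _ _ _ _ C _ _ _ (subOt CA h') (subOt CA1 h1')); first by split; split.
have := hB C (subOt CA h) (subOt CA1 h1) CB. rewrite -(restrR h CA) e (restrR h' _ (subOt CA h')).
rewrite -(restrR h1 CA1 _ a) e1 (restrR h1' _ (subOt CA1 h1')) => ->.
rewrite (restr_pi _ (subOt CA2 h2)) -(restrR h2 CA2) e2 (restrR h2' _ (subOt CA2 h2')). exact: restr_pi. Qed.

Lemma grelD (U V : opens X) (s s' : sections U) (a a' c c' : sections V) :
 grel x s a c -> grel x s' a' c' -> grel x (s + s') (a * a') (c * a' + c' * a).
move=> [A [Ax [[h k] e]]] [A' [Ax' [_ e']]]; exists (capO A A'); split=> //.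
split=> [|B hB kB BA]; first by split=> y [Ay _]; [exact: h|exact: k].
have BA1 : B `<=` A by move=> y /BA []. have BA2 : B `<=` A' by move=> y /BA [].
rewrite !rmorphD !rmorphM -(e B hB kB BA1) -(e' B hB kB BA2); ring. Qed.

Lemma grelM (U V : opens X) (s s' : sections U) (a a' c c' : sections V) :
 grel x s a c -> grel x s' a' c' -> grel x (s * s') (a * a') (c * c').
move=> [A [Ax [[h k] e]]] [A' [Ax' [_ e']]]; exists (capO A A'); split=> //.
split=> [|B hB kB BA]; first by split=> y [Ay _]; [exact: h|exact: k].
have BA1 : B `<=` A by move=> y /BA []. have BA2 : B `<=` A' by move=> y /BA [].
rewrite !rmorphM -(e B hB kB BA1) -(e' B hB kB BA2); ring. Qed.

Lemma grel_cross (U V : opens X) (s : sections U) (a a' c c' : sections V) :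
 grel x s a c -> grel x s a' c' -> geqg x (c * a') (c' * a).
move=> [A [Ax [[h k] e]]] [A' [Ax' [_ e']]]. have k1 : capO A A' `<=` V by move=> y [/k].
have h1 : capO A A' `<=` U by move=> y [/h]. exists (capO A A'), k1, k1; split=> //.
rewrite !rmorphM -(e _ h1 k1 (@capl _ A A')) -(e' _ h1 k1 (@capr _ A A')); ring. Qed.

Lemma geq_cancel (U : opens X) (u s t : sections U) : germ_unit u x -> geqg x (u * s) (u * t) -> geqg x s t.
move=> [A [h [Ax uu]]] [B [k [k' [Bx e]]]].
exists (capO A B), (subOt (@capl _ A B) h), (subOt (@capl _ A B) h); split=> //.
have uu' : is_unit (restr (subOt (@capl _ A B) h) u). by rewrite -(restrR h (@capl _ A B)); exact: unit_morph.
apply: (unit_cancel uu'); rewrite -!rmorphM. have := congr1 (restr (@capr _ A B)) e.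
by rewrite !(restrR _ _ (subOt (@capl _ A B) h)). Qed.

Lemma grel_uniq (U U' V : opens X) (s : sections U) (s' : sections U') (a a' c c' : sections V) :
 germ_unit a x -> germ_unit a' x -> geqg x (c * a') (c' * a) -> grel x s a c -> grel x s' a' c' -> geqg x s s'.
move=> ua ua' [D [d [d' [Dx ed]]]] [A [Ax [[h k] e]]] [A' [Ax' [[h' k'] e']]]. pose C := capO (capO A A') D.
have CA : C `<=` A by move=> y [[]]. have CA' : C `<=` A' by move=> y [[]]. have CD : C `<=` D by move=> y [].
have Cx : oset C x by split. have CV := subOt CA k. apply: (geq_trans (geq_sym (geq_restr (subOt CA h) s Cx))).
apply: geq_sym; apply: (geq_trans (geq_sym (geq_restr (subOt CA' h') s' Cx))); apply: geq_sym.
have uaa : germ_unit (restr CV a * restr CV a') x.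
 by apply/germ_unitM; split; [apply: germ_unit_geq ua|apply: germ_unit_geq ua']; apply: geq_sym; exact: geq_restr.
apply: (geq_cancel uaa). have := congr1 (restr CD) ed; rewrite !(restrR _ _ CV) !rmorphM => ed'.
have e1 := e C (subOt CA h) CV CA; have e2 := e' C (subOt CA' h') CV CA'.
rewrite (_ : restr CV a * restr CV a' * restr (subOt CA h) s =
       restr CV a * restr CV a' * restr (subOt CA' h') s'); first exact: geq_refl.
transitivity (restr (subOt CA h) s * restr CV a * restr CV a'); first by ring. by rewrite e1 ed' -e2; ring. Qed.

Lemma grel_unit (U V : opens X) (s : sections U) (a c : sections V) :
 germ_unit a x -> grel x s a c -> (germ_unit s x <-> germ_unit c x).
move=> ua [A [Ax [[h k] e]]]; have e1 := e A h k (@subO _ A).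
have ra : germ_unit (restr k a) x by apply: germ_unit_geq ua; apply: geq_sym; exact: geq_restr. split=> u.
 apply: (germ_unit_geq (geq_restr k c Ax)); rewrite -e1; apply/germ_unitM; split=> //.
 by apply: germ_unit_geq u; apply: geq_sym; exact: geq_restr. apply: (germ_unit_geq (geq_restr h s Ax)).
have : germ_unit (restr k c) x by apply: germ_unit_geq u; apply: geq_sym; exact: geq_restr.
by rewrite -e1 => /germ_unitM []. Qed.

Lemma grel1 (U V : opens X) : oset U x -> oset V x -> grel x (1 : sections U) (1 : sections V) 1.
move=> Ux Vx; apply: (@grel_intro _ _ _ _ (capO U V) _ _ _ (@capl _ U V) (@capr _ U V)) => //.
by rewrite !rmorph1 mulr1. Qed.

Lemma grel_self (U : opens X) (s : sections U) : oset U x -> grel x s 1 s.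
by move=> Ux; apply: (@grel_intro _ _ _ _ U _ _ _ (@subO _ U) (@subO _ U)); rewrite // rmorph1 mulr1. Qed.

Lemma affine_grel (N U : opens X) (s : sections U) : affine_open N -> oset N x -> oset U x ->
 exists a c : sections N, [/\ germ_unit a x, basicO a `<=` U & forall y, germ_unit a y -> grel y s a c].
move=> aN Nx Ux; have [a [n [c [h [ua e]]]]] := affine_frac s aN Nx Ux.
have un y : germ_unit a y -> germ_unit (a ^+ n.+1) y. elim: n {e} => [|n IH] uy; first by rewrite expr1.
 by rewrite exprS; apply/germ_unitM; split=> //; exact: IH.
have dn y : germ_unit (a ^+ n.+1) y -> germ_unit a y by rewrite exprS => /germ_unitM [].
(* The exponent [n.+1] keeps the basic open of the denominator equal to that of [a] even when [n] is
   0. *)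
exists (a ^+ n.+1), (c * a); split; first exact: un. by move=> y /dn uy; exact: (h y uy).
move=> y /dn uy; apply: (@grel_intro _ _ _ _ (basicO a) _ _ _ h (bsub a)) => //.
by rewrite rmorphXn exprSr mulrA e rmorphM. Qed.

Lemma affine_geq (N : opens X) (p q : sections N) : affine_open N -> oset N x -> geqg x p q ->
 exists b, germ_unit b x /\ b * p = b * q.
move=> aN Nx [A [h [h' [Ax e]]]]; have [_ _ _ base loc] := affine_elim aN.
have [b [ub hb]] := base x (oset A) (oset_open A) Ax Nx. have [_ _ lk] := loc b (basicO b) (bsub b) erefl.
have [m em] : exists m, b ^+ m * (p - q) = 0.
 apply: lk; rewrite rmorphB; have := congr1 (restr (hb : basicO b `<=` A)) e.
 by rewrite !(restrR _ _ (bsub b)) => ->; rewrite subrr.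
exists (b ^+ m); split; last by apply/subr0_eq; rewrite -mulrBr.
elim: m {em} => [|m IH]; first by rewrite expr0; apply: is_unit_germ => //; exact: is_unit1.
by rewrite exprS; apply/germ_unitM; split. Qed.
End Grel.

Lemma mor_grel (W Z : scheme) (f : mor W Z) w (U V : opens Z) (s : sections U) (a c : sections V) :
 grel (f w) s a c -> grel w (mor_sec f U s) (mor_sec f V a) (mor_sec f V c).
move=> [A [Ax [[h k] e]]]. have h1 : opre f A `<=` opre f U by move=> y /h.
have k1 : opre f A `<=` opre f V by move=> y /k. apply: (@grel_intro _ _ _ _ (opre f A) _ _ _ h1 k1) => //.
by rewrite -(mor_nat h) -!(mor_nat k) -(e A h k (@subO _ A)) rmorphM. Qed.

Section AffineTarget.
Variables (W Z : scheme) (N : opens Z).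
Hypothesis aN : affine_open N.

Lemma affine_target_ext (f g : mor W Z) : (forall w, oset N (f w)) -> (forall w, oset N (g w)) ->
 (forall (a : sections N) w, geqg w (mor_sec f N a) (mor_sec g N a)) -> f = g.
move=> fN gN e; have [_ _ inj _ _] := affine_elim aN. have fg w : f w = g w.
 apply: inj => //; apply/seteqP; split=> a; rewrite /nonunits /= => h u; apply: h.
  by apply/mor_germ_unit => //; apply: (germ_unit_geq (geq_sym (e a w))); exact/mor_germ_unit.
 by apply/mor_germ_unit => //; apply: (germ_unit_geq (e a w)); exact/mor_germ_unit. apply: mor_ext => // V s w Vw.
have [a [c [ua _ h]]] := affine_grel s aN (fN w) Vw. have h1 := mor_grel (h _ ua).
have h2 : grel w (mor_sec g V s) (mor_sec g N a) (mor_sec g N c). by apply: mor_grel; rewrite -fg; exact: h.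
have Ow (b : sections N) : geqg w (mor_sec g N b) (mor_sec f N b) by apply: geq_sym; exact: e.
have Vg : oset (opre g V) w by rewrite /= -fg. have h3 := grel_geq (geq_refl (mor_sec g V s) Vg) (Ow a) (Ow c) h2.
have uf : germ_unit (mor_sec f N a) w by apply/mor_germ_unit.
by apply: (grel_uniq uf uf _ h1 h3); apply: geq_refl; exact: fN. Qed.

(** A point [w] goes to the point of [N] whose prime is the preimage of the nonunits at [w], and a
    section represented by [c / a] pulls back to the germ represented by [psi c / psi a]. *)
Lemma affine_target_mor (psi : sections N ~> sections (topO W)) :
 exists f : mor W Z, (forall w, oset N (f w)) /\ forall (a : sections N) w, geqg w (mor_sec f N a) (psi a).
have [pr surj inj base loc] := affine_elim aN.
have ex w : exists x, oset N x /\ nonunits N x = psi @^-1` (nonunits (topO W) w).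
 by apply: surj; apply: preim_prime; exact: nonunits_prime. have [f fP] := choice ex.
have fN w : oset N (f w) by case: (fP w). have fE w a : germ_unit a (f w) <-> germ_unit (psi a) w.
 have [_ e] := fP w; split=> u; apply: contrapT => nu.
  by have : (psi @^-1` (nonunits (topO W) w)) a by []; rewrite -e. by have : (nonunits N (f w)) a by []; rewrite e.
pose rho w (V : opens Z) (s : sections V) (O : opens W) (t : sections O) :=
 exists a c : sections N, [/\ germ_unit a (f w), grel (f w) s a c & grel w t (psi a) (psi c)].
have [|||||||||g [gf gr]] := @mor_make W Z f rho.
- move=> V oV; rewrite openE => w Vw; have [a [ua ha]] := base _ V oV Vw (fN w).
 rewrite /interior nbhsE /=; exists [set w' | germ_unit (psi a) w']. by split; [exact: germ_unit_open|exact/fE].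
 by move=> w' /fE; exact: ha.
- move=> V s w Vw; have [a [c [ua sub h]]] := affine_grel s aN (fN w) Vw.
 have [v hv] : is_unit (restr (bsub (psi a)) (psi a)).
  apply: is_unit_local => y uy; apply: germ_unit_geq (uy); apply: geq_sym; exact: geq_restr.
 exists (basicO (psi a)), (v * restr (bsub (psi a)) (psi c)); split.
 + exact/fE.
 + by move=> w' /fE; exact: sub. move=> w' uw'; exists a, c; split; [exact/fE|by apply: h; exact/fE|].
 apply: (@grel_intro _ _ _ _ (basicO (psi a)) _ _ _ (@subO _ _) (bsub (psi a))) => //.
 by rewrite restr_id mulrAC [v * _]mulrC hv mul1r.
- move=> w V s O O' t t' [a [c [ua h k]]] [a' [c' [ua' h' k']]].
 apply: (grel_uniq _ _ _ k k'); [exact/fE|exact/fE|]. have [b [ub eb]] := affine_geq aN (fN w) (grel_cross h h').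
 have ub' : germ_unit (psi b) w by exact/fE. by apply: (geq_cancel ub'); rewrite -!rmorphM eb; exact: geq_refl.
- move=> w V s O O' t t' [a [c [ua h k]]] e; exists a, c; split=> //. by apply: (grel_geq e _ _ k); exact: geq_refl.
- move=> w V V' h s O t V'w [a [c [ua k k']]]; exists a, c; split=> //.
 by apply: (grel_geq _ _ _ k); [apply: geq_sym; exact: geq_restr|exact: geq_refl|exact: geq_refl].
- move=> w V s s' O t t' [a [c [ua h k]]] [a' [c' [ua' h' k']]].
 exists (a * a'), (c * a' + c' * a); rewrite rmorphD !rmorphM; split; [exact/germ_unitM|exact: grelD|].
 exact: grelD.
- move=> w V s s' O t t' [a [c [ua h k]]] [a' [c' [ua' h' k']]].
 exists (a * a'), (c * c'); rewrite !rmorphM; split; [exact/germ_unitM|exact: grelM|exact: grelM].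
- move=> w V O Vw Ow; exists 1, 1; rewrite rmorph1; split; [|exact: grel1|exact: grel1].
 by apply: is_unit_germ => //; exact: is_unit1.
- move=> w V s O t Vw [a [c [ua h k]]] ut; apply/(grel_unit ua h); apply/fE.
 by apply/(grel_unit _ k) => //; exact/fE. exists g; split=> [w|a w]; first by rewrite gf.
have [b [c [ub h k]]] := gr N a w (fN w). have ub' : germ_unit (psi b) w by exact/fE. have Nw := fN w.
have [d [ud ed]] := affine_geq aN Nw (grel_cross h (grel_self a Nw)).
apply: (grel_uniq (a' := 1) (c' := psi a) ub' _ _ k).
- by apply: is_unit_germ => //; exact: is_unit1.
- have ud' : germ_unit (psi d) w by exact/fE.
 apply: (geq_cancel ud'); rewrite -(rmorph1 psi) -!rmorphM ed; exact: geq_refl. exact: grel_self. Qed.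
End AffineTarget.

Record topology_data := TopologyData {
 td_car :> Type;
 td_open : set (set td_car);
 td_openT : td_open setT;
 td_openI : forall A B, td_open A -> td_open B -> td_open (A `&` B);
 td_openU : forall (I : Type) (F : I -> set td_car), (forall i, td_open (F i)) ->
  td_open (\bigcup_i F i) }.

Definition space_of (d : topology_data) : Type := td_car d.
HB.instance Definition _ (d : topology_data) := gen_eqMixin (space_of d).
HB.instance Definition _ (d : topology_data) := gen_choiceMixin (space_of d).
HB.instance Definition _ (d : topology_data) :=
 isOpenTopological.Build (space_of d) (@td_openT d) (@td_openI d) (@td_openU d).

Lemma space_openE (d : topology_data) (A : set (space_of d)) : open A = td_open A.
by []. Qed.

(** * Open subschemes *)

Lemma opens_eq (X : topologicalType) (U V : opens X) : oset U = oset V -> U = V.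
case: U V => [U oU] [V oV] /= e; subst V; congr Opens; exact: Prop_irrelevance. Qed.

Section OpenSubscheme.
Variables (X : scheme) (O : opens X).

Definition sub_car := {x : X | oset O x}.
Definition img (A : set sub_car) : set X := [set x | exists h : oset O x, A (exist _ x h)].

Lemma img_sval A (y : sub_car) : img A (sval y) <-> A y.
case: y => x h /=; split=> [[h' Ax]|Ax]; last by exists h. by rewrite (Prop_irrelevance h h'). Qed.

Let sub_open := [set A | open (img A)].
Let subT' : sub_open setT.
rewrite /sub_open /=; rewrite (_ : img setT = oset O); first exact: oset_open.
by apply/seteqP; split=> x; [move=> [h]|move=> h; exists h]. Qed.
Let subI A B : sub_open A -> sub_open B -> sub_open (A `&` B).
rewrite /sub_open /= => oA oB; rewrite (_ : img (A `&` B) = img A `&` img B); first exact: openI.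
apply/seteqP; split=> x; first by move=> [h [? ?]]; split; exists h.
by move=> [[h Ah] [h' Bh']]; exists h; split=> //; rewrite (Prop_irrelevance h h'). Qed.
Let subU (I : Type) (F : I -> set sub_car) : (forall i, sub_open (F i)) -> sub_open (\bigcup_i F i).
rewrite /sub_open /= => oF; rewrite (_ : img _ = \bigcup_i img (F i)); first exact: bigcup_open.
apply/seteqP; split=> x; first by move=> [h [i _ Fi]]; exists i => //; exists h.
by move=> [i _ [h Fi]]; exists h, i. Qed.

Definition sub_top := TopologyData subT' subI subU.
Definition sub_space : topologicalType := space_of sub_top.

Definition imgO (V : opens sub_space) : opens X := Opens (oset_open V : open (img V)).

Lemma imgO_sub (V V' : opens sub_space) : V' `<=` V -> imgO V' `<=` imgO V.
by move=> h x [Ox Vx]; exists Ox; exact: h. Qed.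

(** The sections over [V] are, by definition, the sections of [X] over the image of [V], so germs on
    the subscheme and on [X] can be compared directly. *)
Definition opn_ringed : ringed_space.
refine (@RingedSpace sub_space (fun V => sections (imgO V)) (fun U V h => restr (imgO_sub h)) _ _ _).
- by move=> U h s; exact: restr_id.
- by move=> U V W h1 h2 h3 s; exact: restr_comp. move=> I U V h s cov compat; apply: restr_glue.
 by move=> x [Ox /cov [i _ Vi]]; exists i => //; exists Ox. move=> i j W hi hj.
have oW : open ([set y : sub_space | oset W (sval y)]).
 rewrite space_openE /=; rewrite /sub_open /= (_ : img _ = oset W `&` oset O). by apply: openI; exact: oset_open.
 by apply/seteqP; split=> x; [move=> [Ox Wx]|move=> [Wx Ox]; exists Ox]. pose W' : opens sub_space := Opens oW.
have h1 : W' `<=` V i by move=> y /hi /(img_sval (oset (V i)) y).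
have h2 : W' `<=` V j by move=> y /hj /(img_sval (oset (V j)) y).
have WW : W `<=` imgO W' by move=> x Wx; have [Ox _] := hi x Wx; exists Ox.
have := congr1 (restr WW) (compat i j W' h1 h2). by rewrite !(restrR _ _ hi) !(restrR _ _ hj). Defined.

Lemma opn_germ_unit (V : opens sub_space) (s : sections (imgO V)) (y : sub_space) :
 @germ_unit opn_ringed V s y <-> germ_unit s (sval y).
split=> [[A [h [Ay us]]]|[A [h [Ay us]]]]. by exists (imgO A), (imgO_sub h); split=> //; apply/img_sval.
have oA : open ([set y : sub_space | oset A (sval y)]).
 rewrite space_openE /=; rewrite /sub_open /= (_ : img _ = oset A `&` oset O). by apply: openI; exact: oset_open.
 by apply/seteqP; split=> x; [move=> [Ox Ax]|move=> [Ax Ox]; exists Ox]. pose A' : opens sub_space := Opens oA.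
have h1 : A' `<=` V by move=> z /h /(img_sval (oset V) z). exists A', h1; split=> //.
have AA : imgO A' `<=` A by move=> x []. have -> : @restr opn_ringed V A' h1 s = restr AA (restr h s).
 by rewrite (restrR _ _ (imgO_sub h1)); exact: restr_pi. exact: unit_morph. Qed.

Lemma opn_cover (y : opn_ringed) : exists2 U : opens opn_ringed, oset U y & affine_open U.
have [N [Ny aN NO]] := affine_nbhd (svalP y : oset O (sval y)).
have oN : open ([set z : sub_space | oset N (sval z)]).
 rewrite space_openE /=; rewrite /sub_open /= (_ : img _ = oset N); first exact: oset_open.
 by apply/seteqP; split=> x; [move=> []|move=> Nx; exists (NO _ Nx)].
pose U : opens sub_space := Opens oN; exists U => //. have eN : imgO U = N.
 by apply: opens_eq; apply/seteqP; split=> x; [move=> []|move=> Nx; exists (NO _ Nx)].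
have aU : affine_open (imgO U) by rewrite eN. have [pr surj inj base loc] := affine_elim aU.
have imU (z : sub_space) : oset U z <-> oset (imgO U) (sval z) by rewrite -img_sval.
have nuE (z : sub_space) : @nonunits opn_ringed U z = nonunits (imgO U) (sval z).
 by apply/seteqP; split=> s; rewrite /nonunits /= => h u; apply: h; apply/opn_germ_unit. apply: affine_make.
- by move=> z /imU Uz; rewrite nuE; exact: pr.
- move=> P pP; have [x [Ux ex]] := surj P pP. have Ox : oset O x by case: Ux.
 by exists (exist _ x Ox); split; [apply/imU|rewrite nuE].
- move=> [z hz] [w hw] Uz Uw; rewrite !nuE /= => /inj e.
 have ezw : z = w by apply: e; [exact: (imU _).1 Uz|exact: (imU _).1 Uw].
 by subst w; rewrite (Prop_irrelevance hz hw).
- move=> z V oV Vz /imU Uz. have [|a [ua ha]] := base (sval z) (img V) oV _ Uz; first exact/img_sval.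
 by exists a; split; [exact/opn_germ_unit|move=> w /opn_germ_unit /ha /img_sval].
move=> a; apply: loc; apply/seteqP; split=> x /=. by move=> [Ox /opn_germ_unit].
move=> ux; have [Ox _] := germ_unit_sub ux; exists Ox; exact/opn_germ_unit. Qed.

Definition opn : scheme := Scheme opn_cover.

Lemma incl_cont (V : set X) : open V -> open ((fun y : opn => sval y) @^-1` V).
move=> oV; rewrite space_openE /= /sub_open /= (_ : img _ = V `&` oset O). by apply: openI => //; exact: oset_open.
by apply/seteqP; split=> x; [move=> [Ox Vx]|move=> [Vx Ox]; exists Ox]. Qed.

Lemma incl_sub (V : opens X) : imgO (preim_opens incl_cont V) `<=` V.
by move=> x []. Qed.

Definition incl : mor opn X.
refine (@Mor opn X (fun y => sval y) incl_cont (fun V => restr (@incl_sub V)) _ _).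
- by move=> V W h h' s; rewrite /= (restrR _ _ (subOt (@incl_sub W) h)) (restrR _ _ (subOt (@incl_sub W) h)).
move=> V s y Vy /opn_germ_unit; apply: germ_unit_geq; apply: geq_restr. by apply/img_sval. Defined.

Lemma opn_geq (V V' : opens sub_space) (s : sections (imgO V)) (t : sections (imgO V')) (y : sub_space) :
 @geqg opn y V V' s t <-> geqg (sval y) s t.
split=> [[A [h [h' [Ay e]]]]|[A [h [h' [Ay e]]]]].
 by exists (imgO A), (imgO_sub h), (imgO_sub h'); split=> //; apply/img_sval.
have h1 : preim_opens incl_cont A `<=` V by move=> z /h /(img_sval (oset V) z).
have h2 : preim_opens incl_cont A `<=` V' by move=> z /h' /(img_sval (oset V') z).
exists (preim_opens incl_cont A), h1, h2; split=> //. have := congr1 (restr (@incl_sub A)) e.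
by rewrite (restrR _ _ (imgO_sub h1)) (restrR _ _ (imgO_sub h2)). Qed.
End OpenSubscheme.

Lemma mor_eq_geq (W Z : scheme) (f g : mor W Z) (V : opens Z) (s : sections V) w :
 f = g -> oset V (f w) -> geqg w (mor_sec f V s) (mor_sec g V s).
by move=> -> Vw; exact: geq_refl. Qed.

Lemma incl_geq (X : scheme) (O V : opens X) (s : sections V) (y : opn O) :
 oset V (sval y) -> geqg (sval y) (mor_sec (incl O) V s : sections (imgO _)) s.
by move=> Vy; apply: geq_restr; apply/img_sval. Qed.

Lemma opn_local_eq (W Z : scheme) (f g : mor W Z) :
 (forall w, exists O : opens W, oset O w /\ mor_comp f (incl O) = mor_comp g (incl O)) -> f = g.
move=> h; have fg w : f w = g w.
 by have [O [Ow e]] := h w; have := congr1 (fun m : mor (opn O) Z => m (exist _ w Ow)) e.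
apply: mor_ext => // V s w Vw; have [O [Ow e]] := h w. pose y : opn O := exist _ w Ow.
have e1 := mor_eq_geq s (e : mor_comp f (incl O) = mor_comp g (incl O)) (Vw : oset V (mor_comp f (incl O) y)).
have /opn_geq e2 := e1. apply: (geq_trans (geq_sym (@incl_geq W O _ (mor_sec f V s) y Vw))).
apply: (geq_trans e2); apply: (@incl_geq W O _ (mor_sec g V s) y). by rewrite /= -fg. Qed.

(* Morphisms on the members of an open cover glue when each of them is pinned down, on smaller
  opens, by a property [Phi]. *)
Lemma opn_glue (W Z : scheme) (Phi : forall O : opens W, mor (opn O) Z -> Prop) :
 (forall w, exists O (g : mor (opn O) Z), oset O w /\ Phi O g) ->
 (forall O (g : mor (opn O) Z) O' (g' : mor (opn O') Z) (y : opn O) (y' : opn O'), Phi O g -> Phi O' g' ->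
   sval y = sval y' -> g y = g' y' /\ forall (V : opens Z) (s : sections V), oset V (g y) ->
    geqg (sval y) (mor_sec g V s : sections (imgO _)) (mor_sec g' V s : sections (imgO _))) ->
 exists g : mor W Z, forall w, exists O (g0 : mor (opn O) Z), [/\ oset O w, Phi O g0 & mor_comp g (incl O) = g0].
move=> ex compat. pose Ow w := sval (cid (ex w)); pose gw w : mor (opn (Ow w)) Z := sval (cid (svalP (cid (ex w)))).
have Oww w : oset (Ow w) w by case: (svalP (cid (svalP (cid (ex w))))).
have Pg w : Phi (Ow w) (gw w) by case: (svalP (cid (svalP (cid (ex w))))).
pose pt w : opn (Ow w) := exist _ w (Oww w). pose f w := gw w (pt w).
have fE w (y : opn (Ow w)) : f (sval y) = gw w y.
 by have [e _] := compat _ _ _ _ (pt (sval y)) y (Pg (sval y)) (Pg w) erefl; exact: e.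
pose rho w (V : opens Z) (s : sections V) (O : opens W) (t : sections O) :=
 geqg w t (mor_sec (gw w) V s : sections (imgO _)).
have inI w (V : opens Z) : oset V (f w) -> oset (imgO (preim_opens (mor_open (gw w)) V)) w.
 by move=> Vw; exists (Oww w). have [|||||||||g [gf gr]] := @mor_make W Z f rho.
- move=> V oV; rewrite openE => w Vw; rewrite /interior nbhsE /=.
 exists (oset (imgO (preim_opens (mor_open (gw w)) (Opens oV)))). by split; [exact: oset_open|exact: inI].
 by move=> x [Ox] /=; rewrite -(fE w (exist _ x Ox)).
- move=> V s w Vw; exists (imgO (preim_opens (mor_open (gw w)) V)), (mor_sec (gw w) V s); split.
 + exact: inI.
 + by move=> x [Ox] /=; rewrite -(fE w (exist _ x Ox)).
 move=> x [Ox Vx]; have [_ h] := compat _ _ _ _ (exist _ x Ox : opn (Ow w)) (pt x) (Pg w) (Pg x) erefl. exact: h.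
- by move=> w V s O O' t t' h h'; apply: (geq_trans h); exact: geq_sym.
- by move=> w V s O O' t t' h e; apply: geq_trans h; exact: geq_sym.
- move=> w V V' h s O t V'w h'; apply: (geq_trans h').
 apply: geq_sym; apply/(@opn_geq _ _ _ _ _ _ (pt w)); apply: mor_geq; exact: geq_restr.
- by move=> w V s s' O t t' h h'; rewrite /rho rmorphD; exact: geqD.
- by move=> w V s s' O t t' h h'; rewrite /rho rmorphM; exact: geqM.
- by move=> w V O Vw Ow'; rewrite /rho rmorph1; apply: geq1 => //; exact: inI.
- move=> w V s O t Vw h ut; have := germ_unit_geq h ut. move=> /(@opn_germ_unit _ _ _ _ (pt w)) u.
 exact: (@mor_local _ _ (gw w) V s (pt w) Vw u). exists g => w; exists (Ow w), (gw w); split=> //.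
apply: mor_ext => [y|V s y Vy]; first by rewrite /= gf fE.
apply/opn_geq; have Vfy : oset V (f (sval y)) by rewrite -gf. have := gr V s (sval y) Vfy; rewrite /rho => h.
apply: (geq_trans (@incl_geq W (Ow w) _ (mor_sec g V s) y Vy)).
apply: (geq_trans h); have [_ k] := compat _ _ _ _ (pt (sval y)) y (Pg _) (Pg w) erefl. exact: k. Qed.

(** * Isomorphisms *)

(** The inverse pulls a section [s] back to the germ [t] whose pull-back along [f] is [s].
    Bijectivity on a basis of opens provides both existence and uniqueness of [t]. *)
Lemma is_iso_local (Y Z : scheme) (f : mor Y Z) (g0 : Z -> Y) : cancel f g0 -> cancel g0 f ->
 (forall V : set Y, open V -> open (g0 @^-1` V)) ->
 (forall z (V : opens Z), oset V z -> exists M : opens Z, [/\ oset M z, M `<=` V &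
  bijective (mor_sec f M)]) -> is_iso f.
move=> fK gK go bij. pose rho z (U : opens Y) (s : sections U) (O : opens Z) (t : sections O) :=
 oset O z /\ geqg (g0 z) s (mor_sec f O t).
have inj z (O O' : opens Z) (t : sections O) (t' : sections O') : oset O z -> oset O' z ->
  geqg (g0 z) (mor_sec f O t) (mor_sec f O' t') -> geqg z t t'. move=> Oz O'z [A [h [h' [Az e]]]].
 have [M [Mz MA [k kK _]]] := bij z (capO (preim_opens go A) (capO O O')) (conj Az (conj Oz O'z)).
 have MO : M `<=` O by move=> x /MA [_ []]. have MO' : M `<=` O' by move=> x /MA [_ []].
 have fMA : opre f M `<=` A by move=> y /MA [/=]; rewrite fK. exists M, MO, MO'; split=> //; apply: (can_inj kK).
 have h1 : opre f M `<=` opre f O by move=> y /MO. have h1' : opre f M `<=` opre f O' by move=> y /MO'.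
 rewrite (mor_nat MO h1) (mor_nat MO' h1').
 by have := congr1 (restr fMA) e; rewrite (restrR _ _ h1) (restrR _ _ h1').
have [|||||||||g [gg gr]] := @mor_make Z Y g0 rho.
- exact: go.
- move=> U s z Uz; have [M [Mz MU [k kK kK']]] := bij z (preim_opens go U) Uz.
 have fMU : opre f M `<=` U by move=> y /MU /=; rewrite fK.
 exists M, (k (restr fMU s)); split=> // z' Mz'; split=> //; rewrite kK'.
 by apply: geq_sym; apply: geq_restr; rewrite /= gK.
- move=> z U s O O' t t' [Oz h] [Oz' h']; apply: inj => //. by apply: (geq_trans (geq_sym h)).
- move=> z U s O O' t t' [Oz h] e; have [A [a [a' [Az _]]]] := e; split; first exact: a'.
 by apply: (geq_trans h); apply: mor_geq; rewrite gK.
- move=> z U U' h s O t U'z [Oz k]; split=> //; apply: geq_trans k. exact: geq_restr.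
- by move=> z U s s' O t t' [Oz h] [_ h']; split=> //; rewrite rmorphD; exact: geqD.
- by move=> z U s s' O t t' [Oz h] [_ h']; split=> //; rewrite rmorphM; exact: geqM.
- by move=> z U O Uz Oz; split=> //; rewrite rmorph1; apply: geq1 => //=; rewrite gK.
- move=> z U s O t Uz [Oz h] ut; apply: (germ_unit_geq (geq_sym h)). by apply/mor_germ_unit; rewrite gK.
exists g; split; apply: mor_ext => [y|V s y Vy] /=; rewrite ?gg ?fK ?gK //.
- have Vy' : oset V (g0 (f y)) by rewrite -gg. have [_ h] := gr V s (f y) Vy'; rewrite fK in h. exact: geq_sym.
- have Vy' : oset V y by move: Vy; rewrite /= gg gK. have Vz : oset (opre f V) (g0 y) by rewrite /= gK.
 have [Oz h] := gr _ (mor_sec f V s) y Vz. by apply: geq_sym; apply: inj h. Qed.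

(** * Sheaves of functions *)

Section FunctionSheaf.
Variables (X : topologicalType) (K : X -> cring).
Variable L : (forall x, K x) -> X -> Prop.
Hypothesis L_local : forall f g x (V : set X), open V -> V x -> (forall y, V y -> f y = g y) -> L f x -> L g x.
Hypothesis L1 : forall x, L (fun=> 1) x.
Hypothesis LB : forall f g x, L f x -> L g x -> L (fun y => f y - g y) x.
Hypothesis LM : forall f g x, L f x -> L g x -> L (fun y => f y * g y) x.

(** With functions extended by zero, restriction is truncation and gluing is pointwise; only the
    local condition [L] has to be verified. *)
Definition fs_class (U : opens X) : function_class K (oset U).
exists [set f | (forall x, ~ oset U x -> f x = 0) /\ (forall x, oset U x -> L f x)].
- split=> [x nx|x Ux]; first by case: asboolP. by apply: (L_local (oset_open U) Ux) (L1 x) => y Uy; case: asboolP.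
- move=> f g [f0 fL] [g0 gL]; split=> [x nx|x Ux]; first by rewrite f0 // g0 // subrr.
 by apply: LB; [exact: fL|exact: gL].
- move=> f g [f0 fL] [g0 gL]; split=> [x nx|x Ux]; first by rewrite f0 // mul0r.
 by apply: LM; [exact: fL|exact: gL].
- by move=> f x [f0 _]; exact: f0. Defined.

Let cut (V : opens X) (f : forall x, K x) : forall x, K x := fun x => if `[< oset V x >] then f x else 0.
Let cutE (V : opens X) f x : oset V x -> cut V f x = f x.
by rewrite /cut => Vx; case: asboolP. Qed.

Lemma fs_restr_exists (U V : opens X) : V `<=` U -> exists r : fring (fs_class U) ~> fring (fs_class V),
  forall f x, sval (r f) x = if `[< oset V x >] then sval f x else 0.
move=> h; have [||||r rE] := @fring_hom X K (oset V) (fs_class V) (fring (fs_class U)) (fun f => cut V (sval f)).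
- move=> f; split=> [x nx|x Vx]; first by rewrite /cut; case: asboolP.
 apply: (L_local (oset_open V) Vx) ((svalP f).2 x (h _ Vx)) => y Vy; by rewrite cutE.
- by move=> f g x; rewrite /cut fringD; case: asboolP; rewrite ?addr0.
- by move=> f g x; rewrite /cut fringM; case: asboolP; rewrite ?mulr0.
- by move=> x Vx; rewrite cutE // fring_oneE //; exact: h. by exists r => f x; rewrite rE. Qed.

Definition fs_restr (U V : opens X) (h : V `<=` U) := sval (cid (fs_restr_exists h)).
Lemma fs_restrE (U V : opens X) (h : V `<=` U) f x :
 sval (fs_restr h f) x = if `[< oset V x >] then sval f x else 0.
exact: (svalP (cid (fs_restr_exists h))). Qed.
Lemma fs_restr_in (U V : opens X) (h : V `<=` U) f x : oset V x -> sval (fs_restr h f) x = sval f x.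
by rewrite fs_restrE => Vx; case: asboolP. Qed.
Lemma fs_out (U : opens X) (f : fring (fs_class U)) x : ~ oset U x -> sval f x = 0.
exact: (svalP f).1. Qed.

Lemma fs_eq (U : opens X) (f g : fring (fs_class U)) : (forall x, oset U x -> sval f x = sval g x) -> f = g.
move=> e; apply: fring_eq => x; have [Ux|nx] := pselect (oset U x); first exact: e. by rewrite !fs_out. Qed.

Lemma fs_make (U : opens X) (f : forall x, K x) : (forall x, oset U x -> L f x) ->
 exists g : fring (fs_class U), forall x, oset U x -> sval g x = f x.
move=> fL; have h : fclass (fs_class U) (cut U f). split=> [x nx|x Ux]; first by rewrite /cut; case: asboolP.
 by apply: (L_local (oset_open U) Ux) (fL x Ux) => y Uy; rewrite cutE.
by exists (exist _ _ h) => x Ux; rewrite /= cutE. Qed.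

Definition fs_space : ringed_space.
refine (@RingedSpace X (fun U => fring (fs_class U)) (fun U V h => fs_restr h) _ _ _).
- by move=> U h s; apply: fs_eq => x Ux; rewrite fs_restr_in.
- by move=> U V W h1 h2 h3 s; apply: fs_eq => x Wx; rewrite !fs_restr_in //; exact: h2. move=> I U V h s cov compat.
have agree i j x : oset (V i) x -> oset (V j) x -> sval (s i) x = sval (s j) x.
 move=> Vi Vj; have e := compat i j (capO (V i) (V j)) (@capl _ _ _) (@capr _ _ _).
 have := congr1 (fun f => sval f x) e. by rewrite !fs_restr_in.
have ex x : exists v : K x, forall i, oset (V i) x -> v = sval (s i) x.
 have [[i Vi]|nex] := pselect (exists i, oset (V i) x). by exists (sval (s i) x) => j Vj; exact: agree.
 by exists 0 => i Vi; case: nex; exists i. pose f x := sval (cid (ex x)).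
have fE i x : oset (V i) x -> f x = sval (s i) x by exact: (svalP (cid (ex x))). have [|t tE] := @fs_make U f.
 move=> x /cov [i _ Vi]; apply: (L_local (oset_open (V i)) Vi) ((svalP (s i)).2 x Vi).
 by move=> y Vy; rewrite (fE i). exists t; split=> [i|t' ht'].
 by apply: fs_eq => x Vx; rewrite fs_restr_in // tE ?(fE i) //; exact: (h i).
apply: fs_eq => x Ux; have [i _ Vi] := cov _ Ux. by rewrite tE // (fE i) // -ht' fs_restr_in. Defined.

Lemma fs_germ_unit (U : opens fs_space) (f : sections U) x : germ_unit f x -> is_unit (sval f x).
move=> [V [h [Vx [g e]]]]; exists (sval g x).
have := congr1 (fun z => sval z x) e; rewrite fringM fs_restr_in // => ->. exact: fring_oneE. Qed.

Lemma geq_fs (U V : opens fs_space) (f : sections U) (g : sections V) (x : fs_space) :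
 geqg x f g -> sval f x = sval g x.
by move=> [A [h [h' [Ax e]]]]; have := congr1 (fun z => sval z x) e; rewrite !fs_restr_in. Qed.
End FunctionSheaf.

(** * Affine schemes *)

Lemma spn_finite (A : cring) (S : set A) x : spn (idfun : A ~> A) setT S x ->
 exists ss : seq A, (forall s, s \in ss -> S s) /\ spn (idfun : A ~> A) setT (els ss) x.
elim=> [|y z _ [ss [hs hy]] _ [tt [ht hz]]|a v _ Sv].
- by exists [::]; split=> //; exact: spn0.
- exists (ss ++ tt); split=> [s|]; first by rewrite mem_cat => /orP [/hs|/ht].
 by apply: spnD; [apply: spn_sub hy|apply: spn_sub hz] => // v /= h; rewrite mem_cat h ?orbT.
exists [:: v]; split=> [s|]; first by rewrite inE => /eqP ->. by apply: spnG => //=; rewrite inE. Qed.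

Lemma prime_spn (A : cring) (P S : set A) x : is_prime_ideal P ->
 (forall s, S s -> P s) -> spn (idfun : A ~> A) setT S x -> P x.
move=> [P0 PD PM _ _] SP; elim=> [|y z _ hy _ hz|a v _ Sv] //; first exact: PD. by apply: PM; exact: SP. Qed.

(** Quasicompactness of a basic open: a power of [a] lies in the ideal generated by [S], and
    finitely many elements of [S] suffice to express it. *)
Lemma finite_cover (A : cring) (a : A) (S : set A) :
 (forall P, is_prime_ideal P -> ~ P a -> exists2 s, S s & ~ P s) ->
 exists ss : seq A, (forall s, s \in ss -> S s) /\
  forall P, is_prime_ideal P -> ~ P a -> exists2 s, s \in ss & ~ P s.
move=> cov; pose idA : A ~> A := idfun. have idI : is_ideal (spn idA setT S).
 by split=> [|x y|x y]; [exact: spn0|exact: spnD|exact: (@spnZ A A idA _ _ _ _ (idealT A))].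
have [|n hn] := radical_of_primes (a := a) idI.
 move=> P pP SP; apply: contrapT => /(cov P pP) [s Ss]; apply; apply: SP.
 by rewrite -[s]mul1r; apply: (@spnG A A idA). have [ss [hs hx]] := spn_finite hn; exists ss; split=> // P pP nPa.
apply: contrapT => nex; apply: nPa; apply: (@primeX _ P _ n pP); apply: prime_spn hx => // s /= sin.
by apply: contrapT => nPs; apply: nex; exists s. Qed.

Section Spec.
Variable A : cring.

Definition spec_car := {P : set A | is_prime_ideal P}.
Let sopen : set (set spec_car) :=
 [set V | forall P, V P -> exists s, ~ sval P s /\ forall Q, ~ sval Q s -> V Q].
Let sopenT : sopen setT.
by move=> P _; exists 1; split=> //; case: (svalP P). Qed.
Let sopenI U V : sopen U -> sopen V -> sopen (U `&` V).
move=> oU oV P [/oU [s [ns hs]] /oV [t [nt ht]]]; exists (s * t); split. exact: (primeM (svalP P)).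
move=> Q nQ; have [_ _ QM _ _] := svalP Q; split; [apply: hs|apply: ht] => h; apply: nQ.
 by rewrite mulrC; exact: QM. exact: QM. Qed.
Let sopenU (I : Type) (F : I -> set spec_car) : (forall i, sopen (F i)) -> sopen (\bigcup_i F i).
move=> oF P [i _ /oF [s [ns hs]]]; exists s; split=> // Q nQ; exists i => //; exact: hs. Qed.
Definition spec_space : topologicalType := space_of (TopologyData sopenT sopenI sopenU).

Lemma specD_open (a : A) : open [set P : spec_space | ~ sval P a].
by rewrite space_openE /= => P nP; exists a. Qed.
Definition specD (a : A) : opens spec_space := Opens (@specD_open a).

Let locex (P : spec_space) := cid (localization_ring (prime_compl_mult (svalP P))).
Definition spec_stalk (P : spec_space) : cring := sval (locex P).
Definition spec_loc (P : spec_space) : A ~> spec_stalk P := sval (cid (svalP (locex P))).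
Let locP (P : spec_space) : [/\ forall s, ~ sval P s -> is_unit (spec_loc P s),
 forall q, exists a s, ~ sval P s /\ q * spec_loc P s = spec_loc P a
 & forall a, spec_loc P a = 0 <-> exists2 s, ~ sval P s & s * a = 0].
exact: (svalP (cid (svalP (locex P)))). Qed.

Definition spec_L (f : forall P, spec_stalk P) (P : spec_space) : Prop :=
 exists a s, ~ sval P s /\ forall Q, ~ sval Q s -> f Q * spec_loc Q s = spec_loc Q a.

Let notM (Q : spec_space) (s t : A) : ~ sval Q (s * t) -> ~ sval Q s /\ ~ sval Q t.
have [_ _ QM _ _] := svalP Q; move=> n; split=> h; apply: n; last exact: QM. by rewrite mulrC; exact: QM. Qed.

Let L_local f g x (V : set spec_space) : open V -> V x -> (forall y, V y -> f y = g y) ->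
 spec_L f x -> spec_L g x.
rewrite space_openE /= => oV /oV [r [nr hr]] e [a [s [ns h]]].
exists (a * r), (s * r); split; first exact: (primeM (svalP x)).
move=> Q /notM [nQs nQr]; rewrite -e; last exact: hr. by rewrite !rmorphM mulrA h. Qed.
Let L1 x : spec_L (fun=> 1) x.
by exists 1, 1; split=> [|Q _]; [case: (svalP x)|rewrite mul1r]. Qed.
Let LB f g x : spec_L f x -> spec_L g x -> spec_L (fun y => f y - g y) x.
move=> [a [s [ns h]]] [b [t [nt k]]]; exists (a * t - b * s), (s * t); split; first exact: (primeM (svalP x)).
by move=> Q /notM [nQs nQt]; rewrite rmorphB !rmorphM -h // -k //; ring. Qed.
Let LM f g x : spec_L f x -> spec_L g x -> spec_L (fun y => f y * g y) x.
move=> [a [s [ns h]]] [b [t [nt k]]]; exists (a * b), (s * t); split; first exact: (primeM (svalP x)).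
by move=> Q /notM [nQs nQt]; rewrite !rmorphM -h // -k //; ring. Qed.

Definition spec_ringed : ringed_space := fs_space L_local L1 LB LM.

Let Lcan a x : spec_L (fun Q => spec_loc Q a) x.
by exists a, 1; split=> [|Q _]; [case: (svalP x)|rewrite rmorph1 mulr1]. Qed.

Lemma spec_can_exists (U : opens spec_ringed) : exists c : A ~> sections U,
 forall a (Q : spec_space), oset U Q -> sval (c a) Q = spec_loc Q a.
have ex a := fs_make L_local L1 LB LM (U := U) (f := fun Q => spec_loc Q a) (fun x _ => Lcan a x).
have [F FE] := choice ex. have [|||c cE] := @rmorph_make A (sections U) F.
- by move=> a b; apply: fs_eq => x Ux; rewrite fringD !FE // rmorphD.
- by move=> a b; apply: fs_eq => x Ux; rewrite fringM !FE // rmorphM.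
- by apply: fs_eq => x Ux; rewrite FE // rmorph1 fring_oneE. by exists c => a Q UQ; rewrite cE FE. Qed.
Definition spec_can (U : opens spec_ringed) := sval (cid (spec_can_exists U)).
Lemma spec_canE (U : opens spec_ringed) a (Q : spec_space) : oset U Q -> sval (spec_can U a) Q = spec_loc Q a.
exact: (svalP (cid (spec_can_exists U))). Qed.

(** The open is given only up to equality of underlying sets, so that the lemma serves both basic
    opens and the whole space, where [a] is 1. *)
Lemma spec_can_loc a (U : opens spec_ringed) : oset U = oset (specD a) -> is_localization a (spec_can U).
move=> eU; have inU (Q : spec_space) : oset U Q <-> ~ sval Q a by rewrite eU.
have zero s : (forall Q : spec_space, ~ sval Q a -> spec_loc Q s = 0) -> exists n, a ^+ n * s = 0.
 move=> h; pose I := [set r | r * s = 0]. have idI : is_ideal I.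
  split=> [|x y|x y]; rewrite /I /= ?mul0r // => hx; first by move=> hy; rewrite mulrDl hx hy addr0.
  by rewrite -mulrA hx mulr0. have [|n hn] := radical_of_primes (a := a) idI; last by exists n.
 move=> P pP IP; apply: contrapT => nPa.
 have [_ _ k] := locP (exist _ P pP); have /k [t nt et] := h (exist _ P pP) nPa. by apply: nt; apply: IP. split.
- have ex (Q : spec_space) : exists v, ~ sval Q a -> spec_loc Q a * v = 1.
  have [Qa|nQa] := pselect (sval Q a); first by exists 0.
  by have [u _ _] := locP Q; have [v hv] := u a nQa; exists v. pose v Q := sval (cid (ex Q)).
 have vE Q : ~ sval Q a -> spec_loc Q a * v Q = 1 by exact: (svalP (cid (ex Q))).
 have [|g gE] := fs_make L_local L1 LB LM (U := U) (f := v).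
  by move=> x /inU nx; exists 1, a; split=> // Q nQ; rewrite mulrC vE // rmorph1.
 exists g; apply: fs_eq => x Ux; rewrite fringM gE // spec_canE // fring_oneE //. by apply: vE; exact/inU.
- move=> f; pose S := [set s | exists b, forall Q : spec_space, ~ sval Q s -> sval f Q * spec_loc Q s = spec_loc Q b].
 have [|ss [hss cov]] := @finite_cover A a S.
  move=> P pP nPa; have /inU UP : ~ sval (exist _ P pP : spec_space) a by [].
  by have [b [s [ns h]]] := (svalP f).2 _ UP; exists s => //; exists b.
 have [b bE] : exists b : A -> A, forall s, s \in ss -> forall Q : spec_space, ~ sval Q s ->
   sval f Q * spec_loc Q s = spec_loc Q (b s).
  have ex s : exists b, s \in ss -> forall Q : spec_space, ~ sval Q s -> sval f Q * spec_loc Q s = spec_loc Q b.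
   by have [/hss [b hb]|] := boolP (s \in ss); [exists b|exists 0]. by have [b hb] := choice ex; exists b.
 (* for any two members of the finite cover the fractions agree up to a power *)
 have cross s t : s \in ss -> t \in ss -> exists m, (s * t) ^+ m * (t * b s - s * b t) = 0. move=> sin tin.
  pose I := [set r | r * (t * b s - s * b t) = 0]. have idI : is_ideal I.
   split=> [|x y|x y]; rewrite /I /= ?mul0r // => hx; first by move=> hy; rewrite mulrDl hx hy addr0.
   by rewrite -mulrA hx mulr0. have [|n hn] := radical_of_primes (a := s * t) idI; last by exists n.
  move=> P pP IP; apply: contrapT => /(notM (Q := exist _ P pP)) [nPs nPt]. have [_ _ k] := locP (exist _ P pP).
  have /k [r nr er] : spec_loc (exist _ P pP) (t * b s - s * b t) = 0. by rewrite rmorphB !rmorphM -!bE //; ring.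
  by apply: nr; apply: IP.
 have [m hm] : exists m, forall s t, s \in ss -> t \in ss -> (s * t) ^+ m * (t * b s - s * b t) = 0.
  have [M hM] : exists M : A -> A -> nat, forall s t, s \in ss -> t \in ss ->
    (s * t) ^+ M s t * (t * b s - s * b t) = 0. have ex (st : A * A) : exists m, st.1 \in ss -> st.2 \in ss ->
     (st.1 * st.2) ^+ m * (st.2 * b st.1 - st.1 * b st.2) = 0.
    have [sin|] := boolP (st.1 \in ss); last by exists 0%N. have [tin|] := boolP (st.2 \in ss); last by exists 0%N.
    by have [m hm] := cross _ _ sin tin; exists m.
   by have [M hM] := choice ex; exists (fun s t => M (s, t)) => s t; exact: (hM (s, t)).
  exists (\max_(x <- allpairs (fun s t => (s, t)) ss ss) M x.1 x.2) => s t sin tin.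
  have le : (M s t <= \max_(x <- allpairs (fun s t => (s, t)) ss ss) M x.1 x.2)%N.
   by apply: (@leq_bigmax_seq _ _ predT (fun x => M x.1 x.2) (s, t)) => //; exact: allpairs_f.
  by rewrite -(subnK le) exprD -mulrA hM // mulr0.
 (* [J] is the ideal of denominators of [f]. The fractions on the finite cover agree after a common
    power [m], so [J] contains the powers [s ^+ m.+1] and therefore a power of [a]. *)
 pose J := [set r | exists c, forall Q : spec_space, ~ sval Q a -> sval f Q * spec_loc Q r = spec_loc Q c].
 have idJ : is_ideal J. split=> [|x y [c hc] [d hd]|x y [c hc]].
  - by exists 0 => Q _; rewrite !rmorph0 mulr0.
  - by exists (c + d) => Q nQ; rewrite !rmorphD mulrDr hc // hd.
  - by exists (x * c) => Q nQ; rewrite !rmorphM mulrCA hc. have sJ s : s \in ss -> J (s ^+ m.+1).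
  move=> sin; exists (s ^+ m * b s) => Q nQ. have [t tin nt] := cov _ (svalP Q) nQ.
  have [u _ _] := locP Q; have ut := u t nt. have e := congr1 (spec_loc Q) (hm s t sin tin).
  apply: (unit_cancel (is_unitX m.+1 ut)). apply/subr0_eq; rewrite -[RHS]oppr0 -(rmorph0 (spec_loc Q)) -e.
  rewrite !rmorphM rmorphB !rmorphXn !rmorphM -(bE t tin Q nt) !exprS !exprMn. ring.
 have [|n [c hc]] := radical_of_primes (a := a) idJ.
  move=> P pP JP; apply: contrapT => nPa; have [s sin ns] := cov P pP nPa.
  by apply: ns; apply: (@primeX _ P _ m.+1 pP); apply: JP; exact: sJ.
 exists n, c; apply: fs_eq => x Ux; rewrite fringM !spec_canE // -hc; last exact/inU.
 by rewrite -[in LHS]rmorphXn (@spec_canE U). move=> s e; apply: zero => Q /inU UQ; rewrite -(spec_canE s UQ) e.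
by []. Qed.

Lemma spec_top_bij : bijective (spec_can (topO spec_ringed)).
have eT : oset (topO spec_ringed) = oset (specD 1). by apply/seteqP; split=> P // _; case: (svalP P).
have [_ surj ker] := spec_can_loc eT. have sj s : exists a, spec_can (topO spec_ringed) a = s.
 by have [n [a e]] := surj s; exists a; rewrite -e rmorph1 expr1n mulr1.
have inj : injective (spec_can (topO spec_ringed)). by apply: raddf_inj => a /ker [n]; rewrite expr1n mul1r.
have [g gE] := choice sj; exists g => // a; apply: inj; exact: gE. Qed.

Lemma spec_germ_unit (U : opens spec_ringed) a (P : spec_ringed) : oset U P ->
 germ_unit (spec_can U a) P <-> ~ sval P a.
move=> UP; split=> [/fs_germ_unit [q]|na].
 rewrite spec_canE // => e Pa; have [_ frac ker] := locP P; have [b [s [ns es]]] := frac q.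
 have : spec_loc P (a * b - s) = 0 by rewrite rmorphB rmorphM -es mulrA e mul1r subrr.
 move=> /ker [t nt et]; have [P0 PD PM P1 PP] := svalP P. have : sval P (t * s).
  rewrite (_ : t * s = t * b * a + (-1) * (t * (a * b - s))); last by ring. by rewrite et mulr0 addr0; apply: PM.
 by move=> /PP []. have h : capO U (specD a) `<=` U by exact: capl. exists (capO U (specD a)), h; split=> //.
have [[v hv] _ _] := @spec_can_loc a (specD a) erefl.
exists (restr (@capr _ U (specD a)) (v : @sections spec_ringed (specD a))).
have -> : restr h (spec_can U a) = restr (@capr _ U (specD a)) (spec_can (specD a) a).
 by apply: fs_eq => x [Ux Dx]; rewrite !fs_restr_in // !spec_canE. by rewrite -rmorphM hv rmorph1. Qed.

Lemma spec_affine : affine_open (topO spec_ringed).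
have [g gK Kg] := spec_top_bij; set c := spec_can (topO spec_ringed) in gK Kg.
have gu a (P : spec_ringed) : germ_unit (c a) P <-> ~ sval P a by exact: spec_germ_unit.
have nuE (P : spec_ringed) a : nonunits (topO spec_ringed) P (c a) <-> sval P a.
 by rewrite /nonunits /= gu; split=> [/contrapT|h]; [|apply]. apply: affine_make.
- move=> P _; have [P0 PD PM P1 PP] := svalP P; split=> [|s t|s t||s t].
 + by rewrite -(rmorph0 c); apply/nuE.
 + rewrite -(Kg s) -(Kg t) -rmorphD => /nuE h /nuE k; apply/nuE; exact: PD.
 + rewrite -(Kg s) -(Kg t) -rmorphM => /nuE h; apply/nuE; exact: PM.
 + by rewrite -(rmorph1 c) => /nuE.
 + rewrite -(Kg s) -(Kg t) -rmorphM => /nuE /PP [h|h]; [left|right]; exact/nuE.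
- move=> P pP; have pP' : is_prime_ideal (c @^-1` P) by exact: preim_prime.
 exists (exist _ _ pP'); split=> //; apply/seteqP; split=> s; rewrite -(Kg s). by move=> /nuE.
 by move=> h; apply/nuE.
- move=> [P pP] [Q pQ] _ _ e; have ePQ : P = Q. apply/seteqP; split=> a h.
   by have := (nuE (exist _ P pP) a).2 h; rewrite e => /nuE.
  by have := (nuE (exist _ Q pQ) a).2 h; rewrite -e => /nuE. by subst Q; rewrite (Prop_irrelevance pP pQ).
- move=> P V oV VP _; move: oV; rewrite space_openE /= => /(_ P VP) [s [ns hs]].
 by exists (c s); split=> [|Q /gu]; [exact/gu|exact: hs]. move=> s; rewrite -(Kg s); set a := g s.
have eD : oset (basicO (c a)) = oset (specD a). by apply/seteqP; split=> P /gu. have [u f k] := spec_can_loc eD.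
have rE b : restr (bsub (c a)) (c b) = spec_can (basicO (c a)) b.
 by apply: fs_eq => P DP; rewrite fs_restr_in // !spec_canE. split; first by rewrite rE.
 by move=> b; have [n [t e]] := f b; exists n, (c t); rewrite !rE.
move=> t; rewrite -(Kg t) rE => /k [n e]; exists n. by rewrite -rmorphXn -rmorphM e rmorph0. Qed.

Definition Spec : scheme := Scheme (fun x : spec_ringed => ex_intro2 _ _ (topO spec_ringed) Logic.I spec_affine).

Lemma spec_compactE (V : set spec_space) : open V -> cover_compact V ->
 exists ss : seq A, V = [set P | exists2 s, s \in ss & ~ sval P s].
rewrite space_openE /= => oV /(_ A [set s | oset (specD s) `<=` V] (fun s => oset (specD s))) [].
- by move=> s _; exact: oset_open.
- by move=> P VP; have [s [ns hs]] := oV P VP; exists s.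
move=> D DV cov; exists (finmap.enum_fset D); apply/seteqP; split=> P. by move=> /cov [s sD nPs]; exists s.
by move=> [s sD nPs]; have /set_mem := DV s sD; apply. Qed.

Lemma spec_compactI (ss : seq A) : cover_compact [set P : spec_space | exists2 s, s \in ss & ~ sval P s].
move=> I D F oF cov.
have loc (s : A) : exists E : {fset I}%fset, {subset E <= D} /\ (s \in ss -> oset (specD s) `<=` cover [set` E] F).
 have [sin|] := boolP (s \in ss); last by exists fset0%fset.
 pose S := [set r | exists2 i, D i & oset (specD r) `<=` F i]. have [|rs [hrs crs]] := @finite_cover A s S.
  move=> P pP nPs; have [|i Di Fi] := cov (exist _ P pP); first by exists s.
  have := oF i Di; rewrite space_openE /= => /(_ _ Fi) [r [nr hr]]. by exists r => //; exists i.
 have [E [ED EF]] : exists E : {fset I}%fset, {subset E <= D} /\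
   forall r, r \in rs -> oset (specD r) `<=` cover [set` E] F.
  elim: rs hrs {crs} => [|r rs IH] hrs; first by exists fset0%fset.
  have [x xrs|E [ED EF]] := IH; first by apply: hrs; rewrite inE xrs orbT. have [i Di Fi] := hrs r (mem_head _ _).
  exists (i |` E)%fset; split=> [x|x]; first by rewrite in_fset1U => /orP [/eqP ->|/ED //]; exact/mem_set.
  rewrite inE => /orP [/eqP ->|/EF h] P nP; first by exists i; rewrite /= ?in_fset1U ?eqxx //; exact: Fi.
  by have [k kE Fk] := h P nP; exists k => //=; rewrite in_fset1U kE orbT.
 exists E; split=> // _ P nPs; have [r rin nr] := crs (sval P) (svalP P) nPs. exact: EF r rin P nr.
have [E [ED EF]] : exists E : {fset I}%fset, {subset E <= D} /\
  forall r, r \in ss -> oset (specD r) `<=` cover [set` E] F. have : {subset ss <= ss} by [].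
 elim: {1 3}ss => [|r rs IH] sub; first by exists fset0%fset.
 have [x xrs|E [ED EF]] := IH; first by apply: sub; rewrite inE xrs orbT. have [E' [ED' EF']] := loc r.
 exists (E `|` E')%fset; split=> [x|x]; first by rewrite in_fsetU => /orP [/ED|/ED'].
 rewrite inE => /orP [/eqP ->|/EF h] P nP. have [k kE Fk] := EF' (sub _ (mem_head _ _)) P nP.
  by exists k => //=; rewrite in_fsetU kE orbT. by have [k kE Fk] := h P nP; exists k => //=; rewrite in_fsetU kE.
by exists E => // P [s sin nP]; exact: EF s sin P nP. Qed.

Lemma spec_coherent : coherent Spec.
split. rewrite /quasicompact (_ : [set: Spec] = [set P : spec_space | exists2 s, s \in [:: 1] & ~ sval P s]).
  exact: spec_compactI. apply/seteqP; split=> P // _; exists 1; rewrite ?inE //; by case: (svalP P).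
move=> U V oU oV cU cV; have [ss ->] := spec_compactE oU cU; have [tt ->] := spec_compactE oV cV.
rewrite (_ : _ `&` _ = [set P : spec_space | exists2 r, r \in [seq s * t | s <- ss, t <- tt] & ~ sval P r]).
 exact: spec_compactI. apply/seteqP; split=> P.
 move=> [[s sin ns] [t tin nt]]; exists (s * t); first exact: allpairs_f. exact: (primeM (svalP P)).
move=> [_ /allpairsP [[s t] [/= sin tin ->]] /notM [ns nt]]. by split; [exists s|exists t]. Qed.
End Spec.

Lemma mor_land_hom (W Z : scheme) (N : opens Z) (f : mor W Z) : (forall w, oset N (f w)) ->
 exists psi : sections N ~> sections (topO W), forall a w, geqg w (mor_sec f N a) (psi a).
move=> fN; have h : topO W `<=` opre f N by move=> w _; exact: fN.
exists (restr h \o mor_sec f N) => a w; apply: geq_sym; exact: geq_restr. Qed.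

Lemma mor_compA (W1 W2 W3 W4 : scheme) (h : mor W3 W4) (g : mor W2 W3) (f : mor W1 W2) :
 mor_comp h (mor_comp g f) = mor_comp (mor_comp h g) f.
by apply: mor_ext => // V s w Vw; apply: geq_refl. Qed.

Lemma geq_top (W : ringed_space) (s t : sections (topO W)) : (forall w, geqg w s t) -> s = t.
by move=> h; apply: geq_eq => w _. Qed.

Notation gcan R := (spec_can (topO (spec_ringed R))).

Section SpecMor.
Variables (W : scheme) (R : cring).
Notation can := (gcan R).

Lemma spec_mor_ext (f g : mor W (Spec R)) :
 (forall a w, geqg w (mor_sec f (topO (Spec R)) (can a)) (mor_sec g (topO (Spec R)) (can a))) -> f = g.
move=> h; apply: (affine_target_ext (N := topO (Spec R))) => //; first exact: spec_affine.
by have [k _ kK] := @spec_top_bij R => a w; rewrite -(kK a); exact: h. Qed.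

Lemma spec_mor (psi : R ~> sections (topO W)) : exists f : mor W (Spec R),
 forall a w, geqg w (mor_sec f (topO (Spec R)) (can a)) (psi a).
have [k kK Kk] := @spec_top_bij R.
have [|h hE] := @factor_inj (sections (topO (spec_ringed R))) R _ idfun can (can_inj kK).
 by move=> d; exists (k d); exact: Kk. have hc a : h (can a) = a by apply: (can_inj kK); exact: hE.
have [f [_ fP]] := @affine_target_mor W (Spec R) (topO (Spec R)) (@spec_affine R) (psi \o h).
by exists f => a w; have := fP (can a) w; rewrite /= hc. Qed.
End SpecMor.

Lemma spec_to_affine (R : cring) (Z : scheme) (N : opens Z) (psi : sections N ~> R) :
 affine_open N -> exists f : mor (Spec R) Z, (forall Q, oset N (f Q)) /\
  (forall (a : sections N) (Q : Spec R), geqg Q (mor_sec f N a) (gcan R (psi a))) /\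
  forall (a : sections N) (Q : Spec R), germ_unit a (f Q) <-> ~ sval Q (psi a).
move=> aN; have [f [fN fP]] := @affine_target_mor (Spec R) Z N aN (gcan R \o psi).
exists f; split=> //; split=> [a Q|a Q]; first exact: fP.
rewrite -(@spec_germ_unit R (topO (spec_ringed R))) //; split=> u.
 by apply: (germ_unit_geq (fP a Q)); exact/mor_germ_unit.
by apply/mor_germ_unit => //; apply: (germ_unit_geq (geq_sym (fP a Q))). Qed.

Lemma spec_eq (R : cring) (P Q : Spec R) : sval P = sval Q -> P = Q.
case: P Q => [P hP] [Q hQ] /= e; subst Q; congr exist; exact: Prop_irrelevance. Qed.

Lemma spec_mor_germ (W : scheme) (R : cring) (f : mor W (Spec R)) (psi : R ~> sections (topO W)) :
 (forall a w, geqg w (mor_sec f (topO (Spec R)) (gcan R a)) (psi a)) ->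
 forall a w, germ_unit (psi a) w <-> ~ sval (f w) a.
move=> fP a w; rewrite -(@spec_germ_unit R (topO (spec_ringed R)) a (f w)) //.
split=> u; first exact: (@mor_local W (Spec R) f (topO (Spec R)) (gcan R a) w Logic.I (germ_unit_geq (geq_sym (fP a w)) u)).
by apply: (germ_unit_geq (fP a w)); exact: ((@mor_germ_unit W (Spec R) f w (topO (Spec R)) (gcan R a) Logic.I).2 u).
Qed.

Lemma mor_comp_geq (W Y Z : scheme) (g : mor Y Z) (f : mor W Y) (V : opens Z) (s : sections V) w
  (U : opens Y) (t : sections U) (O : opens W) (r : sections O) :
 geqg (f w) (mor_sec g V s) t -> geqg w (mor_sec f U t) r -> geqg w (mor_sec (mor_comp g f) V s) r.
by move=> h k; apply: geq_trans k; exact: (mor_geq h). Qed.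

Lemma land_ext (W Z : scheme) (N : opens Z) (f g : mor W Z) (psi : sections N -> sections (topO W)) :
 affine_open N -> (forall w, oset N (f w)) -> (forall w, oset N (g w)) ->
 (forall a w, geqg w (mor_sec f N a) (psi a)) -> (forall a w, geqg w (mor_sec g N a) (psi a)) -> f = g.
move=> aN fN gN hf hg; apply: (affine_target_ext aN) => // a w. by apply: (geq_trans (hf a w)); exact: geq_sym. Qed.

(** * Universal homeomorphisms of schemes and of rings *)

Section FibreSquare.
Variables (X' X : scheme) (f : mor X' X) (N : opens X).
Hypothesis aN : affine_open N.
Notation N' := (opre f N).
Hypothesis aN' : affine_open N'.
Variables (A R : cring) (c : sections N ~> A).
Variables (i : sections N' ~> R) (j : A ~> R).
Hypothesis tR : is_tensor (mor_sec f N) c i j.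

Lemma fibre_square : exists (a : mor (Spec R) X') (tA : mor (Spec A) X) (pj : mor (Spec R) (Spec A)),
 [/\ mor_comp f a = mor_comp tA pj, forall Q, oset N (tA Q), forall Q, oset N' (a Q),
   (forall s Q, geqg Q (mor_sec tA N s) (gcan A (c s))) /\ (forall s Q, geqg Q (mor_sec a N' s) (gcan R (i s)))
  & (forall s Q, geqg Q (mor_sec pj (topO (Spec A)) (gcan A s)) (gcan R (j s)))
   /\ forall Q, sval (pj Q) = j @^-1` (sval Q)].
have [a [aN1 [aE _]]] := spec_to_affine i aN'. have [tA [tN [tE _]]] := spec_to_affine c aN.
have [pj pE] := @spec_mor (Spec R) A (gcan R \o j). have [ij _ _] := tR. exists a, tA, pj; split=> //; last first.
 split=> // Q; apply/seteqP; split=> s h.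
  apply: contrapT => n; have := (spec_mor_germ pE s Q).1; rewrite /= spec_germ_unit //. by move=> /(_ n).
 by apply: contrapT => n; have := (spec_mor_germ pE s Q).2 n; rewrite /= spec_germ_unit // => /(_ h).
apply: (@land_ext (Spec R) X N (mor_comp f a) _ (fun s => gcan R (i (mor_sec f N s))) aN).
- by move=> Q; exact: (aN1 Q).
- by move=> Q; exact: tN.
- move=> s Q; apply: (mor_comp_geq (t := mor_sec f N s)); first exact: geq_refl (aN1 Q). exact: aE.
move=> s Q; rewrite ij; apply: (@mor_comp_geq _ (Spec A) X tA pj N s Q (topO (Spec A)) (gcan A (c s))). exact: tE.
exact: pE. Qed.
End FibreSquare.

(** The spectrum of the tensor product is a fibre product of schemes: a map to it is a map on global
    sections, since everything lands in the affine opens [N] and its preimage. The homeomorphism of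
    spectra is then translated into primes. *)
Lemma uh_universal (X' X : scheme) (f : mor X' X) (N : opens X) : universal_homeomorphism f ->
 affine_open N -> affine_open (opre f N) -> universal_homeo (mor_sec f N).
move=> uh aN aN' A R c i j tR; have [ij _ _] := tR.
have [a [tA [pj [comm tN aN1 [tE aE] [pE pP]]]]] := fibre_square aN aN' tR. have pb : is_pullback pj a tA f.
 split; first by rewrite comm. move=> W x y exy. have yN w : oset N (f (y w)).
  have := congr1 (fun m : mor W X => m w) exy; move=> /= <-; exact: tN.
 have [psi' hpsi'] := @mor_land_hom W X' (opre f N) y yN.
 have [psiT hpsiT] := @mor_land_hom W (Spec A) (topO (Spec A)) x (fun _ => Logic.I).
 have [|psi [psii psij]] := tensor_lift tR (u := psi') (v := psiT \o gcan A). move=> s /=; apply: geq_top => w.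
  apply: (geq_trans (geq_sym (hpsi' _ w))). have h1 := mor_eq_geq s exy (tN (x w)).
  apply: (geq_trans (geq_sym h1)); apply: geq_trans (hpsiT _ w). exact: (mor_geq (tE s (x w))).
 have [w0 w0E] := spec_mor psi. have wx : mor_comp pj w0 = x.
  apply: spec_mor_ext => s w; apply: (@mor_comp_geq W (Spec R) (Spec A) pj w0 (topO (Spec A)) (gcan A s) w (topO (Spec R)) (gcan R (j s))).
   exact: pE. apply: (geq_trans (w0E _ w)); rewrite -[psi (j s)]/((psi \o j) s) psij; apply: geq_sym; exact: hpsiT.
 have wy : mor_comp a w0 = y. apply: (land_ext (psi := psi') aN') => //; first by move=> w; exact: aN1.
  move=> s w; apply: (@mor_comp_geq W (Spec R) X' a w0 (opre f N) s w (topO (Spec R)) (gcan R (i s))); first exact: aE.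
  apply: (geq_trans (w0E _ w)); rewrite -[psi (i s)]/((psi \o i) s) psii; apply: geq_refl. by [].
 exists w0; split=> // w1 [e1 e2]. have [psi1 h1] := @mor_land_hom W (Spec R) (topO (Spec R)) w1 (fun _ => Logic.I).
 have epsi : psi1 \o gcan R =1 psi.
  apply: (tensor_morph_eq tR) => s; rewrite [RHS]/= -?[psi (i s)]/((psi \o i) s) -?[psi (j s)]/((psi \o j) s).
   rewrite psii; apply: geq_top => w; apply: geq_trans (hpsi' s w); apply: geq_sym.
   have e3 := mor_eq_geq s (esym e2) (yN w : oset (opre f N) (y w)).
   apply: (geq_trans e3); apply: (mor_comp_geq (aE s (w1 w))); exact: h1.
  rewrite psij; apply: geq_top => w; apply: geq_trans (hpsiT _ w); apply: geq_sym.
  have e3 := @mor_eq_geq W (Spec A) _ _ (topO (Spec A)) (gcan A s) w (esym e1) Logic.I.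
  apply: (geq_trans e3); apply: (mor_comp_geq (pE s (w1 w))); exact: h1.
 apply: spec_mor_ext => s w; apply: (geq_trans (w0E s w)); apply: geq_sym.
 by apply: (geq_trans (h1 _ w)); rewrite -epsi; exact: geq_refl. have [cont [g [gK Kg gc]]] := uh _ _ _ _ _ pb.
split.
- move=> Q1 Q2 p1 p2 e. have : (exist _ Q1 p1 : Spec R) = exist _ Q2 p2.
  by apply: (can_inj gK); apply: spec_eq; rewrite !pP. by move=> /(congr1 (@sval _ _)).
- move=> P pP'; exists (sval (g (exist _ P pP'))); split; first exact: svalP. by rewrite -pP Kg.
move=> J; pose V : set (Spec R) := [set Q | exists2 r, J r & ~ sval Q r].
have oV : open V by rewrite space_openE /= => Q [r Jr nr]; exists r; split=> // Q' nQ'; exists r.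
have : open (g @^-1` V) by move/continuousP: gc; exact. rewrite space_openE /= => oI.
exists [set b | forall P : Spec A, ~ sval P b -> V (g P)] => P pP'; pose PP : Spec A := exist _ P pP'.
split=> [[Q [pQ eQ JQ]] b hb|IP]. apply: contrapT => nb; have [r Jr nr] := hb PP nb; apply: nr.
 have -> : g PP = exist _ Q pQ. by rewrite -(gK (exist _ Q pQ)); congr (g _); apply: spec_eq; rewrite pP /= eQ.
 exact: JQ. exists (sval (g PP)); split; [exact: svalP|by rewrite -pP Kg|].
move=> r Jr; apply: contrapT => nr; have [b [nb hb]] := oI PP (ex_intro2 _ _ r Jr nr).
by apply: nb; apply: IP => Q; exact: hb. Qed.

(** The fibre product [P] is known only by its universal property. Its points over a small affine
    open of [T] are reached from the spectrum of a tensor product, whose topology the hypothesis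
    controls. *)
Lemma uh_of_local (X' X : scheme) (f : mor X' X) :
 (forall x, exists N : opens X, [/\ oset N x, affine_open N, affine_open (opre f N) &
  universal_homeo (mor_sec f N)]) -> universal_homeomorphism f.
move=> loc T P t f' t' [comm univ].
(* over a small affine open M of T, f' is the homeomorphism Spec (O(N') (x) O(M)) -> Spec O(M) *)
have key tau : exists (M : opens T) (S : scheme) (sg : mor S T) (j : S -> P), [/\ oset M tau /\ (forall q, f' (j q) = sg q), forall p, oset M (f' p) -> exists q, p = j q,
  injective sg, forall m, oset M m -> exists q, m = sg q &
  (forall V : set S, open V -> open [set m | exists2 q, V q & m = sg q]) /\
  (forall V : set P, open V -> open (j @^-1` V))]. have [N [Nt aN aN' uh]] := loc (t tau).
 have [M [Mtau aM MN]] := @affine_nbhd T (opre t N) tau Nt.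
 pose c : sections N ~> sections M := restr MN \o mor_sec t N.
 have [R [i [j tR]]] := tensor_ring (mor_sec f N) c; have [ij _ _] := tR. have [inj sj cl] := uh _ _ _ _ _ tR.
 have [a [aN1 [aE _]]] := spec_to_affine i aN'. have [sg [sM [sE sU]]] := spec_to_affine j aM.
 have comm1 : mor_comp t sg = mor_comp f a.
  apply: (@land_ext (Spec R) X N (mor_comp t sg) _ (fun s => gcan R (i (mor_sec f N s))) aN).
  - by move=> Q; exact: MN (sM Q).
  - by move=> Q; exact: (aN1 Q).
  - move=> s Q; rewrite ij; apply: (mor_comp_geq (t := c s)); last exact: sE.
   by apply: geq_sym; apply: geq_restr; exact: sM.
  move=> s Q; apply: (mor_comp_geq (t := mor_sec f N s)); first exact: geq_refl (aN1 Q). exact: aE.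
 have [jj [[jf ja] _]] := univ _ sg a comm1.
 have jfE q : f' (jj q) = sg q by have := congr1 (fun m : mor (Spec R) T => m q) jf.
 have [prM surjM injM baseM locM] := affine_elim aM. have nuE Q : nonunits M (sg Q) = j @^-1` (sval Q).
  apply/seteqP; split=> b; rewrite /nonunits /= sU; first by move/contrapT. by move=> h; apply.
 exists M, (Spec R), sg, jj; split=> //.
 - move=> p Mp; pose O := opre f' M.
  have [psiM hM] := @mor_land_hom (opn O) T M (mor_comp f' (incl O)) (fun y => svalP y).
  have tO y : oset (opre f N) (mor_comp t' (incl O) y). have := congr1 (fun m : mor P X => m (sval y)) comm => /= e.
   by rewrite /= -e; apply: (MN); exact: (svalP y).
  have [psi' h'] := @mor_land_hom (opn O) X' _ (mor_comp t' (incl O)) tO.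
  have [|psi [psii psij]] := tensor_lift tR (u := psi') (v := psiM).
   move=> s; apply: (@geq_top (opn O)) => y; change (@geqg (opn O) y _ _ (psi' (mor_sec f N s)) (psiM (c s))).
   apply: (geq_trans (geq_sym (h' _ y))). have e1 := mor_eq_geq s comm (MN _ (svalP y : oset M (f' (sval y)))).
   have e2 := @mor_geq _ _ (incl O) y _ _ _ _ e1. apply: (geq_trans (geq_sym e2)). apply: geq_trans (hM (c s) y).
   exact: (@mor_geq _ _ (mor_comp f' (incl O)) y _ _ (mor_sec t N s) (c s) (geq_sym (geq_restr MN (mor_sec t N s) (svalP y)))).
  have [r rE] := spec_mor psi. have e1 : mor_comp sg r = mor_comp f' (incl O).
   apply: (land_ext (psi := psiM) aM) => //; [by move=> y; exact: sM|by move=> y; exact: svalP y|].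
   move=> s y; apply: (mor_comp_geq (sE s (r y))).
   by apply: (geq_trans (rE _ y)); rewrite -[psi (j s)]/((psi \o j) s) psij; exact: geq_refl.
  have e2 : mor_comp a r = mor_comp t' (incl O).
   apply: (land_ext (psi := psi') aN') => //; first by move=> y; exact: aN1.
   move=> s y; apply: (mor_comp_geq (aE s (r y))).
   by apply: (geq_trans (rE _ y)); rewrite -[psi (i s)]/((psi \o i) s) psii; exact: geq_refl.
  have e3 : mor_comp t (mor_comp f' (incl O)) = mor_comp f (mor_comp t' (incl O)).
   by rewrite (mor_compA t f' (incl O)) (mor_compA f t' (incl O)) comm. have [u0 [_ uni]] := univ _ _ _ e3.
  (* The inclusion of [O] and the map through [Spec R] solve the same problem for [P], so each point
     over [M] comes from [Spec R]. *)
  have h1 : u0 = incl O by apply: uni. have h2 : u0 = mor_comp jj r.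
   apply: uni; split; first by rewrite (mor_compA f' jj r) jf e1. by rewrite (mor_compA t' jj r) ja e2.
  exists (r (exist _ p Mp)). have := congr1 (fun m : mor (opn O) P => m (exist _ p Mp)) (etrans (esym h1) h2).
  by [].
 - move=> Q1 Q2 e; apply: spec_eq; apply: inj; [exact: svalP|exact: svalP|]. by rewrite -!nuE e.
 - move=> m Mm; have [Q [pQ eQ]] := sj _ (prM m Mm). exists (exist _ Q pQ); apply: injM => //; by rewrite nuE /= eQ.
 split; last by move=> V oV; exact: mor_open.
 move=> V oV; have [I hI] := cl [set r | forall Q : Spec R, ~ sval Q r -> V Q].
 have VQ (Q : Spec R) : V Q <-> ~ ([set r | forall Q : Spec R, ~ sval Q r -> V Q] `<=` sval Q).
  split=> [VQ sub|nsub]. by move: oV; rewrite space_openE /= => /(_ Q VQ) [r [nr hr]]; apply: nr; apply: sub.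
  by apply: contrapT => nV; apply: nsub => r hr; apply: contrapT => nr; apply: nV; exact: hr.
 have -> : [set m | exists2 q, V q & m = sg q] = \bigcup_(b in I) [set m | germ_unit b m]. apply/seteqP; split=> m.
   move=> [Q VQ' ->]; apply: contrapT => nb; move/VQ: (VQ'); apply => r hr. have pI : I `<=` nonunits M (sg Q).
    by move=> b Ib; rewrite /nonunits /= => ub; apply: nb; exists b.
   have [Q' [pQ' eQ' JQ']] := (hI _ (prM _ (sM Q))).2 pI.
   have <- : Q' = sval Q by apply: inj => //; [exact: svalP|rewrite eQ' nuE]. exact: JQ'.
  move=> [b Ib ub]; have Mm := germ_unit_sub ub; have [Q [pQ eQ]] := sj _ (prM m Mm).
  have em : m = sg (exist _ Q pQ) by apply: injM => //; rewrite nuE /= eQ.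
  exists (exist _ Q pQ) => //; apply/VQ => sub. have : I `<=` nonunits M m by apply/(hI _ (prM m Mm)); exists Q.
  by move=> /(_ b Ib); apply. by apply: bigcup_open => b _; exact: germ_unit_open. have f'inj : injective f'.
 move=> p1 p2 e; have [M [S [sg [j [[Mt fj] onto inj _ _]]]]] := key (f' p1).
 have [q1 e1] := onto p1 Mt; have [q2 e2] := onto p2 (eq_ind _ (oset M) Mt _ e).
 by rewrite e1 e2; congr (j _); apply: inj; rewrite -!fj -e1 -e2. have f'surj tau : exists p, f' p = tau.
 have [M [S [sg [j [[Mt fj] _ _ sur _]]]]] := key tau. by have [q ->] := sur tau Mt; exists (j q).
have [g gE] := choice f'surj. split; first by apply/continuousP => V; exact: mor_open.
exists g; split=> [p|//|]; first exact: f'inj. apply/continuousP => V oV; rewrite openE => tau Vt.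
have [M [S [sg [j [[Mt fj] onto inj sur [op jo]]]]]] := key tau.
have [q eq] := onto (g tau) (eq_ind_r (oset M) Mt (gE tau)).
rewrite /interior nbhsE /=; exists [set m | exists2 q, (j @^-1` V) q & m = sg q].
 split; first by apply: op; exact: jo. by exists q; rewrite /= -?eq // -fj -eq gE.
move=> m [q' Vq' ->] /=; have -> : g (sg q') = j q' by apply: f'inj; rewrite gE fj. by []. Qed.

(** [ptF] may be any extension of the residue field at [x]: only the kernel of [ptE] is prescribed.
    [rigid_std_descent] relies on this freedom to take values in fields where a polynomial
    splits. *)
Record pt_data (X : scheme) (x : X) := PtData {
 ptN : opens X;
 ptNx : oset ptN x;
 ptA : affine_open ptN;
 ptF : fieldType;
 ptE : sections ptN ~> ptF;
 ptK : forall a, ptE a = 0 <-> nonunits ptN x a }.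

Lemma pt_data_exists (X : scheme) (x : X) : exists d : pt_data x, True.
have [N Nx aN] := scheme_affine_cover x. have [F [chi [k _]]] := residue_field (nonunits_prime Nx).
by exists (PtData Nx aN k). Qed.

Section PointEval.
Variables (X : scheme) (x : X) (d : pt_data x).

Lemma ptev_exists (U : opens X) : oset U x -> exists f : sections U ~> ptF d,
 forall s a c, grel x s a c -> f s * ptE d a = ptE d c.
move=> Ux; have [b [ub sub]] := affine_nbhd_in (ptA d) (ptNx d) Ux. have [_ _ _ _ loc] := affine_elim (ptA d).
have Ln := loc b _ (@bsub X (ptN d) b) erefl.
have nz a : germ_unit a x -> ptE d a != 0 by move=> ua; apply/eqP => /ptK.
have ue : is_unit (ptE d b) by exists (ptE d b)^-1; rewrite mulfV // nz. have [w wE] := loc_lift Ln ue.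
exists (w \o restr sub) => s a c g; have [_ fr _] := Ln. have [n [p e]] := fr (restr sub s).
have := congr1 w e; rewrite rmorphM rmorphXn -[w (restr _ b)]/((w \o restr _) b) -[w (restr _ p)]/((w \o restr _) p) !wE => e1.
have g2 : grel x s (b ^+ n) p by apply: (grel_intro (h := sub) (k := @bsub X (ptN d) b) (A := basicO b)) => //; rewrite rmorphXn.
have [b' [ub' e2]] := affine_geq (ptA d) (ptNx d) (grel_cross g g2).
have e3 : ptE d c * ptE d b ^+ n = ptE d p * ptE d a.
 by apply: (mulfI (nz _ ub')); have := congr1 (ptE d) e2; rewrite !rmorphM rmorphXn.
apply: (mulIf (expf_neq0 n (nz _ ub))); rewrite e3 -e1 /=; ring. Qed.
Definition ptev (U : opens X) (Ux : oset U x) := sval (cid (ptev_exists Ux)).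
Lemma ptevE (U : opens X) (Ux : oset U x) s a c : grel x s a c -> ptev Ux s * ptE d a = ptE d c.
exact: (svalP (cid (ptev_exists Ux))). Qed.

Lemma ptev_geq (U V : opens X) (Ux : oset U x) (Vx : oset V x) s t : geqg x s t -> ptev Ux s = ptev Vx t.
move=> e; have [a [c [ua _ h]]] := affine_grel s (ptA d) (ptNx d) Ux.
have g := h _ ua; have ga := geq_refl a (ptNx d); have gc := geq_refl c (ptNx d).
have nz : ptE d a != 0 by apply/eqP => /ptK.
by apply: (mulIf nz); rewrite (ptevE _ g) (ptevE _ (grel_geq e ga gc g)). Qed.
Lemma ptev_ker (U : opens X) (Ux : oset U x) s : ptev Ux s = 0 <-> nonunits U x s.
have [a [c [ua _ h]]] := affine_grel s (ptA d) (ptNx d) Ux.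
have g := h _ ua; have nz : ptE d a != 0 by apply/eqP => /ptK.
have e := ptevE Ux g; rewrite /nonunits /= (grel_unit ua g).
split=> [z|/ptK z]; first by apply/ptK; rewrite -e z mul0r. by apply: (mulIf nz); rewrite e z mul0r. Qed.
Lemma ptev_N (h : oset (ptN d) x) s : ptev h s = ptE d s.
by have := ptevE h (grel_self s h); rewrite rmorph1 mulr1. Qed.
End PointEval.

(** * The scheme of radicial functions *)

Section Perfection.
Variables (X : scheme) (d : forall x : X, pt_data x).
Let K (x : X) : cring := ptF (d x).

Let T0 (f : forall x, K x) (x : X) := True.
Let T0l f g x (V : set X) : open V -> V x -> (forall y, V y -> f y = g y) -> T0 f x -> T0 g x. by []. Qed.
Let T01 x : T0 (fun=> 1) x. by []. Qed.
Let T0B f g x : T0 f x -> T0 g x -> T0 (fun y => f y - g y) x. by []. Qed.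
Let T0M f g x : T0 f x -> T0 g x -> T0 (fun y => f y * g y) x. by []. Qed.
Definition all_fun : ringed_space := fs_space T0l T01 T0B T0M.
Definition all_cls (V : opens X) := fs_class T0l T01 T0B T0M V.

Lemma val_hom_exists (V : opens X) : exists l : sections V ~> @sections all_fun V,
 forall s x (Vx : oset V x), sval (l s) x = ptev (d x) Vx s.
pose F (s : sections V) x : K x := match pselect (oset V x) with left h => ptev (d x) h s | right _ => 0 end.
have [||||l lE] := @fring_hom X K (oset V) (all_cls V) (sections V) F; last first.
 exists l => s x Vx; rewrite lE /F; case: pselect => // h; congr (ptev _ _ _); exact: Prop_irrelevance.
- by move=> x Vx; rewrite /F; case: pselect => // h; rewrite rmorph1.
- by move=> a b x; rewrite /F; case: pselect => h; rewrite ?mulr0 ?rmorphM.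
- by move=> a b x; rewrite /F; case: pselect => h; rewrite ?addr0 ?rmorphD.
by move=> r; split=> // x nx; rewrite /F; case: pselect. Qed.
Definition val_hom (V : opens X) := sval (cid (val_hom_exists V)).
Lemma val_homE (V : opens X) s x (Vx : oset V x) : sval (val_hom V s) x = ptev (d x) Vx s.
exact: (svalP (cid (val_hom_exists V))). Qed.
Lemma val_hom0 (V : opens X) s x : oset V x -> sval (val_hom V s) x = 0 <-> nonunits V x s.
by move=> Vx; rewrite (val_homE s Vx); exact: ptev_ker. Qed.

Notation rs h := (@restr all_fun _ _ h).
Lemma rs_in (U V : opens X) (h : V `<=` U) (f : @sections all_fun U) x : oset V x -> sval (rs h f) x = sval f x.
exact: fs_restr_in. Qed.
Lemma af_eq (U : opens X) (f g : @sections all_fun U) : (forall x, oset U x -> sval f x = sval g x) -> f = g.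
exact: fs_eq. Qed.
Lemma af_make (U : opens X) (f : forall x, K x) : exists g : @sections all_fun U, forall x, oset U x -> sval g x = f x.
exact: (@fs_make X K T0 T0l T01 T0B T0M U f). Qed.
Lemma af_eval (U : opens X) x : oset U x -> exists pr : @sections all_fun U ~> K x, forall f, pr f = sval f x.
by move=> Ux; exact: (@fring_eval X K (oset U) (all_cls U) x Ux). Qed.

Lemma val_restr (U V : opens X) (h : V `<=` U) (s : sections U) : rs h (val_hom U s) = val_hom V (restr h s).
apply: af_eq => x Vx; rewrite rs_in // (val_homE _ (h _ Vx)) (val_homE _ Vx).
by apply: ptev_geq; apply: geq_sym; exact: geq_restr. Qed.

Lemma nonunits_restr (U V : opens X) (h : V `<=` U) x (s : sections U) : oset V x ->
 nonunits V x (restr h s) <-> nonunits U x s.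
move=> Vx; have e := geq_restr h s Vx; split=> n u; apply: n. exact: germ_unit_geq (geq_sym e) u.
exact: germ_unit_geq e u. Qed.

Lemma iint_restr (U V : opens X) (h : V `<=` U) (I : set (sections U)) (J : set (sections V)) z :
 (forall c, I c -> J (restr h c)) -> iint (val_hom U) I z -> iint (val_hom V) J (rs h z).
move=> IJ i; apply: (@iint_comp _ _ _ (restr h) (val_hom V) I J _ IJ).
by apply: iint_eq_hom (iint_map (rs h) i) => s /=; rewrite val_restr. Qed.

Lemma rad1_restr (U V : opens X) (h : V `<=` U) x z : oset V x ->
 rad1 (val_hom U) (nonunits U x) z -> rad1 (val_hom V) (nonunits V x) (rs h z).
move=> Vx [q [a [Pq i]]]; exists q, (restr h a); split.
 by apply: (pexp_preim (f := restr h)) Pq => c; move/(nonunits_restr h c Vx).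
rewrite -val_restr -rmorphXn -rmorphB; apply: iint_restr i => c; by move/(nonunits_restr h c Vx). Qed.

Definition cutf (V : opens X) (f : forall x, K x) := sval (cid (af_make V f)).
Lemma cutfE V f x : oset V x -> sval (cutf V f) x = f x.
exact: (svalP (cid (af_make V f))). Qed.
Opaque cutf val_hom.
Lemma cutf_sval (V : opens X) (f : @sections all_fun V) : cutf V (sval f) = f.
by apply: af_eq => x Vx; rewrite cutfE. Qed.
Lemma rs_cutf (U V : opens X) (h : V `<=` U) f : rs h (cutf U f) = cutf V f.
by apply: af_eq => x Vx; rewrite rs_in // !cutfE //; exact: h. Qed.

(** [rad1] rather than [radicial_at]: the neighbourhood [V] can be shrunk until a denominator is
    invertible. *)
Definition good (f : forall x, K x) (x : X) : Prop :=
 exists V : opens X, oset V x /\ rad1 (val_hom V) (nonunits V x) (cutf V f).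

Lemma good_local f g x (V : set X) : open V -> V x -> (forall y, V y -> f y = g y) -> good f x -> good g x.
move=> oV Vx e [U [Ux r]]; exists (capO U (Opens oV)); split=> //.
have := rad1_restr (@capl _ U (Opens oV)) (conj Ux Vx : oset (capO U (Opens oV)) x) r.
by rewrite rs_cutf (_ : cutf _ f = cutf _ g) //; apply: af_eq => y [Uy Vy]; rewrite !cutfE ?e. Qed.
Lemma good1 x : good (fun=> 1) x.
exists (topO X); split=> //; rewrite (_ : cutf _ _ = val_hom _ 1); first exact: (rad1_img (val_hom (topO X)) (@nonunits_prime X (topO X) x Logic.I) 1).
by rewrite rmorph1; apply: af_eq => y Vy; rewrite cutfE // fring_oneE. Qed.
Lemma good2 f g x : good f x -> good g x -> exists V : opens X, [/\ oset V x,
 rad1 (val_hom V) (nonunits V x) (cutf V f) & rad1 (val_hom V) (nonunits V x) (cutf V g)].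
move=> [U [Ux r]] [V [Vx r']]; have W : oset (capO U V) x by []. exists (capO U V); split=> //.
 by have := rad1_restr (@capl _ U V) W r; rewrite rs_cutf.
by have := rad1_restr (@capr _ U V) W r'; rewrite rs_cutf. Qed.
Lemma goodB f g x : good f x -> good g x -> good (fun y => f y - g y) x.
move=> gf gg; have [V [Vx rf rg]] := good2 gf gg; exists V; split; first exact: Vx.
rewrite (_ : cutf _ _ = cutf V f - cutf V g); first by have [] := rad1_sub_mul (nonunits_prime Vx) rf rg.
by have pr := af_eval; apply: af_eq => y Vy; have [p pE] := pr _ _ Vy; rewrite -!pE rmorphB !pE !cutfE. Qed.
Lemma goodM f g x : good f x -> good g x -> good (fun y => f y * g y) x.
move=> gf gg; have [V [Vx rf rg]] := good2 gf gg; exists V; split; first exact: Vx.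
rewrite (_ : cutf _ _ = cutf V f * cutf V g); first by have [] := rad1_sub_mul (nonunits_prime Vx) rf rg.
by have pr := af_eval; apply: af_eq => y Vy; have [p pE] := pr _ _ Vy; rewrite -!pE rmorphM !pE !cutfE. Qed.

Definition perf : ringed_space := fs_space good_local good1 goodB goodM.
Let gcls (V : opens X) := fs_class good_local good1 goodB goodM V.

Lemma perf_good (V : opens X) (f : @sections perf V) x : oset V x -> good (sval f) x.
exact: (svalP f).2. Qed.
Lemma perf_eq (U : opens X) (f g : @sections perf U) : (forall x, oset U x -> sval f x = sval g x) -> f = g.
exact: fs_eq. Qed.
Lemma perf_make (U : opens X) (f : forall x, K x) : (forall x, oset U x -> good f x) ->
 exists g : @sections perf U, forall x, oset U x -> sval g x = f x.
exact: fs_make. Qed.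
Lemma perf_eval (U : opens X) x : oset U x -> exists pr : @sections perf U ~> K x, forall f, pr f = sval f x.
by move=> Ux; exact: (@fring_eval X K (oset U) (gcls U) x Ux). Qed.
Lemma perf_in (U V : opens X) (h : V `<=` U) (f : @sections perf U) x : oset V x ->
 sval (@restr perf U V h f) x = sval f x.
exact: fs_restr_in. Qed.

Lemma val_good (V : opens X) s x : oset V x -> good (sval (val_hom V s)) x.
by move=> Vx; exists V; split=> //; rewrite cutf_sval; apply: rad1_img; exact: nonunits_prime. Qed.

Lemma perf_can_exists (V : opens X) : exists c : sections V ~> @sections perf V,
 forall s x, sval (c s) x = sval (val_hom V s) x.
have [||||c cE] := @fring_hom X K (oset V) (gcls V) (sections V) (fun s => sval (val_hom V s)); last first.
 by exists c => s x; rewrite cE.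
- by move=> x Vx; rewrite rmorph1 fring_oneE.
- by move=> a b x; rewrite rmorphM.
- by move=> a b x; rewrite rmorphD.
by move=> s; split=> [x nx|x Vx]; [exact: (svalP (val_hom V s)).1|exact: val_good]. Qed.
Definition perf_can (V : opens X) := sval (cid (perf_can_exists V)).
Lemma perf_canE (V : opens X) s x : sval (perf_can V s) x = sval (val_hom V s) x.
exact: (svalP (cid (perf_can_exists V))). Qed.
Lemma perf_can_restr (U V : opens X) (h : V `<=` U) s : @restr perf U V h (perf_can U s) = perf_can V (restr h s).
by apply: perf_eq => x Vx; rewrite perf_in // !perf_canE -val_restr rs_in. Qed.

Lemma perf_inc_exists (V : opens X) : exists c : @sections perf V ~> @sections all_fun V,
 forall s x, sval (c s) x = sval s x.
have [||||c cE] := @fring_hom X K (oset V) (all_cls V) (@sections perf V) (fun s => sval s); last first.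
 by exists c => s x; rewrite cE.
- by move=> x Vx; rewrite fring_oneE.
- by [].
- by []. by move=> s; split=> // x nx; exact: (svalP s).1. Qed.
Definition perf_inc (V : opens X) := sval (cid (perf_inc_exists V)).
Lemma perf_incE (V : opens X) s x : sval (perf_inc V s) x = sval s x.
exact: (svalP (cid (perf_inc_exists V))). Qed.
Lemma perf_inc_inj (V : opens X) : injective (perf_inc V).
by move=> a b e; apply: perf_eq => x _; rewrite -!perf_incE e. Qed.
Lemma perf_inc_can (V : opens X) s : perf_inc V (perf_can V s) = val_hom V s.
by apply: af_eq => x _; rewrite perf_incE perf_canE. Qed.
Lemma cutf_inc (V : opens X) (f : @sections perf V) : cutf V (sval f) = perf_inc V f.
by apply: af_eq => x Vx; rewrite cutfE // perf_incE. Qed.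

(** The coefficients on the basic open are fractions with powers of [s] as denominators. Scaling [g]
    by a power of [s] clears them, with one factor [s] to spare so that the equation also holds at
    the points where [s] vanishes. *)
Lemma iint_extend (N : opens X) (s : sections N) (J : set (sections (basicO s))) (g : @sections all_fun N) :
 affine_open N -> is_ideal J -> iint (val_hom (basicO s)) J (rs (@bsub X N s) g) ->
 exists M, iint (val_hom N) [set c | J (restr (@bsub X N s) c)] (val_hom N (s ^+ M) * g).
move=> aN idJ /(iint_coef idJ) [n [c [Jc e]]].
have [_ _ _ _ loc] := affine_elim aN; have [_ fr _] := loc s _ (@bsub X N s) erefl. have [J0 JD JM] := idJ.
have [m [b hb]] : exists m (b : nat -> sections N), forall i, (i < n)%N ->
  c i * restr (@bsub X N s) s ^+ m = restr (@bsub X N s) (b i).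
 elim: (n) => [|k [m [b hb]]]; first by exists 0%N, (fun=> 0). have [m' [b' hb']] := fr (c k).
 exists (m + m')%N, (fun i => if i == k then b' * s ^+ m else b i * s ^+ m') => i.
 rewrite ltnS leq_eqVlt; case: eqP => [-> _|ne /= lt]. by rewrite rmorphM rmorphXn -hb' addnC exprD; ring.
 by rewrite rmorphM rmorphXn -hb // exprD; ring. pose S := s ^+ m.+1; exists m.+1.
(* On the basic open [ee i] is [c i * S ^+ (n - i)], the coefficient for the scaled function; its
   factor [s] makes it vanish elsewhere. *)
pose ee i := b i * s * S ^+ (n - i.+1).
have eeE i : (i < n)%N -> restr (@bsub X N s) (ee i) = c i * restr (@bsub X N s) S ^+ (n - i).
 move=> lt; set r := restr (@bsub X N s). have SE : r S = r s * r s ^+ m by rewrite /S rmorphXn exprS.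
 rewrite /ee [LHS]rmorphM [r (b i * s)]rmorphM rmorphXn /r -hb // -(subnSK lt) -/r exprS.
 move: SE; generalize (r S) => RS SE; rewrite [X in _ = _ * (X * _)]SE; ring.
(* The equation is multiplied by [z] once more: where [s] vanishes both sides are then 0, also for
   [n] equal to 0. *)
rewrite -/S; set z := _ * g; exists n.+1. have -> : z ^+ n.+1 = \sum_(i < n) val_hom N (ee i) * z ^+ i.+1.
 apply: af_eq => y Ny; have [pr prE] := af_eval Ny; rewrite -!prE rmorph_sum rmorphXn.
 have zE : pr z = pr (val_hom N S) * pr g by rewrite /z rmorphM.
 have [us|nus] := pselect (germ_unit s y); last first.
  have s0 : pr (val_hom N s) = 0 by rewrite prE; apply/val_hom0.
  rewrite zE /S !rmorphXn s0 expr0n mul0r expr0n /= big1 // => i _. by rewrite /ee !rmorphM s0 mulr0 !mul0r.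
 have [ps psE] := @af_eval (basicO s) y us.
 have psr (a : sections N) : pr (val_hom N a) = ps (val_hom (basicO s) (restr (@bsub X N s) a)).
  by rewrite -val_restr psE rs_in // prE. have gE : pr g = ps (rs (@bsub X N s) g) by rewrite psE rs_in // prE.
 have := congr1 ps e; rewrite rmorphXn -gE rmorph_sum => e1.
 rewrite exprS zE exprMn e1 !mulr_sumr; apply: eq_bigr => i _.
 have eE : pr (val_hom N (ee i)) = ps (val_hom (basicO s) (c i)) * pr (val_hom N S) ^+ (n - i).
  by rewrite psr eeE // !rmorphM !rmorphXn -psr.
 rewrite [pr (val_hom N (ee i) * _)]rmorphM [pr (z ^+ _)]rmorphXn eE zE [ps (_ * _)]rmorphM [ps (_ ^+ _)]rmorphXn -gE.
 rewrite exprMn [_ ^+ i.+1]exprS [pr g ^+ i.+1]exprS.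
 have -> : pr (val_hom N S) ^+ n = pr (val_hom N S) ^+ (n - i) * pr (val_hom N S) ^+ i by rewrite -exprD subnK // ltnW.
 ring. apply: spn_sum => i _; apply: spnG; last by exists i.+1 => //; exact: ltn_ord.
by rewrite /= eeE // mulrC; exact: JM. Qed.

Lemma good_basic (N : opens X) f x : affine_open N -> oset N x -> good f x -> exists s : sections N,
 germ_unit s x /\ rad1 (val_hom (basicO s)) (nonunits (basicO s) x) (cutf (basicO s) f).
move=> aN Nx [V [Vx r]]; have [s [us sub]] := affine_nbhd_in aN Nx Vx.
by exists s; split=> //; have := rad1_restr sub us r; rewrite rs_cutf. Qed.

Opaque perf_can perf_inc.
Lemma rs_inc (U V : opens X) (h : V `<=` U) z : rs h (perf_inc U z) = cutf V (sval z).
by rewrite -(rs_cutf h) cutf_inc. Qed.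

(** The sections whose product with [z] is integral form an ideal. No prime contains it: near the
    corresponding point [z] is integral, and [iint_extend] puts a power of a section that is a unit
    there in the ideal. *)
Lemma perf_int_all (N : opens X) (z : @sections perf N) : affine_open N -> iint (val_hom N) setT (perf_inc N z).
move=> aN; pose I1 := [set s | iint (val_hom N) setT (val_hom N s * perf_inc N z)].
have [n1|] := pselect (I1 1); first by move: n1; rewrite /I1 /= rmorph1 mul1r. have idT := @idealT (sections N).
have idI : is_ideal I1. split=> [|a b ha hb|a b hb]; rewrite /I1 /=.
 - by rewrite rmorph0 mul0r; exact: iint0.
 - by rewrite rmorphD mulrDl; exact: iintD. by rewrite rmorphM -mulrA mulrC; apply: iint_mul => //; exact: iint_img.
move=> n1; have [P [pP IP]] := prime_containing idI n1.
have [_ surj _ _ _] := affine_elim aN; have [x [Nx eP]] := surj P pP.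
have [s [us r]] := good_basic aN Nx (perf_good z Nx). have := rad1_integral r.
rewrite -(rs_inc (@bsub X N s)) => /(iint_extend aN (@idealT _)) [M hM].
have : P (s ^+ M) by apply: IP; apply: iint_sub hM. by move/(primeX pP); rewrite -eP. Qed.

Lemma perf_iint (N : opens X) (I : set (sections N)) z : is_ideal I -> iint (val_hom N) I (perf_inc N z) ->
 iint (perf_can N) I z.
move=> idI i; apply: (iint_inj idI (@perf_inc_inj N)); apply: iint_eq_hom i => s; by rewrite /= perf_inc_can. Qed.

(** The equation valid on a basic open is spread over [N] by [iint_extend]; the powers of [s] that
    this costs become the denominator allowed in [radicial_at]. *)
Lemma perf_radicial (N : opens X) (z : @sections perf N) P : affine_open N -> is_prime_ideal P ->
 radicial_at (perf_can N) P z.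
move=> aN pP; have [_ surj _ _ loc] := affine_elim aN; have [x [Nx eP]] := surj P pP.
have [s [us [q [a [Pq i]]]]] := good_basic aN Nx (perf_good z Nx). pose h := @bsub X N s.
have [_ fr _] := loc s _ h erefl; have [n [a0 ea]] := fr a.
have pS := nonunits_prime (us : oset (basicO s) x); have idS := prime_ideal pS.
have i2 : iint (val_hom (basicO s)) (nonunits (basicO s) x) (rs h (val_hom N (s ^+ n) * perf_inc N z ^+ q - val_hom N a0)).
 rewrite rmorphB rmorphM !val_restr [rs h (_ ^+ q)]rmorphXn rs_inc -ea [restr h (s ^+ n)]rmorphXn.
 rewrite (_ : _ - _ = (cutf (basicO s) (sval z) ^+ q - val_hom _ a) * val_hom _ (restr h s ^+ n)).
  by apply: iint_mul => //; exact: iint_img. rewrite [val_hom _ (a * _)]rmorphM; ring.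
have [M hM] := iint_extend aN idS i2. exists q, (s ^+ M * s ^+ n), (s ^+ M * a0); split.
- case: Pq => [->|[p [e [pp -> hp]]]]; [by left|right; exists p, e; split=> //].
 by rewrite -eP -(nonunits_restr h _ us) rmorph_nat.
- by apply: primeM => // /(primeX pP); rewrite -eP. apply: perf_iint; first exact: prime_ideal.
rewrite [X in iint _ _ X](_ : _ = val_hom N (s ^+ M) * (val_hom N (s ^+ n) * perf_inc N z ^+ q - val_hom N a0)); last first.
 by rewrite rmorphB !rmorphM !rmorphXn !perf_inc_can; ring.
by apply: iint_sub hM => c; rewrite -eP /= (nonunits_restr h c us). Qed.

Lemma perf_can_ker (N : opens X) x s : oset N x -> sval (perf_can N s) x = 0 <-> nonunits N x s.
by move=> Nx; rewrite perf_canE; exact: val_hom0. Qed.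

Lemma perf_uh (N : opens X) : affine_open N -> universal_homeo (perf_can N).
move=> aN; apply: radicial_universal => [z|P pP|P pP z]; last exact: perf_radicial.
 by apply: perf_iint; [exact: idealT|exact: perf_int_all].
have [_ surj _ _ _] := affine_elim aN; have [x [Nx eP]] := surj P pP. have [pr prE] := @perf_eval N x Nx.
exists [set z | pr z = 0]; split; first exact: (@kernel_prime _ (ptF (d x))).
by rewrite -eP; apply/seteqP; split=> s /=; rewrite prE perf_can_ker. Qed.

(** If [sval f x] is nonzero, the section [a] that approximates [f ^+ q] is a unit at [x]. Then
    [rad1_inverse] exhibits an inverse of [f ^+ q] near [x], up to a unit, as an element that is
    again good. *)
Lemma perf_germ_unit (N : opens X) (f : @sections perf N) x : @germ_unit perf N f x <-> oset N x /\ sval f x <> 0.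
split=> [u|[Nx nz]]. split; first exact: germ_unit_sub u.
 by have [b e] := fs_germ_unit u => z; move: e; rewrite z mul0r => /esym /eqP; rewrite oner_eq0.
have [V0 [V0x r0]] := perf_good f Nx; pose V := capO N V0; have Vx : oset V x by [].
have [q [a [Pq i]]] := rad1_restr (@capr _ N V0) Vx r0; rewrite rs_cutf in i.
have pV := nonunits_prime Vx; have idV := prime_ideal pV; have q0 := pexp_gt0 Pq.
pose f' : @sections perf V := @restr perf N V (@capl _ N V0) f. have fE : cutf V (sval f) = perf_inc V f'.
 by apply: af_eq => y Vy; rewrite cutfE // perf_incE perf_in. have [pr prE] := af_eval Vx.
have na : ~ nonunits V x a.
 move=> nza; apply: nz; have k c : nonunits V x c -> pr (val_hom V c) = 0 by rewrite prE => /val_hom0; apply.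
 have := @iint_field_vanish _ _ (ptF (d x)) (val_hom V) _ pr _ idV k i.
 rewrite rmorphB (k a) // subr0 rmorphXn prE cutfE // => /eqP; rewrite expf_eq0 => /andP [_ /eqP]; exact.
have [|||||e [r [ne [r' _ rE] er]]] := @rad1_inverse _ _ (val_hom V) _ pV (range (perf_inc V)) (cutf V (sval f) ^+ q) a.
- split; first by exists 1 => //; rewrite rmorph1.
  by move=> _ _ [a1 _ <-] [a2 _ <-]; exists (a1 - a2) => //; rewrite rmorphB.
 by move=> _ _ [a1 _ <-] [a2 _ <-]; exists (a1 * a2) => //; rewrite rmorphM.
- by move=> c; exists (perf_can V c) => //; exact: perf_inc_can.
- by exists (f' ^+ q) => //; rewrite fE rmorphXn.
- exact: na.
- exact: i. have e1 : f' ^+ q * r' = perf_can V e.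
 by apply: perf_inc_inj; rewrite rmorphM rmorphXn rE perf_inc_can -fE.
have [W [h [Wx ue]]] : germ_unit e x by apply: contrapT. have : @germ_unit perf V (f' ^+ q * r') x.
 by rewrite e1; exists W, h; split=> //; rewrite perf_can_restr; exact: unit_morph.
move=> /germ_unitM [] u _; apply: (germ_unit_geq (@geq_restr perf x N V (@capl _ N V0) f Vx)).
have [k qk] : exists k, q = k.+1 by exists q.-1; rewrite prednK.
by move: u; rewrite qk exprS => /germ_unitM [] u _; exact: u. Qed.

Lemma perf_can_unit (N : opens X) x s : oset N x -> @germ_unit perf N (perf_can N s) x <-> germ_unit s x.
move=> Nx; rewrite perf_germ_unit perf_can_ker //; split=> [[_ n]|u]; first exact: contrapT.
by split=> // n; exact: n. Qed.

Lemma perf_can_preim (N : opens X) x : oset N x -> perf_can N @^-1` (@nonunits perf N x) = nonunits N x.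
by move=> Nx; apply/seteqP; split=> s n u; apply: n; apply/(perf_can_unit s Nx). Qed.

Lemma spec_homeo_self (C E : cring) (f : C ~> E) : universal_homeo f -> spec_homeo f.
move=> uh; apply: (uh C E idfun idfun f); split=> // [r|G beta [bD bD' bM]].
 by exists [:: (r, 1)]; rewrite big_seq1 /= rmorph1 mulr1.
exists (fun r => beta r 1); split=> [x y|b c /=]; first exact: bD. by rewrite mulrC bM /= mulr1. Qed.

(* [s ^+ M * h], extended by zero, is again a good function: off the basic open
  it is integral over the ideal generated by [s]. *)
Lemma perf_extend (N : opens X) (s : sections N) (h : @sections perf (basicO s)) : affine_open N ->
 exists M (b : @sections perf N), forall x, germ_unit s x -> sval b x = sval (perf_can N (s ^+ M)) x * sval h x.
move=> aN; have aS := affine_basic s aN; have sub := @bsub X N s. pose g := cutf N (sval (perf_inc _ h)).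
have hE : rs (@bsub X N s) g = perf_inc _ h by rewrite rs_cutf cutf_sval.
have [M hM] : exists M, iint (val_hom N) setT (val_hom N (s ^+ M) * g).
 have [|M hM] := @iint_extend N s setT g aN (@idealT _); first by rewrite hE; exact: perf_int_all.
 by exists M; apply: iint_sub hM. pose F := val_hom N s * (val_hom N (s ^+ M) * g).
have FE : F = val_hom N (s ^+ M.+1) * g by rewrite /F exprS rmorphM mulrA. have [|b bE] := @perf_make N (sval F).
 move=> x Nx; have [us|ns] := pselect (germ_unit s x).
  apply: (good_local (oset_open (basicO s)) us) (goodM (val_good (s ^+ M.+1) Nx) (perf_good h us)) => y uy.
  have [pr prE] := @af_eval N y (sub y uy). by rewrite FE -!prE rmorphM !prE cutfE ?perf_incE //; exact: sub.
 exists N; split=> //; exists 1%N, 0; split; first by left. rewrite rmorph0 subr0 expr1 cutf_sval.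
 by apply: iint_mul => //; [exact: prime_ideal (nonunits_prime Nx)|exact: iint_img].
exists M.+1, b => x us; have Nx := sub x us; rewrite bE // FE. have [pr prE] := @af_eval N x Nx.
by rewrite -prE rmorphM !prE perf_canE cutfE // perf_incE. Qed.

(** Points and topology come from [N], through the universal homeomorphism [perf_can N]. What is
    left is to describe functions on the basic open of [z] as fractions. *)
Lemma perf_affine (N : opens X) : affine_open N -> @affine_open perf N.
move=> aN; have [prN surjN injN baseN locN] := affine_elim aN. have [sinj _ _] := spec_homeo_self (perf_uh aN).
have pr' x : oset N x -> is_prime_ideal (@nonunits perf N x). move=> Nx; have [pr prE] := perf_eval Nx.
 rewrite (_ : @nonunits perf N x = [set z | pr z = 0]); first exact: (@kernel_prime _ (ptF (d x))).
 apply/seteqP; split=> z; rewrite /nonunits /= perf_germ_unit prE. by move=> n; apply: contrapT => nz; apply: n.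
 by move=> z0 []. have surj' P : is_prime_ideal P -> exists x, oset N x /\ @nonunits perf N x = P.
 move=> pP; have [x [Nx e]] := surjN _ (preim_prime (perf_can N) pP); exists x; split=> //.
 exact: (sinj _ _ (pr' x Nx) pP (etrans (perf_can_preim Nx) e)). apply: affine_make => //.
- move=> x y Nx Ny e; apply: (injN x y Nx Ny); rewrite -(perf_can_preim Nx) -(perf_can_preim Ny).
 exact: (congr1 (fun Q => perf_can N @^-1` Q) e).
- move=> x V oV Vx Nx; have [a [ua sub]] := baseN x V oV Vx Nx.
 exists (perf_can N a); split; first exact: ((perf_can_unit a Nx).2 ua).
 by move=> y uy; apply: (sub); exact: ((perf_can_unit a (germ_unit_sub uy)).1 uy).
move=> z; pose D := @basicO perf N z; pose h := @bsub perf N z; split.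
- apply: is_unit_local => x Dx; apply: germ_unit_geq (Dx). by apply: geq_sym; apply: geq_restr.
(* [J] is the ideal of denominators of [y]. A prime that omits [z] cannot contain it, because near
   its point [perf_extend] extends a multiple of [y] to [N]. So a power of [z] is a denominator. *)
- move=> y; pose J : set (@sections perf N) := [set s : @sections perf N | exists b : @sections perf N, forall x, oset D x -> sval y x * sval s x = sval b x].
 have ev x : oset D x -> exists pr : @sections perf N ~> K x, forall f, pr f = sval f x.
  by move=> Dx; apply: perf_eval; exact: h. have idJ : is_ideal J. split=> [|a a' [b hb] [b' hb']|a a' [b hb]].
  - by exists 0 => x Dx; have [pr prE] := ev x Dx; rewrite -!prE rmorph0 mulr0.
  - exists (b + b') => x Dx; have [pr prE] := ev x Dx; rewrite -!prE !rmorphD mulrDr !prE. by rewrite hb // hb'.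
  exists (a * b) => x Dx; have [pr prE] := ev x Dx; rewrite -!prE !rmorphM mulrCA !prE. by rewrite hb.
 have [Q pQ JQ|n [b hb]] := radical_of_primes (a := z) idJ. apply: contrapT => nQ; have [x [Nx eQ]] := surj' Q pQ.
  have Dx : oset D x by move: nQ; rewrite -eQ => /contrapT. have [s [us sub]] := affine_nbhd_in aN Nx Dx.
  have [M [b hb]] := perf_extend (@restr perf D (basicO s) sub y) aN. have : Q (perf_can N (s ^+ M.+1)).
   apply: JQ; exists (perf_can N s * b) => x' Dx'; have [pr prE] := ev x' Dx'.
   rewrite -[sval (perf_can N (s ^+ M.+1)) x']prE -[sval (perf_can N s * b) x']prE exprS !rmorphM.
   have [us'|ns'] := pselect (germ_unit s x'). have hbx := hb x' us'; rewrite perf_in // in hbx.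
    rewrite [pr b]prE hbx -[sval (perf_can N (s ^+ M)) x']prE.
    move: (pr (perf_can N s)) (pr (perf_can N (s ^+ M))) (sval y x') => u v w; ring.
   have -> : pr (perf_can N s) = 0 by rewrite prE; apply/perf_can_ker => //; exact: h. by rewrite !mul0r mulr0.
  rewrite rmorphXn => /(primeX pQ); rewrite -eQ; apply; exact/perf_can_unit.
 exists n, b; apply: perf_eq => x Dx; rewrite perf_in // -hb //.
 have [pr prE] := @perf_eval D x Dx; rewrite -prE rmorphM rmorphXn !prE; congr (_ * _).
 have [pr2 prE2] := ev x Dx; by rewrite perf_in // -!prE2 rmorphXn.
(* A function that vanishes wherever [z] is nonzero is killed by [z] itself. *)
move=> t e; exists 1%N; apply: perf_eq => x Nx; have [pr prE] := perf_eval Nx.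
rewrite expr1 -!prE rmorphM rmorph0 !prE. have [u|nu] := pselect (germ_unit z x).
 by have := congr1 (fun f => sval f x) e; rewrite perf_in // => ->; rewrite /= -[RHS](mulr0 (sval z x)).
suff -> : sval z x = 0 by rewrite mul0r. by apply: contrapT => nz; apply: nu; apply/perf_germ_unit. Qed.

Lemma perf_cover (x : perf) : exists2 U : opens perf, oset U x & affine_open U.
by have [N Nx aN] := @scheme_affine_cover X x; exists N => //; exact: perf_affine. Qed.
Definition perf_scheme : scheme := Scheme perf_cover.

Definition perf_mor : mor perf_scheme X.
refine (@Mor perf_scheme X (fun x => x) (fun V oV => oV) (fun V => perf_can V) _ _).
- by move=> V W h h' s; rewrite -perf_can_restr; apply: restr_pi. by move=> V s x Vx /(perf_can_unit s Vx). Defined.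

Lemma perf_reduced : reduced perf_scheme.
move=> U a n e; apply: perf_eq => x Ux; have [pr prE] := perf_eval Ux.
by rewrite -!prE rmorph0; apply/eqP; have := congr1 pr e; rewrite rmorphXn rmorph0 => /eqP; rewrite expf_eq0 => /andP [].
Qed.

Lemma perf_mor_uh : universal_homeomorphism perf_mor.
apply: uh_of_local => x; have [N Nx aN] := @scheme_affine_cover X x; exists N.
by split=> //; [exact: perf_affine|exact: perf_uh]. Qed.

Hypothesis rigid : topologically_rigid X.

(** Rigidity makes [perf_mor] an isomorphism. As it is the identity on points, its inverse can be
    read over any open [V] and turns a good function into a section. *)
Lemma rigid_good_section (V : opens X) (f : forall x, K x) : (forall x, oset V x -> good f x) ->
 exists s : sections V, forall x, oset V x -> sval (val_hom V s) x = f x.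
move=> gf; have [z zE] := perf_make gf. have [g [gr rg]] := rigid.2 _ _ perf_reduced perf_mor_uh.
have gE x : g x = x by have := congr1 (fun m : mor X X => m x) rg.
have h : V `<=` opre g (V : opens perf_scheme) by move=> x Vx; rewrite /= gE.
exists (restr h (mor_sec g (V : opens perf_scheme) z)) => x Vx.
rewrite -zE // -perf_canE -perf_can_restr perf_in //.
have Vg : oset (V : opens perf_scheme) (mor_comp g perf_mor x) by rewrite /= gE.
have e := @mor_eq_geq perf_scheme perf_scheme _ _ (V : opens perf_scheme) z x gr Vg.
exact: (@geq_fs X K good good_local good1 goodB goodM _ _ _ _ x e). Qed.

(** A nilpotent section becomes 0 in the reduced scheme of functions, and the inverse isomorphism
    brings this back to [X]. *)
Lemma rigid_reduced : reduced X.
move=> U s n e; have [g [gr rg]] := rigid.2 _ _ perf_reduced perf_mor_uh. have z : perf_can U s = 0.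
 by apply: (@perf_reduced U _ n); rewrite -rmorphXn e rmorph0.
apply: geq_eq => x Ux; have Ug : oset U (mor_comp perf_mor g x) by rewrite rg.
have h1 := mor_eq_geq s rg Ug; have h2 := mor_eq_geq 0 rg Ug. apply: geq_trans (geq_sym h1) _; apply: geq_trans h2.
suff -> : mor_sec (mor_comp perf_mor g) U s = mor_sec (mor_comp perf_mor g) U 0 by apply: geq_refl.
rewrite [RHS]rmorph0; transitivity (mor_sec g (opre perf_mor U) (perf_can U s)); first by []. by rewrite z rmorph0.
Qed.

Section Values.
Variables (T : opens X) (D : cring) (lam : sections T ~> D).
Variable Th : D ~> @sections all_fun T.
Hypothesis ThE : Th \o lam =1 val_hom T.

(** On the basic open of the denominator [b], dividing by [b] turns [radicial_at] into [rad1]. The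
    function of [z] is therefore good at each point of [T]. *)
Lemma rigid_values z : affine_open T -> (forall P, is_prime_ideal P -> radicial_at lam P z) ->
 exists s : sections T, val_hom T s = Th z.
move=> aT rad; have [|s sE] := @rigid_good_section T (sval (Th z)); last first.
 by exists s; apply: af_eq => x Tx; exact: sE.
move=> x Tx; have pT := nonunits_prime Tx; have [q [b [a [Pq nb i]]]] := rad _ pT.
have ub : germ_unit b x by apply: contrapT. have h := @bsub X T b; exists (basicO b); split=> //.
have [c ec] : is_unit (restr h b).
 by apply: is_unit_local => y uy; apply: germ_unit_geq (uy); apply: geq_sym; exact: geq_restr.
have pb := nonunits_prime (ub : oset (basicO b) x). exists q, (restr h a * c); split.
 by apply: (pexp_preim (f := restr h)) Pq => e; move/(nonunits_restr h e ub).
have i1 : iint (val_hom T) (nonunits T x) (Th (lam b * z ^+ q - lam a)). by apply: iint_eq_hom ThE (iint_map Th i).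
have i2 : iint (val_hom (basicO b)) (nonunits (basicO b) x) (rs h (Th (lam b * z ^+ q - lam a))).
 by apply: iint_restr i1 => e; move/(nonunits_restr h e ub). have idb := prime_ideal pb.
have := iint_mul idb i2 (iint_img (val_hom (basicO b)) (Logic.I : setT c)).
have eT : Th (lam b * z ^+ q - lam a) = val_hom T b * Th z ^+ q - val_hom T a.
 by rewrite rmorphB rmorphM rmorphXn -!ThE.
rewrite eT [rs h (_ - _)]rmorphB [rs h (_ * _)]rmorphM [rs h (_ ^+ _)]rmorphXn !val_restr.
rewrite (_ : rs h (Th z) = cutf (basicO b) (sval (Th z))); last by rewrite -(rs_cutf h) cutf_sval.
rewrite mulrBl -[val_hom _ (restr h a) * _]rmorphM.
rewrite [X in X - _](_ : _ = val_hom _ (restr h b * c) * cutf (basicO b) (sval (Th z)) ^+ q); last by rewrite rmorphM; ring.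
by rewrite ec rmorph1 mul1r. Qed.
End Values.
End Perfection.

(** * Localization and base change of standard etale algebras *)

Section PolynomialValues.
Variable A : cring.
Implicit Types c : nat -> A.

(** Here and below the new coefficients serve all [S], [u] and [x] at once, because a universal
    property over all test rings will be checked with them. *)
Lemma pv_widen c k j : exists c', forall (S : cring) (u : A ~> S) x, pv u c' (k + j) x = pv u c k x.
exists (fun i => if (i < k)%N then c i else 0) => S u x.
rewrite /pv (big_ord_widen (k + j) (fun i => u (c i) * x ^+ i) (leq_addr j k)) [RHS]big_mkcond.
by apply: eq_bigr => i _; case: ifP => // _; rewrite rmorph0 mul0r. Qed.
Lemma pvD c k c' k' : exists c'' k'', forall (S : cring) (u : A ~> S) x,
 pv u c'' k'' x = pv u c k x + pv u c' k' x.
have [d dE] := pv_widen c k k'; have [d' dE'] := pv_widen c' k' k.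
exists (fun i => d i + d' i), (k + k')%N => S u x; rewrite -dE -dE' addnC /pv -big_split.
by apply: eq_bigr => i _ /=; rewrite rmorphD mulrDl. Qed.
Lemma pv_monomial c k a j : exists c'' k'', forall (S : cring) (u : A ~> S) x,
 pv u c'' k'' x = u a * x ^+ j * pv u c k x.
exists (fun i => if (i < j)%N then 0 else a * c (i - j)%N), (j + k)%N => S u x.
rewrite /pv big_split_ord /= big1 ?add0r => [|i _]; last by rewrite ltn_ord rmorph0 mul0r.
rewrite mulr_sumr; apply: eq_bigr => i _; rewrite ltnNge leq_addr /= addKn rmorphM exprD; ring. Qed.
Lemma pvM c k c' k' : exists c'' k'', forall (S : cring) (u : A ~> S) x,
 pv u c'' k'' x = pv u c k x * pv u c' k' x.
elim: k => [|k [d [m h]]]; first by exists c, 0%N => S u x; rewrite /pv !big_ord0 mul0r.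
have [d1 [m1 h1]] := pv_monomial c' k' (c k) k; have [d2 [m2 h2]] := pvD d m d1 m1.
by exists d2, m2 => S u x; rewrite h2 h h1 [pv u c k.+1 x]/pv big_ord_recr /= mulrDl. Qed.
Lemma pvX c k n : exists c'' k'', forall (S : cring) (u : A ~> S) x, pv u c'' k'' x = pv u c k x ^+ n.
elim: n => [|n [d [m h]]]. by exists (fun=> 1), 1%N => S u x; rewrite /pv big_ord1 rmorph1 mul1r !expr0.
by have [d1 [m1 h1]] := pvM c k d m; exists d1, m1 => S u x; rewrite h1 h exprS. Qed.
Lemma pv_comp (B R : cring) (f : A ~> B) (l : B ~> R) c k x : l (pv f c k x) = pv (l \o f) c k (l x).
by rewrite rmorph_sum; apply: eq_bigr => i _; rewrite rmorphM rmorphXn. Qed.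
Lemma pv_hom (S : cring) (u v : A -> S) c k x : u =1 v -> pv u c k x = pv v c k x.
by move=> e; apply: eq_bigr => i _; rewrite e. Qed.
End PolynomialValues.

(** Some power of [h(t)] times [s] is a polynomial value [c(t)], so inverting [s] amounts to
    replacing [h] by [h c]. *)
Lemma std_etale_loc (A E E' : cring) (phi : A ~> E) (s : E) (l : E ~> E') :
 std_etale phi -> is_localization s l -> std_etale (l \o phi).
move=> [t [n [g [m [h [g1 gt [uh ug] fr univ]]]]]] L; have [us lfr _] := L.
have [N [k [c ec]]] := fr s; have [hc [mc hcE]] := pvM h m c k.
have ecl : pv (l \o phi) h m (l t) ^+ N * l s = pv (l \o phi) c k (l t). by rewrite -!pv_comp -ec rmorphM rmorphXn.
have uh' : is_unit (pv (l \o phi) h m (l t)) by rewrite -pv_comp; exact: unit_morph.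
exists (l t), n, g, mc, hc; split=> //.
- by rewrite -pv_comp gt rmorph0.
- split; last by rewrite -pv_comp; exact: unit_morph.
 by rewrite hcE -ecl; apply: is_unitM => //; apply: is_unitM => //; exact: is_unitX.
- move=> e'; have [q [e ee]] := lfr e'; have [N0 [k0 [d0 ed]]] := fr e.
 have [c1 [k1 E1]] := pvX c k N0; have [c2 [k2 E2]] := pvX h m ((N * q) + q)%N.
 have [c3 [k3 E3]] := pvM c1 k1 c2 k2; have [c4 [k4 E4]] := pvM c3 k3 d0 k0.
 exists (q + N0)%N, k4, c4; rewrite E4 E3 E1 E2 hcE -[pv _ d0 _ _]pv_comp -ed rmorphM rmorphXn -ee pv_comp -ecl.
 set H := pv _ h _ _; rewrite !exprMn !exprD exprM; move: (H ^+ N) => HN; ring.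
move=> S u x gx uhc; move: uhc; rewrite hcE => uhc. have [w [wp wt]] := univ S u x gx (unit_factor uhc).
have uw : is_unit (w s). have e : w (pv phi h m t ^+ N * s) = pv u c k x by rewrite ec pv_comp wt; exact: pv_hom.
 apply: (@unit_factor _ _ (w (pv phi h m t ^+ N))); rewrite mulrC -rmorphM e.
 by apply: (@unit_factor _ _ (pv u h m x)); rewrite mulrC.
have [w' w'E] := loc_lift L uw; exists w'; split=> [a|]; last by rewrite -wt -w'E.
by rewrite /= -[w' (l _)]/((w' \o l) _) w'E -wp. Qed.

Lemma std_etale_base (A E A' R : cring) (phi : A ~> E) (psi : A ~> A') (i : E ~> R) (j : A' ~> R) :
 is_tensor phi psi i j -> std_etale phi -> std_etale j.
move=> tR [t [n [g [m [h [g1 gt [uh ug] fr univ]]]]]]; have [ij span _] := tR.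
have pvE c k : pv j (psi \o c) k (i t) = i (pv phi c k t). by rewrite pv_comp; apply: eq_bigr => q _ /=; rewrite ij.
exists (i t), n, (psi \o g), m, (psi \o h); split.
- by rewrite /= g1 rmorph1.
- by rewrite pvE gt rmorph0.
- split; first by rewrite pvE; exact: unit_morph.
 rewrite (_ : pv _ _ _ _ = i (pv phi (fun q => g q.+1 *+ q.+1) n t)); first exact: unit_morph.
 by rewrite -[in RHS]pvE; apply: eq_bigr => q _; rewrite /= [psi (_ *+ _)]rmorphMn.
- move=> r; have [s ->] := span r; rewrite pvE. elim: s => [|[e a'] s [N [k [c ec]]]].
  by exists 0%N, 0%N, (fun=> 0); rewrite big_nil mulr0 /pv big_ord0. have [N' [k' [c' ec']]] := fr e.
 have [c1 [k1 E1]] := pvX (psi \o h) m N; have [c2 [k2 E2]] := pvX (psi \o h) m N'.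
 have [c3 [k3 E3]] := pv_monomial (psi \o c') k' a' 0.
 have [c4 [k4 E4]] := pvM c1 k1 c3 k3; have [c5 [k5 E5]] := pvM c2 k2 c k. have [c6 [k6 E6]] := pvD c4 k4 c5 k5.
 exists (N + N')%N, k6, c6; rewrite E6 E4 E5 E1 E2 E3 -ec !pvE -ec' rmorphM rmorphXn big_cons exprD /= expr0; ring.
move=> S u x gx ux; have [||w [wp wt]] := univ S (u \o psi) x.
- by move: gx.
- by move: ux. have [|w' [w'i w'j]] := tensor_lift tR (u := w) (v := u); first by move=> a; exact: wp.
by exists w'; split=> //; rewrite -wt -w'i. Qed.

Lemma std_etale_id (A : cring) : std_etale (idfun : A ~> A).
(* [A] is presented as [A[X]/(X)]: [g] is [X], its root is 0 and [h] is 1. *)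
exists 0, 1%N, (fun i => if i == 1%N then 1 else 0), 1%N, (fun=> 1); split=> //.
- by rewrite /pv big_ord_recr big_ord1 /= mul0r expr1 mulr0 addr0.
- by rewrite /pv !big_ord1 /= !mulr1; split; exact: is_unit1.
- by move=> e; exists 0%N, 1%N, (fun=> e); rewrite expr0 mul1r /pv big_ord1 expr0 mulr1.
move=> S u x; rewrite /pv big_ord_recr big_ord1 /= rmorph0 mul0r add0r rmorph1 mul1r expr1 => -> _.
by exists u; split=> //; rewrite rmorph0. Qed.

Lemma std_etale_poly (A E : nzcring) (phi : A ~> E) : std_etale phi ->
 exists (t : E) (g h : {poly A}), [/\ g \is monic, evp phi t g = 0,
  is_unit (evp phi t h) /\ is_unit (evp phi t g^`()), forall e, exists N P, evp phi t h ^+ N * e = evp phi t P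
 & forall (S : nzcring) (u : A ~> S) (x : S),
   evp u x g = 0 -> is_unit (evp u x h) -> exists w : E ~> S, w \o phi =1 u /\ w t = x].
move=> [t [n [g [m [h [g1 gt [uh ug] fr univ]]]]]].
have pE (S : nzcring) (u : A ~> S) x c k : evp u x (\poly_(i < k) c i) = pv u c k x.
 by rewrite (evp_pv _ _ (size_poly _ _)); apply: eq_bigr => i _; rewrite coef_poly ltn_ord.
exists t, (\poly_(i < n.+1) g i), (\poly_(i < m) h i).
have sg : size (\poly_(i < n.+1) g i) = n.+1 by apply: size_poly_eq; rewrite g1 oner_neq0. split.
- by rewrite monicE lead_coefE sg coef_poly ltnSn g1.
- by rewrite pE.
- rewrite pE; split=> //; rewrite (@evp_pv _ _ _ _ n) ?(leq_trans (size_poly _ _)) ?sg //.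
 rewrite (_ : pv _ _ _ _ = pv phi (fun i => g i.+1 *+ i.+1) n t) //.
 by apply: eq_bigr => i _; rewrite coef_deriv coef_poly ltnS ltn_ord.
- by move=> e; have [N [k [c ec]]] := fr e; exists N, (\poly_(i < k) c i); rewrite !pE.
by move=> S u x; rewrite !pE => gx hx; exact: univ. Qed.

Lemma std_etale_reduced (C E : cring) (phi : C ~> E) : std_etale phi -> reduced_ring C -> reduced_ring E.
have [e0|nz] := pselect ((1 : E) = 0). by move=> _ _ a n _; rewrite -[a]mulr1 e0 mulr0.
have nzC : (1 : C) <> 0 by move=> e; apply: nz; rewrite -(rmorph1 phi) e rmorph0.
have [C' eC] := comNzRing_of nzC; have [E' eE] := comNzRing_of nz; clear nz nzC; subst C E.
move=> /std_etale_poly [t [g [h [gm gt [uh ug] fr univ]]]]. exact: (standard_reduced gm gt uh ug fr univ). Qed.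

Lemma std_etale_descent (C E B : cring) (phi : C ~> E) (eta : E ~> B) :
 (1 : E) <> 0 -> (1 : B) <> 0 -> std_etale phi -> (forall b, iint eta setT b) -> spec_surj eta ->
 field_unique eta -> reduced_ring B -> forall (I : Type) (Pt : I -> set C), (forall x, is_prime_ideal (Pt x)) ->
 (forall P, is_prime_ideal P -> exists x, Pt x = P) ->
 forall a : B, exists (F : I -> fieldType) (ev : forall x, C ~> F x) (D : cring)
  (lam : C ~> D) (pr : forall x, D ~> F x) (d : nat -> D),
 [/\ forall x c, ev x c = 0 <-> Pt x c, forall z, iint lam setT z, forall x c, pr x (lam c) = ev x c,
   forall k (F : fieldType) (u v : D ~> F), u \o lam =1 v \o lam -> u (d k) = v (d k)
  & forall gam : nat -> C, (forall k x, ev x (gam k) = pr x (d k)) -> exists e, eta e = a].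
move=> nz nzB; have nzC : (1 : C) <> 0 by move=> e; apply: nz; rewrite -(rmorph1 phi) e rmorph0.
have [C' eC] := comNzRing_of nzC; have [E' eE] := comNzRing_of nz; have [B' eB] := comNzRing_of nzB.
clear nz nzC nzB; subst C E B.
move=> /std_etale_poly [t [g [h [gm gt [uh ug] fr univ]]]] int surj uniq red I Pt pP allP a.
have rfe x := root_field_exists gm univ surj (pP x). pose rf x := sval (cid (rfe x)).
have [D [lam [pr [d [h1 h2 h3 h4]]]]] := standard_descent gm gt uh ug fr int uniq red a rf allP.
by exists (fun x => rf_field (rf x)), (fun x => rf_ev (rf x)), D, lam, pr, d; split=> // x c; exact: rf_ker. Qed.

Lemma surj_inj_bijective (T U : Type) (f : T -> U) : injective f -> (forall u, exists t, f t = u) -> bijective f.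
move=> inj sur; exists (fun u => sval (cid (sur u))) => [t|u]; last exact: (svalP (cid (sur u))).
by apply: inj; exact: (svalP (cid (sur (f t)))). Qed.

(** * Standard etale spectra over a rigid scheme are rigid *)

Section RigidEtale.
Variables (X : scheme) (T : opens X).
Hypotheses (rigid : topologically_rigid X) (aT : affine_open T).

(** The elements [d k] of the descent are integral over the sections of [T] and constant on field
    points over a given point, hence radicial; [rigid_values] turns them into sections of [T], which
    is what the descent asks for. *)
Lemma rigid_std_descent (E B : cring) (phi : sections T ~> E) (eta : E ~> B) :
 (1 : E) <> 0 -> (1 : B) <> 0 -> std_etale phi -> (forall b, iint eta setT b) -> spec_surj eta ->
 field_unique eta -> reduced_ring B -> forall a, exists e, eta e = a.
move=> nz nzB st int surj uniq red a. have [_ surjT _ _ _] := affine_elim aT.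
have [||F [ev [D [lam [pr [d [evK intD prl rad conc]]]]]]] :=
 @std_etale_descent _ E B phi eta nz nzB st int surj uniq red {x : X | oset T x} (fun x => nonunits T (sval x)) _ _ a.
- by move=> x; exact: (nonunits_prime (svalP x)).
- by move=> P /surjT [x [Tx e]]; exists (exist _ x Tx).
(* On [T] the value fields are those of the descent; elsewhere any choice will do. The decision [p]
   stays an argument, so that it can be destructed together with the types that depend on it. *)
pose D1 (x : X) (h : oset T x) : pt_data x := PtData h aT (evK (exist _ x h)).
pose dd (x : X) (p : {oset T x} + {~ oset T x}) : pt_data x :=
 match p with left h => D1 x h | right _ => sval (cid (pt_data_exists x)) end.
pose pd (x : X) : pt_data x := dd x (pselect (oset T x)).
pose Fp r (x : X) (p : {oset T x} + {~ oset T x}) : ptF (dd x p) :=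
 match p return ptF (dd x p) with left h => pr (exist _ x h) r | right _ => 0 end.
have Fev (x : X) (Tx : oset T x) c z p : ptev (dd x p) Tx c = Fp z x p <-> ev (exist _ x Tx) c = pr (exist _ x Tx) z.
 case: p => [h|//] /=; rewrite (Prop_irrelevance h Tx). by rewrite (ptev_N (d := D1 x Tx)).
have F0 r (x : X) p : ~ oset T x -> Fp r x p = 0 by case: p.
have FD r r' (x : X) p : Fp (r + r') x p = Fp r x p + Fp r' x p. by case: p => [h|n] /=; rewrite ?addr0 ?rmorphD.
have FM r r' (x : X) p : Fp (r * r') x p = Fp r x p * Fp r' x p. by case: p => [h|n] /=; rewrite ?mulr0 ?rmorphM.
have F1 (x : X) p : oset T x -> Fp 1 x p = 1 by case: p => [h|//] _ /=; rewrite rmorph1.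
have [Th ThE] : exists Th : D ~> @sections (all_fun pd) T, forall r x, sval (Th r) x = Fp r x (pselect (oset T x)).
 have [||||Th ThE] := @fring_hom X (fun x => ptF (pd x)) (oset T) (all_cls pd T) D
   (fun r x => Fp r x (pselect (oset T x))).
 - by move=> r; split=> // x nx; exact: F0.
 - by move=> r r' x; exact: FD.
 - by move=> r r' x; exact: FM.
 - by move=> x Tx; exact: F1. by exists Th => r x; rewrite ThE. have Thl : Th \o lam =1 val_hom pd T.
 move=> c; apply: af_eq => x Tx; rewrite [LHS]ThE (val_homE _ c Tx); apply/esym/Fev. by rewrite prl.
have gam k := @rigid_values X pd rigid T D lam Th Thl (d k) aT (radicial_of_field_points intD (rad k)).
apply: (conc (fun k => sval (cid (gam k)))) => k [x Tx]. have e := congr1 (fun f => sval f x) (svalP (cid (gam k))).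
by move: e; rewrite /= ThE (val_homE _ _ Tx) => /Fev. Qed.

Lemma rigid_std_bijective (E B : cring) (phi : sections T ~> E) (eta : E ~> B) :
 std_etale phi -> universal_homeo eta -> reduced_ring B -> bijective eta.
move=> st uh red; have surj := universal_surj uh. apply: surj_inj_bijective.
 apply: spec_surj_inj surj _; apply: std_etale_reduced st _; exact: (rigid_reduced (fun x => sval (cid (pt_data_exists x))) rigid).
have [e0 b|nz] := pselect ((1 : E) = 0). by exists 0; rewrite -[b]mulr1 -(rmorph1 eta) e0 rmorph0 mulr0.
apply: (rigid_std_descent nz _ st (universal_integral uh) surj (universal_field_unique uh) red).
move=> e; have [P pP] := prime_exists nz; have [Q [[Q0 _ _ Q1 _] _]] := surj P pP. by apply: Q1; rewrite e. Qed.

Lemma mor_id_l (Y Z : scheme) (f : mor Y Z) : mor_comp (mor_id Z) f = f.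
by apply: mor_ext => // V s w Vw; apply: geq_refl. Qed.
Lemma mor_id_r (Y Z : scheme) (f : mor Y Z) : mor_comp f (mor_id Y) = f.
by apply: mor_ext => // V s w Vw; apply: geq_refl. Qed.

(** Being an isomorphism is checked on basic opens of [Spec E] with affine preimage. Their rings are
    localizations of [E], again standard etale over [T], so [rigid_std_bijective] applies to the
    comorphism. *)
Lemma spec_rigid (E : cring) (phi : sections T ~> E) : std_etale phi -> topologically_rigid (Spec E).
move=> st; split=> [|Y' f redY uh]; first exact: spec_coherent.
(* Base change along the identity shows that [f] itself is a homeomorphism. *)
have pb : is_pullback f (mor_id Y') (mor_id (Spec E)) f. split; first by rewrite mor_id_l mor_id_r.
 move=> W x y; rewrite mor_id_l => e; exists y; split; first by rewrite mor_id_l.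
 by move=> w [_ <-]; rewrite mor_id_l. have [_ [g0 [gK Kg gc]]] := uh _ _ _ _ _ pb.
apply: (is_iso_local gK Kg) => [V oV|z V Vz]; first by move/continuousP: gc; exact.
have [U' [U'z aU' U'V]] : exists U' : opens Y', [/\ oset U' (g0 z), affine_open U' & U' `<=` opre f V].
 by apply: affine_nbhd; rewrite /= Kg.
have : open (g0 @^-1` oset U') by move/continuousP: gc => h; apply: (h); exact: oset_open.
(* The preimage of the basic open of [e] lies in the affine [U'], where it is again a basic open and
   hence affine. *)
rewrite space_openE /= => /(_ z U'z) [e [ne eW]].
pose M : opens (Spec E) := specD e; pose ce : sections (topO (Spec E)) := gcan E e. have aM : affine_open M.
 rewrite (_ : M = basicO ce); first exact: (@affine_basic (Spec E) _ ce (@spec_affine E)).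
 by apply: opens_eq; apply/seteqP; split=> Q; rewrite /= /ce spec_germ_unit.
have sub : U' `<=` opre f (topO (Spec E)) by []. have aM' : affine_open (opre f M).
 rewrite (_ : preim_opens _ _ = basicO (restr sub (mor_sec f _ ce))); first exact: affine_basic.
 have iff y : oset U' y -> germ_unit (restr sub (mor_sec f _ ce)) y <-> ~ sval (f y) e.
  move=> Uy; rewrite -(@spec_germ_unit E (topO (spec_ringed E)) e (f y)) //.
  have gq := geq_restr sub (mor_sec f _ ce) Uy; split=> u.
   by apply: (mor_local (m := f) (V := topO (Spec E)) (s := ce)) => //; exact: germ_unit_geq gq u.
  apply: (germ_unit_geq (geq_sym gq)). exact: ((@mor_germ_unit Y' (Spec E) f y (topO (Spec E)) ce Logic.I).2 u).
 apply: opens_eq; apply/seteqP; split=> y. move=> My; have Uy : oset U' y by have := eW _ My; rewrite /= gK.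
  exact: (iff y Uy).2 My. move=> u; have Uy := germ_unit_sub u; exact: (iff y Uy).1 u. exists M; split=> //.
 by move=> Q MQ; have /U'V := eW Q MQ; rewrite /= Kg.
have L : is_localization e (spec_can (M : opens (spec_ringed E))) by exact: spec_can_loc.
exact: (rigid_std_bijective (std_etale_loc st L) (uh_universal uh aM aM') (redY _)). Qed.
End RigidEtale.

(** * The cartesian square *)

Section OpenInclusion.
Variables (X : scheme) (O' O : opens X) (OO : O' `<=` O).
Let pt (y : opn O') : opn O := exist _ (sval y) (OO (proj2_sig y)).

Lemma opn_sub_open (V : set (opn O)) : open V -> open (pt @^-1` V).
move=> oV; rewrite space_openE /= (_ : img _ = img V `&` oset O'). by apply: openI; [exact: oV|exact: oset_open].
apply/seteqP; split=> x; first by move=> [h Vx]; split=> //; exists (OO h).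
by move=> [[h Vx] h']; exists h'; rewrite /pt /=; rewrite (Prop_irrelevance (OO h') h). Qed.

Lemma opn_sub_img (V : opens (opn O)) : imgO (preim_opens opn_sub_open V) `<=` imgO V.
by move=> x [h Vx]; exists (OO h). Qed.

Definition opn_sub : mor (opn O') (opn O).
refine (@Mor (opn O') (opn O) pt opn_sub_open (fun V => restr (@opn_sub_img V)) _ _).
- move=> V W h h' s.
 by rewrite /= (restrR _ _ (subOt (@opn_sub_img W) (imgO_sub h))) (restrR _ _ (subOt (@opn_sub_img W) (imgO_sub h))).
move=> V s y Vy /opn_germ_unit u; apply/opn_germ_unit; apply: germ_unit_geq u; apply: geq_restr. exact/img_sval.
Defined.

Lemma incl_opn_sub : mor_comp (incl O) opn_sub = incl O'.
apply: mor_ext => // V s w Vw; apply/opn_geq.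
have h1 : oset (imgO (preim_opens opn_sub_open (preim_opens (@incl_cont X O) V))) (sval w) by apply/img_sval.
have h2 : oset (imgO (preim_opens (@incl_cont X O) V)) (sval w) by apply/(img_sval _ (pt w)).
have h3 : oset (imgO (preim_opens (@incl_cont X O') V)) (sval w) by apply/img_sval.
apply: geq_trans (geq_sym (geq_restr (@incl_sub X O' V) s h3)). apply: geq_trans (geq_restr (@incl_sub X O V) s h2).
exact: (geq_restr _ _ h1). Qed.

Lemma opn_sub_geq (Z : scheme) (g : mor (opn O) Z) (V : opens Z) (s : sections V) (y : opn O') : oset V (g (opn_sub y)) ->
 geqg (sval y) (mor_sec (mor_comp g opn_sub) V s : sections (imgO _)) (mor_sec g V s : sections (imgO _)).
by move=> Vy; apply: geq_restr; apply/img_sval. Qed.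
End OpenInclusion.

Lemma opn_eq_at (X Z : scheme) (O1 O2 O : opens X) (h1 : O `<=` O1) (h2 : O `<=` O2)
  (g1 : mor (opn O1) Z) (g2 : mor (opn O2) Z) (y1 : opn O1) (y2 : opn O2) :
 mor_comp g1 (opn_sub h1) = mor_comp g2 (opn_sub h2) -> oset O (sval y1) -> sval y1 = sval y2 ->
 g1 y1 = g2 y2 /\ forall (V : opens Z) (s : sections V), oset V (g1 y1) ->
  geqg (sval y1) (mor_sec g1 V s : sections (imgO _)) (mor_sec g2 V s : sections (imgO _)).
case: y1 y2 => [x k1] [x2 k2] /= E Ox e; subst x2; pose z : opn O := exist _ x Ox.
have z1 : opn_sub h1 z = exist _ x k1 by congr exist; exact: Prop_irrelevance.
have z2 : opn_sub h2 z = exist _ x k2 by congr exist; exact: Prop_irrelevance.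
have eg : g1 (opn_sub h1 z) = g2 (opn_sub h2 z) by have := congr1 (fun m : mor (opn O) Z => m z) E.
rewrite -z1 -z2; split=> // V s Vz. have /opn_geq e0 := mor_eq_geq s E (Vz : oset V (mor_comp g1 (opn_sub h1) z)).
apply: (geq_trans (geq_sym (opn_sub_geq s Vz))); apply: (geq_trans e0). by apply: opn_sub_geq; rewrite -eg. Qed.

Section Cartesian.
Variables (X Y : scheme) (p : mor Y X).
Hypothesis p_etale : etale p.
Variables (Xt Yt : scheme) (epsX : mor Xt X) (epsY : mor Yt Y).
Hypotheses (HX : is_trig epsX) (HY : is_trig epsY).
Variable q : mor Yt Xt.
Hypothesis Hp : mor_comp epsX q = mor_comp p epsY.

(* [Spec E] is the fibre product of [T] and [V] over [X]. It is etale over [T], hence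
  rigid, and so it maps to [Yt]. *)
Lemma local_chart (x0 : Xt) (y0 : Y) : epsX x0 = p y0 ->
 exists (T : opens Xt) (V : opens Y) (E : cring) (sg : mor (Spec E) Yt), [/\ oset T x0, oset V y0,
  forall (W : scheme) (x : mor W Xt) (y : mor W Y), mor_comp epsX x = mor_comp p y ->
   (forall w, oset T (x w)) -> (forall w, oset V (y w)) ->
   exists r : mor W (Spec E), mor_comp q (mor_comp sg r) = x /\ mor_comp epsY (mor_comp sg r) = y
 & forall (W : scheme) (r r' : mor W (Spec E)), mor_comp q (mor_comp sg r) = mor_comp q (mor_comp sg r') ->
   mor_comp epsY (mor_comp sg r) = mor_comp epsY (mor_comp sg r') -> r = r'].
move=> exy; have [U [V0 [h [V0y aU aV0 et]]]] := p_etale y0.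
have [s [ns loc]] := etale_locally_standard et (nonunits_prime V0y). have us : germ_unit s y0 by apply: contrapT.
have [_ _ _ _ loc0] := affine_elim aV0. have bs := @bsub Y V0 s; have st := loc _ _ (loc0 s _ bs erefl).
have aV := affine_basic s aV0. have Ux : oset (opre epsX U) x0 by rewrite /= exy; exact: h V0y.
have [T [Tx aT TU]] := affine_nbhd Ux. pose psi : sections U ~> sections T := restr TU \o mor_sec epsX U.
pose phi : sections U ~> sections (basicO s) := restr bs \o (restr h \o mor_sec p U).
have [E [i [j tE]]] := tensor_ring phi psi; have [ij _ _] := tE.
have rig : topologically_rigid (Spec E) by apply: (spec_rigid HX.1 aT (std_etale_base tE st)).
have [aX [aXT [aXE _]]] := spec_to_affine j aT; have [aY [aYV [aYE _]]] := spec_to_affine i aV.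
have phiE a y : oset (basicO s) y -> geqg y (mor_sec p U a) (phi a).
 move=> Vy; apply: geq_sym; apply: (geq_trans (geq_restr bs (restr h (mor_sec p U a)) Vy)).
 by apply: geq_restr; exact: (bs y Vy). have psiE a x : oset T x -> geqg x (mor_sec epsX U a) (psi a).
 by move=> Tx'; apply: geq_sym; apply: geq_restr. have comm : mor_comp p aY = mor_comp epsX aX.
 apply: (@land_ext (Spec E) X U (mor_comp p aY) _ (fun a => gcan E (i (phi a))) aU).
 - by move=> Q; exact: (h _ (bs _ (aYV Q))).
 - by move=> Q; exact: (TU _ (aXT Q)).
 - by move=> a Q; apply: (mor_comp_geq (phiE a _ (aYV Q))); exact: aYE.
 by move=> a Q; rewrite ij; apply: (mor_comp_geq (psiE a _ (aXT Q))); exact: aXE.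
(* [q] after [sg] and [aX] become equal in [X], and [Spec E] is rigid, so the adjunction for [X]
   identifies them. *)
have [sg [sgE _]] := HY.2 _ aY rig. have qsg : mor_comp q sg = aX.
 have [u [_ uni]] := HX.2 _ (mor_comp epsX aX) rig. rewrite -(uni aX erefl); apply/esym/uni.
 by rewrite mor_compA Hp -mor_compA sgE. exists T, (basicO s), E, sg; split=> //.
- move=> W x y exy' xT yV. have [psi1 h1] := mor_land_hom xT; have [psi2 h2] := mor_land_hom yV.
 have [|ps [pi' pj']] := tensor_lift tE (u := psi2) (v := psi1).
  move=> a; apply: (@geq_top W) => w; change (geqg w (psi2 (phi a)) (psi1 (psi a))).
  apply: (geq_trans (geq_sym (h2 _ w))); apply: geq_trans (h1 _ w).
  apply: (geq_trans (geq_sym (mor_geq (phiE a _ (yV w))))); apply: geq_trans (mor_geq (psiE a _ (xT w))).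
  exact: (mor_eq_geq a (esym exy') (h _ (bs _ (yV w)))).
 have [r rE] := spec_mor ps; exists r; rewrite !mor_compA qsg sgE; split.
  apply: (land_ext (psi := psi1) aT) => // [w|a w]; first exact: aXT.
  apply: (mor_comp_geq (aXE a (r w))); apply: (geq_trans (rE _ w)).
  by rewrite -[ps (j a)]/((ps \o j) a) pj'; exact: geq_refl.
 apply: (land_ext (psi := psi2) aV) => // [w|a w]; first exact: aYV.
 apply: (mor_comp_geq (aYE a (r w))); apply: (geq_trans (rE _ w)).
 by rewrite -[ps (i a)]/((ps \o i) a) pi'; exact: geq_refl. move=> W r r'; rewrite !mor_compA qsg sgE => eX eY.
have [rho hr] := @mor_land_hom W (Spec E) (topO (Spec E)) r (fun _ => Logic.I).
have [rho' hr'] := @mor_land_hom W (Spec E) (topO (Spec E)) r' (fun _ => Logic.I).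
have e : rho \o gcan E =1 rho' \o gcan E. apply: (tensor_morph_eq tE) => a; apply: (@geq_top W) => w.
  have e1 := mor_eq_geq a eY (aYV (r w)).
  apply: (geq_trans (geq_sym (mor_comp_geq (aYE a (r w)) (hr _ w)))); apply: (geq_trans e1).
  exact: (mor_comp_geq (aYE a (r' w)) (hr' _ w)). have e1 := mor_eq_geq a eX (aXT (r w)).
 apply: (geq_trans (geq_sym (mor_comp_geq (aXE a (r w)) (hr _ w)))); apply: (geq_trans e1).
 exact: (mor_comp_geq (aXE a (r' w)) (hr' _ w)).
apply: spec_mor_ext => a w; apply: (geq_trans (hr _ w)); apply: geq_sym; apply: (geq_trans (hr' _ w)).
by have := e a; rewrite /= => ->; exact: geq_refl. Qed.

(** [W] is not rigid, so the adjunction cannot be applied to [v] and [v'] directly. Locally each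
    passes through an affine open of [Yt] whose inclusion factors through [sg], and the two
    factorizations agree because [Spec E] is a fibre product. *)
Lemma lift_unique (W : scheme) (v v' : mor W Yt) :
 mor_comp q v = mor_comp q v' -> mor_comp epsY v = mor_comp epsY v' -> v = v'.
move=> eq ey; apply: opn_local_eq => w.
have epq z : epsX (q z) = p (epsY z) by have := congr1 (fun m : mor Yt X => m z) Hp.
have [T [V [E [sg [Tw Vw lift mono]]]]] := local_chart (epq (v w)).
have factor (Q : opens Yt) : affine_open Q -> (forall z, oset Q z -> oset T (q z) /\ oset V (epsY z)) ->
  forall (W' : scheme) (u : mor W' Yt), (forall w', oset Q (u w')) -> exists r : mor W' (Spec E), u = mor_comp sg r.
 (* [jQ] is the inclusion of [Q]. Its two projections factor through [Spec E]; followed by [sg] this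
    factorization is [jQ] again, as maps from the rigid spectrum of [Q] to [Yt] are determined by
    their image in [Y]. *)
 move=> aQ QTV W' u uQ. have [jQ [jQQ [jQE _]]] := spec_to_affine (idfun : sections Q ~> sections Q) aQ.
 have [|||rQ [_ e2]] := lift _ (mor_comp q jQ) (mor_comp epsY jQ).
 - by rewrite !mor_compA Hp.
 - by move=> z; have [] := QTV _ (jQQ z).
 - by move=> z; have [] := QTV _ (jQQ z).
 have rig : topologically_rigid (Spec (sections Q)) by apply: (spec_rigid HY.1 aQ (@std_etale_id _)).
 have e3 : mor_comp sg rQ = jQ. have [u0 [_ uni]] := HY.2 _ (mor_comp epsY jQ) rig.
  by rewrite -(uni jQ erefl); apply/esym/uni. have [ps hps] := mor_land_hom uQ; have [r0 r0E] := spec_mor ps.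
 exists (mor_comp rQ r0); rewrite mor_compA e3. apply: (land_ext (psi := ps) aQ) => // [a|a w']; first exact: jQQ.
 by apply: (mor_comp_geq (jQE a (r0 w'))); exact: r0E. pose TV : opens Yt := capO (opre q T) (opre epsY V).
have vTV : oset TV (v w) by []. have v'TV : oset TV (v' w).
 by split; [have := congr1 (fun m : mor W Xt => m w) eq|have := congr1 (fun m : mor W Y => m w) ey]; rewrite /= => <-.
have [Q [Qv aQ QT]] := affine_nbhd vTV; have [Q' [Qv' aQ' QT']] := affine_nbhd v'TV.
pose O := capO (opre v Q) (opre v' Q'); exists O; split; first by split.
have [|r er] := factor Q aQ QT _ (mor_comp v (incl O)); first by move=> [z [Qz Qz']].
have [|r' er'] := factor Q' aQ' QT' _ (mor_comp v' (incl O)); first by move=> [z [Qz Qz']].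
rewrite er er'; congr mor_comp; apply: mono. by rewrite -er -er' !mor_compA eq. by rewrite -er -er' !mor_compA ey.
Qed.

Lemma lift_exists (W : scheme) (x : mor W Xt) (y : mor W Y) : mor_comp epsX x = mor_comp p y ->
 exists w : mor W Yt, mor_comp q w = x /\ mor_comp epsY w = y.
(* [Phi] determines a local lift by [lift_unique], which is the agreement on overlaps that
   [opn_glue] requires. *)
move=> exy; pose Phi (O : opens W) (g : mor (opn O) Yt) :=
 mor_comp q g = mor_comp x (incl O) /\ mor_comp epsY g = mor_comp y (incl O).
have [w|O1 g1 O2 g2 y1 y2 [a1 b1] [a2 b2] e|g gP] := @opn_glue W Yt Phi.
- have ew : epsX (x w) = p (y w) by have := congr1 (fun m : mor W X => m w) exy.
 have [T [V [E [sg [Tw Vw lift _]]]]] := local_chart ew. pose O := capO (opre x T) (opre y V).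
 have [|||r [e1 e2]] := lift _ (mor_comp x (incl O)) (mor_comp y (incl O)).
 - by rewrite !mor_compA exy.
 - by move=> [z [Tz Vz]].
 - by move=> [z [Tz Vz]]. by exists O, (mor_comp sg r); split.
- apply: (@opn_eq_at W Yt O1 O2 (capO O1 O2) (@capl _ O1 O2) (@capr _ O1 O2)) => //.
  apply: lift_unique; rewrite !mor_compA ?a1 ?a2 ?b1 ?b2 -!mor_compA !incl_opn_sub //.
 by split; [exact: (proj2_sig y1)|rewrite e; exact: (proj2_sig y2)].
exists g; split; apply: opn_local_eq => w; have [O [g0 [Ow [a b] e]]] := gP w; exists O; split=> //.
 by rewrite -mor_compA e. by rewrite -mor_compA e. Qed.
End Cartesian.

Theorem corollary8p6p2 (X Y : scheme) (p : mor Y X)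
    (X_coherent : coherent X) (Y_coherent : coherent Y)
    (X_reduced : reduced X) (Y_reduced : reduced Y)
    (p_etale : etale p) (p_surjective : surjective p)
    (Xtrig Ytrig : scheme) (epsX : mor Xtrig X) (epsY : mor Ytrig Y)
    (HX : is_trig epsX) (HY : is_trig epsY)
    (ptrig : mor Ytrig Xtrig) (Hp : is_trig_mor epsX epsY p ptrig) :
  is_pullback ptrig epsY epsX p.
Proof.
split=> // W x y exy; have [w [wx wy]] := lift_exists p_etale HX HY Hp exy.
exists w; split=> // w' [wx' wy']; apply: (lift_unique p_etale HX HY Hp); first by rewrite wx.
by rewrite wy.
Qed.
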